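(* Let $\Sigma(A,B,C,\mathbf{G})$ be a system node on $(U,X,Y)$ with finite-dimensional input space $U$ and finite-dimensional output space $Y$. Then $\Sigma(A,B,C,\mathbf{G})$ is $C^\infty$-BIBO stable if and only if it is $L^\infty$-BIBO stable.
   Context: All Banach spaces are complex. $\mathbb{C}_\alpha=\{z\in\mathbb{C}:\operatorname{Re}z>\alpha\}$. For the generator $A$ of a strongly continuous semigroup $\mathbb{T}=(\mathbb{T}(t))_{t\ge0}$ on a Banach space $X$, $\omega(\mathbb{T})=\inf\{\omega\in\mathbb{R}:\sup_{t>0}e^{-t\omega}\|\mathbb{T}(t)\|<\infty\}$ is its growth bound. $X_1$ is $D(A)$ with norm $\|(\beta I-A)x\|_X$ and $X_{-1}$ is the completion of $X$ with respect to $\|(\beta I-A)^{-1}x\|_X$, for a fixed $\beta\in\rho(A)$. The semigroup extends uniquely to a strongly continuous semigroup on $X_{-1}$ whose generator $X\to X_{-1}$ extends $A$; the extensions are again denoted $\mathbb{T}$ and $A$. System node: for Banach spaces $U,X,Y$, a system node on $(U,X,Y)$ is a collection $\Sigma(A,B,C,\mathbf{G})$ where $A:D(A)\subset X\to X$ generates a strongly continuous semigroup $\mathbb{T}$ on $X$, $B\in\mathcal{L}(U,X_{-1})$, $C\in\mathcal{L}(X_1,Y)$, and $\mathbf{G}:\mathbb{C}_{\omega(\mathbb{T})}\to\mathcal{L}(U,Y)$ is analytic with $\mathbf{G}(\alpha)-\mathbf{G}(\beta)=C[(\alpha I-A)^{-1}-(\beta I-A)^{-1}]B$ for all $\alpha,\beta\in\mathbb{C}_{\omega(\mathbb{T})}$.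 Combined observation/feedthrough operator: $C\&D\begin{bmatrix}x\\ u\end{bmatrix}=C[x-(\beta I-A)^{-1}Bu]+\mathbf{G}(\beta)u$ with $\beta\in\mathbb{C}_{\omega(\mathbb{T})}$ (independent of the choice of $\beta$) and domain $D(C\&D)=\{\begin{bmatrix}x\\ u\end{bmatrix}\in X\times U: Ax+Bu\in X\}$. Classical solution: a triple $(u,x,y)$ with $u\in C([0,\infty),U)$, $x\in C^1([0,\infty),X)$, $y\in C([0,\infty),Y)$, $\begin{bmatrix}x(t)\\ u(t)\end{bmatrix}\in D(C\&D)$ for all $t\ge0$, and $\dot x(t)=Ax(t)+Bu(t)$, $y(t)=C\&D\begin{bmatrix}x(t)\\ u(t)\end{bmatrix}$ for all $t\ge0$. Generalised solution in the distributional sense: a triple $(u,x,y)$ with $u\in L^1_{\mathrm{loc}}([0,\infty),U)$, $x\in C([0,\infty),X_{-1})$, $x(t)=\mathbb{T}(t)x_0+\int_0^t\mathbb{T}(t-s)Bu(s)\,\mathrm{d}s$ for some $x_0\in X$ and all $t\ge0$, and $y$ the $Y$-valued distribution (linear functional on $C_c^\infty([0,\infty),Y')$) acting by $y(\varphi)=\int_0^\infty\left\langle\varphi''(t),(C\&D)\int_0^t(t-s)\begin{bmatrix}x(s)\\ u(s)\end{bmatrix}\mathrm{d}s\right\rangle_{Y',Y}\mathrm{d}t$. A function $y\in L^1_{\mathrm{loc}}([0,\infty),Y)$ is identified with the distribution $\varphi\mapsto\int_0^\infty\langle\varphi(t),y(t)\rangle_{Y',Y}\,\mathrm{d}t$.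 $L^\infty$-BIBO stability: there exists $c>0$ such that for any generalised solution in the distributional sense $(u,x,y)$ with $u\in L^\infty_{\mathrm{loc}}([0,\infty),U)$ and $x(0)=0$ one has $y\in L^\infty_{\mathrm{loc}}([0,\infty),Y)$ and $\|y\|_{L^\infty([0,t],Y)}\le c\|u\|_{L^\infty([0,t],U)}$ for all $t>0$. $C^\infty$-BIBO stability: there exists $c>0$ such that for all classical solutions $(u,x,y)$ with $x(0)=0$ and $u\in C_c^\infty((0,\infty),U)$ one has $y\in C_b([0,\infty),Y)$ and $\|y\|_{L^\infty([0,\infty),Y)}\le c\|u\|_{L^\infty([0,\infty),U)}$. *)

(* Defs.v *)
From HB Require Import structures.
From mathcomp Require Import all_boot all_order all_algebra.
From mathcomp Require Import all_classical all_reals all_analysis.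
From mathcomp Require Import ess_sup_inf complex.

Set Implicit Arguments.
Unset Strict Implicit.
Unset Printing Implicit Defensive.

Import Order.TTheory GRing.Theory Num.Theory.
Import numFieldNormedType.Exports.

Local Open Scope classical_set_scope.
Local Open Scope ring_scope.
Local Open Scope complex_scope.

(* Norms on a normedModType over R[i] take values in R[i]; they are real and
   nonnegative there, so taking the real part loses nothing. *)
Definition rnorm (R : realType) (V : normedModType R[i]) (v : V) : R :=
  complex.Re `|v|.

Definition finite_dimensional (R : realType) (V : normedModType R[i]) : Prop :=
  exists (n : nat) (e : 'I_n -> V),
    forall v : V, exists c : 'I_n -> R[i], v = \sum_(i < n) c i *: e i.

Definition op_norm (R : realType) (V W : normedModType R[i]) (f : V -> W) :
    \bar R :=
  ereal_sup [set (rnorm (f v))%:E | v in [set v : V | rnorm v <= 1]].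

(* Convergence in operator norm along the filter F. *)
Definition op_cvg (R : realType) (V W : normedModType R[i]) (I : Type)
    (F : set_system I) (f : I -> V -> W) (L : V -> W) : Prop :=
  op_norm (fun v => f h v - L v) @[h --> F] --> 0%E.

(* [0, +oo[ ; functions on it are represented by functions on R whose values
   at negative times are ignored. *)
Definition half_line (R : realType) : set R := [set t | 0 <= t].

(* Difference quotients at t of functions on J use only increments staying in
   J, so derivatives at an endpoint of J are one-sided. *)
Definition increments (R : realType) (J : set R) (t : R) : set_system R :=
  within [set h | J (t + h)] (0 : R)^'.

Definition has_derivative_on (R : realType) (V : normedModType R[i])
    (J : set R) (f f' : R -> V) : Prop :=
  forall t, J t ->
    (h^-1)%:C *: (f (t + h) - f t) @[h --> increments J t] --> f' t.

Record c0_semigroup (R : realType) (X : normedModType R[i]) := C0Semigroup {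
  sg :> R -> {linear X -> X};
  sg_continuous : forall t : R, 0 <= t -> continuous (sg t);
  sg0 : forall x, sg 0 x = x;
  sgD : forall (s t : R) x, 0 <= s -> 0 <= t -> sg (s + t) x = sg s (sg t x);
  sg_strong : forall x, sg t x @[t --> 0^'+] --> x }.

(* The graph of the infinitesimal generator. *)
Definition generator (R : realType) (X : normedModType R[i])
    (T : c0_semigroup X) (x y : X) : Prop :=
  (h^-1)%:C *: (T h x - x) @[h --> 0^'+] --> y.

Definition growth_bound (R : realType) (X : normedModType R[i])
    (T : c0_semigroup X) : \bar R :=
  ereal_inf [set w%:E | w in [set w : R |
    (ereal_sup [set ((expR (- (t * w)))%:E * op_norm (T t))%E
                 | t in [set t : R | 0 < t]%R] < +oo)%E]].

Definition half_plane (R : realType) (a : \bar R) : set R[i] :=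
  [set z | (a < (complex.Re z)%:E)%E].

(* (z I - A)^-1, for a linear A with domain D, possibly taking values in a
   space Z into which X is embedded by j; it is the genuine inverse
   whenever z I - A is a bijection from D onto Z. *)
Definition resolvent (R : realType) (X Z : normedModType R[i]) (j : X -> Z)
    (D : set X) (A : X -> Z) (z : R[i]) (y : Z) : X :=
  xget 0 [set x | D x /\ z *: j x - A x = y].

Definition resolvent_set (R : realType) (X : normedModType R[i])
    (D : set X) (A : X -> X) : set R[i] :=
  [set z | (forall y, exists! x, D x /\ z *: x - A x = y) /\
           (op_norm (resolvent idfun D A z) < +oo)%E].

Definition analytic_on (R : realType) (V W : normedModType R[i])
    (O : set R[i]) (G : R[i] -> {linear V -> W}) : Prop :=
  forall z, O z -> exists2 G' : {linear V -> W}, continuous G' &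
    op_cvg (0 : R[i]^o)^' (fun h v => h^-1 *: (G (z + h) v - G z v)) G'.

Record system_node (R : realType) (U X Y : completeNormedModType R[i]) :=
  SystemNode {
  sn_T : c0_semigroup X;
  (* sn_A is only meaningful on its domain sn_dom *)
  sn_dom : set X;
  sn_A : X -> X;
  sn_A_generates : forall x y, generator sn_T x y <-> sn_dom x /\ sn_A x = y;
  sn_beta : R[i];
  sn_betaP : resolvent_set sn_dom sn_A sn_beta;
  (* X_{-1}: a completion of X for |(beta I - A)^-1 x|, with embedding sn_j *)
  sn_Xm1 : completeNormedModType R[i];
  sn_j : {linear X -> sn_Xm1};
  sn_j_norm : forall x,
    rnorm (sn_j x) = rnorm (resolvent idfun sn_dom sn_A sn_beta x);
  sn_j_dense : closure (range sn_j) = setT;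
  (* the extensions of the semigroup and of A to X_{-1} *)
  sn_Tm1 : c0_semigroup sn_Xm1;
  sn_Tm1E : forall (t : R) x, 0 <= t -> sn_Tm1 t (sn_j x) = sn_j (sn_T t x);
  sn_Am1 : {linear X -> sn_Xm1};
  sn_Am1_generates : forall z w,
    generator sn_Tm1 z w <-> exists2 x, sn_j x = z & sn_Am1 x = w;
  sn_Am1E : forall x, sn_dom x -> sn_Am1 x = sn_j (sn_A x);
  sn_B : {linear U -> sn_Xm1};
  sn_B_continuous : continuous sn_B;
  (* sn_C is only meaningful on D(A), as an element of L(X_1, Y) *)
  sn_C : X -> Y;
  sn_C_linear : forall (a : R[i]) x1 x2, sn_dom x1 -> sn_dom x2 ->
    sn_C (a *: x1 + x2) = a *: sn_C x1 + sn_C x2;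
  sn_C_bounded : exists M : R, forall x, sn_dom x ->
    rnorm (sn_C x) <= M * rnorm (sn_beta *: x - sn_A x);
  (* sn_G is only meaningful on the half-plane C_omega(T) *)
  sn_G : R[i] -> {linear U -> Y};
  sn_G_continuous : forall z, half_plane (growth_bound sn_T) z ->
    continuous (sn_G z);
  sn_G_analytic : analytic_on (half_plane (growth_bound sn_T)) sn_G;
  sn_G_identity : forall z1 z2 u,
    half_plane (growth_bound sn_T) z1 ->
    half_plane (growth_bound sn_T) z2 ->
    sn_G z1 u - sn_G z2 u =
      sn_C (resolvent sn_j setT sn_Am1 z1 (sn_B u) -
            resolvent sn_j setT sn_Am1 z2 (sn_B u)) }.

Arguments sn_T {R U X Y} s.
Arguments sn_dom {R U X Y} s.
Arguments sn_A {R U X Y} s.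
Arguments sn_beta {R U X Y} s.
Arguments sn_Xm1 {R U X Y} s.
Arguments sn_j {R U X Y} s.
Arguments sn_Tm1 {R U X Y} s.
Arguments sn_Am1 {R U X Y} s.
Arguments sn_B {R U X Y} s.
Arguments sn_C {R U X Y} s.
Arguments sn_G {R U X Y} s.

Section combined_operator.
Context (R : realType) (U X Y : completeNormedModType R[i]).
Variable S : system_node U X Y.

Definition CD_at (z : R[i]) (x : X) (u : U) : Y :=
  sn_C S (x - resolvent (sn_j S) setT (sn_Am1 S) z (sn_B S u)) + sn_G S z u.

(* CD_at z does not depend on z in the half-plane, so any point will do. *)
Definition CD : X -> U -> Y :=
  CD_at (xget 0 (half_plane (growth_bound (sn_T S)))).

Definition domCD (x : X) (u : U) : Prop :=
  exists w : X, sn_Am1 S x + sn_B S u = sn_j S w.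

(* CD on elements of X_{-1} that lie in (the image of) X. *)
Definition CDm1 (z : sn_Xm1 S) (u : U) : Y :=
  CD (xget 0 [set x | sn_j S x = z]) u.

End combined_operator.

Section bochner.
Context (R : realType) (V : normedModType R[i]).

(* The function \sum_i 1_(sfset i) v_i. *)
Record simple_fun := SimpleFun {
  sfsize : nat;
  sfset : 'I_sfsize -> set R;
  sfval : 'I_sfsize -> V;
  sfset_measurable : forall i, measurable (sfset i);
  sfset_finite : forall i, (lebesgue_measure (sfset i) < +oo)%E }.

Definition simple_eval (s : simple_fun) (t : R) : V :=
  \sum_(i < sfsize s) (\1_(sfset (s := s) i) t : R)%:C *: sfval i.

Definition simple_integral (D : set R) (s : simple_fun) : V :=
  \sum_(i < sfsize s)
    (fine (lebesgue_measure (sfset (s := s) i `&` D)))%:C *: sfval i.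

Definition approximates (D : set R) (s : nat -> simple_fun) (f : R -> V) :
    Prop :=
  {ae lebesgue_measure, forall t : R,
    D t -> simple_eval (s n) t @[n --> \oo] --> f t}.

Definition strongly_measurable (D : set R) (f : R -> V) : Prop :=
  exists s, approximates D s f.

Definition is_bochner_integral (D : set R) (f : R -> V) (v : V) : Prop :=
  exists s : nat -> simple_fun,
    [/\ approximates D s f,
        (\int[lebesgue_measure]_(t in D) (rnorm (f t - simple_eval (s n) t))%:E)%E
          @[n --> \oo] --> 0%E &
        simple_integral D (s n) @[n --> \oo] --> v].

(* 0 if f is not Bochner integrable on D *)
Definition bochner_integral (D : set R) (f : R -> V) : V :=
  xget 0 [set v | is_bochner_integral D f v].

Definition Linf_norm (D : set R) (f : R -> V) : \bar R :=
  ess_sup lebesgue_measure ((fun t : R => (rnorm (f t))%:E) \_ D).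

Definition L1_loc (f : R -> V) : Prop :=
  strongly_measurable (@half_line R) f /\
  forall t : R, 0 < t ->
    (\int[lebesgue_measure]_(s in `[0%R, t]) (rnorm (f s))%:E < +oo)%E.

Definition Linf_loc (f : R -> V) : Prop :=
  strongly_measurable (@half_line R) f /\
  forall t : R, 0 < t -> (Linf_norm `[0%R, t] f < +oo)%E.

End bochner.

Definition complex_integral (R : realType) (D : set R) (f : R -> R[i]) : R[i] :=
  (\int[lebesgue_measure]_(t in D) complex.Re (f t)) +i*
  (\int[lebesgue_measure]_(t in D) complex.Im (f t)).

(* Elements of C_c^oo([0, +oo[, Y'), given with all their derivatives:
   [phi 0] is the test function and [phi n] its n-th derivative. The test
   function need not vanish at 0. *)
Record test_function (R : realType) (Y : normedModType R[i]) := TestFunction {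
  tf :> nat -> R -> {linear Y -> R[i]^o};
  tf_continuous : forall n (t : R), 0 <= t -> continuous (tf n t);
  tf_derivative : forall n (t : R), 0 <= t ->
    op_cvg (increments (@half_line R) t)
      (fun h y => (h^-1)%:C *: (tf n (t + h) y - tf n t y)) (tf n.+1 t);
  tf_support : exists M : R, forall t y, M < t -> tf 0 t y = 0 }.

(* Only functionals given by an explicit integral formula linear in the test
   function are considered below, so linearity is not part of the type. *)
Definition Y_distribution (R : realType) (Y : normedModType R[i]) : Type :=
  test_function Y -> R[i].

Definition represents (R : realType) (Y : normedModType R[i])
    (f : R -> Y) (y : Y_distribution Y) : Prop :=
  forall phi, y phi = complex_integral (@half_line R) (fun t => phi 0 t (f t)).

(* C_c^oo(]0, +oo[, V); v n is the n-th derivative of f *)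
Definition Cc_infty (R : realType) (V : normedModType R[i]) (f : R -> V) :
    Prop :=
  (exists v : nat -> R -> V, (forall t : R, 0 < t -> v 0 t = f t) /\
     forall n, has_derivative_on [set t | 0 < t] (v n) (v n.+1)) /\
  (exists a b : R, 0 < a /\
     forall t, 0 < t -> (t < a) || (b < t) -> f t = 0).

Section solutions.
Context (R : realType) (U X Y : completeNormedModType R[i]).
Variable S : system_node U X Y.

Definition classical_solution (u : R -> U) (x : R -> X) (y : R -> Y) : Prop :=
  [/\ {within @half_line R, continuous u},
      {within @half_line R, continuous y},
      (forall t : R, 0 <= t -> domCD S (x t) (u t)),
      (exists x' : R -> X,
        [/\ {within @half_line R, continuous x'},
            has_derivative_on (@half_line R) x x' &
            forall t : R, 0 <= t -> sn_j S (x' t) = sn_Am1 S (x t) + sn_B S (u t)]) &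
      forall t : R, 0 <= t -> y t = CD S (x t) (u t)].

Definition generalised_solution (u : R -> U) (x : R -> sn_Xm1 S)
    (y : Y_distribution Y) : Prop :=
  [/\ L1_loc u,
      {within @half_line R, continuous x},
      (exists x0 : X, forall t : R, 0 <= t ->
        x t = sn_Tm1 S t (sn_j S x0) +
              bochner_integral `[0, t]
                (fun s => sn_Tm1 S (t - s) (sn_B S (u s)))) &
      forall phi, y phi = complex_integral (@half_line R) (fun t => phi 2 t
        (CDm1 (bochner_integral `[0, t] (fun s => (t - s)%:C *: x s))
              (bochner_integral `[0, t] (fun s => (t - s)%:C *: u s))))].

Definition Linf_BIBO_stable : Prop :=
  exists2 c : R, 0 < c &
  forall u x y, generalised_solution u x y -> Linf_loc u -> x 0 = 0 ->
    exists f : R -> Y, [/\ Linf_loc f, represents f y &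
      forall t : R, 0 < t ->
        (Linf_norm `[0%R, t] f <= c%:E * Linf_norm `[0%R, t] u)%E].

Definition Cinf_BIBO_stable : Prop :=
  exists2 c : R, 0 < c &
  forall u x y, classical_solution u x y -> x 0 = 0 -> Cc_infty u ->
    [/\ {within @half_line R, continuous y},
        (exists M : R, forall t : R, 0 <= t -> rnorm (y t) <= M) &
        (Linf_norm (@half_line R) y <= c%:E * Linf_norm (@half_line R) u)%E].

End solutions.

(* Main.v *)
Require Import Defs.
From HB Require Import structures.
From mathcomp Require Import all_boot all_order all_algebra.
From mathcomp Require Import all_classical all_reals all_analysis.
From mathcomp Require Import ess_sup_inf complex measurable_realfun.
From mathcomp Require Import ring lra.

Set Implicit Arguments.
Unset Strict Implicit.
Unset Printing Implicit Defensive.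

Import Order.TTheory GRing.Theory Num.Theory.
Import numFieldNormedType.Exports.

Local Open Scope classical_set_scope.
Local Open Scope ring_scope.
Local Open Scope complex_scope.

(** Both stability notions are compared through the output response [ramp_out S e]
    of the node to the ramp input [t e]. The input [B u] lives in X_{-1}, but after
    one integration the response of the state is already in X (and after two it
    is continuously differentiable there), so [ramp_out S e] is an honest
    continuous function, and every other output is obtained from it by convolving
    with a scalar input and differentiating twice.

    Suppose that smooth inputs have bounded outputs. If [phi] is smooth and
    vanishes near time 0, the input [phi e] drives a classical solution whose
    output is the convolution of [ramp_out S e] with the second derivative of
    [phi]; by assumption it is bounded by a multiple of the supremum of [phi]
    ([Cinf_smooth_bound]). Mollifying a bounded measurable scalar [k] yields smooth
    inputs that are no larger, so the second derivatives of their responses are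
    uniformly bounded; in the limit the convolution of [ramp_out S e] with [k] is
    differentiable with a Lipschitz derivative ([bounded_kernel]). The output of a
    generalised solution is by definition the second distributional derivative of
    a function which, in a basis of U, is a finite sum of such convolutions
    ([generalised_output]). Real coordinates on Y reduce a Lipschitz function to
    scalar ones, which are primitives of their bounded densities by the
    Radon-Nikodym theorem ([lipschitz_density]); integrating by parts twice
    identifies the resulting bounded function with the output
    ([pairing_density]).

    Suppose conversely that essentially bounded inputs have essentially bounded
    outputs. A classical solution satisfies the variation of constants formula
    ([variation_of_constants]), so it is a generalised one, and its distributional
    output is the classical output ([classical_output]). A continuous function that
    coincides as a distribution with an essentially bounded one satisfies the same
    bound at every point: test against bumps that concentrate at the point
    ([pointwise_bound]).

    The functions that have to be integrated (continuous orbits multiplied by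
    bounded Borel scalars) are uniform limits of finitely valued functions on
    bounded sets. The integral is therefore handled through the predicate [Bint],
    which is linear and stable under uniform approximation, and
    [Bint_bochner_integral] translates the results back to Bochner integrals.
    Continuity and one-sided differentiability on a set of times are likewise
    used in the equivalent epsilon-delta forms [cont_on] and [deriv_on]. *)

(** * Real-valued norms on complex normed spaces *)

Lemma realC_norm (R : realType) (r : R) : `|r%:C| = `|r|%:C :> R[i].
Proof. by rewrite normc_def /= expr0n /= addr0 sqrtr_sqr. Qed.

Lemma Re_norm_ge0 (R : realType) (c : R[i]) : 0 <= complex.Re `|c|.
Proof. by rewrite normc_def /= sqrtr_ge0. Qed.

Section RNorm.
Context (R : realType) (V : normedModType R[i]).
Implicit Types (v w : V) (r : R).

Lemma normC_rnorm v : `|v| = (rnorm v)%:C :> R[i].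
Proof.
rewrite /rnorm; have := normr_ge0 v.
case: (`|v|) => a b; rewrite lecE /= => /andP[/eqP-> _].
reflexivity.
Qed.

Lemma rnorm_ge0 v : 0 <= rnorm v.
Proof. rewrite -(@lecR R) -normC_rnorm; exact: normr_ge0. Qed.

Lemma rnorm0 : rnorm (0 : V) = 0.
Proof. by rewrite /rnorm normr0. Qed.

Lemma rnorm0_eq0 v : rnorm v = 0 -> v = 0.
Proof. by move=> v0; apply/eqP; rewrite -normr_eq0 normC_rnorm v0. Qed.

Lemma rnormN v : rnorm (- v) = rnorm v.
Proof. by rewrite /rnorm normrN. Qed.

Lemma rnorm_distC v w : rnorm (v - w) = rnorm (w - v).
Proof. by rewrite -rnormN opprB. Qed.

Lemma ler_rnormD v w : rnorm (v + w) <= rnorm v + rnorm w.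
Proof. by rewrite -(@lecR R) rmorphD /= -!normC_rnorm ler_normD. Qed.

Lemma ler_rnormB v w : rnorm (v - w) <= rnorm v + rnorm w.
Proof. by rewrite (le_trans (ler_rnormD _ _))// rnormN. Qed.

Lemma ler_rdistD u v w : rnorm (v - w) <= rnorm (v - u) + rnorm (u - w).
Proof. by rewrite -{1}(subrK u v) -addrA ler_rnormD. Qed.

Lemma ler_rnorm_dist v w : `|rnorm v - rnorm w| <= rnorm (v - w).
Proof.
have h (u u' : V) : rnorm u - rnorm u' <= rnorm (u - u').
  by rewrite lerBlDr (le_trans _ (ler_rnormD _ _))// subrK.
by rewrite ler_norml h andbT lerNl opprB rnorm_distC.
Qed.

Lemma rnormZ (c : R[i]) v : rnorm (c *: v) = complex.Re `|c| * rnorm v.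
Proof.
rewrite /rnorm normrZ normC_rnorm.
by rewrite normc_def; case: c => a b /=; rewrite !mulr0 !subr0.
Qed.

Lemma rnormZr r v : rnorm (r%:C *: v) = `|r| * rnorm v.
Proof. by rewrite rnormZ realC_norm. Qed.

Lemma ler_rnorm_sum (I : Type) (s : seq I) (P : pred I) (F : I -> V) :
  rnorm (\sum_(i <- s | P i) F i) <= \sum_(i <- s | P i) rnorm (F i).
Proof.
elim/big_rec2: _ => [|i x v _ h]; first by rewrite rnorm0.
by rewrite (le_trans (ler_rnormD _ _))// lerD2l.
Qed.

Lemma cvg_rnormP (T : Type) (F : set_system T) {FF : Filter F} (f : T -> V) l :
  f @ F --> l <-> forall e : R, 0 < e -> \forall x \near F, rnorm (f x - l) <= e.
Proof.
split=> [/cvgrPdist_le fl e e0|fl].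
  have /fl : 0 < e%:C :> R[i] by rewrite ltcR.
  by apply: filterS => x; rewrite normC_rnorm lecR rnorm_distC.
apply/cvgrPdist_le => e e0.
have ee : e = (complex.Re e)%:C by apply/esym/RRe_real; rewrite gtr0_real.
rewrite ee; apply: (filterS _ (fl (complex.Re e) _)) => [x|].
  by rewrite normC_rnorm lecR rnorm_distC.
by rewrite -(@ltcR R) -ee.
Qed.

Lemma rnorm_eq_le v w : (forall e : R, 0 < e -> rnorm (v - w) <= e) -> v = w.
Proof.
move=> h; apply/subr0_eq/rnorm0_eq0/eqP; rewrite eq_le rnorm_ge0 andbT.
by apply/ler_addgt0Pr => e /h; rewrite add0r.
Qed.

Lemma cvg_rnormP_ltn (u : nat -> V) l :
  u @ \oo --> l <-> forall e : R, 0 < e ->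
    exists N, forall n, (N <= n)%N -> rnorm (u n - l) <= e.
Proof.
split=> [/cvg_rnormP h e /h[N _ hN]|h].
  by exists N => n Nn; exact: hN.
by apply/cvg_rnormP => e /h[N hN]; exists N.
Qed.

End RNorm.

Lemma rcauchy_cvg (R : realType) (V : completeNormedModType R[i]) (u : nat -> V) :
  (forall e : R, 0 < e -> exists N, forall m n, (N <= m)%N -> (N <= n)%N ->
     rnorm (u m - u n) <= e) ->
  exists l, forall e : R, 0 < e ->
    exists N, forall n, (N <= n)%N -> rnorm (u n - l) <= e.
Proof.
move=> h; suff : cvg (u @ \oo).
  by move=> /cvg_ex[l /= /cvg_rnormP_ltn hl]; exists l.
apply/cauchy_cvgP/cauchy_exP => e e0.
have ee : e = (complex.Re e)%:C by apply/esym/RRe_real; rewrite gtr0_real.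
have e'0 : 0 < complex.Re e / 2 by rewrite divr_gt0// -(@ltcR R) -ee.
have [N hN] := h _ e'0.
exists (u N); exists N => // n /= Nn; rewrite -ball_normE /ball_ /=.
rewrite ee normC_rnorm ltcR (le_lt_trans (hN _ _ (leqnn N) Nn))//.
by rewrite ltr_pdivrMr// ltr_pMr ?ltr1n// -(@ltcR R) -ee.
Qed.

Lemma linear_bounded_rnorm (R : realType) (V W : normedModType R[i])
    (L : {linear V -> W}) : continuous L ->
  exists2 M : R, 0 < M & forall v, rnorm (L v) <= M * rnorm v.
Proof.
move=> /(_ 0); rewrite /continuous_at linear0 => /cvg_rnormP /(_ 1 ltr01).
move=> /nbhs_ballP[e /= e0 he].
have ee : e = (complex.Re e)%:C by apply/esym/RRe_real; rewrite gtr0_real.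
have d0 : 0 < complex.Re e by rewrite -(@ltcR R) -ee.
set d := complex.Re e in ee d0.
exists (2 / d); first by rewrite divr_gt0.
move=> v; have [->|v0] := eqVneq v 0; first by rewrite linear0 !rnorm0 mulr0.
have nv0 : 0 < rnorm v.
  rewrite lt_neqAle rnorm_ge0 andbT eq_sym; apply/eqP => /rnorm0_eq0 /eqP.
  by rewrite (negPf v0).
have dv : 0 < d / 2 / rnorm v by rewrite !divr_gt0.
have : rnorm (L ((d / 2 / rnorm v)%:C *: v) - 0) <= 1.
  apply: he; rewrite -ball_normE /ball_ /= sub0r normrN normC_rnorm ee ltcR.
  rewrite rnormZr gtr0_norm// divfK ?gt_eqF// ltr_pdivrMr// ltr_pMr// ltr1n //.
rewrite subr0 linearZ rnormZr gtr0_norm//.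
rewrite mulrC -ler_pdivlMr// div1r.
by rewrite invf_div [X in _ <= X -> _]mulrC invf_div.
Qed.

(** Complex scalars act on real-linear data through [r%:C]; additive maps that
    commute with these scalars are what real coordinates and the operators of
    the node have in common. *)
Definition rlinear (R : realType) (V W : normedModType R[i]) (L : V -> W) :=
  (forall v w, L (v + w) = L v + L w) /\
  (forall (r : R) v, L (r%:C *: v) = r%:C *: L v).

Definition rbounded (R : realType) (V W : normedModType R[i]) (L : V -> W) :=
  exists2 M : R, 0 < M & forall v, rnorm (L v) <= M * rnorm v.

(** * Continuity and derivatives along a set of times *)

Section EpsDelta.
Context (R : realType) (V : normedModType R[i]).
Implicit Types (J : set R) (f : R -> V).

Definition cont_on J f := forall t, J t -> forall e : R, 0 < e ->
  exists2 d : R, 0 < d & forall s, J s -> `|s - t| < d -> rnorm (f s - f t) <= e.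

Definition deriv_on J f f' := forall t, J t -> forall e : R, 0 < e ->
  exists2 d : R, 0 < d & forall s, J s -> `|s - t| < d ->
    rnorm (f s - f t - (s - t)%:C *: f' t) <= e * `|s - t|.

Lemma cont_onP J f : {within J, continuous f} <-> cont_on J f.
Proof.
split=> [/subspace_continuousP fc t Jt e e0|fc].
  have /cvg_rnormP /(_ e e0) := fc t Jt.
  rewrite near_withinE => /nbhs_ballP[d /= d0 hd]; exists d => // s Js st.
  by apply: hd => //; rewrite -ball_normE /ball_ /= distrC.
apply/subspace_continuousP => t Jt; apply/cvg_rnormP => e e0.
have [d d0 hd] := fc t Jt e e0.
rewrite near_withinE; apply/nbhs_ballP; exists d => //= s.
by rewrite -ball_normE /ball_ /= distrC => st Js; exact: hd.
Qed.

Lemma has_derivative_onP J f f' : has_derivative_on J f f' <-> deriv_on J f f'.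
Proof.
split=> [fd t Jt e e0|fd t Jt].
  have /cvg_rnormP /(_ e e0) := fd t Jt.
  rewrite /increments near_withinE near_withinE => /nbhs_ballP[d /= d0 hd].
  exists d => // s Js st.
  have [->|/eqP sNt] := eqVneq s t.
    by rewrite !subrr scale0r subr0 rnorm0 normr0 mulr0.
  have st0 : s - t != 0 by rewrite subr_eq0; apply/eqP.
  have /= := hd (s - t); rewrite -ball_normE /ball_ /= sub0r normrN.
  have -> : t + (s - t) = s by rewrite addrC subrK.
  move=> /(_ st st0 Js).
  have -> : f s - f t - (s - t)%:C *: f' t =
      (s - t)%:C *: (((s - t)^-1)%:C *: (f s - f t) - f' t).
    by rewrite scalerBr scalerA -rmorphM /= mulfV// scale1r.
  by rewrite rnormZr => h; rewrite mulrC ler_wpM2r.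
apply/cvg_rnormP => e e0; have [d d0 hd] := fd t Jt e e0.
rewrite /increments near_withinE near_withinE; apply/nbhs_ballP.
exists d => //= h; rewrite -ball_normE /ball_ /= sub0r normrN => hd' h0 Jth.
have := hd (t + h) Jth; rewrite (addrC t) addrK => /(_ hd').
have -> : f (h + t) - f t - h%:C *: f' t =
      h%:C *: ((h^-1)%:C *: (f (h + t) - f t) - f' t).
  by rewrite scalerBr scalerA -rmorphM /= mulfV// scale1r.
by rewrite rnormZr mulrC ler_pM2r// normr_gt0.
Qed.

Lemma deriv_on_cont J f f' : deriv_on J f f' -> cont_on J f.
Proof.
move=> fd t Jt e e0; have [d d0 hd] := fd t Jt 1 ltr01.
have N0 : 0 < 1 + rnorm (f' t) by rewrite ltr_wpDr// rnorm_ge0.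
exists (Num.min d (e / (1 + rnorm (f' t)))).
  by rewrite lt_min d0 divr_gt0.
move=> s Js; rewrite lt_min => /andP[/(hd s Js) h1]; rewrite ltr_pdivlMr// => h2.
have := ler_rnormD (f s - f t - (s - t)%:C *: f' t) ((s - t)%:C *: f' t).
rewrite subrK => /le_trans; apply; rewrite rnormZr.
apply: le_trans (ltW h2); rewrite mulrDr mulr1 lerD2r.
by rewrite (le_trans h1)// mul1r.
Qed.

Lemma deriv_onW (J J' : set R) f f' : J' `<=` J -> deriv_on J f f' -> deriv_on J' f f'.
Proof.
move=> JJ fd t /JJ Jt e e0; have [d d0 hd] := fd t Jt e e0.
by exists d => // s /JJ; exact: hd.
Qed.

Lemma cont_onW (J J' : set R) f : J' `<=` J -> cont_on J f -> cont_on J' f.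
Proof.
move=> JJ fd t /JJ Jt e e0; have [d d0 hd] := fd t Jt e e0.
by exists d => // s /JJ; exact: hd.
Qed.

Lemma cont_on_cst J (v : V) : cont_on J (fun=> v).
Proof. by move=> t Jt e e0; exists 1 => // s; rewrite subrr rnorm0 ltW. Qed.

Lemma cont_onD J f g : cont_on J f -> cont_on J g -> cont_on J (fun t => f t + g t).
Proof.
move=> fc gc t Jt e e0; have e20 : 0 < e / 2 by rewrite divr_gt0.
have [d1 d10 h1] := fc t Jt _ e20; have [d2 d20 h2] := gc t Jt _ e20.
exists (Num.min d1 d2); first by rewrite lt_min d10.
move=> s Js; rewrite lt_min => /andP[/(h1 s Js) h /(h2 s Js) h'].
by rewrite opprD addrACA (le_trans (ler_rnormD _ _))// (splitr e) lerD.
Qed.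

Lemma deriv_on_ext J f f' g g' : (forall t, J t -> f t = g t) ->
  (forall t, J t -> f' t = g' t) -> deriv_on J f f' -> deriv_on J g g'.
Proof.
move=> fg fg' fd t Jt e e0; have [d d0 hd] := fd t Jt e e0.
by exists d => // s Js; rewrite -!fg// -fg'//; exact: hd.
Qed.

Lemma cont_on_ext J f g : (forall t, J t -> f t = g t) ->
  cont_on J f -> cont_on J g.
Proof.
move=> fg fd t Jt e e0; have [d d0 hd] := fd t Jt e e0.
by exists d => // s Js; rewrite -!fg//; exact: hd.
Qed.

Lemma deriv_onD J f f' g g' : deriv_on J f f' -> deriv_on J g g' ->
  deriv_on J (fun t => f t + g t) (fun t => f' t + g' t).
Proof.
move=> fc gc t Jt e e0; have e20 : 0 < e / 2 by rewrite divr_gt0.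
have [d1 d10 h1] := fc t Jt _ e20; have [d2 d20 h2] := gc t Jt _ e20.
exists (Num.min d1 d2); first by rewrite lt_min d10.
move=> s Js; rewrite lt_min => /andP[/(h1 s Js) h /(h2 s Js) h'].
rewrite scalerDr !opprD (addrACA (f s)) (addrACA (f s - f t)).
by rewrite (le_trans (ler_rnormD _ _))// (splitr e) mulrDl lerD.
Qed.

End EpsDelta.

Section RLinear.
Context (R : realType) (V W : normedModType R[i]).
Implicit Types (J : set R) (f : R -> V) (L : V -> W).

Lemma rlinearB L : rlinear L -> forall v w, L (v - w) = L v - L w.
Proof.
move=> [LD LZ] v w; rewrite LD; congr (_ + _).
have := LZ (-1) w; rewrite rmorphN /= !scaleNr.
by rewrite !scale1r.
Qed.

Lemma rlinear0 L : rlinear L -> L 0 = 0.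
Proof. by move=> lL; rewrite -(subrr 0) rlinearB// subrr. Qed.

Lemma rlinear_sum L (I : Type) (s : seq I) (P : pred I) (F : I -> V) :
  rlinear L -> L (\sum_(i <- s | P i) F i) = \sum_(i <- s | P i) L (F i).
Proof.
move=> lL; elim/big_rec2: _ => [|i x v _ <-]; first exact: rlinear0.
by case: lL => ->.
Qed.

Lemma linear_rlinear (L : {linear V -> W}) : rlinear L.
Proof. by split=> [v w|r v]; rewrite ?linearD ?linearZ. Qed.

Lemma rlinear_cont_on L J f : rlinear L -> rbounded L -> cont_on J f ->
  cont_on J (fun t => L (f t)).
Proof.
move=> lL [M M0 hM] fc t Jt e e0.
have [d d0 hd] := fc t Jt (e / M) (divr_gt0 e0 M0).
exists d => // s Js /(hd s Js); rewrite ler_pdivlMr// => h.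
by rewrite -rlinearB// (le_trans (hM _))// mulrC.
Qed.

Lemma rlinear_deriv_on L J f f' : rlinear L -> rbounded L -> deriv_on J f f' ->
  deriv_on J (fun t => L (f t)) (fun t => L (f' t)).
Proof.
move=> lL [M M0 hM] fc t Jt e e0.
have [d d0 hd] := fc t Jt (e / M) (divr_gt0 e0 M0).
exists d => // s Js /(hd s Js).
rewrite mulrAC ler_pdivlMr// => h.
have -> : L (f s) - L (f t) - (s - t)%:C *: L (f' t) =
   L (f s - f t - (s - t)%:C *: f' t) by rewrite !rlinearB//; case: lL => _ ->.
by rewrite (le_trans (hM _))// mulrC.
Qed.

End RLinear.
(** * The integral of vector-valued functions *)

Section AlmostEverywhere.
Context (R : realType).
Notation mu := (@lebesgue_measure R).
Implicit Types (P Q : R -> Prop).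

Lemma ae_imp P Q : (forall x, P x -> Q x) ->
  {ae mu, forall x, P x} -> {ae mu, forall x, Q x}.
Proof.
move=> PQ [N [mN N0 hN]]; exists N; split => // x /= nQ.
by apply: hN => /= Px; exact/nQ/PQ.
Qed.

Lemma ae_and P Q : {ae mu, forall x, P x} -> {ae mu, forall x, Q x} ->
  {ae mu, forall x, P x /\ Q x}.
Proof.
move=> [N [mN N0 hN]] [M [mM M0 hM]]; exists (N `|` M); split.
- exact: measurableU.
- by rewrite measureU0.
- move=> x /= nPQ; have [Px|nPx] := pselect (P x); last by left; exact: hN.
  by right; apply: hM => /= Qx; exact: nPQ.
Qed.

Lemma ae_all P : (forall x, P x) -> {ae mu, forall x, P x}.
Proof. by move=> h; exists set0; split => // x /=. Qed.

End AlmostEverywhere.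

Section LowerIntegral.
Context (R : realType).
Notation mu := (@lebesgue_measure R).
Local Open Scope ereal_scope.
Import HBNNSimple.
Implicit Types (D : set R) (p q : R -> \bar R).

(** The integral of a nonnegative function is a supremum over simple minorants,
    so it is monotone almost everywhere as soon as the larger function is
    measurable: the minorants then compare with an honest integral. *)
Lemma le_lower_integral D p q : measurable D ->
  (forall x, D x -> 0 <= p x) -> (forall x, D x -> 0 <= q x) ->
  measurable_fun D q -> {ae mu, forall x, D x -> p x <= q x} ->
  \int[mu]_(x in D) p x <= \int[mu]_(x in D) q x.
Proof.
move=> mD p0 q0 mq pq; rewrite ge0_integralE// ge_ereal_sup// => _ [h /= hp <-].
rewrite -integralT_nnsfun [leRHS]integral_mkcond.
apply: ae_ge0_le_integral => //.
- by move=> x _; rewrite lee_fin; exact: fun_ge0.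
- by apply/measurable_EFinP.
- by move=> x _; rewrite patchE; case: ifP => // /set_mem /q0.
- exact/(measurable_restrictT _ _).1.
- apply: ae_imp pq => x pqx _; apply: le_trans (hp x) _.
  by rewrite !patchE; case: ifP => // /set_mem /pqx.
Qed.

(** Here the minorants of the smaller function are cut off on the exceptional
    null set, which costs nothing when that function is measurable. *)
Lemma le_lower_integral_r D p q : measurable D ->
  (forall x, D x -> 0 <= p x) -> (forall x, D x -> 0 <= q x) ->
  measurable_fun D p -> {ae mu, forall x, D x -> p x <= q x} ->
  \int[mu]_(x in D) p x <= \int[mu]_(x in D) q x.
Proof.
move=> mD p0 q0 mp [N [mN N0 hN]].
have mNC : measurable (~` N) by exact: measurableC.
pose p1 := p \_ (~` N).
have mp1 : measurable_fun D p1.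
  by apply/(measurable_restrict _ mNC mD); exact: measurable_funS mp.
have p10 x : D x -> 0 <= p1 x.
  by move=> Dx; rewrite /p1 patchE; case: ifP => // _; exact: p0.
have -> : \int[mu]_(x in D) p x = \int[mu]_(x in D) p1 x.
  apply: ae_eq_integral => //; exists N; split => // x /= h.
  apply: contrapT => Nx; apply: h => Dx.
  by rewrite /p1 patchE mem_set.
rewrite !ge0_integralE//; apply: le_ereal_sup => _ [h /= hp <-].
exists h => // x; rewrite (le_trans (hp x))// !patchE; case: ifP => // /set_mem Dx.
rewrite /p1 patchE; case: ifP => [/set_mem Nx|_]; last exact: q0.
apply: contrapT => pq; apply: Nx; apply: hN => /= h'; exact/pq/h'.
Qed.

End LowerIntegral.

(** ** Finitely valued functions *)

(** A finitely valued function is presented as [w \o g], where the label map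
    [g] takes values in a finite type: common refinements of two such functions
    are then pairs of labels, with no normal form for overlapping sets. *)
Definition labelling (R : realType) (T : finType) (g : R -> T) :=
  forall i, measurable (g @^-1` [set i]).

Definition sint (R : realType) (V : normedModType R[i]) (D : set R)
    (T : finType) (g : R -> T) (w : T -> V) : V :=
  \sum_(i : T) (fine (lebesgue_measure (D `&` g @^-1` [set i])))%:C *: w i.

Section Labels.
Context (R : realType).
Notation mu := (@lebesgue_measure R).
Implicit Types (D : set R) (T : finType).

Lemma labelling_pred T (g : R -> T) (P : set T) :
  labelling g -> measurable (g @^-1` P).
Proof.
move=> mg; have -> : g @^-1` P = \bigcup_(i in P) g @^-1` [set i].
  by apply/seteqP; split=> [x Px|x [i Pi /= ->]] //=; exists (g x).
by apply: fin_bigcup_measurable => // i _; exact: mg.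
Qed.

Lemma labelling_comp T T' (g : R -> T) (f : T -> T') :
  labelling g -> labelling (f \o g).
Proof. by move=> mg i; rewrite comp_preimage; exact: labelling_pred. Qed.

Lemma labelling_pair T T' (g : R -> T) (g' : R -> T') :
  labelling g -> labelling g' -> labelling (fun x => (g x, g' x)).
Proof.
move=> mg mg' [i j].
have -> : (fun x => (g x, g' x)) @^-1` [set (i, j)] =
    g @^-1` [set i] `&` g' @^-1` [set j].
  by apply/seteqP; split=> x /= [-> ->].
exact: measurableI.
Qed.

Lemma labelling_measurable T (g : R -> T) (p : T -> R) D : measurable D ->
  labelling g -> measurable_fun D (p \o g).
Proof.
move=> mD mg _ Y mY; apply: measurableI => //.
by rewrite comp_preimage; exact: labelling_pred.
Qed.

Lemma measure_label_partition T T' (g : R -> T') (f : T' -> T) D i :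
  measurable D -> (mu D < +oo)%E -> labelling g ->
  fine (mu (D `&` (f \o g) @^-1` [set i])) =
  \sum_(j | f j == i) fine (mu (D `&` g @^-1` [set j])).
Proof.
move=> mD Dfin mg.
have mE (A : set R) : measurable A ->
    (mu (D `&` A) = \int[mu]_(x in D) (\1_A x)%:E)%E.
  by move=> mA; rewrite integral_indic// setIC.
have fin j : mu (D `&` g @^-1` [set j]) \is a fin_num.
  rewrite ge0_fin_numE// (le_lt_trans _ Dfin)// le_measure ?inE//.
  by apply: measurableI => //; exact: mg.
have fini : mu (D `&` (f \o g) @^-1` [set i]) \is a fin_num.
  rewrite ge0_fin_numE// (le_lt_trans _ Dfin)// le_measure ?inE//.
  by apply: measurableI => //; exact: labelling_comp.
apply: EFin_inj; rewrite -sumEFin fineK// mE; last exact: labelling_comp.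
 under eq_bigr do rewrite fineK//.
under eq_bigr do rewrite mE//.
rewrite -big_filter -ge0_integral_sum//; last first.
  by move=> j; apply/measurable_EFinP/measurable_indic; exact: mg.
apply: eq_integral => x _; rewrite big_filter.
rewrite indicE; case: (boolP (f (g x) == i)) => fgi.
  rewrite mem_set; last exact/eqP.
  rewrite (bigD1 (g x))//= indicE mem_set// big1 ?adde0// => j /andP[_ jg].
  by rewrite indicE memNset//= => gj; rewrite gj eqxx in jg.
rewrite memNset; last by move=> /eqP; rewrite (negPf fgi).
rewrite big1// => j fj; rewrite indicE memNset//= => gj.
by rewrite gj fj in fgi.
Qed.

Lemma integral_labels T (g : R -> T) (p : T -> R) D :
  measurable D -> (mu D < +oo)%E -> labelling g -> (forall i, 0 <= p i) ->
  (\int[mu]_(x in D) (p (g x))%:E)%E =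
  (\sum_i fine (mu (D `&` g @^-1` [set i])) * p i)%:E.
Proof.
move=> mD Dfin mg p0.
have fin j : mu (D `&` g @^-1` [set j]) \is a fin_num.
  rewrite ge0_fin_numE// (le_lt_trans _ Dfin)// le_measure ?inE//.
  by apply: measurableI => //; exact: mg.
transitivity (\int[mu]_(x in D)
    (\sum_i (p i)%:E * (\1_(g @^-1` [set i]) x)%:E)%E)%E.
  apply: eq_integral => x _; rewrite (bigD1 (g x))//= indicE mem_set// mule1.
  rewrite big1 ?adde0// => j jg; rewrite indicE memNset ?mule0//= => gj.
  by rewrite gj eqxx in jg.
rewrite ge0_integral_sum//; last 2 first.
- move=> j; apply: emeasurable_funM => //.
  by apply/measurable_EFinP/measurable_indic; exact: mg.
- by move=> j x _; rewrite mule_ge0// lee_fin.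
rewrite -sumEFin; apply: eq_bigr => i _.
rewrite ge0_integralZl//; last 2 first.
- by apply/measurable_EFinP/measurable_indic; exact: mg.
- by rewrite lee_fin.
by rewrite integral_indic//; [rewrite setIC EFinM fineK// muleC|exact: mg].
Qed.

End Labels.

Section StepIntegral.
Context (R : realType) (V : normedModType R[i]).
Notation mu := (@lebesgue_measure R).
Context (D : set R) (mD : measurable D) (Dfin : (mu D < +oo)%E).
Implicit Types (T : finType).

Lemma sint_refine T T' (g : R -> T') (f : T' -> T) (w : T -> V) :
  labelling g -> sint D (f \o g) w = sint D g (w \o f).
Proof.
move=> mg; rewrite /sint.
under eq_bigr do rewrite (measure_label_partition _ _ mD Dfin mg)
  rmorph_sum scaler_suml.
rewrite [RHS](partition_big f xpredT)//=; apply: eq_bigr => i _.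
by apply: eq_bigr => j /eqP ->.
Qed.

Lemma sintB T (g : R -> T) (w w' : T -> V) :
  sint D g w - sint D g w' = sint D g (fun i => w i - w' i).
Proof.
by rewrite /sint -sumrB; apply: eq_bigr => i _; rewrite scalerBr.
Qed.

Lemma sintD T (g : R -> T) (w w' : T -> V) :
  sint D g w + sint D g w' = sint D g (fun i => w i + w' i).
Proof.
by rewrite /sint -big_split; apply: eq_bigr => i _; rewrite scalerDr.
Qed.

Lemma sint_le T (g : R -> T) (w : T -> V) : labelling g ->
  ((rnorm (sint D g w))%:E <= \int[mu]_(x in D) (rnorm (w (g x)))%:E)%E.
Proof.
move=> mg; rewrite (@integral_labels _ _ g (fun i => rnorm (w i)))//; last first.
  by move=> i; exact: rnorm_ge0.
rewrite lee_fin (le_trans (ler_rnorm_sum _ _ _))// ler_sum// => i _.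
by rewrite rnormZr ger0_norm// fine_ge0.
Qed.

Lemma sint_pair_le T T' (g : R -> T) (g' : R -> T') (w : T -> V) (w' : T' -> V) :
  labelling g -> labelling g' ->
  ((rnorm (sint D g w - sint D g' w'))%:E <=
    \int[mu]_(x in D) (rnorm (w (g x) - w' (g' x)))%:E)%E.
Proof.
move=> mg mg'; have mgg := labelling_pair mg mg'.
have -> : sint D g w = sint D (fun x => (g x, g' x)) (w \o fst).
  exact: (@sint_refine _ _ _ fst w mgg).
have -> : sint D g' w' = sint D (fun x => (g x, g' x)) (w' \o snd).
  exact: (@sint_refine _ _ _ snd w' mgg).
by rewrite sintB; exact: sint_le.
Qed.

(** Overlapping sets of a simple function are separated by labelling a point
    with the set of indices whose sets contain it. *)
Definition atoms (s : simple_fun V) (x : R) : {set 'I_(sfsize s)} :=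
  [set i | x \in sfset (s := s) i]%SET.

Definition atom_val (s : simple_fun V) (A : {set 'I_(sfsize s)}) : V :=
  \sum_(i in A) sfval (s := s) i.

Lemma labelling_atoms s : labelling (@atoms s).
Proof.
move=> A; have -> : @atoms s @^-1` [set A] =
    \bigcap_(i in [set: 'I_(sfsize s)])
      (if i \in A then sfset (s := s) i else ~` sfset (s := s) i).
  apply/seteqP; split=> [x <- i _|x h].
    by rewrite inE; case: ifPn => [/set_mem//|/negP xi /mem_set].
  apply/setP => i; rewrite inE; have := h i Logic.I.
  by case: ifP => [_ /mem_set//|_ xi]; apply/negP => /set_mem.
apply: fin_bigcap_measurable; first exact: finite_finset.
move=> i _; case: ifP => _; first exact: sfset_measurable.
by apply: measurableC; exact: sfset_measurable.
Qed.

Lemma simple_evalE s x : simple_eval s x = atom_val (@atoms s x).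
Proof.
rewrite /simple_eval /atom_val [RHS]big_mkcond; apply: eq_bigr => i _.
rewrite !inE indicE; case: ifP => _; first by rewrite scale1r.
by rewrite scale0r.
Qed.

Lemma simple_integralE s : simple_integral D s = sint D (@atoms s) (@atom_val s).
Proof.
rewrite /simple_integral /sint /atom_val.
under [RHS]eq_bigr do rewrite scaler_sumr.
rewrite (exchange_big_dep xpredT)//=; apply: eq_bigr => i _.
rewrite -scaler_suml -rmorph_sum; congr (_%:C *: _).
rewrite setIC.
have -> : sfset (s := s) i = ((fun A : {set 'I_(sfsize s)} => i \in A) \o @atoms s) @^-1` [set true].
  by apply/seteqP; split=> x /=; rewrite inE; [move=> /mem_set|move=> /set_mem].
rewrite (@measure_label_partition _ _ _ (@atoms s))//; last exact: labelling_atoms.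
by apply: eq_bigl => A; case: (i \in A).
Qed.

End StepIntegral.
(** ** Uniform limits of finitely valued functions *)

(** Every integrand below is a uniform limit of finitely valued functions, so
    its integral is described by uniform approximation; [Bint_bochner_integral]
    identifies the resulting value with the Bochner integral. *)
Definition Bint (R : realType) (V : normedModType R[i]) (D : set R)
    (f : R -> V) (v : V) : Prop :=
  forall e : R, 0 < e -> exists (T : finType) (g : R -> T) (w : T -> V),
    [/\ labelling g, forall s, D s -> rnorm (f s - w (g s)) <= e &
        rnorm (v - sint D g w) <= e].

Definition simplifiable (R : realType) (V : normedModType R[i]) (D : set R)
    (f : R -> V) : Prop :=
  forall e : R, 0 < e -> exists (T : finType) (g : R -> T) (w : T -> V),
    labelling g /\ forall s, D s -> rnorm (f s - w (g s)) <= e.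

Section BintTheory.
Context (R : realType) (V : normedModType R[i]).
Notation mu := (@lebesgue_measure R).
Context (D : set R) (mD : measurable D) (Dfin : (mu D < +oo)%E).

Implicit Types (T : finType).

Let m := fine (mu D).
Let m0 : 0 <= m. Proof. exact: fine_ge0. Qed.
Let mE : mu D = m%:E. Proof. by rewrite fineK// ge0_fin_numE. Qed.

Lemma integral_finite_cst (r : R) : (\int[mu]_(x in D) r%:E = (r * m)%:E)%E.
Proof. by rewrite integral_cst// EFinM -mE. Qed.

Lemma sint_dist T T' (g : R -> T) (g' : R -> T') (w : T -> V) (w' : T' -> V) (e : R) :
  0 <= e -> labelling g -> labelling g' ->
  (forall s, D s -> rnorm (w (g s) - w' (g' s)) <= e) ->
  rnorm (sint D g w - sint D g' w') <= e * m.
Proof.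
move=> e0 mg mg' h; rewrite -lee_fin (le_trans (sint_pair_le mD Dfin _ _ mg mg'))//.
rewrite -integral_finite_cst ge0_le_integral//.
- by move=> x _; rewrite lee_fin rnorm_ge0.
- apply/measurable_EFinP.
  exact: (labelling_measurable (fun a => rnorm (w a.1 - w' a.2)) mD
    (labelling_pair mg mg')).
Qed.

Lemma Bint_simplifiable (f : R -> V) v : Bint D f v -> simplifiable D f.
Proof.
by move=> h e /h[T [g [w [mg fg _]]]]; exists T, g, w.
Qed.

Lemma Bint_ext (f f' : R -> V) v : (forall s, D s -> f s = f' s) ->
  Bint D f v -> Bint D f' v.
Proof.
move=> ff h e /h[T [g [w [mg fg vg]]]]; exists T, g, w; split => // s Ds.
by rewrite -ff// fg.
Qed.

Lemma simplifiable_ext (f f' : R -> V) : (forall s, D s -> f s = f' s) ->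
  simplifiable D f -> simplifiable D f'.
Proof.
move=> ff h e /h[T [g [w [mg fg]]]]; exists T, g, w; split => // s Ds.
by rewrite -ff// fg.
Qed.

Lemma BintD (f f' : R -> V) v v' : Bint D f v -> Bint D f' v' ->
  Bint D (fun s => f s + f' s) (v + v').
Proof.
move=> hf hf' e e0; have e20 : 0 < e / 2 by rewrite divr_gt0.
have [T [g [w [mg fg vg]]]] := hf _ e20.
have [T' [g' [w' [mg' fg' vg']]]] := hf' _ e20.
have mgg := labelling_pair mg mg'.
exists (T * T')%type, (fun s => (g s, g' s)), (fun a => w a.1 + w' a.2); split=> //.
  move=> s Ds; rewrite opprD addrACA (le_trans (ler_rnormD _ _))//.
  by rewrite (splitr e) lerD// ?fg// fg'.
have -> : sint D (fun s => (g s, g' s)) (fun a => w a.1 + w' a.2) =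
    sint D g w + sint D g' w'.
  rewrite -sintD; congr (_ + _); apply/esym.
  - exact: (sint_refine mD Dfin fst w mgg).
  - exact: (sint_refine mD Dfin snd w' mgg).
rewrite opprD addrACA (le_trans (ler_rnormD _ _))//.
by rewrite (splitr e) lerD.
Qed.

Lemma Bint_indic_cst (A : set R) (b : V) : measurable A ->
  Bint D (fun s => if s \in A then b else 0) ((fine (mu (D `&` A)))%:C *: b).
Proof.
move=> mA e e0; exists bool, (fun s => s \in A), (fun c : bool => if c then b else 0).
have E c : (fun s => s \in A) @^-1` [set c] = if c then A else ~` A.
  apply/seteqP; case: c; split=> x /=.
  - by move=> /set_mem. - exact: mem_set.
  - by move=> xA /mem_set; rewrite xA. - by move=> nA; exact: memNset.
split.
- by move=> c; rewrite E; case: c => //; exact: measurableC.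
- by move=> s _; rewrite subrr rnorm0 ltW.
- rewrite /sint big_bool /= scaler0 addr0 E subrr rnorm0 ltW//.
Qed.

Lemma Bint0 : Bint D (fun=> 0) (0 : V).
Proof.
have := @Bint_indic_cst set0 0 measurable0; rewrite scaler0.
by apply: Bint_ext => s _; case: ifP.
Qed.

Lemma Bint_sum (I : Type) (r : seq I) (F : I -> R -> V) (z : I -> V) :
  (forall i, Bint D (F i) (z i)) ->
  Bint D (fun s => \sum_(i <- r) F i s) (\sum_(i <- r) z i).
Proof.
move=> h; elim: r => [|i r IH].
  by rewrite big_nil; apply: Bint_ext Bint0 => s _; rewrite big_nil.
rewrite big_cons; apply: Bint_ext (BintD (h i) IH) => s _.
by rewrite big_cons.
Qed.

Lemma Bint_le (f : R -> V) v (p : R -> R) : Bint D f v -> measurable_fun D p ->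
  (forall s, D s -> rnorm (f s) <= p s) ->
  ((rnorm v)%:E <= \int[mu]_(x in D) (p x)%:E)%E.
Proof.
move=> h mp fp; apply/lee_addgt0Pr => e e0.
have m10 : 0 < 1 + m by rewrite ltr_pwDl.
have [T [g [w [mg fg vg]]]] := h _ (divr_gt0 e0 m10).
set d := e / (1 + m) in fg vg; have d0 : 0 < d by rewrite divr_gt0.
have -> : e = d + d * m by rewrite -[X in X + _]mulr1 -mulrDr divfK ?gt_eqF.
have vle : rnorm v <= d + rnorm (sint D g w).
  by rewrite -{1}(subrK (sint D g w) v) (le_trans (ler_rnormD _ _))// lerD2r.
apply: (@le_trans _ _ (d%:E + (rnorm (sint D g w))%:E)%E).
  by rewrite -EFinD lee_fin.
rewrite EFinD addeCA leeD2l//.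
have p0 s : D s -> 0 <= p s by move=> Ds; rewrite (le_trans (rnorm_ge0 _) (fp s Ds)).
rewrite (le_trans (sint_le mD Dfin w mg))//.
rewrite -integral_finite_cst -ge0_integralD//; last 2 first.
- exact/measurable_EFinP.
- by move=> s Ds; rewrite lee_fin ltW.
apply: ge0_le_integral => //.
- by move=> s Ds; rewrite lee_fin rnorm_ge0.
- apply/measurable_EFinP.
  exact: (labelling_measurable (fun a => rnorm (w a)) mD mg).
- by apply: emeasurable_funD => //; exact/measurable_EFinP.
- move=> s Ds; rewrite -EFinD lee_fin.
  rewrite -(subrK (f s) (w (g s))) (le_trans (ler_rnormD _ _))// addrC lerD ?fp//.
  by rewrite rnorm_distC fg.
Qed.

Lemma Bint_le_cst (f : R -> V) v (M : R) : Bint D f v ->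
  (forall s, D s -> rnorm (f s) <= M) -> rnorm v <= M * m.
Proof.
move=> h fM; rewrite -lee_fin -integral_finite_cst.
exact: (Bint_le h (measurable_cst M)).
Qed.

Lemma simplifiable_bounded (f : R -> V) : simplifiable D f ->
  exists2 M, 0 < M & forall s, D s -> rnorm (f s) <= M.
Proof.
move=> /(_ 1 ltr01)[T [g [w [_ h]]]].
have S0 : 0 <= \sum_i rnorm (w i) by apply: sumr_ge0 => i _; exact: rnorm_ge0.
exists (1 + \sum_i rnorm (w i)); first by rewrite ltr_pwDl.
move=> s Ds; rewrite -(subrK (w (g s)) (f s)) (le_trans (ler_rnormD _ _))//.
rewrite lerD ?h// (bigD1 (g s))//= lerDl sumr_ge0// => i _; exact: rnorm_ge0.
Qed.

(** A function is simplifiable as soon as it oscillates little on the fibres of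
    some label map: sampled values then serve as approximations. *)
Lemma simplifiable_osc (f : R -> V) :
  (forall e : R, 0 < e -> exists (T : finType) (g : R -> T), labelling g /\
     forall s s', D s -> D s' -> g s = g s' -> rnorm (f s - f s') <= e) ->
  simplifiable D f.
Proof.
move=> h e /h[T [g [mg hg]]].
exists T, g, (fun i => f (xget 0 [set s | D s /\ g s = i])); split => // s Ds.
have [Ds' gs'] : [set s' | D s' /\ g s' = g s] (xget 0 [set s' | D s' /\ g s' = g s]).
  by apply: xgetPex; exists s.
exact: hg.
Qed.

(** The set of thresholds [i * d] below [phi s] is a label for [s] that
    locates [phi s] up to an error smaller than [d]. *)
Lemma threshold_labels (phi : R -> R) (B d : R) : 0 < d ->
  measurable_fun setT phi -> (forall s, D s -> 0 <= phi s <= B) ->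
  exists (T : finType) (g : R -> T), labelling g /\
    forall s s', D s -> D s' -> g s = g s' -> `|phi s - phi s'| < d.
Proof.
move=> d0 mphi hB; pose N := (Num.truncn (B / d)).+1.
pose E (i : 'I_N) : set R := [set s | i%:R * d <= phi s].
have mE' i : measurable (E i).
  have := mphi measurableT `[i%:R * d, +oo[%classic (measurable_itv _).
  rewrite setTI; congr measurable; apply/seteqP.
  by split=> x /=; rewrite in_itv /= andbT.
pose g s := [set i : 'I_N | s \in E i]%SET.
exists {set 'I_N}, g; split.
  move=> A; have -> : g @^-1` [set A] =
      \bigcap_(i in [set: 'I_N]) (if i \in A then E i else ~` E i).
    apply/seteqP; split=> [x <- i _|x h].
      by rewrite inE; case: ifPn => [/set_mem//|/negP xi /mem_set].
    apply/setP => i; rewrite inE; have := h i Logic.I.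
    by case: ifP => [_ /mem_set//|_ xi]; apply/negP => /set_mem.
  apply: fin_bigcap_measurable; first exact: finite_finset.
  by move=> i _; case: ifP => _; [|apply: measurableC]; exact: mE'.
have half s s' : D s -> D s' -> g s = g s' -> phi s - phi s' < d.
  move=> Ds Ds' gss; rewrite ltNge; apply/negP => hd.
  have [ps0 psB] := andP (hB s Ds); have [ps'0 _] := andP (hB s' Ds').
  have pd0 : 0 <= phi s / d by rewrite divr_ge0// ltW.
  have iN : (Num.truncn (phi s / d) < N)%N.
    by rewrite ltnS le_truncn// ler_wpM2r// invr_ge0 ltW.
  have /andP[t1 t2] := truncn_itv pd0.
  have : Ordinal iN \in g s by rewrite inE; apply/mem_set; rewrite /E /= -ler_pdivlMr.
  rewrite gss inE => /set_mem; rewrite /E /= => h.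
  have : phi s < (Num.truncn (phi s / d)).+1%:R * d by rewrite -ltr_pdivrMr.
  rewrite -natr1 mulrDl mul1r ltNge => /negP; apply.
  by rewrite -lerBrDr (le_trans h)// lerBrDr -lerBrDl.
move=> s s' Ds Ds' gss; rewrite ltr_norml half// andbT ltrNl opprB.
by rewrite half.
Qed.

(** Label a point by the thresholds passed by the scalar together with the
    label coming from the vector factor: the product oscillates little on the
    fibres. *)
Lemma simplifiable_scale (k : R -> R) (K : R) (f : R -> V) :
  measurable_fun setT k -> (forall s, D s -> `|k s| <= K) ->
  simplifiable D f -> simplifiable D (fun s => (k s)%:C *: f s).
Proof.
move=> mk kK sf; have [M M0 fM] := simplifiable_bounded sf.
apply: simplifiable_osc => e e0.
have K0 : 0 < `|K| + 1 by rewrite ltr_pwDr.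
have [T [g [w [mg hg]]]] := sf _ (divr_gt0 (divr_gt0 e0 (ltr0n _ 4)) K0).
set d := e / 4%:R / _ in hg.
have [T' [g' [mg' hg']]] : exists (T : finType) (g : R -> T), labelling g /\
    forall s s', D s -> D s' -> g s = g s' -> `|(k s + K) - (k s' + K)| < e / 2 / M.
  apply: (@threshold_labels _ (K + K)).
  - by rewrite !divr_gt0.
  - exact: measurable_funD.
  - move=> s /kK; rewrite ler_norml => /andP[h1 h2].
    by rewrite -lerBlDr sub0r h1 lerD2r.
exists (T * T')%type, (fun s => (g s, g' s)); split; first exact: labelling_pair.
move=> s s' Ds Ds' [gs gs'].
have := hg' s s' Ds Ds' gs'; rewrite opprD addrACA subrr addr0 => hk.
have -> : (k s)%:C *: f s - (k s')%:C *: f s' =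
    (k s - k s')%:C *: f s + (k s')%:C *: (f s - f s').
  by rewrite rmorphB scalerBl scalerBr addrA subrK.
rewrite (le_trans (ler_rnormD _ _))// !rnormZr (splitr e) lerD//.
  rewrite (@le_trans _ _ (e / 2 / M * M))//; last by rewrite divfK// gt_eqF.
  by apply: ler_pM => //; [exact: rnorm_ge0|exact: ltW|exact: fM].
have -> : e / 2 = (`|K| + 1) * (d + d).
  by rewrite /d; field; rewrite gt_eqF.
apply: ler_pM => //; first exact: rnorm_ge0.
  by rewrite (le_trans (kK s' Ds'))// (le_trans (ler_norm K))// lerDl.
rewrite (le_trans (ler_rdistD (w (g s)) _ _))// lerD ?hg//.
by rewrite gs rnorm_distC hg.
Qed.

(** This links the vector-valued integral with the real one; it is applied to
    the real and imaginary parts of complex values. *)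
Lemma Bint_real (l : V -> R) (f : R -> V) v (M : R) : 0 < M ->
  (forall v w, l (v + w) = l v + l w) ->
  (forall (r : R) v, l (r%:C *: v) = r * l v) ->
  (forall v, `|l v| <= M * rnorm v) -> Bint D f v ->
  mu.-integrable D (EFin \o (l \o f)) /\ l v = \int[mu]_(x in D) l (f x).
Proof.
move=> M0 lD lZ lM h.
have lB a b : l (a - b) = l a - l b.
  by rewrite lD -[- b]scale1r scalerN -scaleNr -(rmorph1 (real_complex R)) -rmorphN lZ mulN1r.
have lS (T : finType) (F : T -> V) : l (\sum_i F i) = \sum_i l (F i).
  elim/big_rec2: _ => [|i x y _ <-]; last by rewrite lD.
  by rewrite -(subrr 0) lB subrr.
have lab (T : finType) (g : R -> T) (p : T -> R) : labelling g ->
    mu.-integrable D (EFin \o (p \o g)) /\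
    \int[mu]_(x in D) p (g x) =
      \sum_i fine (mu (D `&` g @^-1` [set i])) * p i.
  move=> mg.
  have ip (q : T -> R) : mu.-integrable D (EFin \o (q \o g)).
    apply: measurable_bounded_integrable => //.
      exact: (labelling_measurable q mD mg).
    exists (\sum_i `|q i|); split; first exact: num_real.
    move=> x Sx y _ /=; rewrite (le_trans _ (ltW Sx))// (bigD1 (g y))//= lerDl.
    by rewrite sumr_ge0.
  split=> //; pose P := \sum_i `|p i|.
  have E := @integral_labels _ _ g (fun i => p i + P) D mD Dfin mg _.
  have : \int[mu]_(x in D) (p (g x) + P) =
      \sum_i fine (mu (D `&` g @^-1` [set i])) * (p i + P).
    rewrite /Rintegral E// => i; rewrite -lerBlDr sub0r lerNl.
    rewrite (le_trans (ler_norm _))// normrN /P (bigD1 i)//= lerDl sumr_ge0//.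
  have E2 := @integral_labels _ _ g (fun i => P) D mD Dfin mg _.
  have : \int[mu]_(x in D) P =
      \sum_i fine (mu (D `&` g @^-1` [set i])) * P.
    by rewrite /Rintegral E2// => i; rewrite sumr_ge0.
  rewrite RintegralD//; [|exact: ip|exact: (ip (fun=> P))].
  move=> ->; under [X in _ = X -> _]eq_bigr do rewrite mulrDr.
  by rewrite big_split /= => /addIr.
have mlf : measurable_fun D (l \o f).
  have [G hG] : exists G : nat -> R -> R, (forall n, measurable_fun D (G n)) /\
      forall n x, D x -> `|l (f x) - G n x| <= M * n.+1%:R^-1.
    have : forall n, exists Gn : R -> R, measurable_fun D Gn /\
      forall x, D x -> `|l (f x) - Gn x| <= M * n.+1%:R^-1.
      move=> n; have n0 : 0 < n.+1%:R^-1 :> R by rewrite invr_gt0.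
      have [T [g [w [mg fg _]]]] := h _ n0.
      exists (fun x => l (w (g x))); split.
        exact: (labelling_measurable (fun i => l (w i)) mD mg).
      move=> x Dx; rewrite -lB (le_trans (lM _))// ler_pM2l//.
      exact: fg.
    move=> /choice[G hG]; exists G; split=> n; first by have [] := hG n.
    by have [_] := hG n.
  case: hG => mG hG.
  apply: (measurable_fun_cvg mG) => x Dx.
  apply/cvgrPdist_le => e e0; near=> n.
  rewrite (le_trans (hG n x Dx))// -ler_pdivlMl// -(invrK (M^-1 * e)).
  rewrite lef_pV2 ?posrE//; last by rewrite invr_gt0 mulr_gt0// invr_gt0.
  near: n; apply: filterS (nbhs_infty_gtr ((M^-1 * e)^-1)) => n /= /ltW/le_trans.
  by apply; rewrite ler_nat.
have ilf : mu.-integrable D (EFin \o (l \o f)).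
  apply: measurable_bounded_integrable => //.
  have [B B0 fB] := simplifiable_bounded (Bint_simplifiable h).
  exists (M * B); split; first exact: num_real.
  move=> x Sx y Dy /=; rewrite (le_trans _ (ltW Sx))// (le_trans (lM _))//.
  by rewrite ler_pM2l// fB.
split=> //; apply/eqP; rewrite -subr_eq0 -normr_le0; apply/ler_addgt0Pr => e e0.
have M10 : 0 < M * (1 + m) by rewrite mulr_gt0// ltr_pwDl.
have [T [g [w [mg fg vg]]]] := h _ (divr_gt0 e0 M10); set d := e / _ in fg vg.
have [ig Eg] := lab T g (l \o w) mg.
have lsint : l (sint D g w) = \int[mu]_(x in D) l (w (g x)).
  by rewrite Eg lS; apply: eq_bigr => i _; rewrite lZ.
have -> : l v - \int[mu]_(x in D) l (f x) =
    l (v - sint D g w) - \int[mu]_(x in D) (l (f x) - l (w (g x))).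
  by rewrite RintegralB// lB lsint; ring.
rewrite add0r (le_trans (ler_normB _ _))//.
have -> : e = M * d + M * d * m.
  by rewrite /d; field; rewrite !gt_eqF// ltr_pwDl.
rewrite lerD//.
  by rewrite (le_trans (lM _))// ler_pM2l.
rewrite (le_trans (le_normr_Rintegral _ _))//.
  rewrite /comp; under eq_fun do rewrite EFinB.
  exact: integrableB.
rewrite -Rintegral_cst//.
have ib : mu.-integrable D (EFin \o (fun x => `|l (f x) - l (w (g x))|)).
  have ifg : mu.-integrable D (EFin \o (fun x => l (f x) - l (w (g x)))).
    rewrite /comp; under eq_fun do rewrite EFinB.
    exact: integrableB.
  exact: (integrable_norm ifg).
apply: le_Rintegral => //.
  apply: measurable_bounded_integrable => //.
  exists `|M * d|; split; first exact: num_real.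
  by move=> x /ltW Sx y _.
by move=> x Dx; rewrite -lB (le_trans (lM _))// ler_pM2l//; exact: fg.
Unshelve. all: end_near. Qed.

End BintTheory.
Section BintExistence.
Context (R : realType).
Notation mu := (@lebesgue_measure R).
Context (D : set R) (mD : measurable D) (Dfin : (mu D < +oo)%E).

Let m := fine (mu D).
Let m0 : 0 <= m. Proof. exact: fine_ge0. Qed.

(** Two approximations within [e] of [f] have integrals within [2 e] times the
    measure of the domain, so completeness of V provides the limit. *)
Lemma Bint_exists (V : completeNormedModType R[i]) (f : R -> V) :
  simplifiable D f -> exists v, Bint D f v.
Proof.
move=> h; have : forall n : nat, exists z : V, exists (T : finType) (g : R -> T)
    (w : T -> V), [/\ labelling g,
      forall s, D s -> rnorm (f s - w (g s)) <= n.+1%:R^-1 & z = sint D g w].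
  move=> n; have n0 : 0 < n.+1%:R^-1 :> R by rewrite invr_gt0.
  by have [T [g [w [mg fg]]]] := h _ n0; exists (sint D g w), T, g, w.
move=> /choice[z hz].
have inv_small (e : R) : 0 < e -> exists N : nat, forall n, (N <= n)%N ->
    n.+1%:R^-1 <= e.
  move=> e0; exists (Num.truncn e^-1) => n Nn.
  rewrite -[leRHS]invrK lef_pV2 ?posrE ?invr_gt0//.
  by rewrite (le_trans (ltW (truncnS_gt _)))// ler_nat.
have zz n p : rnorm (z n - z p) <= (n.+1%:R^-1 + p.+1%:R^-1) * m.
  have [T [g [w [mg fg ->]]]] := hz n; have [T' [g' [w' [mg' fg' ->]]]] := hz p.
  apply: sint_dist => //.
  move=> s Ds; rewrite (le_trans (ler_rdistD (f s) _ _))// lerD ?fg'//.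
  by rewrite rnorm_distC fg.
have [|v hv] := @rcauchy_cvg R V z.
  move=> e e0; have m10 : 0 < 1 + m by rewrite ltr_pwDl.
  have [N hN] := inv_small _ (divr_gt0 (divr_gt0 e0 (ltr0n _ 2)) m10).
  exists N => n p Nn Np; rewrite (le_trans (zz n p))//.
  rewrite (@le_trans _ _ ((e / 2 / (1 + m) + e / 2 / (1 + m)) * (1 + m)))//.
    apply: ler_pM => //; first by rewrite lerD ?hN.
    by rewrite lerDr.
  by rewrite -mulrDl -splitr divfK// gt_eqF.
exists v => e e0; have [N hN] := hv e e0; have [N' hN'] := inv_small e e0.
have [T [g [w [mg fg zE]]]] := hz (maxn N N').
exists T, g, w; split => //.
  by move=> s Ds; rewrite (le_trans (fg s Ds))// hN'// leq_maxr.
by rewrite -zE rnorm_distC hN// leq_maxl.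
Qed.

Lemma Bint_map (V W : normedModType R[i]) (L : V -> W) (f : R -> V) v :
  rlinear L -> rbounded L -> Bint D f v -> Bint D (fun s => L (f s)) (L v).
Proof.
move=> lL [M M0 hM] h e e0; have [T [g [w [mg fg vg]]]] := h _ (divr_gt0 e0 M0).
exists T, g, (fun i => L (w i)); split => //.
  move=> s Ds; rewrite -rlinearB// (le_trans (hM _))// mulrC -ler_pdivlMr//.
  exact: fg.
have -> : sint D g (fun i => L (w i)) = L (sint D g w).
  by rewrite /sint rlinear_sum//; apply: eq_bigr => i _; case: lL => _ ->.
by rewrite -rlinearB// (le_trans (hM _))// mulrC -ler_pdivlMr.
Qed.

Context (V : normedModType R[i]).

Lemma labelled_simple (T : finType) (g : R -> T) (w : T -> V) : labelling g ->
  exists s : simple_fun V, (forall x, D x -> simple_eval s x = w (g x)) /\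
    simple_integral D s = sint D g w.
Proof.
move=> mg; pose E (i : 'I_#|T|) := D `&` g @^-1` [set enum_val i].
have mE i : measurable (E i) by apply: measurableI => //; exact: mg.
have Efin i : (mu (E i) < +oo)%E.
  apply: le_lt_trans Dfin; rewrite le_measure ?inE//; first exact: mE.
  by move=> x [].
exists (SimpleFun (fun i => w (enum_val i)) mE Efin); split.
  move=> x Dx; rewrite /simple_eval /=.
  rewrite (bigD1 (enum_rank (g x)))//= big1 ?addr0; last first.
    move=> i ig; rewrite indicE memNset ?scale0r// => -[_ /= gi].
    by move: ig; rewrite gi enum_valK eqxx.
  rewrite indicE mem_set ?scale1r ?enum_rankK//.
  by split=> //=; rewrite enum_rankK.
rewrite /simple_integral /sint /= [RHS](reindex (@enum_val T T))/=; last first.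
  exact: (onW_bij _ (@enum_val_bij _)).
by apply: eq_bigr => i _; rewrite setIC /E setIA setIid.
Qed.

Lemma Bint_bochner (f f' : R -> V) v : Bint D f v ->
  {ae mu, forall s, D s -> f s = f' s} -> is_bochner_integral D f' v.
Proof.
move=> h ff'.
have inv_small (e : R) : 0 < e -> exists N : nat, forall n, (N <= n)%N ->
    n.+1%:R^-1 <= e.
  move=> e0; exists (Num.truncn e^-1) => n Nn.
  rewrite -[leRHS]invrK lef_pV2 ?posrE ?invr_gt0//.
  by rewrite (le_trans (ltW (truncnS_gt _)))// ler_nat.
have : forall n : nat, exists s : simple_fun V,
    (forall x, D x -> rnorm (f x - simple_eval s x) <= n.+1%:R^-1) /\
    rnorm (v - simple_integral D s) <= n.+1%:R^-1.
  move=> n; have n0 : 0 < n.+1%:R^-1 :> R by rewrite invr_gt0.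
  have [T [g [w [mg fg vg]]]] := h _ n0.
  have [s [sE sI]] := labelled_simple w mg.
  by exists s; rewrite sI; split=> // x Dx; rewrite sE// fg.
move=> /choice[s hs]; exists s; split.
- apply: ae_imp ff' => x fx Dx; rewrite -fx//.
  apply/cvg_rnormP_ltn => e /inv_small[N hN]; exists N => n Nn.
  by rewrite rnorm_distC (le_trans ((hs n).1 x Dx))// hN.
- apply: (@squeeze_cvge _ _ _ _ (cst 0%E) _ (fun n => (n.+1%:R^-1 * m)%:E)).
  + apply: nearW => n; apply/andP; split.
      by apply: integral_ge0 => x _; rewrite lee_fin rnorm_ge0.
    rewrite -(integral_finite_cst mD Dfin); apply: le_lower_integral => //.
    * by move=> x _; rewrite lee_fin rnorm_ge0.
    * apply: ae_imp ff' => x fx Dx; rewrite -fx// lee_fin.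
      exact: (hs n).1.
  + exact: cvg_cst.
  + apply/fine_cvgP; split; first exact: nearW.
    rewrite /comp /=; apply/cvgrPdist_le => e e0.
    have m10 : 0 < 1 + m by rewrite ltr_pwDl.
    have [N hN] := inv_small _ (divr_gt0 e0 m10).
    exists N => // n /= Nn; rewrite sub0r normrN ger0_norm ?mulr_ge0//.
    rewrite (@le_trans _ _ (e / (1 + m) * (1 + m)))//; last by rewrite divfK// gt_eqF.
    by apply: ler_pM => //; [rewrite hN|rewrite lerDr].
- apply/cvg_rnormP_ltn => e /inv_small[N hN]; exists N => n Nn.
  by rewrite rnorm_distC (le_trans (hs n).2)// hN.
Qed.

(** On the common refinement of a uniform approximation and a simple one, the
    distance of their integrals is at most the integral of the distance to
    [f'], which tends to zero. *)
Lemma Bint_bochner_unique (f f' : R -> V) v v' : Bint D f v ->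
  {ae mu, forall s, D s -> f s = f' s} -> is_bochner_integral D f' v' -> v' = v.
Proof.
move=> h ff' [s [_ hs1 hs2]]; apply: rnorm_eq_le => e e0.
have m30 : 0 < 3%:R + m by rewrite ltr_pwDl.
set d := e / (3%:R + m); have d0 : 0 < d by rewrite divr_gt0.
have [T [g [w [mg fg vg]]]] := h _ d0.
have /cvg_rnormP_ltn/(_ _ d0)[N hN] := hs2.
have : \forall n \near \oo,
   (\int[mu]_(t in D) (rnorm (f' t - simple_eval (s n) t))%:E <= d%:E)%E.
  have /fine_cvgP[fin /cvgrPdist_le /(_ _ d0) cvg0] := hs1.
  near=> n; rewrite -[leLHS]fineK; last by near: n.
  rewrite lee_fin; apply: le_trans (ler_norm _) _; rewrite -normrN -sub0r.
  by near: n.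
move=> [N' _ hN']; pose n := maxn N N'.
have Nn : (N <= n)%N by rewrite leq_maxl.
have /= hn := hN' n (leq_maxr _ _); clear hN'.
pose q (a : T * {set 'I_(sfsize (s n))}) := rnorm (w a.1 - atom_val a.2).
pose gg x := (g x, atoms (s n) x).
have mgg : labelling gg := labelling_pair mg (@labelling_atoms _ _ (s n)).
have mq (p : _ -> R) : measurable_fun D (p \o gg) := labelling_measurable p mD mgg.
have le1 : ((rnorm (sint D g w - simple_integral D (s n)))%:E <= (d + d * m)%:E)%E.
  rewrite simple_integralE//.
  rewrite (le_trans (sint_pair_le mD Dfin _ _ mg (@labelling_atoms _ _ (s n))))//.
  apply: (@le_trans _ _ (\int[mu]_(x in D) ((Num.max (q (gg x) - d) 0)%:E + d%:E)%E)%E).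
    apply: ge0_le_integral => //.
    - by move=> x _; rewrite lee_fin rnorm_ge0.
    - by apply/measurable_EFinP; exact: (mq q).
    - by apply: emeasurable_funD => //; apply/measurable_EFinP;
        exact: (mq (fun a => Num.max (q a - d) 0)).
    - by move=> x Dx; rewrite -EFinD lee_fin -lerBlDr le_max lexx.
  rewrite ge0_integralD//; last 3 first.
  - by move=> x _; rewrite lee_fin le_max lexx orbT.
  - by apply/measurable_EFinP; exact: (mq (fun a => Num.max (q a - d) 0)).
  - by move=> x _; rewrite lee_fin ltW.
  rewrite integral_finite_cst// EFinD leeD2r//.
  apply: le_trans hn; apply: le_lower_integral_r => //.
  - by move=> x _; rewrite lee_fin le_max lexx orbT.
  - by move=> x _; rewrite lee_fin rnorm_ge0.
  - by apply/measurable_EFinP; exact: (mq (fun a => Num.max (q a - d) 0)).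
  - apply: ae_imp ff' => x fx Dx; rewrite lee_fin -fx// ge_max rnorm_ge0 andbT.
    rewrite lerBlDl /q /gg /= -simple_evalE.
    rewrite (le_trans (ler_rdistD (f x) _ _))// lerD2r rnorm_distC.
    exact: fg.
rewrite lee_fin in le1.
rewrite (le_trans (ler_rdistD (simple_integral D (s n)) _ _))//.
have -> : e = d + (d + d * m + d) by rewrite /d; field; rewrite gt_eqF.
rewrite lerD//; first by rewrite rnorm_distC hN.
rewrite (le_trans (ler_rdistD (sint D g w) _ _))// lerD// rnorm_distC//.
Unshelve. all: end_near. Qed.

Lemma Bint_bochner_integral (f f' : R -> V) v : Bint D f v ->
  {ae mu, forall s, D s -> f s = f' s} -> bochner_integral D f' = v.
Proof.
move=> h ff'; apply: (Bint_bochner_unique h ff').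
by apply: xgetPex; exists v; exact: (Bint_bochner h).
Qed.

Lemma Bint_unique (f f' : R -> V) v v' : (forall s, D s -> f s = f' s) ->
  Bint D f v -> Bint D f' v' -> v = v'.
Proof.
move=> ff h h'; rewrite -(Bint_bochner_integral h (ae_all (fun _ => ff _))).
exact: (Bint_bochner_integral h' (ae_all (fun _ _ => erefl))).
Qed.

End BintExistence.
(** ** Continuous integrands and the fundamental theorem of calculus *)

Section Segments.
Context (R : realType).
Notation mu := (@lebesgue_measure R).

Lemma segment_lty (a b : R) : (mu `[a, b]%classic < +oo)%E.
Proof. by rewrite lebesgue_measure_itv /=; case: ifP; rewrite // ltry. Qed.

Lemma fine_segment (t : R) : 0 <= t -> fine (mu `[0, t]%classic) = t.
Proof.
move=> t0; rewrite lebesgue_measure_itv /= lte_fin; case: ifPn => /=.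
  by rewrite subr0.
by rewrite -leNgt => t0'; apply/eqP; rewrite eq_le t0 t0'.
Qed.

Lemma fine_sub_segment (a b c : R) : 0 <= a -> a <= b -> b <= c ->
  fine (mu (`[0, c]%classic `&` `]a, b]%classic)) = b - a.
Proof.
move=> a0 ab bc; have -> : `[0, c]%classic `&` `]a, b]%classic = `]a, b]%classic.
  apply/seteqP; split=> x /=; first by case.
  rewrite !in_itv /= => /andP[ax xb]; rewrite ax xb (le_trans xb)//.
  by rewrite (le_trans a0)// ltW.
rewrite lebesgue_measure_itv /= lte_fin; case: ifPn => //=.
by rewrite -leNgt => t0'; apply/eqP; rewrite eq_sym subr_eq0 eq_le ab t0'.
Qed.

Context (V : normedModType R[i]).
Implicit Types (f : R -> V).

Lemma cont_on_unif (T : R) f : cont_on `[0, T]%classic f ->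
  forall e : R, 0 < e -> exists2 d : R, 0 < d & forall s s',
    `[0, T]%classic s -> `[0, T]%classic s' -> `|s' - s| < d ->
    rnorm (f s' - f s) <= e.
Proof.
move=> fc e e0; have := @segment_compact R 0 T => /compact_near_coveringP.
move=> /(_ R 0^'+ (fun d x => `[0, T]%classic x -> forall s', `[0, T]%classic s' ->
  `|s' - x| < d -> rnorm (f s' - f x) <= e) _) [].
  move=> x Kx; have [d d0 hd] := fc x Kx (e / 2) (divr_gt0 e0 (ltr0n _ 2)).
  exists ([set y | `|y - x| < d / 2], [set r | r < d / 2]); first split => /=.
  - apply/nbhs_ballP; exists (d / 2) => /=; first by rewrite divr_gt0.
    by move=> y; rewrite -ball_normE /ball_ /= distrC.
  - by apply: nbhs_right_lt; rewrite divr_gt0.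
  - move=> [y r] /= [yx rd] Ky s' Ks' s'y.
    rewrite (le_trans (ler_rdistD (f x) _ _))// (splitr e) lerD//.
      apply: hd => //; rewrite -(subrK y s') -addrA (le_lt_trans (ler_normD _ _))//.
      by rewrite (splitr d) ltrD// (lt_trans s'y).
    rewrite rnorm_distC; apply: hd => //.
    by rewrite (lt_le_trans yx)// ler_pdivrMr// ler_pMr// ler1n.
move=> d /= d0 hd; exists (d / 2); first by rewrite divr_gt0.
move=> s s' Ks Ks'; apply: hd => //=; last by rewrite divr_gt0.
rewrite sub0r normrN gtr0_norm ?divr_gt0// ltr_pdivrMr// ltr_pMr// ltr1n//.
Qed.

Lemma cont_on_simplifiable (T : R) f : cont_on `[0, T]%classic f ->
  simplifiable `[0, T]%classic f.
Proof.
move=> fc; apply: simplifiable_osc => e e0.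
have [d d0 hd] := cont_on_unif fc e0.
have [|T' [g [mg hg]]] := @threshold_labels R `[0, T]%classic id T d d0 (@measurable_id _ _ _).
  by move=> s; rewrite /= in_itv.
exists T', g; split => // s s' Ks Ks' gs; apply: hd => //.
exact: hg.
Qed.

Lemma BintN (D : set R) f v : measurable D -> (mu D < +oo)%E ->
  Bint D f v -> Bint D (fun s => - f s) (- v).
Proof.
move=> mD Dfin; apply: (@Bint_map R D V V -%R).
  split=> [a b|r a]; first by rewrite opprD.
  by rewrite scalerN.
by exists 1 => // a; rewrite rnormN mul1r.
Qed.

Lemma BintB (D : set R) f f' v v' : measurable D -> (mu D < +oo)%E ->
  Bint D f v -> Bint D f' v' -> Bint D (fun s => f s - f' s) (v - v').
Proof. by move=> mD Dfin h h'; apply: BintD => //; exact: BintN. Qed.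

Lemma BintZ (D : set R) (r : R) f v : measurable D -> (mu D < +oo)%E ->
  Bint D f v -> Bint D (fun s => r%:C *: f s) (r%:C *: v).
Proof.
move=> mD Dfin; apply: (@Bint_map R D V V (fun v => r%:C *: v)).
  split=> [a b|r' a]; first by rewrite scalerDr.
  by rewrite !scalerA mulrC.
exists (`|r| + 1); first by rewrite ltr_pwDr.
by move=> a; rewrite rnormZr ler_wpM2r ?rnorm_ge0// lerDl.
Qed.

Lemma Bint_extend (D D' : set R) f v : measurable D -> measurable D' ->
  D `<=` D' -> Bint D f v -> Bint D' (fun s => if s \in D then f s else 0) v.
Proof.
move=> mD mD' DD' h e e0; have [T [g [w [mg fg vg]]]] := h e e0.
pose g' s := if s \in D then Some (g s) else None.
exists (option T), g', (fun o => if o is Some i then w i else 0); split.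
- case=> [i|].
  + have -> : g' @^-1` [set Some i] = D `&` g @^-1` [set i].
      apply/seteqP; split=> x; rewrite /g' /=.
        by case: ifPn => // /set_mem Dx [<-].
      by move=> [Dx <-]; rewrite mem_set.
    by apply: measurableI => //; exact: mg.
  + have -> : g' @^-1` [set None] = ~` D; last exact: measurableC.
    apply/seteqP; split=> x; rewrite /g' /=.
      by case: ifPn => // /negP nD _ Dx; apply: nD; exact: mem_set.
    by move=> nD; rewrite memNset.
- move=> s D's; rewrite /g'; case: ifPn => [/set_mem Ds|_]; first exact: fg.
  by rewrite subrr rnorm0 ltW.
- suff -> : sint D' g' (fun o => if o is Some i then w i else 0) = sint D g w by [].
  rewrite /sint (bigD1 None)//= scaler0 add0r.
  rewrite (reindex_omap Some id)/=; last by case.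
  apply: eq_big => [i|i _]; first by rewrite eqxx.
  congr ((fine (mu _))%:C *: _); apply/seteqP; split=> x; rewrite /g' /=.
    by move=> [_]; case: ifPn => // /set_mem Dx [].
  by move=> [Dx <-]; rewrite mem_set//; split => //; exact: DD'.
Qed.

(** The shape of estimate needed for increments in the upper limit of an
    integral: small everywhere, and merely bounded on a short interval. *)
Lemma Bint_le_step (T a b c1 c2 : R) f v : 0 <= a -> a <= b -> b <= T ->
  0 <= c2 -> Bint `[0, T]%classic f v ->
  (forall s, 0 <= s <= T -> ~~ (a < s <= b) -> rnorm (f s) <= c1) ->
  (forall s, a < s <= b -> rnorm (f s) <= c1 + c2) ->
  rnorm v <= c1 * T + c2 * (b - a).
Proof.
move=> a0 ab bT c20 h h1 h2; have T0 : 0 <= T by rewrite (le_trans a0)// (le_trans ab).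
have mT : measurable `[0, T]%classic by exact: measurable_itv.
have mab : measurable (`]a, b]%classic : set R) by exact: measurable_itv.
have c10 : 0 <= c1.
  rewrite (le_trans (rnorm_ge0 (f 0)))// h1 ?lexx//.
  by rewrite negb_and -leNgt a0.
pose p s := c1 + c2 * (\1_(`]a, b]%classic : set R) s).
have mp : measurable_fun `[0, T]%classic p.
  apply: measurable_funD => //; apply: measurable_funM => //.
rewrite -lee_fin; apply: le_trans (Bint_le mT (segment_lty 0 T) h mp _) _.
  move=> s; rewrite /= in_itv /= => sT; rewrite /p indicE.
  have [sab|sab] := boolP (a < s <= b).
    by rewrite mem_set ?mulr1 ?h2//= in_itv.
  by rewrite memNset ?mulr0 ?addr0 ?h1//= in_itv; exact/negP.
rewrite /p; under eq_integral do rewrite EFinD EFinM.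
rewrite ge0_integralD//; last 2 first.
- by move=> s _; rewrite mule_ge0// lee_fin.
- by apply: emeasurable_funM => //; apply/measurable_EFinP.
rewrite integral_finite_cst ?segment_lty// fine_segment// EFinD leeD2l//.
rewrite ge0_integralZl//; last by apply/measurable_EFinP.
rewrite integral_indic// setIC EFinM lee_wpmul2l// ?lee_fin//.
rewrite -(fine_sub_segment a0 ab bT) fineK// ge0_fin_numE//.
apply: le_lt_trans (segment_lty 0 T); rewrite le_measure ?inE//.
by apply: measurableI.
Qed.
End Segments.
Section Calculus.
Context (R : realType).
Notation mu := (@lebesgue_measure R).

Lemma in_set_itv (i : interval R) s : (s \in [set` i]%classic) = (s \in i).
Proof. by apply/idP/idP => [/set_mem|/mem_set]. Qed.

Lemma segment_sub (t T : R) : t <= T -> `[0, t]%classic `<=` `[0, T]%classic.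
Proof. by move=> tT s; rewrite /= !in_itv /= => /andP[-> /le_trans]; apply. Qed.

Lemma Bint_increment (V : normedModType R[i]) (f : R -> V) (a b e : R) va vb c :
  0 <= a -> a <= b -> 0 <= e ->
  Bint `[0, a]%classic f va -> Bint `[0, b]%classic f vb ->
  (forall s, a < s <= b -> rnorm (f s - c) <= e) ->
  rnorm (vb - va - (b - a)%:C *: c) <= e * (b - a).
Proof.
move=> a0 ab e0 ha hb hc.
have mI (x y : R) : measurable (`[x, y]%classic : set R) by exact: measurable_itv.
have fin (x y : R) := @segment_lty R x y.
have sub := segment_sub ab.
have h := BintB (mI _ _) (fin _ _) (BintB (mI _ _) (fin _ _) hb
  (Bint_extend (mI _ _) (mI _ _) sub ha))
  (Bint_indic_cst `[0, b]%classic c (measurable_itv `]a, b])).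
rewrite fine_sub_segment// in h.
rewrite -[leRHS]add0r -(mul0r b).
apply: (Bint_le_step a0 ab (lexx b) e0 h) => s.
- move=> sb nab; have sa : s <= a.
    by move: nab; case/andP: sb => _ ->; rewrite andbT -leNgt.
  by rewrite !in_set_itv !in_itv /= (negPf nab) sa (andP sb).1 subrr subr0 rnorm0.
- move=> sab; rewrite !in_set_itv !in_itv /= sab [s <= a]leNgt (andP sab).1.
  by rewrite andbF subr0 add0r hc.
Qed.

(** The mean value inequality by continuous induction: the set of times up to
    which the increment is at most [e] per unit of time is closed and can
    always be enlarged. *)
Lemma deriv_on0_cst (V : normedModType R[i]) (G : R -> V) (T t : R) :
  deriv_on `[0, T]%classic G (fun=> 0) -> 0 <= t <= T -> G t = G 0.
Proof.
move=> dG /andP[t0 tT]; apply: rnorm_eq_le => e' e'0.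
have T0 : 0 <= T by exact: le_trans tT.
have T10 : 0 < T + 1 by rewrite ltr_pwDr.
pose e := e' / (T + 1); have e0 : 0 < e by rewrite divr_gt0.
pose E := [set x | 0 <= x <= T /\ forall s, 0 <= s <= x -> rnorm (G s - G 0) <= e * s].
have E0 : E 0.
  split; first by rewrite lexx.
  move=> s /andP[s0 s0']; have -> : s = 0 by apply/eqP; rewrite eq_le s0 s0'.
  by rewrite subrr rnorm0 mulr0.
have ubE : ubound E T by move=> x [/andP[]].
have supE : has_sup E by split; [exists 0|exists T].
pose c := sup E.
have c0 : 0 <= c by apply: ub_le_sup => //; exists T.
have cT : c <= T by apply: ge_sup => //; exists 0.
have below s : 0 <= s -> s < c -> rnorm (G s - G 0) <= e * s.
  move=> s0 sc; have cs0 : 0 < c - s by rewrite subr_gt0.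
  have [x [xT hx] sx] := sup_adherent cs0 supE.
  apply: hx; rewrite s0 /=; apply/ltW.
  by have := sx; rewrite -/c opprB addrCA subrr addr0 => ->.
have [|d d0 hd] := dG c _ e e0; first by rewrite /= in_itv /= c0.
have near s : 0 <= s <= T -> `|s - c| < d -> rnorm (G s - G c) <= e * `|s - c|.
  move=> sT sc; have := hd s; rewrite scaler0 subr0; exact.
have Gc : rnorm (G c - G 0) <= e * c.
  have [c00|cn0] := eqVneq c 0; first by rewrite c00 subrr rnorm0 mulr0.
  have cgt0 : 0 < c by rewrite lt_neqAle eq_sym cn0.
  pose s := Num.max 0 (c - d / 2).
  have s0 : 0 <= s by rewrite le_max lexx.
  have sc : s < c by rewrite gt_max cgt0 ltrBlDr ltrDl divr_gt0.
  have sd : c - s < d.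
    rewrite ltrBlDl -ltrBlDr lt_max; apply/orP; right.
    by rewrite ltrD2l ltrN2 ltr_pdivrMr// ltr_pMr// ltr1n.
  rewrite (le_trans (ler_rdistD (G s) _ _))//.
  have -> : e * c = e * (c - s) + e * s by rewrite -mulrDr subrK.
  rewrite lerD//; last exact: below.
  rewrite rnorm_distC (le_trans (near s _ _))//.
  - by rewrite s0 (le_trans (ltW sc)).
  - by rewrite distrC ger0_norm// subr_ge0 ltW.
  - by rewrite distrC ger0_norm// subr_ge0 ltW.
have above s : c <= s -> s <= T -> s < c + d -> rnorm (G s - G 0) <= e * s.
  move=> cs sT sd; rewrite (le_trans (ler_rdistD (G c) _ _))//.
  have -> : e * s = e * (s - c) + e * c by rewrite -mulrDr subrK.
  rewrite lerD// (le_trans (near s _ _))//.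
  - by rewrite (le_trans c0).
  - by rewrite ger0_norm ?subr_ge0// ltrBlDl.
  - by rewrite ger0_norm ?subr_ge0.
have all s : 0 <= s -> s <= T -> s < c + d -> rnorm (G s - G 0) <= e * s.
  by move=> s0 sT sd; have [/above|/below] := leP c s; apply.
have Tc : T < c + d.
  rewrite ltNge; apply/negP => cdT.
  pose x := c + d / 2.
  have xcd : x < c + d by rewrite ltrD2l ltr_pdivrMr// ltr_pMr// ltr1n.
  have : x <= c.
    apply: ub_le_sup; first by exists T.
    split; first by rewrite (ltW (lt_le_trans xcd cdT)) andbT addr_ge0// ltW// divr_gt0.
    move=> s /andP[s0 sx]; have sc := le_lt_trans sx xcd.
    by apply: all => //; rewrite ltW// (lt_le_trans sc).
  by rewrite leNgt /x ltrDl divr_gt0.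
rewrite (le_trans (all t t0 tT (le_lt_trans tT Tc)))//.
rewrite /e mulrAC ler_pdivrMr// ler_pM2l// (le_trans tT)// lerDl//.
Qed.

Context (V : completeNormedModType R[i]).

Lemma Bint_segment0 (f : R -> V) v : Bint `[0, 0]%classic f v -> v = 0.
Proof.
move=> h; apply: rnorm0_eq0; apply/eqP; rewrite eq_le rnorm_ge0 andbT.
have [M M0 hM] := simplifiable_bounded (Bint_simplifiable h).
have := Bint_le_cst (measurable_itv _) (segment_lty 0 0) h hM.
by rewrite fine_segment// mulr0.
Qed.

Lemma Bint_primitive (f : R -> V) (T : R) (Phi : R -> V) :
  cont_on `[0, T]%classic f ->
  (forall t, 0 <= t <= T -> Bint `[0, t]%classic f (Phi t)) ->
  deriv_on `[0, T]%classic Phi f.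
Proof.
move=> fc hPhi t tT e e0; have [d d0 hd] := fc t tT e e0.
exists d => // s sT st; move: (tT) (sT); rewrite /= !in_itv /= => tT' sT'.
have [ts|st'] := leP t s.
- rewrite ger0_norm ?subr_ge0//.
  apply: (Bint_increment _ ts (ltW e0)) (hPhi _ tT') (hPhi _ sT') _.
    by case/andP: tT'.
  move=> r /andP[tr rs]; apply: hd.
    rewrite /= in_itv /= (le_trans _ (ltW tr)) ?(le_trans rs)//.
      by case/andP: sT'.
    by case/andP: tT'.
  rewrite ger0_norm ?subr_ge0 ?ltW//; apply: le_lt_trans st.
  by rewrite ger0_norm ?subr_ge0// lerD2r.
- rewrite ltr0_norm ?subr_lt0// opprB.
  have -> : Phi s - Phi t - (s - t)%:C *: f t =
     - (Phi t - Phi s - (t - s)%:C *: f t).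
    by rewrite !opprD !opprK -scaleNr -rmorphN opprB [Phi s - _]addrC.
  rewrite rnormN.
  apply: (Bint_increment _ (ltW st') (ltW e0)) (hPhi _ sT') (hPhi _ tT') _.
    by case/andP: sT'.
  move=> r /andP[sr rt]; apply: hd.
    rewrite /= in_itv /= (le_trans _ (ltW sr)) ?(le_trans rt)//.
      by case/andP: tT'.
    by case/andP: sT'.
  rewrite ler0_norm ?subr_le0//; apply: le_lt_trans st.
  by rewrite ltr0_norm ?subr_lt0// lerN2 lerD2r ltW.
Qed.

Lemma Bint_FTC (F f : R -> V) (T : R) : 0 <= T ->
  deriv_on `[0, T]%classic F f -> cont_on `[0, T]%classic f ->
  Bint `[0, T]%classic f (F T - F 0).
Proof.
move=> T0 dF fc.
have : forall t, exists v, 0 <= t <= T -> Bint `[0, t]%classic f v.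
  move=> t; have [/andP[t0 tT]|] := boolP (0 <= t <= T); last by exists 0.
  have [|v hv] := @Bint_exists R `[0, t]%classic (measurable_itv _) (segment_lty _ _) V f.
    by apply: cont_on_simplifiable; apply: cont_onW fc; exact: segment_sub.
  by exists v.
move=> /choice[Phi hPhi].
have dPhi := Bint_primitive fc hPhi.
have P0 : Phi 0 = 0 by apply: (@Bint_segment0 f); apply: hPhi; rewrite lexx.
have dd : deriv_on `[0, T]%classic (fun t => Phi t - F t) (fun=> 0).
  apply: (@deriv_on_ext _ _ _ (fun t => Phi t + (- F t)) (fun t => f t + - f t)) => //.
    by move=> t _; rewrite subrr.
  apply: deriv_onD => //.
  apply: (@rlinear_deriv_on _ _ _ -%R) dF.
    by split=> [a b|r a]; rewrite ?opprD ?scalerN.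
  by exists 1 => // a; rewrite rnormN mul1r.
have TT : 0 <= T <= T by rewrite T0 lexx.
have := deriv_on0_cst dd TT; rewrite P0 sub0r => /eqP.
by rewrite subr_eq addrC => /eqP <-; exact: hPhi.
Qed.

Lemma deriv_on_increment (F f : R -> V) (T a b e : R) (c : V) : 0 <= a -> a <= b ->
  b <= T -> 0 <= e -> deriv_on `[0, T]%classic F f -> cont_on `[0, T]%classic f ->
  (forall s, a < s <= b -> rnorm (f s - c) <= e) ->
  rnorm (F b - F a - (b - a)%:C *: c) <= e * (b - a).
Proof.
move=> a0 ab bT e0 dF fc hc; have b0 := le_trans a0 ab.
have B x : 0 <= x -> x <= T -> Bint `[0, x]%classic f (F x - F 0).
  move=> x0 xT; apply: Bint_FTC => //.
  - by apply: deriv_onW dF; exact: segment_sub.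
  - by apply: cont_onW fc; exact: segment_sub.
have -> : F b - F a = F b - F 0 - (F a - F 0) by rewrite opprB addrA subrK.
by apply: Bint_increment hc => //; apply: B => //; exact: le_trans bT.
Qed.

End Calculus.

(** ** Convolution of a scalar input with a vector-valued kernel *)

Section VConv.
Context (R : realType).
Notation mu := (@lebesgue_measure R).

Definition loc_bounded (k : R -> R) := measurable_fun setT k /\
  forall T : R, exists K : R, forall s : R, 0 <= s <= T -> `|k s| <= K.

Definition vconv (V : normedModType R[i]) (v : R -> V) (k : R -> R) (t : R) : V :=
  bochner_integral `[0, t]%classic (fun s => (k s)%:C *: v (t - s)).

Lemma half_line_segment (T : R) : `[0, T]%classic `<=` @half_line R.
Proof. by move=> s; rewrite /= in_itv /= => /andP[]. Qed.

Lemma cont_on_reverse (V : normedModType R[i]) (v : R -> V) (t : R) :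
  cont_on (@half_line R) v -> cont_on `[0, t]%classic (fun s => v (t - s)).
Proof.
move=> vc s; rewrite /= in_itv /= => /andP[s0 st] e e0.
have ts : half_line (t - s) by rewrite /half_line /= subr_ge0.
have [d d0 hd] := vc (t - s) ts e e0; exists d => // r.
rewrite in_itv /= => /andP[r0 rt] rs; apply: hd.
  by rewrite /half_line /= subr_ge0.
have -> : t - r - (t - s) = s - r by ring.
by rewrite distrC.
Qed.

Context (V : completeNormedModType R[i]).
Implicit Types (v : R -> V) (k : R -> R).

Lemma vconvP v k t : cont_on (@half_line R) v -> loc_bounded k ->
  Bint `[0, t]%classic (fun s => (k s)%:C *: v (t - s)) (vconv v k t).
Proof.
move=> vc [mk bk]; have [K hK] := bk t.
have [|z hz] := @Bint_exists R `[0, t]%classic (measurable_itv _) (segment_lty _ _) V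
    (fun s => (k s)%:C *: v (t - s)).
  apply: (simplifiable_scale mk (K := K)).
    by move=> s; rewrite /= in_itv /=; exact: hK.
  exact: cont_on_simplifiable (cont_on_reverse vc).
rewrite /vconv (Bint_bochner_integral (measurable_itv _) (segment_lty 0 t) hz)//.
exact: ae_all.
Qed.

Lemma vconv0 v k : cont_on (@half_line R) v -> loc_bounded k -> vconv v k 0 = 0.
Proof. by move=> vc bk; exact: Bint_segment0 (vconvP _ vc bk). Qed.

(** The kernel is extended by zero to negative times, which puts the
    convolutions at all times below [T] on the same domain of integration. *)
Definition causal_ext v (r : R) : V := if 0 <= r then v r else 0.

Lemma vconv_extend v k t T : 0 <= t -> t <= T ->
  cont_on (@half_line R) v -> loc_bounded k ->
  Bint `[0, T]%classic (fun s => (k s)%:C *: causal_ext v (t - s)) (vconv v k t).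
Proof.
move=> t0 tT vc bk.
have := Bint_extend (measurable_itv _) (measurable_itv _) (segment_sub tT)
  (@vconvP v k t vc bk).
apply: Bint_ext => s; rewrite /= in_itv /= /causal_ext subr_ge0 => /andP[s0 sT].
by rewrite in_set_itv in_itv /= s0 /=; case: ifP => //; rewrite scaler0.
Qed.

Lemma cont_on_bounded v (T : R) : cont_on (@half_line R) v ->
  exists2 M, 0 < M & forall s, 0 <= s <= T -> rnorm (v s) <= M.
Proof.
move=> vc; have := cont_on_simplifiable (cont_onW (@half_line_segment T) vc).
by move=> /simplifiable_bounded[M M0 hM]; exists M.
Qed.

Lemma loc_bounded_gt0 k (T : R) : loc_bounded k ->
  exists2 K, 0 < K & forall s, 0 <= s <= T -> `|k s| <= K.
Proof.
move=> [_ /(_ T)[K hK]]; exists (`|K| + 1); first by rewrite ltr_pwDr.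
by move=> s /hK/le_trans; apply; rewrite (le_trans (ler_norm _))// lerDl.
Qed.

Lemma Bint_scaled_le_step k (w : R -> V) z (T K lo hi c1 c2 : R) :
  0 <= lo -> lo <= hi -> hi <= T -> 0 <= K -> 0 <= c1 -> 0 <= c2 ->
  (forall s, 0 <= s <= T -> `|k s| <= K) ->
  Bint `[0, T]%classic (fun s => (k s)%:C *: w s) z ->
  (forall s, 0 <= s -> s <= lo -> rnorm (w s) <= c1) ->
  (forall s, lo < s -> s <= hi -> rnorm (w s) <= c2) ->
  (forall s, hi < s -> w s = 0) ->
  rnorm z <= K * c1 * T + K * c2 * (hi - lo).
Proof.
move=> lo0 lohi hiT K0 c10 c20 kK h h1 h2 h3.
apply: (Bint_le_step lo0 lohi hiT _ h); first by rewrite mulr_ge0.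
- move=> s sT; rewrite negb_and -leNgt -ltNge rnormZr => /orP[slo|his].
    by rewrite ler_pM ?rnorm_ge0 ?kK// h1//; case/andP: sT.
  by rewrite h3// rnorm0 mulr0 mulr_ge0.
- move=> s /andP[los shi]; rewrite rnormZr -[leLHS]add0r lerD ?mulr_ge0//.
  by rewrite ler_pM ?rnorm_ge0 ?kK ?h2// (le_trans _ (ltW los))//= (le_trans shi).
Qed.

Lemma maxB_min (t t' : R) : Num.max t t' - Num.min t t' = `|t' - t|.
Proof.
case: (leP t t') => tt'; first by rewrite ger0_norm ?subr_ge0.
by rewrite ltr0_norm ?subr_lt0// opprB.
Qed.

(** By uniform continuity of the kernel, except on the short interval between
    the two times where its zero extension jumps. *)
Lemma vconv_cont v k : cont_on (@half_line R) v -> loc_bounded k ->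
  cont_on (@half_line R) (vconv v k).
Proof.
move=> vc bk t t0 e e0; rewrite /half_line /= in t0.
pose T := t + 1; have tT : t <= T by rewrite lerDl.
have T0 : 0 <= T := le_trans t0 tT.
have [K K0 hK] := loc_bounded_gt0 T bk.
have [M M0 hM] := cont_on_bounded T vc.
have T10 : 0 < T + 1 by rewrite ltr_pwDr.
pose e1 := e / 2 / (K * (T + 1)).
have e10 : 0 < e1 by rewrite !divr_gt0// mulr_gt0.
have [d d0 hd] := cont_on_unif (cont_onW (@half_line_segment T) vc) e10.
have M20 : 0 < M + M by rewrite addr_gt0.
exists (Num.min (Num.min d 1) (e / 2 / (K * (M + M)))).
  by rewrite !lt_min d0 ltr01 !divr_gt0// mulr_gt0.
move=> t' t'0; rewrite /half_line /= in t'0.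
rewrite !lt_min => /andP[/andP[t'd t'1]].
rewrite ltr_pdivlMr ?mulr_gt0// => t'e.
have t'T : t' <= T by rewrite -lerBlDl (le_trans (ler_norm _))// ltW.
have h := BintB (measurable_itv _) (segment_lty _ _)
  (vconv_extend t'0 t'T vc bk) (vconv_extend t0 tT vc bk).
have {}h : Bint `[0, T]%classic
    (fun s => (k s)%:C *: (causal_ext v (t' - s) - causal_ext v (t - s)))
    (vconv v k t' - vconv v k t).
  by apply: Bint_ext h => s _; rewrite scalerBr.
have extM r : r <= T -> rnorm (causal_ext v r) <= M.
  move=> rT; rewrite /causal_ext; case: ifP => r0; first by rewrite hM// r0.
  by rewrite rnorm0 ltW.
have le1 := Bint_scaled_le_step (lo := Num.min t t') (hi := Num.max t t')
  _ _ _ (ltW K0) (ltW e10) (ltW M20) hK h _ _ _.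
apply: le_trans (le1 _ _ _ _ _ _) _.
- by rewrite le_min t0.
- by rewrite -subr_ge0 maxB_min.
- by rewrite ge_max tT.
- move=> s s0; rewrite le_min => /andP[st st'].
  rewrite /causal_ext !subr_ge0 st st'; apply: hd.
  + by rewrite /= in_itv /= subr_ge0 st lerBlDr (le_trans tT)// lerDl.
  + by rewrite /= in_itv /= subr_ge0 st' lerBlDr (le_trans t'T)// lerDl.
  + by rewrite opprB addrA subrK.
- move=> s los _; have s0 : 0 <= s.
    by rewrite (le_trans _ (ltW los))// le_min t0.
  rewrite (le_trans (ler_rnormB _ _))// lerD// extM// lerBlDr.
  + by rewrite (le_trans t'T)// lerDl.
  + by rewrite (le_trans tT)// lerDl.
- move=> s; rewrite gt_max => /andP[ts t's].
  by rewrite /causal_ext !subr_ge0 !leNgt ts t's subrr.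
rewrite maxB_min (splitr e) lerD//; last by rewrite mulrC ltW.
have -> : K * e1 * T = e / 2 * (T / (T + 1)).
  by rewrite /e1; field; rewrite !gt_eqF.
rewrite ger_pMr ?divr_gt0// ler_pdivrMr// mul1r lerDl//.
Qed.

(** The kernel vanishes at 0, so its zero extension is differentiable except
    for a kink of the derivative; the interval that meets the kink is short,
    which makes its contribution of second order. *)
Lemma vconv_deriv v v' k : deriv_on (@half_line R) v v' ->
  cont_on (@half_line R) v' -> v 0 = 0 -> loc_bounded k ->
  deriv_on (@half_line R) (vconv v k) (vconv v' k).
Proof.
move=> dv vc' v0 bk t t0 e e0; rewrite /half_line /= in t0.
have vc := deriv_on_cont dv.
pose T := t + 1; have tT : t <= T by rewrite lerDl.
have T0 : 0 <= T := le_trans t0 tT.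
have [K K0 hK] := loc_bounded_gt0 T bk.
have [M M0 hM] := cont_on_bounded T vc'.
have T10 : 0 < T + 1 by rewrite ltr_pwDr.
pose e1 := e / 2 / (K * (T + 1)).
have e10 : 0 < e1 by rewrite !divr_gt0// mulr_gt0.
have vcT := cont_onW (@half_line_segment T) vc'.
have dvT := deriv_onW (@half_line_segment T) dv.
have [d d0 hd] := cont_on_unif vcT e10.
have M30 : 0 < M + M by rewrite addr_gt0.
exists (Num.min (Num.min d 1) (e / 2 / (K * (M + M)))).
  by rewrite !lt_min d0 ltr01 !divr_gt0// mulr_gt0.
move=> t' t'0; rewrite /half_line /= in t'0.
rewrite !lt_min => /andP[/andP[t'd t'1]].
rewrite ltr_pdivlMr ?mulr_gt0// => t'e.
have t'T : t' <= T by rewrite -lerBlDl (le_trans (ler_norm _))// ltW.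
have h1 := BintB (measurable_itv _) (segment_lty _ _)
  (vconv_extend t'0 t'T vc bk) (vconv_extend t0 tT vc bk).
have h := BintB (measurable_itv _) (segment_lty _ _) h1
  (BintZ (t' - t) (measurable_itv _) (segment_lty _ _) (vconv_extend t0 tT vc' bk)).
have {h1}h : Bint `[0, T]%classic
    (fun s => (k s)%:C *: (causal_ext v (t' - s) - causal_ext v (t - s) -
       (t' - t)%:C *: causal_ext v' (t - s)))
    (vconv v k t' - vconv v k t - (t' - t)%:C *: vconv v' k t).
  apply: Bint_ext h => s _; rewrite !scalerBr; congr (_ - _).
  by rewrite !scalerA mulrC.
have ext1 r : r <= T -> rnorm (causal_ext v' r) <= M.
  move=> rT; rewrite /causal_ext; case: ifP => r0; first by rewrite hM// r0.
  by rewrite rnorm0 ltW.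
have ext2 r a : 0 <= a -> r <= a -> r <= T -> rnorm (causal_ext v r) <= M * a.
  move=> a0 ra rT; rewrite /causal_ext; case: ifP => r0; last first.
    by rewrite rnorm0 mulr_ge0// ltW.
  have := deriv_on_increment (c := 0) (lexx 0) r0 rT (ltW M0) dvT vcT.
  rewrite v0 scaler0 !subr0 => le; apply: le_trans (le _) _.
    by move=> s /andP[s0 sr]; rewrite subr0 hM// (ltW s0) (le_trans sr).
  by rewrite ler_pM2l.
have main a b : 0 <= a -> a <= T -> 0 <= b -> b <= T -> `|b - a| < d ->
    rnorm (v b - v a - (b - a)%:C *: v' a) <= e1 * `|b - a|.
  move=> a0 aT b0 bT bad; case: (leP a b) => ab.
    rewrite ger0_norm ?subr_ge0//.
    apply: (deriv_on_increment a0 ab bT (ltW e10) dvT vcT) => s /andP[as' sb].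
    apply: hd; rewrite /= ?in_itv /= ?a0 ?aT//.
      by rewrite (le_trans a0 (ltW as')) (le_trans sb).
    rewrite gtr0_norm ?subr_gt0//; apply: le_lt_trans bad.
    by rewrite ger0_norm ?subr_ge0// lerD2r.
  rewrite ltr0_norm ?subr_lt0// opprB.
  have -> : v b - v a - (b - a)%:C *: v' a = - (v a - v b - (a - b)%:C *: v' a).
    by rewrite !opprD !opprK -scaleNr -rmorphN opprB [v b - _]addrC.
  rewrite rnormN.
  apply: (deriv_on_increment b0 (ltW ab) aT (ltW e10) dvT vcT) => s /andP[bs sa].
  apply: hd; rewrite /= ?in_itv /= ?a0 ?aT//.
    by rewrite (le_trans b0 (ltW bs)) (le_trans sa).
  rewrite ler0_norm ?subr_le0// opprB; apply: le_lt_trans bad.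
  by rewrite ltr0_norm ?subr_lt0// opprB lerD2l lerN2 ltW.
have tt0 : 0 <= `|t' - t| by [].
have e1t : 0 <= e1 * `|t' - t| by rewrite mulr_ge0// ltW.
have Mt : 0 <= (M + M) * `|t' - t| by rewrite mulr_ge0// ltW.
have le1 := Bint_scaled_le_step (lo := Num.min t t') (hi := Num.max t t')
  _ _ _ (ltW K0) e1t Mt hK h _ _ _.
apply: le_trans (le1 _ _ _ _ _ _) _.
- by rewrite le_min t0.
- by rewrite -subr_ge0 maxB_min.
- by rewrite ge_max tT.
- move=> s s0; rewrite le_min => /andP[st st'].
  rewrite /causal_ext !subr_ge0 st st'.
  have -> : t' - t = (t' - s) - (t - s) by rewrite opprB addrA subrK.
  apply: main; rewrite ?subr_ge0//.
  + by rewrite lerBlDr (le_trans tT)// lerDl.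
  + by rewrite lerBlDr (le_trans t'T)// lerDl.
  + by rewrite opprB addrA subrK.
- move=> s los shi; have s0 : 0 <= s.
    by rewrite (le_trans _ (ltW los))// le_min t0.
  have near a b : a - b <= `|t' - t| -> s > b -> a <= T ->
      rnorm (causal_ext v (a - s)) <= M * `|t' - t|.
    move=> ab bs aT; apply: ext2 => //; last by rewrite lerBlDr (le_trans aT)// lerDl.
    by apply: le_trans ab; rewrite lerD2l lerN2 ltW.
  move: los shi; rewrite gt_min le_max; case: (leP s t) => st /=.
    move=> t's _; rewrite (_ : causal_ext v (t' - s) = 0) ?sub0r; last first.
      by rewrite /causal_ext subr_ge0 leNgt t's.
    rewrite mulrDl (le_trans (ler_rnormB _ _))// rnormN lerD//.
      by rewrite (near t t')// distrC ler_norm.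
    by rewrite rnormZr mulrC ler_wpM2r// ext1// lerBlDr (le_trans tT)// lerDl.
  move=> _ st'; have ext0 w : causal_ext w (t - s) = 0.
    by rewrite /causal_ext subr_ge0 leNgt st.
  rewrite !ext0 subr0 scaler0 subr0.
  by rewrite (le_trans (near t' t _ _ _))// ?ler_norm// ler_wpM2r// lerDl ltW.
- move=> s; rewrite gt_max => /andP[ts t's].
  by rewrite /causal_ext !subr_ge0 !leNgt ts t's subrr scaler0 subr0.
rewrite maxB_min (splitr e) (mulrDl (e / 2)) lerD//; last first.
  rewrite (mulrA K) ler_wpM2r// mulrC.
  exact: ltW.
have -> : K * (e1 * `|t' - t|) * T = e / 2 * (T / (T + 1)) * `|t' - t|.
  by rewrite /e1; field; rewrite !gt_eqF.
rewrite ler_wpM2r// ger_pMr ?divr_gt0// ler_pdivrMr// mul1r lerDl//.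
Qed.

End VConv.
(** * Strongly continuous semigroups *)

(** ** Uniform boundedness *)

Section UniformBoundedness.
Context (R : realType).

Lemma geometric_cvg (V : completeNormedModType R[i]) (u : nat -> V) (C r : R) :
  0 <= C -> 0 < r -> r < 1 ->
  (forall n, rnorm (u n.+1 - u n) <= C * r ^+ n) ->
  exists l, (forall n, rnorm (l - u n) <= C * r ^+ n / (1 - r)) /\
    forall e : R, 0 < e ->
      exists N, forall n, (N <= n)%N -> rnorm (u n - l) <= e.
Proof.
move=> C0 r0 r1 hu; have r10 : 0 < 1 - r by rewrite subr_gt0.
have r'0 : 0 <= r by rewrite ltW.
have X0 n : 0 <= C * r ^+ n / (1 - r).
  by rewrite divr_ge0 ?mulr_ge0 ?exprn_ge0// ltW.
have tail n p : rnorm (u (n + p)%N - u n) <= C * r ^+ n / (1 - r).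
  suff : rnorm (u (n + p)%N - u n) <= C * r ^+ n / (1 - r) * (1 - r ^+ p).
    move/le_trans; apply; rewrite -[leRHS]mulr1 ler_wpM2l//.
    by rewrite gerBl exprn_ge0.
  elim: p => [|p IH]; first by rewrite addn0 subrr rnorm0 expr0 subrr mulr0.
  rewrite (le_trans (ler_rdistD (u (n + p)%N) _ _))// addnS.
  rewrite (le_trans (lerD (hu (n + p)%N) IH))// le_eqVlt; apply/orP; left; apply/eqP.
  by rewrite exprD exprS; field; rewrite gt_eqF.
have small (e : R) : 0 < e -> exists N, forall n, (N <= n)%N ->
    C * r ^+ n / (1 - r) <= e.
  move=> e0; have C1 : 0 < C + 1 by rewrite ltr_pwDr.
  have /cvg_expr/cvgrPdist_le : `|r| < 1 by rewrite ger0_norm.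
  move=> /(_ _ (divr_gt0 (mulr_gt0 e0 r10) C1))[N _ hN]; exists N => n Nn.
  rewrite ler_pdivrMr//; have := hN n Nn.
  rewrite /= sub0r normrN ger0_norm ?exprn_ge0// ler_pdivlMr// mulrC => /(le_trans _); apply.
  by rewrite ler_wpM2r ?exprn_ge0// lerDl.
have [|l hl] := @rcauchy_cvg R V u.
  move=> e e0; have [N hN] := small _ (divr_gt0 e0 (ltr0n _ 2)).
  exists N => m n Nm Nn; rewrite (le_trans (ler_rdistD (u N) _ _))// (splitr e) lerD//.
    by rewrite -(subnKC Nm) (le_trans (tail _ _))// hN.
  by rewrite rnorm_distC -(subnKC Nn) (le_trans (tail _ _))// hN.
exists l; split => // n; apply/ler_addgt0Pr => e /hl[N hN].
rewrite (le_trans (ler_rdistD (u (n + N)%N) _ _))// addrC lerD//.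
by rewrite rnorm_distC hN// leq_addl.
Qed.

Definition unit_sup (V W : normedModType R[i]) (L : V -> W) : R :=
  sup [set rnorm (L v) | v in [set v | rnorm v <= 1]].

Section UnitSup.
Context (V W : normedModType R[i]) (L : V -> W).
Hypothesis (lL : rlinear L) (bL : rbounded L).

Let hsup : has_sup [set rnorm (L v) | v in [set v | rnorm v <= 1]].
Proof.
split; first by exists (rnorm (L 0)), 0; rewrite //= rnorm0.
have [M M0 hM] := bL; exists M => _ [v /= v1 <-].
by rewrite (le_trans (hM v))// ger_pMr.
Qed.

Lemma unit_supP v : rnorm (L v) <= unit_sup L * rnorm v.
Proof.
have [->|v0] := eqVneq v 0; first by rewrite (rlinear0 lL) !rnorm0 mulr0.
have nv0 : 0 < rnorm v.
  rewrite lt_neqAle rnorm_ge0 andbT eq_sym; apply/eqP => /rnorm0_eq0 /eqP.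
  by rewrite (negPf v0).
rewrite -ler_pdivrMr//.
have := sup_upper_bound hsup; apply; exists (((rnorm v)^-1)%:C *: v).
  by rewrite /= rnormZr gtr0_norm ?invr_gt0// mulVf// gt_eqF.
case: lL => _ ->; rewrite rnormZr gtr0_norm ?invr_gt0// mulrC //.
Qed.

Lemma unit_sup_norming : 0 < unit_sup L ->
  exists2 v, rnorm v <= 1 & 2 / 3 * unit_sup L < rnorm (L v).
Proof.
move=> s0; have e0 : 0 < unit_sup L / 3 by rewrite divr_gt0.
have [_ [v /= v1 <-] h] := sup_adherent e0 hsup.
exists v => //; apply: le_lt_trans h; rewrite le_eqVlt; apply/orP; left; apply/eqP.
by rewrite /unit_sup; field.
Qed.

End UnitSup.

(** Sokal's elementary argument: a vector on which the norms explode is built as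
    a sum of steps of length [3^-n], each one chosen so that the [n]-th
    operator is large on the [n]-th partial sum; the remaining steps are too
    short to undo this. *)
Lemma uniform_boundedness (V : completeNormedModType R[i]) (W : normedModType R[i])
    (L : nat -> V -> W) :
  (forall n, rlinear (L n)) -> (forall n, rbounded (L n)) ->
  (forall v, exists M, forall n, rnorm (L n v) <= M) ->
  exists M, forall n v, rnorm (L n v) <= M * rnorm v.
Proof.
move=> lL bL pb; apply: contrapT => nub.
have big (C : R) : exists n, C < unit_sup (L n).
  apply: contrapT => h; apply: nub; exists C => n v.
  rewrite (le_trans (unit_supP (lL n) (bL n) v))// ler_wpM2r ?rnorm_ge0//.
  by rewrite leNgt; apply/negP => Cn; apply: h; exists n.
have /choice[s hs] : forall k : nat, exists n, k.+1%:R * 6 * 3 ^+ k < unit_sup (L n).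
  by move=> k; exact: big.
have spos k : 0 < unit_sup (L (s k)).
  by apply: lt_trans (hs k); rewrite !mulr_gt0// exprn_gt0.
have /choice[w hw] : forall k, exists v, rnorm v <= (3^-1) ^+ k /\
    2 / 3 * unit_sup (L (s k)) * (3^-1) ^+ k <= rnorm (L (s k) v).
  move=> k; have [v v1 hv] := unit_sup_norming (bL (s k)) (spos k).
  have t0 : 0 <= (3^-1 : R) ^+ k by rewrite exprn_ge0.
  exists (((3^-1) ^+ k)%:C *: v); split.
    by rewrite rnormZr ger0_norm// ler_piMr.
  case: (lL (s k)) => _ ->; rewrite rnormZr ger0_norm// mulrC ler_wpM2l//.
  exact: ltW.
pose step k (y : V) : V :=
  if rnorm (L (s k) (y - w k)) <= rnorm (L (s k) (y + w k)) then y + w k else y - w k.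
pose fix y n : V := if n is m.+1 then step m (y m) else 0.
have stepn k z : rnorm (step k z - z) <= 1 * (3^-1) ^+ k.
  rewrite mul1r /step; case: ifP => _; rewrite addrAC subrr sub0r || rewrite addrAC subrr add0r.
    by rewrite ?rnormN; exact: (hw k).1.
  by rewrite ?rnormN ?add0r ?rnormN; exact: (hw k).1.
have stepL k z : rnorm (L (s k) (w k)) <= rnorm (L (s k) (step k z)).
  have e : L (s k) (w k) *+ 2 = L (s k) (z + w k) - L (s k) (z - w k).
    rewrite -rlinearB//.
    have -> : z + w k - (z - w k) = w k + w k by rewrite opprB addrC addrA subrK.
    by case: (lL (s k)) => -> _.
  have : rnorm (L (s k) (w k)) *+ 2 <= rnorm (L (s k) (step k z)) *+ 2.
    have -> : rnorm (L (s k) (w k)) *+ 2 = rnorm (L (s k) (w k) *+ 2).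
      have -> : L (s k) (w k) *+ 2 = (2 : R)%:C *: L (s k) (w k).
        by rewrite rmorph_nat scaler_nat.
      by rewrite rnormZr ger0_norm// mulr_natl.
    rewrite e (le_trans (ler_rnormB _ _))// /step mulr2n.
    case: ifP => [h|/negbT]; first by rewrite lerD2l.
    by rewrite -ltNge => /ltW h; rewrite lerD2r.
  by rewrite lerMn2r.
have [||||l [hl _]] := @geometric_cvg V y 1 3^-1.
- by [].
- by rewrite invr_gt0.
- by rewrite invf_lt1// ltr1n.
- by move=> n; exact: stepn.
have [M hM] := pb l.
pose k := Num.truncn M.
have := hM (s k); rewrite leNgt => /negP; apply.
apply: lt_le_trans (truncnS_gt M) _; rewrite -/k.
set S := unit_sup (L (s k)); set q := (3^-1 : R) ^+ k.
have q0 : 0 < q by rewrite exprn_gt0// invr_gt0.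
have low : 2 / 3 * S * q <= rnorm (L (s k) (y k.+1)).
  exact: le_trans (hw k).2 (stepL _ _).
have tl : rnorm (L (s k) (y k.+1 - l)) <= S * (q / 2).
  rewrite (le_trans (unit_supP (lL _) (bL _) _))// ler_wpM2l ?(ltW (spos k))//.
  rewrite rnorm_distC (le_trans (hl k.+1))// exprS -/q le_eqVlt.
  by apply/orP; left; apply/eqP; field.
have : rnorm (L (s k) (y k.+1)) <= S * (q / 2) + rnorm (L (s k) l).
  rewrite -{1}(subrK l (y k.+1)); case: (lL (s k)) => -> _.
  by rewrite (le_trans (ler_rnormD _ _))// lerD2r.
move=> /(le_trans low); rewrite -lerBlDl; apply: le_trans.
have -> : 2 / 3 * S * q - S * (q / 2) = S * (q / 6) by field.
have := hs k; rewrite -/S => /ltW hS.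
have -> : (k.+1%:R : R) = k.+1%:R * 6 * 3 ^+ k * (q / 6).
  by rewrite /q exprVn; field; rewrite expf_neq0.
by rewrite ler_wpM2r// divr_ge0// ltW.
Qed.

(** The Neumann series. *)
Lemma contraction_solve (V : completeNormedModType R[i]) (L : V -> V) (q : R) :
  rlinear L -> 0 < q -> q < 1 -> (forall v, rnorm (L v) <= q * rnorm v) ->
  forall b, exists w, w - L w = b.
Proof.
move=> lL q0 q1 hL b; pose fix u n : V := if n is m.+1 then b + L (u m) else 0.
have hu n : rnorm (u n.+1 - u n) <= rnorm b * q ^+ n.
  elim: n => [|n IH]; first by rewrite /= (rlinear0 lL) addr0 subr0 expr0 mulr1.
  have -> : u n.+2 - u n.+1 = L (u n.+1 - u n).
    by rewrite rlinearB// -[u n.+2]/(b + L (u n.+1)) -[in X in _ - X]/(b + L (u n)) opprD addrACA subrr add0r.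
  by rewrite (le_trans (hL _))// exprS mulrCA ler_pM2l.
have [l [_ hl]] := geometric_cvg (rnorm_ge0 b) q0 q1 hu.
exists l; apply: rnorm_eq_le => e e0.
have [N hN] := hl _ (divr_gt0 e0 (ltr0n _ 2)).
have -> : l - L l - b = (l - u N.+1) + L (u N - l).
  by rewrite -[u N.+1]/(b + L (u N)) rlinearB// opprD !addrA subrK addrAC.
rewrite (le_trans (ler_rnormD _ _))// (splitr e) lerD//.
  by rewrite rnorm_distC hN.
rewrite (le_trans (hL _))// (le_trans _ (hN N (leqnn N)))//.
by rewrite ler_piMl ?rnorm_ge0// ltW.
Qed.

End UniformBoundedness.
(** ** Orbits, generators and resolvents *)

Section Primitive.
Context (R : realType) (V : completeNormedModType R[i]).
Implicit Types (f F G : R -> V).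

Definition primitive f (t : R) : V := bochner_integral `[0, t]%classic f.

Lemma primitiveP f t : cont_on (@half_line R) f ->
  Bint `[0, t]%classic f (primitive f t).
Proof.
move=> fc; have [|z hz] := @Bint_exists R `[0, t]%classic (measurable_itv _) (segment_lty _ _) V f.
  by apply: cont_on_simplifiable; apply: cont_onW fc; exact: half_line_segment.
rewrite /primitive (Bint_bochner_integral (measurable_itv _) (segment_lty 0 t) hz)//.
exact: ae_all.
Qed.

Lemma primitive0 f : cont_on (@half_line R) f -> primitive f 0 = 0.
Proof. by move=> fc; exact: Bint_segment0 (primitiveP _ fc). Qed.

(** Derivatives are local, so statements on segments extend to all times. *)
Lemma deriv_on_segments F f :
  (forall T, deriv_on `[0, T]%classic F f) -> deriv_on (@half_line R) F f.
Proof.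
move=> h t t0 e e0; rewrite /half_line /= in t0.
have tT : `[0, t + 1]%classic t by rewrite /= in_itv /= t0 /= lerDl.
have [d d0 hd] := h (t + 1) t tT e e0.
exists (Num.min d 1); first by rewrite lt_min d0 ltr01.
move=> s s0; rewrite lt_min => /andP[sd s1]; apply: hd => //.
rewrite /= in_itv /=; apply/andP; split; first exact: s0.
by rewrite -lerBlDl (le_trans (ler_norm _))// ltW.
Qed.

Lemma primitive_deriv f : cont_on (@half_line R) f ->
  deriv_on (@half_line R) (primitive f) f.
Proof.
move=> fc; apply: deriv_on_segments => T.
apply: Bint_primitive => [|t _]; last exact: primitiveP.
by apply: cont_onW fc; exact: half_line_segment.
Qed.

Lemma deriv_on_unique F G f : deriv_on (@half_line R) F f ->
  deriv_on (@half_line R) G f -> F 0 = G 0 -> forall t, 0 <= t -> F t = G t.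
Proof.
move=> dF dG FG0 t t0.
have d : deriv_on `[0, t]%classic (fun s => F s - G s) (fun=> 0).
  apply: deriv_onW (@half_line_segment R t) _.
  apply: (@deriv_on_ext _ _ _ (fun t => F t + (- G t)) (fun t => f t + - f t)) => //.
    by move=> s _; rewrite subrr.
  apply: deriv_onD => //.
  apply: (@rlinear_deriv_on _ _ _ -%R) dG.
    by split=> [a b|r a]; rewrite ?opprD ?scalerN.
  by exists 1 => // a; rewrite rnormN mul1r.
apply/eqP; rewrite -subr_eq0 (deriv_on0_cst d (t := t)) ?t0 ?lexx//.
by rewrite FG0 subrr.
Qed.

Lemma primitive_FTC F f : deriv_on (@half_line R) F f ->
  cont_on (@half_line R) f -> forall t, 0 <= t -> primitive f t = F t - F 0.
Proof.
move=> dF fc; apply: (@deriv_on_unique _ _ f).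
- exact: primitive_deriv.
- have dc : deriv_on (@half_line R) (fun=> - F 0) (fun=> 0).
    by move=> t _ e e0; exists 1 => // s _ _; rewrite subrr sub0r scaler0 oppr0 rnorm0 mulr_ge0// ltW.
  have := deriv_onD dF dc; apply: deriv_on_ext => // t _.
  by rewrite addr0.
- by rewrite primitive0// subrr.
Qed.

End Primitive.

Section Semigroup.
Context (R : realType) (X : completeNormedModType R[i]).
Implicit Types (T : c0_semigroup X) (t h e M d : R).

Lemma sg_rlinear T t : rlinear (T t).
Proof. exact: linear_rlinear. Qed.

Lemma sgZ T t h x : T t (h%:C *: x) = h%:C *: T t x.
Proof. exact: linearZ. Qed.

Lemma sg_rbounded T t : 0 <= t -> rbounded (T t).
Proof. by move=> t0; apply: linear_bounded_rnorm; exact: sg_continuous. Qed.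

Lemma sg_strong_eps T x (e : R) : 0 < e ->
  exists2 d : R, 0 < d & forall h, 0 < h -> h < d -> rnorm (T h x - x) <= e.
Proof.
move=> e0; have /cvg_rnormP/(_ e e0) := @sg_strong _ _ T x.
rewrite /at_right near_withinE => /nbhs_ballP[d /= d0 hd].
exists d => // h h0 hdd; apply: hd => //.
by rewrite -ball_normE /ball_ /= sub0r normrN gtr0_norm.
Qed.

(** Otherwise the operators at some times tending to 0 would have unbounded
    norms, although they converge pointwise. *)
Lemma sg_bounded_near0 T : exists2 d : R, 0 < d &
  exists M, forall t x, 0 <= t -> t < d -> rnorm (T t x) <= M * rnorm x.
Proof.
apply: contrapT => nb.
have : forall n : nat, exists tx : R * X, [/\ 0 <= tx.1, tx.1 < n.+1%:R^-1 &
    n%:R * rnorm tx.2 < rnorm (T tx.1 tx.2)].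
  move=> n; apply: contrapT => h; apply: nb; exists n.+1%:R^-1.
    by rewrite invr_gt0.
  exists n%:R => t x t0 tn; rewrite leNgt; apply/negP => htx; apply: h.
  by exists (t, x).
move=> /choice[tx htx].
have [||v|M hM] := @uniform_boundedness R X X (fun n => T (tx n).1).
- by move=> n; exact: sg_rlinear.
- by move=> n; apply: sg_rbounded; have [] := htx n.
- have [d d0 hd] := sg_strong_eps T v ltr01.
  pose N := Num.truncn d^-1.
  have hN n : (N <= n)%N -> rnorm (T (tx n).1 v) <= 1 + rnorm v.
    move=> Nn; have [t0 tn _] := htx n.
    rewrite -lerBlDr (le_trans (ler_norm _))// (le_trans (ler_rnorm_dist _ _))//.
    move: t0; rewrite le_eqVlt => /predU1P[<-|t0].
      by rewrite sg0 subrr rnorm0.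
    apply: hd => //; apply: lt_le_trans tn _.
    rewrite -[leRHS]invrK lef_pV2 ?posrE ?invr_gt0//.
    by rewrite (le_trans (ltW (truncnS_gt _)))// ler_nat.
  exists (1 + rnorm v + \sum_(n < N) rnorm (T (tx n).1 v)) => n.
  have [Nn|nN] := leqP N n.
    by rewrite (le_trans (hN n Nn))// lerDl sumr_ge0// => i _; exact: rnorm_ge0.
  rewrite (bigD1 (Ordinal nN))//= addrCA lerDl addr_ge0//.
    by rewrite addr_ge0// rnorm_ge0.
  by apply: sumr_ge0 => i _; exact: rnorm_ge0.
- pose n := Num.truncn M.
  have [_ _] := htx n.+1; rewrite ltNge => /negP; apply.
  rewrite (le_trans (hM _ _))// ler_wpM2r ?rnorm_ge0//.
  exact: ltW (truncnS_gt M).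
Qed.

Lemma sg_exp_bound T : exists (M w : R), 0 < M /\
  forall t x, 0 <= t -> rnorm (T t x) <= M * expR (t * w) * rnorm x.
Proof.
have [d' d'0 [M' hM']] := sg_bounded_near0 T.
pose d := d' / 2; have d0 : 0 < d by rewrite divr_gt0.
have dd' : d < d' by rewrite ltr_pdivrMr// ltr_pMr// ltr1n.
pose M := `|M'| + 1; have M1 : 1 <= M by rewrite lerDr.
have M0 : 0 < M by exact: lt_le_trans M1.
have hM t x : 0 <= t -> t <= d -> rnorm (T t x) <= M * rnorm x.
  move=> t0 td; rewrite (le_trans (hM' _ _ _ _))//; first exact: le_lt_trans dd'.
  by rewrite ler_wpM2r ?rnorm_ge0// (le_trans (ler_norm _))// lerDl.
have lM0 : 0 <= ln M by exact: ln_ge0.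
have step n t x : 0 <= t -> t <= d -> rnorm (T (n%:R * d + t) x) <= M ^+ n * (M * rnorm x).
  move=> t0 td; elim: n => [|n IH]; first by rewrite mul0r add0r expr0 mul1r hM.
  rewrite -natr1 mulrDl mul1r -addrA addrCA sgD ?(ltW d0)//; last first.
    by rewrite addr_ge0// mulr_ge0// ltW.
  by rewrite (le_trans (hM _ _ _ _)) ?(ltW d0)// exprS -mulrA ler_pM2l.
exists M, (ln M / d); split => // t x t0.
have td0 : 0 <= t / d by rewrite divr_ge0// ltW.
have /andP[n1 n2] := truncn_itv td0; set n := Num.truncn _ in n1 n2.
have tE : t = n%:R * d + (t - n%:R * d) by rewrite addrC subrK.
rewrite tE (le_trans (step n _ x _ _))//.
- by rewrite subr_ge0 -ler_pdivlMr.
- move: n2; rewrite ltr_pdivrMr// -natr1 mulrDl mul1r => /ltW.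
  by rewrite lerBlDl.
- rewrite -tE mulrA ler_wpM2r ?rnorm_ge0// mulrC ler_pM2l//.
  rewrite -{1}(lnK (x := M))// -expRM_natl ler_expR.
  have -> : t * (ln M / d) = t / d * ln M by rewrite mulrA mulrAC.
  by rewrite ler_wpM2r.
Qed.

Lemma sg_loc_bound T (t0 : R) : exists2 M : R, 0 < M &
  forall t x, 0 <= t -> t <= t0 -> rnorm (T t x) <= M * rnorm x.
Proof.
have [M [w [M0 hM]]] := sg_exp_bound T.
exists (M * expR (`|t0 * w|)); first by rewrite mulr_gt0// expR_gt0.
move=> t x t_ge0 tt0; rewrite (le_trans (hM _ _ _))// ler_wpM2r ?rnorm_ge0//.
rewrite ler_pM2l// ler_expR (le_trans (ler_norm _))// !normrM.
by rewrite ler_wpM2r// ger0_norm// (le_trans tt0)// ler_norm.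
Qed.

Lemma orbit_cont T x : cont_on (@half_line R) (fun t => T t x).
Proof.
move=> t t0 e e0; rewrite /half_line /= in t0.
have [M M0 hM] := sg_loc_bound T (t + 1).
have [d d0 hd] := sg_strong_eps T x (divr_gt0 e0 M0).
have key a b : 0 <= a -> a <= t + 1 -> a <= b -> b - a < d ->
    rnorm (T b x - T a x) <= e.
  move=> a0 at1; rewrite le_eqVlt => /predU1P[<- _|ab bad].
    by rewrite subrr rnorm0 ltW.
  have -> : T b x = T a (T (b - a) x).
    by rewrite -sgD// ?subr_ge0 ?(ltW ab)// addrC subrK.
  rewrite -linearB (le_trans (hM _ _ _ _))// mulrC -ler_pdivlMr//.
  by apply: hd => //; rewrite subr_gt0.
exists (Num.min d 1); first by rewrite lt_min d0 ltr01.
move=> s s0; rewrite lt_min => /andP[sd s1]; rewrite /half_line /= in s0.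
have [ts|st] := leP t s.
  by apply: key => //; [rewrite lerDl|rewrite (le_lt_trans (ler_norm _))].
rewrite rnorm_distC; apply: key => //.
- by rewrite ltW// (lt_le_trans st)// lerDl.
- exact: ltW.
- by rewrite (le_lt_trans (ler_norm _))// distrC.
Qed.

Lemma generatorP T x y : generator T x y <-> forall e : R, 0 < e ->
  exists2 d : R, 0 < d & forall h, 0 < h -> h < d ->
    rnorm (T h x - x - h%:C *: y) <= e * h.
Proof.
have scal h : 0 < h -> T h x - x - h%:C *: y =
    h%:C *: ((h^-1)%:C *: (T h x - x) - y).
  by move=> h0; rewrite scalerBr scalerA -rmorphM /= mulfV ?gt_eqF// scale1r.
split=> [/cvg_rnormP g e e0|g].
  have := g e e0; rewrite /at_right near_withinE => /nbhs_ballP[d /= d0 hd].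
  exists d => // h h0 hdd; rewrite scal// rnormZr gtr0_norm// mulrC ler_pM2r//.
  by apply: hd => //; rewrite -ball_normE /ball_ /= sub0r normrN gtr0_norm.
apply/cvg_rnormP => e e0; have [d d0 hd] := g e e0.
rewrite /at_right near_withinE; apply/nbhs_ballP; exists d => //= h.
rewrite -ball_normE /ball_ /= sub0r normrN => hdd h0.
rewrite gtr0_norm// in hdd; have := hd h h0 hdd.
by rewrite scal// rnormZr gtr0_norm// mulrC ler_pM2r.
Qed.

Lemma generator_orbit T x y t : 0 <= t -> generator T x y ->
  generator T (T t x) (T t y).
Proof.
move=> t0 /generatorP g; apply/generatorP => e e0.
have [M M0 hM] := sg_loc_bound T t.
have [d d0 hd] := g _ (divr_gt0 e0 M0); exists d => // h h0 hdd.
have -> : T h (T t x) - T t x - h%:C *: T t y = T t (T h x - x - h%:C *: y).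
  by rewrite !linearB sgZ -!sgD ?(ltW h0)// (addrC h).
rewrite (le_trans (hM _ _ _ _))// mulrC -ler_pdivlMr// mulrAC.
exact: hd.
Qed.

Lemma orbit_deriv T x y : generator T x y ->
  deriv_on (@half_line R) (fun t => T t x) (fun t => T t y).
Proof.
move=> g t t0 e e0; rewrite /half_line /= in t0.
have [M M0 hM] := sg_loc_bound T t.
have e20 : 0 < e / 2 / M by rewrite !divr_gt0.
have [d d0 hd] := (generatorP T x y).1 g _ e20.
have [d' d'0 hd'] := sg_strong_eps T y e20.
exists (Num.min d d'); first by rewrite lt_min d0.
move=> s s0; rewrite lt_min => /andP[sd sd']; rewrite /half_line /= in s0.
have e2e : e / 2 / M <= e / M by rewrite ler_pM2r ?invr_gt0// ler_piMr ?invf_le1 ?ler1n// ltW.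
have [ts|st|->] := ltgtP t s; last by rewrite !subrr scale0r subr0 rnorm0 normr0 mulr0.
- rewrite gtr0_norm ?subr_gt0// in sd sd' *.
  have -> : T s x - T t x - (s - t)%:C *: T t y =
      T t (T (s - t) x - x - (s - t)%:C *: y).
    by rewrite !linearB sgZ -sgD ?subr_ge0 ?(ltW ts)// (addrC t) subrK.
  rewrite (le_trans (hM _ _ _ _))// mulrC -ler_pdivlMr// mulrAC.
  rewrite (le_trans (hd _ _ _)) ?subr_gt0//.
  by rewrite ler_pM2r// subr_gt0.
- rewrite ltr0_norm ?subr_lt0// opprB in sd sd' *.
  have -> : T s x - T t x - (s - t)%:C *: T t y =
      - T s ((T (t - s) x - x - (t - s)%:C *: y) - (t - s)%:C *: (T (t - s) y - y)).
    have -> : T s (T (t - s) x - x - (t - s)%:C *: y - (t - s)%:C *: (T (t - s) y - y)) =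
        T t x - T s x - (t - s)%:C *: T t y.
      rewrite scalerBr opprB addrA subrK !linearB sgZ -!sgD ?subr_ge0 ?(ltW st)//.
      by rewrite (addrC s) subrK.
    rewrite !opprB addrC; congr (_ + _).
    by rewrite -scaleNr -rmorphN opprB.
  rewrite rnormN (le_trans (hM _ _ _ _)) ?(ltW st)// mulrC -ler_pdivlMr// mulrAC.
  rewrite (le_trans (ler_rnormB _ _))// rnormZr gtr0_norm ?subr_gt0//.
  have -> : e / M * (t - s) = e / 2 / M * (t - s) + (t - s) * (e / 2 / M) by field; rewrite gt_eqF.
  rewrite lerD ?hd ?subr_gt0// ler_pM2l ?subr_gt0//.
  by rewrite hd' ?subr_gt0.
Qed.
End Semigroup.
Section Generator.
Context (R : realType) (X : completeNormedModType R[i]).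
Implicit Types (T : c0_semigroup X) (t h e d : R).

Lemma generatorD T x y x' y' : generator T x y -> generator T x' y' ->
  generator T (x + x') (y + y').
Proof.
move=> /generatorP g /generatorP g'; apply/generatorP => e e0.
have e20 : 0 < e / 2 by rewrite divr_gt0.
have [d d0 hd] := g _ e20; have [d' d'0 hd'] := g' _ e20.
exists (Num.min d d'); first by rewrite lt_min d0.
move=> h h0; rewrite lt_min => /andP[hdd hdd'].
have -> : T h (x + x') - (x + x') - h%:C *: (y + y') =
    (T h x - x - h%:C *: y) + (T h x' - x' - h%:C *: y').
  by rewrite linearD scalerDr !opprD (addrACA (T h x)) (addrACA (T h x - x)).
by rewrite (le_trans (ler_rnormD _ _))// (splitr e) mulrDl lerD ?hd ?hd'.
Qed.

Lemma generatorZ T (c : R[i]) x y : generator T x y -> generator T (c *: x) (c *: y).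
Proof.
move=> /generatorP g; apply/generatorP => e e0.
have c0 : 0 < complex.Re `|c| + 1.
  by rewrite ltr_wpDl// Re_norm_ge0.
have [d d0 hd] := g _ (divr_gt0 e0 c0); exists d => // h h0 hdd.
have -> : T h (c *: x) - c *: x - h%:C *: (c *: y) = c *: (T h x - x - h%:C *: y).
  by rewrite linearZ !scalerBr !scalerA (mulrC c).
rewrite rnormZ (@le_trans _ _ ((complex.Re `|c| + 1) * (e / (complex.Re `|c| + 1) * h)))//.
  by rewrite ler_pM ?rnorm_ge0 ?Re_norm_ge0 ?hd ?lerDl.
by rewrite mulrA mulrCA mulfV ?mulr1 ?gt_eqF.
Qed.

Lemma deriv_on_shift (F f : R -> X) h : 0 <= h -> deriv_on (@half_line R) F f ->
  deriv_on (@half_line R) (fun t => F (t + h)) (fun t => f (t + h)).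
Proof.
move=> h0 dF t t0 e e0; rewrite /half_line /= in t0.
have th : half_line (t + h) by rewrite /half_line /= addr_ge0.
have [d d0 hd] := dF _ th e e0; exists d => // s s0 st.
have := hd (s + h); rewrite opprD addrACA subrr addr0; apply => //.
by rewrite /half_line /= addr_ge0.
Qed.

(** [T h] shifts the integral of an orbit by [h], so the difference quotient of
    the integral involves the orbit at its two endpoints only. *)
Lemma orbit_primitive_generator T x t : 0 <= t ->
  generator T (primitive (fun s => T s x) t) (T t x - x).
Proof.
move=> t0; set Phi := primitive _; have oc := orbit_cont T x.
have dPhi := primitive_deriv oc.
have shift h : 0 <= h -> T h (Phi t) = Phi (t + h) - Phi h.
  move=> h0; apply: (@deriv_on_unique _ _ (fun s => T h (Phi s))
    (fun s => Phi (s + h) - Phi h) (fun s => T (s + h) x)) => //.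
  - have := rlinear_deriv_on (sg_rlinear T h) (sg_rbounded T h0) dPhi.
    apply: deriv_on_ext => // s s0; rewrite /half_line /= in s0.
    by rewrite addrC sgD.
  - have dc : deriv_on (@half_line R) (fun=> - Phi h) (fun=> 0).
      by move=> s _ e e0; exists 1 => // r _ _; rewrite subrr sub0r scaler0 oppr0 rnorm0 mulr_ge0// ltW.
    have := deriv_onD (deriv_on_shift h0 dPhi) dc.
    by apply: deriv_on_ext => // s _; rewrite addr0.
  - by rewrite /Phi primitive0// linear0 add0r subrr.
apply/generatorP => e e0; have e20 : 0 < e / 2 by rewrite divr_gt0.
have [d d0 hd] := dPhi t t0 _ e20.
have [d' d'0 hd'] := dPhi 0 (lexx 0) _ e20.
exists (Num.min d d'); first by rewrite lt_min d0.
move=> h h0; rewrite lt_min => /andP[hdd hdd']; have h'0 := ltW h0.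
have -> : T h (Phi t) - Phi t - h%:C *: (T t x - x) =
    (Phi (t + h) - Phi t - h%:C *: T t x) - (Phi h - h%:C *: x).
  rewrite shift// scalerBr (addrAC (Phi (t + h))) !opprB !addrA.
  by rewrite [LHS](ACl (1*2*5*4*3)).
rewrite (le_trans (ler_rnormB _ _))// (splitr e) mulrDl lerD//.
  have := hd (t + h); rewrite (addrC t) addrK gtr0_norm//; apply => //.
  by rewrite /half_line /= addr_ge0.
have := hd' h; rewrite !subr0 gtr0_norm// /Phi primitive0// subr0 sg0.
by apply.
Qed.

Lemma generator_dense T x e : 0 < e ->
  exists x' y', generator T x' y' /\ rnorm (x' - x) <= e.
Proof.
move=> e0; have oc := orbit_cont T x.
have [d d0 hd] := primitive_deriv oc (lexx 0) e0.
pose h := d / 2; have h0 : 0 < h by rewrite divr_gt0.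
have hdd : h < d by rewrite ltr_pdivrMr// ltr_pMr// ltr1n.
exists ((h^-1)%:C *: primitive (fun s => T s x) h), ((h^-1)%:C *: (T h x - x)).
split; first by apply: generatorZ; apply: orbit_primitive_generator; exact: ltW.
have := hd h (ltW h0); rewrite !subr0 gtr0_norm// primitive0// subr0 sg0 => /(_ hdd).
have -> : primitive (fun s => T s x) h - h%:C *: x =
    h%:C *: ((h^-1)%:C *: primitive (fun s => T s x) h - x).
  by rewrite scalerBr scalerA -rmorphM /= mulfV ?gt_eqF// scale1r.
by rewrite rnormZr gtr0_norm// mulrC ler_pM2r.
Qed.

Lemma generator_integral T x y t : generator T x y -> 0 <= t ->
  T t x - x = primitive (fun s => T s y) t.
Proof.
move=> g t0; rewrite (primitive_FTC (orbit_deriv g) (orbit_cont T y))//.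
by rewrite sg0.
Qed.

Lemma integral_generator T x y :
  (forall t, 0 <= t -> T t x - x = primitive (fun s => T s y) t) ->
  generator T x y.
Proof.
move=> H; apply/generatorP => e e0.
have oc := orbit_cont T y.
have [d d0 hd] := primitive_deriv oc (lexx 0) e0; exists d => // h h0 hdd.
have := hd h (ltW h0); rewrite !subr0 gtr0_norm// primitive0// subr0 sg0.
by rewrite H ?(ltW h0)//; apply.
Qed.

(** Generator pairs are characterised by an integral identity, which survives
    limits. *)
Lemma generator_closed T (xs ys : nat -> X) x y :
  (forall n, generator T (xs n) (ys n)) ->
  (forall e, 0 < e -> exists N, forall n, (N <= n)%N -> rnorm (xs n - x) <= e) ->
  (forall e, 0 < e -> exists N, forall n, (N <= n)%N -> rnorm (ys n - y) <= e) ->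
  generator T x y.
Proof.
move=> g cx cy; apply: integral_generator => t t0; apply: rnorm_eq_le => e e0.
have [M M0 hM] := sg_loc_bound T t.
have C0 : 0 < M + 1 + M * t by rewrite ltr_pwDl ?addr_gt0// mulr_ge0// ltW.
set C := _ + M * t in C0; pose r := e / C; have r0 : 0 < r by rewrite divr_gt0.
have [N hN] := cx r r0; have [N' hN'] := cy r r0; pose n := maxn N N'.
have nx := hN n (leq_maxl _ _); have ny := hN' n (leq_maxr _ _).
have le1 : rnorm (primitive (fun s => T s (ys n)) t - primitive (fun s => T s y) t)
    <= M * r * t.
  have B := BintB (measurable_itv _) (segment_lty 0 t)
    (primitiveP t (orbit_cont T (ys n))) (primitiveP t (orbit_cont T y)).
  have := Bint_le_cst (M := M * r) (measurable_itv _) (segment_lty 0 t) B.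
  rewrite fine_segment//; apply => s.
  rewrite /= in_itv /= => /andP[s0 st]; rewrite -linearB (le_trans (hM _ _ s0 st))//.
  by rewrite ler_pM2l.
have -> : T t x - x - primitive (fun s => T s y) t =
   (primitive (fun s => T s (ys n)) t - primitive (fun s => T s y) t) -
   (T t (xs n - x) - (xs n - x)).
  rewrite -(generator_integral (g n) t0) (linearB (T t)) !opprB !addrA.
  by rewrite [RHS](ACl ((1*7)*(2*4)*(6*5*3)))/= subrr addNr !add0r.
have -> : e = M * r * t + (M * r + r) by rewrite /r /C; field; rewrite gt_eqF.
rewrite (le_trans (ler_rnormB _ _))// lerD// (le_trans (ler_rnormB _ _))// lerD//.
by rewrite (le_trans (hM _ _ t0 (lexx t)))// ler_pM2l.
Qed.

End Generator.
(** ** Rescaled semigroups and the resolvent *)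

Section Rescaling.
Context (R : realType).

(** [cexpN z t] is the complex number [exp (- z t)]. *)
Definition cexpN (z : R[i]) (t : R) : R[i] :=
  (expR (- (complex.Re z * t)) * cos (complex.Im z * t)) +i*
  (- (expR (- (complex.Re z * t)) * sin (complex.Im z * t))).

Lemma cexpN0 z : cexpN z 0 = 1.
Proof. by rewrite /cexpN !mulr0 oppr0 expR0 cos0 sin0 mulr1 mulr0 oppr0. Qed.

Lemma cexpND z s t : cexpN z (s + t) = cexpN z s * cexpN z t.
Proof.
rewrite /cexpN !mulrDr opprD expRD cosD sinD.
set E := expR _; set F := expR _; set c := cos _; set d := cos _.
set u := sin _; set v := sin _.
by apply/eqP; rewrite eq_complex /=; apply/andP; split; apply/eqP; ring.
Qed.

Lemma cexpN_mulN z h : cexpN (- z) h * cexpN z h = 1.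
Proof.
case: z => a' b'; apply/eqP; rewrite eq_complex /cexpN /= !mulNr opprK cosN sinN.
set a := a' * h; set b := b' * h.
have e1 : expR a * expR (- a) = 1 by rewrite -expRD subrr expR0.
have cs := cos2Dsin2 b.
apply/andP; split; apply/eqP.
  transitivity ((expR a * expR (- a)) * (cos b ^+ 2 + sin b ^+ 2)); first by ring.
  by rewrite e1 cs mul1r.
by ring.
Qed.

Lemma norm_cexpN z t : `|cexpN z t| = (expR (- (complex.Re z * t)))%:C.
Proof.
rewrite normc_def /=; congr (_ %:C).
rewrite sqrrN !exprMn -mulrDr cos2Dsin2 mulr1 sqrtr_sqr ger0_norm//.
Qed.

Lemma Re_norm_le (x y : R) : complex.Re `|x +i* y| <= `|x| + `|y|.
Proof.
rewrite normc_def /= -(ger0_norm (addr_ge0 (normr_ge0 x) (normr_ge0 y))).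
rewrite -sqrtr_sqr ler_wsqrtr// sqrrD !real_normK ?num_real//.
by rewrite addrAC lerDl mulrn_wge0// mulr_ge0.
Qed.

Lemma is_derive0_eps (f : R -> R) (l : R) : is_derive (0 : R) (1 : R) f l ->
  forall e : R, 0 < e -> exists2 d : R, 0 < d & forall h : R, 0 < h -> h < d ->
    `|f h - f 0 - l * h| <= e * h.
Proof.
move=> [df fl] e e0; have := df => /cvg_ex[/= l' hl'].
have ll' : l' = l.
  by rewrite -fl; apply/esym; apply: cvg_lim => //.
move: hl' => /cvgrPdist_le /(_ e e0); rewrite ll' near_withinE.
move=> /nbhs_ballP[d /= d0 hd]; exists d => // h h0 hdd.
have := hd h; rewrite /ball /= sub0r normrN gtr0_norm// => /(_ hdd).
rewrite gt_eqF// => /(_ isT); rewrite addr0 /GRing.scale /= mulr1 => {}hd.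
have -> : f h - f 0 - l * h = - ((l - h^-1 * (f h - f 0)) * h).
  by field; rewrite gt_eqF.
by rewrite normrN normrM (gtr0_norm h0) ler_pM2r.
Qed.

Lemma cexpN_deriv z (e : R) : 0 < e -> exists2 d : R, 0 < d &
  forall h : R, 0 < h -> h < d ->
    complex.Re `|cexpN z h - 1 + h%:C * z| <= e * h.
Proof.
move=> e0; have e20 : 0 < e / 2 by rewrite divr_gt0.
case: z => a b.
have d1 : is_derive (0 : R) 1 (fun t : R => expR (- (a * t)) * cos (b * t)) (- a).
  apply: is_derive_eq.
  rewrite /GRing.scale /= !mulr0 oppr0 expR0 cos0 sin0.
  ring.
have d2 : is_derive (0 : R) 1 (fun t : R => - (expR (- (a * t)) * sin (b * t))) (- b).
  apply: is_derive_eq.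
  rewrite /GRing.scale /= !mulr0 oppr0 expR0 cos0 sin0.
  ring.
have [d d0 hd] := is_derive0_eps d1 e20.
have [d' d'0 hd'] := is_derive0_eps d2 e20.
exists (Num.min d d'); first by rewrite lt_min d0.
move=> h h0; rewrite lt_min => /andP[/(hd h h0) h1 /(hd' h h0) h2].
move: h1 h2; rewrite !mulr0 oppr0 expR0 cos0 sin0 mulr1 mulr0 oppr0 subr0 => h1 h2.
have -> : cexpN (a +i* b) h - 1 + h%:C * (a +i* b) =
   (expR (- (a * h)) * cos (b * h) - 1 - - a * h) +i*
   (- (expR (- (a * h)) * sin (b * h)) - - b * h).
  by apply/eqP; rewrite eq_complex /cexpN /=; apply/andP; split; apply/eqP; ring.
by rewrite (le_trans (Re_norm_le _ _))// (splitr e) mulrDl lerD.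
Qed.

Context (X : completeNormedModType R[i]).

Section Rescale.
Context (T : c0_semigroup X) (z : R[i]).

Definition rescale_fun (t : R) : {linear X -> X} := (cexpN z t \*: T t).

Lemma rescale_continuous t : 0 <= t -> continuous (rescale_fun t).
Proof.
move=> t0 x; apply: cvgZr; exact: sg_continuous.
Qed.

Lemma rescale0 x : rescale_fun 0 x = x.
Proof. by rewrite /rescale_fun /= cexpN0 scale1r sg0. Qed.

Lemma rescaleD (s t : R) x : 0 <= s -> 0 <= t ->
  rescale_fun (s + t) x = rescale_fun s (rescale_fun t x).
Proof.
by move=> s0 t0; rewrite /rescale_fun /= linearZ /= scalerA -cexpND sgD.
Qed.

Lemma rescale_diff (h : R) x y :
  rescale_fun h x - x - h%:C *: (y - z *: x) =
  cexpN z h *: (T h x - x - h%:C *: y) + ((cexpN z h - 1) * h%:C) *: y +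
  (cexpN z h - 1 + h%:C * z) *: x.
Proof.
rewrite /rescale_fun /= !scalerBr !scalerDl !scalerA mulrBl mul1r scalerBl !scaleNr !scale1r.
rewrite opprB !addrA.
rewrite [RHS](ACl ((2*6)*(3*4)*(1*7*5*8)))/= addNr addNr !add0r.
by rewrite [RHS](ACl (1*2*4*3)).
Qed.

Let N := complex.Re `|z|.
Let E := expR `|complex.Re z|.

Lemma cexpN_bound (h : R) : 0 < h -> h <= 1 -> complex.Re `|cexpN z h| <= E.
Proof.
move=> h0 h1; rewrite norm_cexpN /= ler_expR (le_trans (ler_norm _))//.
by rewrite normrN normrM (gtr0_norm h0) ler_piMr.
Qed.

Lemma cexpN_sub1 (h : R) : 0 < h ->
  complex.Re `|cexpN z h - 1 + h%:C * z| <= 1 * h ->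
  complex.Re `|cexpN z h - 1| <= (1 + N) * h.
Proof.
move=> h0 le2; rewrite -[X in `|X|](addrK (h%:C * z)) mulrDl.
have := ler_normB (cexpN z h - 1 + h%:C * z) (h%:C * z).
rewrite normrM realC_norm (gtr0_norm h0) => le.
have : complex.Re `|cexpN z h - 1 + h%:C * z - h%:C * z| <=
    complex.Re (`|cexpN z h - 1 + h%:C * z| + h%:C * `|z|).
  by move: le; rewrite lecE => /andP[_].
move/le_trans; apply; rewrite raddfD /= lerD//.
by rewrite mul0r subr0 mulrC.
Qed.

Lemma rescale_generator_eps x y : generator T x y -> forall e : R, 0 < e ->
  exists2 d : R, 0 < d & forall h, 0 < h -> h < d ->
    rnorm (rescale_fun h x - x - h%:C *: (y - z *: x)) <= e * h.
Proof.
move=> /generatorP g e e0; have E0 : 0 < E := expR_gt0 _.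
have N0 : 0 <= N := Re_norm_ge0 z.
pose C := E + (1 + N) * rnorm y + rnorm x.
have C0 : 0 < C.
  by rewrite ltr_wpDr ?rnorm_ge0// ltr_wpDr// mulr_ge0 ?rnorm_ge0// addr_ge0.
pose r := e / C; have r0 : 0 < r by rewrite divr_gt0.
have [d d0 hd] := g r r0.
have [d' d'0 hd'] := cexpN_deriv z r0.
have [d'' d''0 hd''] := cexpN_deriv z ltr01.
exists (Num.min (Num.min d d') (Num.min d'' (Num.min 1 r))).
  by rewrite !lt_min d0 d'0 d''0 ltr01 r0.
move=> h h0; rewrite !lt_min => /andP[/andP[hdd hdd'] /and3P[hdd'' h1 hr]].
have h10 : complex.Re `|cexpN z h - 1| <= (1 + N) * h.
  exact: cexpN_sub1 (hd'' h h0 hdd'').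
have -> : e * h = E * (r * h) + ((1 + N) * h) * r * rnorm y + r * h * rnorm x.
  by rewrite /r /C; field; rewrite gt_eqF.
rewrite rescale_diff (le_trans (ler_rnormD _ _))// lerD//.
  rewrite (le_trans (ler_rnormD _ _))// lerD//.
    rewrite rnormZ ler_pM ?Re_norm_ge0 ?rnorm_ge0 ?cexpN_bound ?(ltW h1)//.
    exact: hd.
  rewrite mulrC -scalerA rnormZr gtr0_norm// rnormZ mulrA ler_wpM2r ?rnorm_ge0//.
  by rewrite mulrC ler_pM ?Re_norm_ge0// ?ltW.
rewrite rnormZ ler_wpM2r ?rnorm_ge0//; exact: hd'.
Qed.

Lemma rescale_strong x : rescale_fun t x @[t --> 0^'+] --> x.
Proof.
apply/cvg_rnormP => e e0; have E0 : 0 < E := expR_gt0 _.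
have N0 : 0 <= N := Re_norm_ge0 z.
have C0 : 0 < E + (1 + N) * rnorm x.
  by rewrite ltr_wpDr// mulr_ge0 ?rnorm_ge0// addr_ge0.
pose r := e / (E + (1 + N) * rnorm x); have r0 : 0 < r by rewrite divr_gt0.
have [d d0 hd] := sg_strong_eps T x r0.
have [d'' d''0 hd''] := cexpN_deriv z ltr01.
rewrite /at_right near_withinE; apply/nbhs_ballP.
exists (Num.min d (Num.min d'' (Num.min 1 r))) => /=.
  by rewrite !lt_min d0 d''0 ltr01 r0.
move=> h; rewrite -ball_normE /ball_ /= sub0r normrN => hm h0; move: hm.
rewrite gtr0_norm// !lt_min => /and4P[hdd hdd'' h1 hr].
have h10 := cexpN_sub1 h0 (hd'' h h0 hdd'').
have -> : cexpN z h *: T h x - x = cexpN z h *: (T h x - x) + (cexpN z h - 1) *: x.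
  by rewrite scalerBr scalerBl scale1r addrA subrK.
have -> : e = E * r + (1 + N) * r * rnorm x.
  by rewrite /r; field; rewrite gt_eqF.
rewrite (le_trans (ler_rnormD _ _))// !rnormZ lerD//.
  by rewrite ler_pM ?Re_norm_ge0 ?rnorm_ge0 ?cexpN_bound ?(ltW h1)// hd.
rewrite ler_wpM2r ?rnorm_ge0// (le_trans h10)// ler_wpM2l ?ltW//.
by rewrite ltr_pwDl.
Qed.

Definition rescale : c0_semigroup X :=
  C0Semigroup rescale_continuous rescale0 rescaleD rescale_strong.

Lemma rescale_generator x y : generator T x y -> generator rescale x (y - z *: x).
Proof. by move=> g; apply/generatorP; exact: rescale_generator_eps. Qed.

End Rescale.

Lemma rescale_generatorV (T : c0_semigroup X) z x y :
  generator (rescale T z) x y -> generator T x (y + z *: x).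
Proof.
move=> /(rescale_generator (z := - z)) /generatorP g; apply/generatorP => e e0.
have [d d0 hd] := g e e0; exists d => // h h0 hdd.
have := hd h h0 hdd; rewrite scaleNr opprK.
have -> : rescale (rescale T z) (- z) h x = T h x; last exact.
rewrite /rescale /= scalerA -[RHS]scale1r; congr (_ *: _).
exact: cexpN_mulN.
Qed.

(** If [exp (- z t0) T(t0)] is a contraction, then [z - A] is a bijection: with
    [w] solving [w - exp (- z t0) T(t0) w = b], the integral over [0, t0] of the
    rescaled orbit of [w] is a preimage of [b]. *)
Lemma resolvent_surj (T : c0_semigroup X) (z : R[i]) (t0 q : R) :
  0 <= t0 -> 0 < q -> q < 1 ->
  (forall x, rnorm (rescale T z t0 x) <= q * rnorm x) ->
  exists2 M : R, 0 < M & forall b, exists x y,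
    [/\ generator T x y, z *: x - y = b & rnorm x <= M * rnorm b].
Proof.
move=> t00 q0 q1 hq; have q10 : 0 < 1 - q by rewrite subr_gt0.
have [N N0 hN] := sg_loc_bound (rescale T z) t0.
have t10 : 0 < t0 + 1 by rewrite ltr_pwDr.
exists (N / (1 - q) * (t0 + 1)); first by rewrite mulr_gt0// divr_gt0.
move=> b.
have [w wE] := contraction_solve (sg_rlinear (rescale T z) t0) q0 q1 hq b.
have wb : rnorm w <= rnorm b / (1 - q).
  rewrite ler_pdivlMr// mulrBr mulr1 lerBlDr -{1}(subrK (rescale T z t0 w) w).
  by rewrite (le_trans (ler_rnormD _ _))// -wE lerD2l mulrC.
have g := @orbit_primitive_generator _ _ (rescale T z) w t0 t00.
exists (primitive (fun s => rescale T z s w) t0).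
exists (rescale T z t0 w - w + z *: primitive (fun s => rescale T z s w) t0).
split; first exact: rescale_generatorV.
  by rewrite opprD opprB addrCA subrr addr0 wE.
have P := primitiveP t0 (orbit_cont (rescale T z) w).
have := Bint_le_cst (M := N * rnorm w) (measurable_itv _) (segment_lty 0 t0) P.
rewrite fine_segment// => /(_ _)/le_trans; apply.
  by move=> s; rewrite /= in_itv /= => /andP[s0 st]; exact: hN.
rewrite (@le_trans _ _ (N * (rnorm b / (1 - q)) * t0))//.
  by rewrite ler_wpM2r// ler_pM2l.
have -> : N / (1 - q) * (t0 + 1) * rnorm b = N * (rnorm b / (1 - q)) * (t0 + 1).
  by field; rewrite gt_eqF.
by rewrite ler_wpM2l ?lerDl// mulr_ge0 ?divr_ge0 ?rnorm_ge0// ltW.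
Qed.

(** An eigenvector would be fixed by the contraction. *)
Lemma resolvent_inj (T : c0_semigroup X) (z : R[i]) (t0 q : R) :
  0 <= t0 -> q < 1 ->
  (forall x, rnorm (rescale T z t0 x) <= q * rnorm x) ->
  forall x, generator T x (z *: x) -> x = 0.
Proof.
move=> t00 q1 hq x /(rescale_generator (z := z)); rewrite subrr => g.
have : rescale T z t0 x - x = 0.
  rewrite (generator_integral g t00).
  rewrite (@primitive_FTC _ _ (fun=> 0) (fun s => rescale T z s 0)) ?subrr//.
    move=> t _ e e0; exists 1 => // s _ _.
    by rewrite linear0 scaler0 !subr0 rnorm0 mulr_ge0// ltW.
  exact: orbit_cont.
move/eqP; rewrite subr_eq0 => /eqP xE; have := hq x; rewrite xE => h.
apply: rnorm0_eq0; apply/eqP; rewrite eq_le rnorm_ge0 andbT leNgt; apply/negP => x0.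
by move: h; rewrite leNgt gtr_pMl// q1.
Qed.

(** Beyond the growth bound the rescaled semigroup decays exponentially, so it
    is a contraction at some time. *)
Lemma growth_bound_contraction (T : c0_semigroup X) (z : R[i]) :
  half_plane (growth_bound T) z ->
  exists t0, [/\ 0 <= t0 & forall x, rnorm (rescale T z t0 x) <= 2^-1 * rnorm x].
Proof.
rewrite /half_plane /= /growth_bound => /ereal_inf_lt[_ [w /= hw <-]].
rewrite lte_fin => wz; move: hw.
set S := ereal_sup _ => Sfin.
have S0 : (0 <= S)%E.
  apply: le_ereal_sup_tmp; exists ((expR (- (1 * w)))%:E * op_norm (T 1%R))%E.
    by exists 1; [exact: ltr01|].
  rewrite mule_ge0 ?lee_fin ?expR_ge0//.
  apply: le_ereal_sup_tmp; exists (rnorm (T 1 0))%:E; last by rewrite lee_fin rnorm_ge0.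
  by exists 0 => //=; rewrite rnorm0.
pose M := fine S + 1.
have M0 : 0 < M by rewrite ltr_wpDl// fine_ge0.
have hM t x : 0 < t -> rnorm (T t x) <= M * expR (t * w) * rnorm x.
  move=> t0.
  have le1 : ((expR (- (t * w)))%:E * op_norm (T t) <= M%:E)%E.
    apply: (@le_trans _ _ S); first by apply: ereal_sup_ubound; exists t.
    by rewrite -[leLHS]fineK ?ge0_fin_numE// lee_fin lerDl.
  have [->|x0] := eqVneq x 0; first by rewrite linear0 !rnorm0 mulr0.
  have nx0 : 0 < rnorm x.
    rewrite lt_neqAle rnorm_ge0 andbT eq_sym; apply/eqP => /rnorm0_eq0 /eqP.
    by rewrite (negPf x0).
  have le2 : ((rnorm (T t (((rnorm x)^-1)%:C *: x)))%:E <= op_norm (T t))%E.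
    apply: ereal_sup_ubound; exists (((rnorm x)^-1)%:C *: x) => //=.
    by rewrite rnormZr gtr0_norm ?invr_gt0// mulVf// gt_eqF.
  have : (expR (- (t * w)) * rnorm (T t (((rnorm x)^-1)%:C *: x)) <= M)%R.
    rewrite -lee_fin EFinM (le_trans _ le1)// lee_wpmul2l// lee_fin.
  rewrite sgZ rnormZr gtr0_norm ?invr_gt0// mulrA mulrAC ler_pdivrMr//.
  rewrite expRN mulrC ler_pdivrMr ?expR_gt0//.
  by rewrite mulrAC.
pose d := complex.Re z - w; have d0 : 0 < d by rewrite subr_gt0.
pose t0 := `|ln (2 * M)| / d + 1.
have t00 : 0 < t0 by rewrite ltr_wpDl// divr_ge0// ltW.
exists t0; split; first exact: ltW.
move=> x; rewrite /rescale /= rnormZ norm_cexpN /=.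
rewrite (le_trans (ler_wpM2l (expR_ge0 _) (hM t0 x t00)))// !mulrA.
rewrite ler_wpM2r ?rnorm_ge0// mulrAC -expRD.
have -> : - (complex.Re z * t0) + t0 * w = - (d * t0) by rewrite /d; ring.
rewrite expRN ler_pdivrMl ?expR_gt0// ler_pdivlMr// mulrC.
rewrite -[leLHS](lnK (x := 2 * M)) ?posrE ?mulr_gt0// ler_expR.
have -> : d * t0 = `|ln (2 * M)| + d by rewrite /t0; field; rewrite gt_eqF.
by rewrite (le_trans (ler_norm _))// lerDl ltW.
Qed.

End Rescaling.
(** * The system node *)

Section VConvLinear.
Context (R : realType).
Implicit Types (k : R -> R).

Lemma vconv_map (V W : completeNormedModType R[i]) (L : V -> W) v k t :
  rlinear L -> rbounded L -> cont_on (@half_line R) v -> loc_bounded k ->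
  vconv (fun r => L (v r)) k t = L (vconv v k t).
Proof.
move=> lL bL vc bk; have B := Bint_map lL bL (vconvP t vc bk).
rewrite /vconv; apply: (Bint_bochner_integral (measurable_itv _) (segment_lty 0 t) B).
by apply: ae_all => s _; case: lL => _ ->.
Qed.

Lemma vconvD (V : completeNormedModType R[i]) (v v' : R -> V) k t :
  cont_on (@half_line R) v -> cont_on (@half_line R) v' -> loc_bounded k ->
  vconv (fun r => v r + v' r) k t = vconv v k t + vconv v' k t.
Proof.
move=> vc vc' bk.
have B := BintD (measurable_itv _) (segment_lty 0 t) (vconvP t vc bk) (vconvP t vc' bk).
rewrite [LHS]/vconv; apply: (Bint_bochner_integral (measurable_itv _) (segment_lty 0 t) B).
by apply: ae_all => s _; rewrite scalerDr.
Qed.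

Lemma primitive_map (V W : completeNormedModType R[i]) (L : V -> W) f t :
  rlinear L -> rbounded L -> cont_on (@half_line R) f ->
  primitive (fun r => L (f r)) t = L (primitive f t).
Proof.
move=> lL bL fc; have B := Bint_map lL bL (primitiveP t fc).
rewrite /primitive; apply: (Bint_bochner_integral (measurable_itv _) (segment_lty 0 t) B).
exact: ae_all.
Qed.

Lemma eq_vconv (V : completeNormedModType R[i]) (v v' : R -> V) k t :
  (forall r, 0 <= r -> v r = v' r) -> cont_on (@half_line R) v -> loc_bounded k ->
  vconv v' k t = vconv v k t.
Proof.
move=> vv vc bk; rewrite [LHS]/vconv.
apply: (Bint_bochner_integral (measurable_itv _) (segment_lty 0 t) (vconvP t vc bk)).
by apply: ae_all => s; rewrite /= in_itv /= => /andP[s0 st]; rewrite vv// subr_ge0.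
Qed.

End VConvLinear.

Lemma ramp_deriv (R : realType) (V : normedModType R[i]) (J : set R) (b : V) :
  deriv_on J (fun r => r%:C *: b) (fun=> b).
Proof.
move=> t _ e e0; exists 1 => // s _ _.
by rewrite -scalerBl -rmorphB subrr rnorm0 mulr_ge0// ltW.
Qed.

Lemma ramp_cont (R : realType) (V : normedModType R[i]) (b : V) :
  cont_on (@half_line R) (fun r => r%:C *: b).
Proof. exact: (deriv_on_cont (@ramp_deriv R V _ b)). Qed.

Lemma opp_rlinear (R : realType) (V : normedModType R[i]) : rlinear (-%R : V -> V).
Proof. by split=> [v w|r v]; rewrite ?opprD ?scalerN. Qed.

Lemma opp_rbounded (R : realType) (V : normedModType R[i]) : rbounded (-%R : V -> V).
Proof. by exists 1 => // v; rewrite rnormN mul1r. Qed.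

Lemma scale_rlinear (R : realType) (V : normedModType R[i]) (c : R[i]) :
  rlinear (fun v : V => c *: v).
Proof. by split=> [v w|r v]; rewrite ?scalerDr// !scalerA mulrC. Qed.

Lemma scale_rbounded (R : realType) (V : normedModType R[i]) (c : R[i]) :
  rbounded (fun v : V => c *: v).
Proof.
exists (complex.Re `|c| + 1); first by rewrite ltr_wpDl// Re_norm_ge0.
by move=> v; rewrite rnormZ ler_wpM2r ?rnorm_ge0// lerDl.
Qed.

Section Node.
Context (R : realType) (U X Y : completeNormedModType R[i]).
Variable S : system_node U X Y.
Local Notation j := (sn_j S).
Local Notation T := (sn_T S).
Local Notation Tm1 := (sn_Tm1 S).
Local Notation Am1 := (sn_Am1 S).
Local Notation dom := (sn_dom S).
Local Notation A := (sn_A S).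
Local Notation beta := (sn_beta S).
Local Notation Rb := (resolvent idfun (sn_dom S) (sn_A S) (sn_beta S)).

Lemma half_plane_nonempty : half_plane (growth_bound T) !=set0.
Proof.
have [M [w [M0 hM]]] := sg_exp_bound T.
exists ((w + 1)%:C); rewrite /half_plane /=.
apply: (@le_lt_trans _ _ w%:E); last by rewrite lte_fin ltrDl.
apply: ereal_inf_lbound; exists w => //=.
apply: (@le_lt_trans _ _ M%:E); last by rewrite ltry.
apply: ge_ereal_sup => _ [t /= t0 <-].
have le1 : (op_norm (T t) <= (M * expR (t * w))%:E)%E.
  apply: ge_ereal_sup => _ [x /= x1 <-]; rewrite lee_fin.
  rewrite (le_trans (hM _ _ (ltW t0)))// ler_piMr// mulr_ge0 ?expR_ge0//.
  exact: ltW.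
apply: (le_trans (lee_wpmul2l _ le1)); first by rewrite lee_fin expR_ge0.
by rewrite -EFinM lee_fin mulrCA expRN mulVf ?mulr1// gt_eqF// expR_gt0.
Qed.

Definition node_pt : R[i] := xget 0 (half_plane (growth_bound T)).

Lemma node_ptP : half_plane (growth_bound T) node_pt.
Proof. exact: (xgetPex 0 half_plane_nonempty). Qed.

Lemma domP x : dom x -> generator T x (A x).
Proof. by move=> dx; apply/sn_A_generates. Qed.

Lemma generator_dom x y : generator T x y -> dom x /\ A x = y.
Proof. by move=> /sn_A_generates. Qed.

Lemma dom0 : dom 0 /\ A 0 = 0.
Proof.
apply: generator_dom; apply: integral_generator => t t0.
rewrite linear0 subrr (@primitive_FTC _ _ (fun=> 0) (fun s => T s 0)) ?subrr//.
  by move=> s _ e e0; exists 1 => // r _ _; rewrite linear0 scaler0 !subr0 rnorm0 mulr_ge0// ltW.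
exact: orbit_cont.
Qed.

Lemma RbP y : dom (Rb y) /\ beta *: Rb y - A (Rb y) = y.
Proof.
have [h _] := @sn_betaP _ _ _ _ S; have [x [hx _]] := h y.
by apply: (@xgetPex _ 0 [set x | dom x /\ beta *: idfun x - A x = y]); exists x.
Qed.

Lemma Rb_unique x : dom x -> Rb (beta *: x - A x) = x.
Proof.
move=> dx; have [h _] := @sn_betaP _ _ _ _ S.
have [x' [_ hu]] := h (beta *: x - A x).
by rewrite -(hu _ (RbP _)) -(hu x).
Qed.

Lemma rnorm_j x : rnorm (j x) = rnorm (Rb x).
Proof. exact: sn_j_norm. Qed.

Lemma j_inj x y : j x = j y -> x = y.
Proof.
move=> jxy; have : rnorm (j (x - y)) = 0 by rewrite linearB jxy subrr rnorm0.
rewrite rnorm_j => /rnorm0_eq0 Rxy; apply/eqP; rewrite -subr_eq0; apply/eqP.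
by have [_] := RbP (x - y); rewrite Rxy scaler0 sub0r dom0.2 oppr0 => <-.
Qed.

Lemma j_rbounded : rbounded j.
Proof.
have [_] := @sn_betaP _ _ _ _ S; set N := op_norm _ => Nfin.
have N0 : (0 <= N)%E.
  apply: le_ereal_sup_tmp; exists (rnorm (Rb 0))%:E; last by rewrite lee_fin rnorm_ge0.
  by exists 0 => //=; rewrite rnorm0.
exists (fine N + 1); first by rewrite ltr_wpDl// fine_ge0.
move=> x; have [->|x0] := eqVneq x 0; first by rewrite linear0 !rnorm0 mulr0.
have nx0 : 0 < rnorm x.
  rewrite lt_neqAle rnorm_ge0 andbT eq_sym; apply/eqP => /rnorm0_eq0 /eqP.
  by rewrite (negPf x0).
rewrite -ler_pdivrMr// mulrC -[X in X * _]gtr0_norm ?invr_gt0// -rnormZr -linearZ.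
rewrite rnorm_j -lee_fin; apply: (@le_trans _ _ N).
  apply: ereal_sup_ubound; exists (((rnorm x)^-1)%:C *: x) => //=.
  by rewrite rnormZr gtr0_norm ?invr_gt0// mulVf// gt_eqF.
by rewrite -[leLHS]fineK ?ge0_fin_numE// lee_fin lerDl.
Qed.

(** [Lam = beta - A_{-1}] maps X isometrically onto X_{-1}; it transports the
    semigroup, the generator and the norm from one space to the other. *)
Definition Lam (x : X) : sn_Xm1 S := beta *: j x - Am1 x.

Lemma Lam_linear : linear Lam.
Proof.
move=> c x y; rewrite /Lam (linearP (sn_j S)) (linearP (sn_Am1 S)) scalerDr scalerBr !scalerA opprD.
by rewrite (mulrC beta) addrACA.
Qed.

Lemma Lam_rlinear : rlinear Lam.
Proof.
split=> [x y|r x]; first by have := Lam_linear 1 x y; rewrite !scale1r.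
have L0 : Lam 0 = 0.
  by rewrite /Lam (linear0 (sn_j S)) (linear0 (sn_Am1 S)) scaler0 subr0.
by have := Lam_linear r%:C x 0; rewrite L0 !addr0.
Qed.

Lemma Lam_dom x : dom x -> Lam x = j (beta *: x - A x).
Proof. by move=> dx; rewrite /Lam sn_Am1E// linearB linearZ. Qed.

Lemma rnorm_Lam_dom x : dom x -> rnorm (Lam x) = rnorm x.
Proof. by move=> dx; rewrite Lam_dom// rnorm_j Rb_unique. Qed.

Lemma Am1_graph x : generator Tm1 (j x) (Am1 x).
Proof. by apply/sn_Am1_generates; exists x. Qed.

Lemma graph_Am1 x w : generator Tm1 (j x) w -> w = Am1 x.
Proof. by move=> /sn_Am1_generates[x' /j_inj -> ->]. Qed.

(** The images converge because Lam is isometric on the dense domain, and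
    closedness of the extended generator identifies their limit. *)
Let Lam_seq (xs : nat -> X) x : (forall n, dom (xs n)) ->
  (forall e : R, 0 < e -> exists N, forall n, (N <= n)%N -> rnorm (xs n - x) <= e) ->
  forall e : R, 0 < e -> exists N, forall n, (N <= n)%N ->
    rnorm (Lam (xs n) - Lam x) <= e.
Proof.
move=> dxs cx.
have [|l hl] := @rcauchy_cvg _ (sn_Xm1 S) (Lam \o xs).
  move=> e e0; have [N hN] := cx _ (divr_gt0 e0 (ltr0n _ 2)).
  exists N => m n Nm Nn; rewrite /= -(rlinearB Lam_rlinear).
  have dmn : dom (xs m - xs n).
    have := generatorD (domP (dxs m)) (generatorZ (c := -1) (domP (dxs n))).
    by rewrite !scaleN1r => /generator_dom[].
  rewrite rnorm_Lam_dom// (le_trans (ler_rdistD x _ _))// (splitr e) lerD ?hN//.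
  by rewrite rnorm_distC hN.
suff -> : Lam x = l by [].
have [K K0 hK] := j_rbounded.
have b0 : 0 <= complex.Re `|beta| := Re_norm_ge0 _.
have g : generator Tm1 (j x) (beta *: j x - l).
  apply: (@generator_closed _ _ _ (fun n => j (xs n)) (fun n => Am1 (xs n))).
  - by move=> n; exact: Am1_graph.
  - move=> e e0; have [N hN] := cx _ (divr_gt0 e0 K0); exists N => n Nn.
    rewrite -linearB (le_trans (hK _))// mulrC -ler_pdivlMr//; exact: hN.
  - move=> e e0; have e20 : 0 < e / 2 by rewrite divr_gt0.
    have C0 : 0 < (complex.Re `|beta| + 1) * K by rewrite mulr_gt0// ltr_wpDl.
    have [N hN] := cx _ (divr_gt0 e20 C0); have [N' hN'] := hl _ e20.
    exists (maxn N N') => n; rewrite geq_max => /andP[/hN h1 /hN' h2].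
    have -> : Am1 (xs n) - (beta *: j x - l) =
        beta *: j (xs n - x) - (Lam (xs n) - l).
      rewrite /Lam (linearB (sn_j S)) scalerBr !opprB !addrA.
      by rewrite [RHS](ACl ((1*5)*4*3*2))/= subrr add0r.
    rewrite (le_trans (ler_rnormB _ _))// (splitr e) lerD//.
    rewrite rnormZ; apply: le_trans (_ : (complex.Re `|beta| + 1) * (K * rnorm (xs n - x)) <= _).
      by rewrite ler_pM ?rnorm_ge0 ?hK ?lerDl.
    by rewrite mulrA mulrC -ler_pdivlMr.
have := graph_Am1 g; rewrite /Lam => <-.
by rewrite opprB addrC subrK.
Qed.

Let dense_seq x : exists xs : nat -> X, (forall n, dom (xs n)) /\
  forall e : R, 0 < e -> exists N, forall n, (N <= n)%N -> rnorm (xs n - x) <= e.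
Proof.
have : forall n : nat, exists x', dom x' /\ rnorm (x' - x) <= n.+1%:R^-1.
  move=> n; have n0 : 0 < n.+1%:R^-1 :> R by rewrite invr_gt0.
  by have [x' [y' [/generator_dom[dx' _] h]]] := generator_dense T x n0; exists x'.
move=> /choice[xs hxs]; exists xs; split=> [n|e e0]; first by have [] := hxs n.
exists (Num.truncn e^-1) => n Nn; have [_ /le_trans] := hxs n; apply.
rewrite -[leRHS]invrK lef_pV2 ?posrE ?invr_gt0//.
by rewrite (le_trans (ltW (truncnS_gt _)))// ler_nat.
Qed.

Lemma rnorm_Lam x : rnorm (Lam x) = rnorm x.
Proof.
have [xs [dxs cx]] := dense_seq x; have cL := Lam_seq dxs cx.
apply/eqP; rewrite -subr_eq0 -normr_le0; apply/ler_addgt0Pr => e e0; rewrite add0r.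
have e20 : 0 < e / 2 by rewrite divr_gt0.
have [N hN] := cx _ e20; have [N' hN'] := cL _ e20; pose n := maxn N N'.
have -> : rnorm (Lam x) - rnorm x = (rnorm (Lam x) - rnorm (Lam (xs n))) +
    (rnorm (xs n) - rnorm x) by rewrite (rnorm_Lam_dom (dxs n)) addrA subrK.
rewrite (le_trans (ler_normD _ _))// (splitr e) lerD//.
  by rewrite (le_trans (ler_rnorm_dist _ _))// rnorm_distC hN'// leq_maxr.
by rewrite (le_trans (ler_rnorm_dist _ _))// hN// leq_maxl.
Qed.

(** The range of Lam is complete and contains the dense range of [j]. *)
Lemma Lam_surj b : exists x, Lam x = b.
Proof.
have : forall n : nat, exists y, rnorm (j y - b) <= n.+1%:R^-1.
  move=> n; have n0 : 0 < n.+1%:R^-1 :> R by rewrite invr_gt0.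
  have : closure (range j) b by rewrite sn_j_dense.
  move=> /(_ (ball b (n.+1%:R^-1)%:C)) [].
    by apply: nbhsx_ballx; rewrite ltcR.
  move=> _ [[y _ <-]]; rewrite -ball_normE /ball_ /= normC_rnorm ltcR => /ltW h.
  by exists y; rewrite rnorm_distC.
move=> /choice[ys hys].
have cy (e : R) : 0 < e -> exists N, forall n, (N <= n)%N -> rnorm (j (ys n) - b) <= e.
  move=> e0; exists (Num.truncn e^-1) => n Nn; have /le_trans := hys n; apply.
  rewrite -[leRHS]invrK lef_pV2 ?posrE ?invr_gt0//.
  by rewrite (le_trans (ltW (truncnS_gt _)))// ler_nat.
have LR y : Lam (Rb y) = j y by have [dR RE] := RbP y; rewrite Lam_dom// RE.
have [|x hx] := @rcauchy_cvg _ X (fun n => Rb (ys n)).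
  move=> e e0; have [N hN] := cy _ (divr_gt0 e0 (ltr0n _ 2)).
  exists N => m n Nm Nn; rewrite -rnorm_Lam (rlinearB Lam_rlinear) !LR.
  by rewrite (le_trans (ler_rdistD b _ _))// (splitr e) lerD ?hN// rnorm_distC hN.
exists x; apply: rnorm_eq_le => e e0; have e20 : 0 < e / 2 by rewrite divr_gt0.
have [N hN] := hx _ e20; have [N' hN'] := cy _ e20; pose n := maxn N N'.
rewrite (le_trans (ler_rdistD (j (ys n)) _ _))// (splitr e) lerD//; last first.
  by rewrite hN'// leq_maxr.
by rewrite -LR -(rlinearB Lam_rlinear) rnorm_Lam rnorm_distC hN// leq_maxl.
Qed.

Definition Lami (b : sn_Xm1 S) : X := xget 0 [set x | Lam x = b].

Lemma LamiK b : Lam (Lami b) = b.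
Proof. exact: (xgetPex 0 (Lam_surj b)). Qed.

Lemma Lam_inj x y : Lam x = Lam y -> x = y.
Proof.
move=> Lxy; apply/eqP; rewrite -subr_eq0; apply/eqP/rnorm0_eq0.
by rewrite -rnorm_Lam (rlinearB Lam_rlinear) Lxy subrr rnorm0.
Qed.

Lemma LamK x : Lami (Lam x) = x.
Proof. by apply: Lam_inj; rewrite LamiK. Qed.

Lemma Lami_rlinear : rlinear Lami.
Proof.
have [LD LZ] := Lam_rlinear.
by split=> [a b|r a]; apply: Lam_inj; rewrite ?LD ?LZ !LamiK.
Qed.

Lemma Lami_rbounded : rbounded Lami.
Proof. by exists 1 => // b; rewrite mul1r -{2}(LamiK b) rnorm_Lam. Qed.

Lemma Am1_rbounded : rbounded Am1.
Proof.
have [K K0 hK] := j_rbounded; have b0 : 0 <= complex.Re `|beta| := Re_norm_ge0 _.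
exists (complex.Re `|beta| * K + 1); first by rewrite ltr_wpDl// mulr_ge0// ltW.
move=> x; have -> : Am1 x = beta *: j x - Lam x by rewrite /Lam opprB addrC subrK.
rewrite mulrDl mul1r (le_trans (ler_rnormB _ _))// rnorm_Lam lerD2r.
by rewrite rnormZ -mulrA ler_wpM2l.
Qed.

Lemma Tm1_Lam t x : 0 <= t -> Tm1 t (Lam x) = Lam (T t x).
Proof.
move=> t0; rewrite /Lam linearB linearZ /= sn_Tm1E//; congr (_ - _).
by apply: graph_Am1; rewrite -sn_Tm1E//; apply: generator_orbit => //; exact: Am1_graph.
Qed.

Lemma dom_Am1 x w : Am1 x = j w -> dom x /\ A x = w.
Proof.
move=> Axw; have xE : x = Rb (beta *: x - w).
  apply: Lam_inj; have [dR RE] := RbP (beta *: x - w).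
  by rewrite (Lam_dom dR) RE /Lam linearB linearZ Axw.
have [dR RE] := RbP (beta *: x - w); rewrite -xE in dR RE; split=> //.
by move: RE => /addrI/oppr_inj.
Qed.

(** ** The resolvent and the combined observation operator *)

Definition Rz (b : sn_Xm1 S) : X := resolvent j setT Am1 node_pt b.

Let contr : exists t0, 0 <= t0 /\
  forall x, rnorm (rescale T node_pt t0 x) <= 2^-1 * rnorm x.
Proof. by have [t0 []] := growth_bound_contraction node_ptP; exists t0. Qed.

Let contr_m1 t0 : 0 <= t0 ->
  (forall x, rnorm (rescale T node_pt t0 x) <= 2^-1 * rnorm x) ->
  forall b, rnorm (rescale Tm1 node_pt t0 b) <= 2^-1 * rnorm b.
Proof.
move=> t00 h b; rewrite -(LamiK b) rnorm_Lam /rescale /= rnormZ Tm1_Lam// rnorm_Lam.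
by have := h (Lami b); rewrite /rescale /= rnormZ.
Qed.

Lemma half1 : 0 < (2^-1 : R) /\ (2^-1 : R) < 1.
Proof. by rewrite invr_gt0 ltr0n invf_lt1// ltr1n. Qed.

Lemma RzP b : node_pt *: j (Rz b) - Am1 (Rz b) = b.
Proof.
have [t0 [t00 ht0]] := contr; have [h0 h1] := half1.
have [M M0 hM] := resolvent_surj t00 h0 h1 (contr_m1 t00 ht0).
have [z [w [/sn_Am1_generates[x jx Ax] zw _]]] := hM b.
have [] // : [set x | setT x /\ node_pt *: j x - Am1 x = b] (Rz b).
by apply: (@xgetPex _ 0); exists x; split=> //; rewrite jx Ax.
Qed.

Lemma Rz_unique x b : node_pt *: j x - Am1 x = b -> Rz b = x.
Proof.
move=> xb; have [t0 [t00 ht0]] := contr; have [h0 h1] := half1.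
suff : j (Rz b - x) = 0.
  by move=> jd; apply/eqP; rewrite -subr_eq0; apply/eqP/j_inj; rewrite jd linear0.
apply: (resolvent_inj t00 h1 (contr_m1 t00 ht0)).
have -> : node_pt *: j (Rz b - x) = Am1 (Rz b - x); last exact: Am1_graph.
apply/eqP; rewrite -subr_eq0 (linearB (sn_j S)) (linearB (sn_Am1 S)) scalerBr.
rewrite opprD opprK addrACA RzP.
by rewrite [X in b + X]addrC -opprB xb subrr.
Qed.

(** [CR = C (z - A)^{-1}] is bounded from X to Y, and expresses C&D through
    [z x - (A x + B u)], which lies in X. *)
Definition CR (y : X) : Y := sn_C S (Rz (j y)).

Lemma Rz_j y : dom (Rz (j y)) /\ A (Rz (j y)) = node_pt *: Rz (j y) - y.
Proof.
apply: dom_Am1; rewrite (linearB (sn_j S)) linearZ /=.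
by move/eqP: (RzP (j y)); rewrite subr_eq addrC -subr_eq => /eqP ->.
Qed.

Lemma Rz_rbounded : exists2 M : R, 0 < M & forall y, rnorm (Rz (j y)) <= M * rnorm y.
Proof.
have [t0 [t00 ht0]] := contr; have [h0 h1] := half1.
have [M M0 hM] := resolvent_surj t00 h0 h1 ht0.
exists M => // y; have [x [w [g xw xM]]] := hM y.
suff -> : Rz (j y) = x by [].
have [dx Ax] := generator_dom g.
by apply: Rz_unique; rewrite sn_Am1E// Ax -xw (linearB (sn_j S)) linearZ.
Qed.

Lemma Rz_linear (c : R[i]) b b' : Rz (c *: b + b') = c *: Rz b + Rz b'.
Proof.
apply: Rz_unique; rewrite (linearP (sn_j S)) (linearP (sn_Am1 S)) scalerDr.
rewrite opprD addrACA !scalerA (mulrC node_pt) -!scalerA -scalerBr.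
by rewrite !RzP.
Qed.

Lemma CR_linear (c : R[i]) y y' : CR (c *: y + y') = c *: CR y + CR y'.
Proof.
rewrite /CR (linearP (sn_j S)) Rz_linear sn_C_linear//; first exact: (Rz_j y).1.
exact: (Rz_j y').1.
Qed.

Lemma CR_rlinear : rlinear CR.
Proof.
split=> [y y'|r y]; first by have := CR_linear 1 y y'; rewrite !scale1r.
have C0 : CR 0 = 0.
  have := CR_linear 1 0 0; rewrite !scale1r addr0 => /eqP.
  by rewrite addrC -subr_eq subrr eq_sym => /eqP.
by have := CR_linear r%:C y 0; rewrite C0 !addr0.
Qed.

Lemma CR_rbounded : rbounded CR.
Proof.
have [N hN] := @sn_C_bounded _ _ _ _ S; have [M M0 hM] := Rz_rbounded.
pose c := complex.Re `|beta - node_pt|.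
have c0 : 0 <= c := Re_norm_ge0 _.
have C0 : 0 <= c * M + 1 by rewrite addr_ge0// mulr_ge0// ltW.
exists (`|N| * (c * M + 1) + 1); first by rewrite ltr_wpDl// mulr_ge0.
move=> y; have [dR AR] := Rz_j y.
rewrite mulrDl mul1r (le_trans (hN _ dR))// ler_wpDr ?rnorm_ge0//.
rewrite -mulrA AR; apply: (le_trans (ler_wpM2r (rnorm_ge0 _) (ler_norm N))).
rewrite ler_wpM2l//.
have -> : beta *: Rz (j y) - (node_pt *: Rz (j y) - y) = (beta - node_pt) *: Rz (j y) + y.
  by rewrite opprB addrA addrAC scalerBl.
rewrite (le_trans (ler_rnormD _ _))// mulrDl mul1r lerD2r rnormZ -mulrA.
by rewrite ler_wpM2l.
Qed.

Lemma CD_formula x u w : Am1 x + sn_B S u = j w ->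
  CD S x u = CR (node_pt *: x - w) + sn_G S node_pt u.
Proof.
move=> xuw; rewrite /CD /CD_at -/node_pt; congr (sn_C S _ + _).
rewrite -/(Rz (sn_B S u)); apply/esym/Rz_unique.
rewrite !(linearB (sn_j S)) (linearB (sn_Am1 S)) linearZ /= -xuw scalerBr.
have := RzP (sn_B S u); set r := Rz _ => <-.
by rewrite !opprD !opprK !addrA (addrAC (node_pt *: j x)).
Qed.

Lemma G_rlinear : rlinear (sn_G S node_pt).
Proof. exact: linear_rlinear. Qed.

Lemma G_rbounded : rbounded (sn_G S node_pt).
Proof. apply: linear_bounded_rnorm; apply: sn_G_continuous; exact: node_ptP. Qed.

(** ** Step and ramp responses *)

Section Responses.
Variable e : U.
Let b : sn_Xm1 S := sn_B S e.

(** [resp1] and [resp2] are the state responses, with values in X, to the step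
    input [e] and to the ramp input [r e]. *)
Definition resp1 (t : R) : X :=
  Lami (beta *: primitive (fun s => Tm1 s b) t - (Tm1 t b - b)).

Definition resp2 : R -> X := primitive resp1.

Let s1 := primitive (fun s => Tm1 s b).

Lemma resp1P t : 0 <= t -> j (resp1 t) = s1 t /\ Am1 (resp1 t) = Tm1 t b - b.
Proof.
move=> t0; have /sn_Am1_generates[x jx Ax] := @orbit_primitive_generator _ _ Tm1 b t t0.
suff -> : resp1 t = x by [].
by rewrite /resp1 -jx -Ax -/(Lam x) LamK.
Qed.

Lemma s1_deriv : deriv_on (@half_line R) s1 (fun t => Tm1 t b).
Proof. by apply: primitive_deriv; exact: orbit_cont. Qed.

Lemma resp1_cont : cont_on (@half_line R) resp1.
Proof.
apply: (rlinear_cont_on Lami_rlinear Lami_rbounded).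
apply: cont_onD.
  exact: (rlinear_cont_on (@scale_rlinear _ _ _) (@scale_rbounded _ _ _) (deriv_on_cont s1_deriv)).
apply: (rlinear_cont_on (@opp_rlinear _ _) (@opp_rbounded _ _)).
apply: cont_onD; last exact: cont_on_cst.
exact: orbit_cont.
Qed.

Lemma resp1_0 : resp1 0 = 0.
Proof.
apply: j_inj; rewrite (resp1P (lexx 0)).1 linear0 /s1 primitive0//.
exact: orbit_cont.
Qed.

Lemma resp2_deriv : deriv_on (@half_line R) resp2 resp1.
Proof. exact: primitive_deriv resp1_cont. Qed.

Lemma resp2_0 : resp2 0 = 0.
Proof. exact: primitive0 resp1_cont. Qed.

Lemma j_resp1_deriv : deriv_on (@half_line R) (fun t => j (resp1 t)) (fun t => Tm1 t b).
Proof.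
apply: deriv_on_ext s1_deriv => // t t0.
by rewrite (resp1P t0).1.
Qed.

Lemma Am1_resp2 t : 0 <= t -> Am1 (resp2 t) = j (resp1 t) - t%:C *: b.
Proof.
move=> t0; rewrite /resp2 -(primitive_map t (linear_rlinear (sn_Am1 S)) Am1_rbounded resp1_cont).
apply: (@deriv_on_unique _ _ _ (fun t => j (resp1 t) - t%:C *: b) (fun t => Tm1 t b - b)) => //.
- have c := rlinear_cont_on (linear_rlinear (sn_Am1 S)) Am1_rbounded resp1_cont.
  apply: deriv_on_ext (primitive_deriv c) => // s s0.
  by rewrite (resp1P s0).2.
- apply: deriv_onD; first exact: j_resp1_deriv.
  exact: (rlinear_deriv_on (@opp_rlinear _ _) (@opp_rbounded _ _) (@ramp_deriv _ _ _ b)).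
- rewrite primitive0; last first.
    exact: (rlinear_cont_on (linear_rlinear (sn_Am1 S)) Am1_rbounded resp1_cont).
  by rewrite resp1_0 linear0 scale0r subrr.
Qed.

Definition ramp_out (t : R) : Y := CD S (resp2 t) (t%:C *: e).

Lemma ramp_outE t : 0 <= t ->
  ramp_out t = CR (node_pt *: resp2 t - resp1 t) + t%:C *: sn_G S node_pt e.
Proof.
move=> t0; rewrite /ramp_out (@CD_formula _ _ (resp1 t)); first by case: G_rlinear => _ ->.
by rewrite Am1_resp2//; case: (linear_rlinear (sn_B S)) => _ ->; exact: subrK.
Qed.

Lemma state2_cont : cont_on (@half_line R) (fun t => node_pt *: resp2 t - resp1 t).
Proof.
apply: cont_onD.
  exact: (rlinear_cont_on (@scale_rlinear _ _ _) (@scale_rbounded _ _ _) (deriv_on_cont resp2_deriv)).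
exact: (rlinear_cont_on (@opp_rlinear _ _) (@opp_rbounded _ _) resp1_cont).
Qed.

Lemma ramp_out_cont : cont_on (@half_line R) ramp_out.
Proof.
apply: (@cont_on_ext _ _ _ (fun t => CR (node_pt *: resp2 t - resp1 t) +
  t%:C *: sn_G S node_pt e)).
  by move=> t t0; rewrite ramp_outE.
apply: cont_onD; last exact: ramp_cont.
exact: (rlinear_cont_on CR_rlinear CR_rbounded state2_cont).
Qed.

Section Input.
Variable k : R -> R.
Hypothesis bk : loc_bounded k.

(** The state equation integrated twice against [k]: unlike the state equation
    itself it can be read in X, so it is the form to which [CD_formula]
    applies. *)
Lemma state_eq t : 0 <= t ->
  Am1 (vconv resp2 k t) + sn_B S (vconv (fun r => r%:C *: e) k t) =
  j (vconv resp1 k t).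
Proof.
move=> t0; have c2 := deriv_on_cont resp2_deriv; have c1 := resp1_cont.
have rB := linear_rlinear (sn_B S).
have bB := linear_bounded_rnorm (@sn_B_continuous _ _ _ _ S).
rewrite -(vconv_map t (linear_rlinear (sn_Am1 S)) Am1_rbounded c2 bk).
rewrite -(vconv_map t rB bB (ramp_cont e) bk).
rewrite -(vconv_map t (linear_rlinear (sn_j S)) j_rbounded c1 bk).
have cA := rlinear_cont_on (linear_rlinear (sn_Am1 S)) Am1_rbounded c2.
have cB := rlinear_cont_on rB bB (ramp_cont e).
have cj := rlinear_cont_on (linear_rlinear (sn_j S)) j_rbounded c1.
rewrite -(vconvD t cA cB bk); apply: (eq_vconv t _ cj bk).
move=> r r0; rewrite Am1_resp2//; case: rB => _ ->; exact/esym/subrK.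
Qed.

Lemma vconv_scale (V : completeNormedModType R[i]) (c : R[i]) (v : R -> V) t :
  cont_on (@half_line R) v ->
  vconv (fun r => c *: v r) k t = c *: vconv v k t.
Proof.
by move=> vc; apply: vconv_map => //; [exact: scale_rlinear|exact: scale_rbounded].
Qed.

(** The combined operator is bounded on pairs for which the state equation
    holds in X, so it commutes with the convolution. *)
Lemma vconv_ramp_out t : 0 <= t ->
  CR (node_pt *: vconv resp2 k t - vconv resp1 k t) +
    sn_G S node_pt (vconv (fun r => r%:C *: e) k t) = vconv ramp_out k t.
Proof.
move=> t0; have c2 := deriv_on_cont resp2_deriv; have c1 := resp1_cont.
have c1N := rlinear_cont_on (@opp_rlinear _ _) (@opp_rbounded _ _) c1.
have c2z := rlinear_cont_on (@scale_rlinear _ _ node_pt) (@scale_rbounded _ _ _) c2.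
rewrite -(vconv_scale _ _ c2) -(vconv_map t (@opp_rlinear _ _) (@opp_rbounded _ _) c1 bk).
rewrite -(vconvD t c2z c1N bk).
rewrite -(vconv_map t CR_rlinear CR_rbounded state2_cont bk).
rewrite -(vconv_map t G_rlinear G_rbounded (ramp_cont e) bk).
have cC := rlinear_cont_on CR_rlinear CR_rbounded state2_cont.
have cG := rlinear_cont_on G_rlinear G_rbounded (ramp_cont e).
rewrite -(vconvD t cC cG bk); apply: (eq_vconv t _ ramp_out_cont bk).
by move=> r r0; rewrite ramp_outE//; case: G_rlinear => _ ->.
Qed.

Lemma vconv_resp2_deriv :
  deriv_on (@half_line R) (vconv resp2 k) (vconv resp1 k).
Proof. exact: (vconv_deriv resp2_deriv resp1_cont resp2_0 bk). Qed.

Lemma j_vconv_resp1_deriv :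
  deriv_on (@half_line R) (fun t => j (vconv resp1 k t)) (vconv (fun t => Tm1 t b) k).
Proof.
have h : deriv_on (@half_line R) (vconv (fun t => j (resp1 t)) k) (vconv (fun t => Tm1 t b) k).
  apply: (vconv_deriv j_resp1_deriv (orbit_cont Tm1 b) _ bk).
  by rewrite resp1_0 linear0.
apply: deriv_on_ext h => // t t0.
exact: (vconv_map t (linear_rlinear (sn_j S)) j_rbounded resp1_cont bk).
Qed.

End Input.
End Responses.
End Node.

(** * The complex line as a Banach space *)

Lemma Re_line_norm (R : realType) (z : R[i]^o) : `|complex.Re z| <= rnorm z.
Proof. by have := normc_ge_Re z; rewrite lecE => /andP[]. Qed.

Lemma Im_line_norm (R : realType) (z : R[i]^o) : `|complex.Im z| <= rnorm z.
Proof.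
rewrite -(_ : rnorm (- 'i * z : R[i]^o) = rnorm z).
  apply: le_trans (Re_line_norm _); case: z => a b /=.
  by rewrite !(mul0r, mulN1r, oppr0, sub0r, opprK).
by rewrite /rnorm normrM normrN normCi mul1r.
Qed.

Lemma line_norm_parts (R : realType) (z : R[i]^o) :
  rnorm z <= `|complex.Re z| + `|complex.Im z|.
Proof.
have -> : z = (complex.Re z)%:C *: (1 : R[i]^o) + (complex.Im z)%:C *: ('i : R[i]^o).
  case: z => a b; rewrite /GRing.scale/=; simpc.
  by [].
apply: le_trans (ler_rnormD _ _) _; rewrite !rnormZr.
by rewrite {1 2}/rnorm normr1 normCi/= !mulr1/=; simpc.
Qed.

(** Completeness is inherited from the real and the imaginary part. *)
Lemma complex_line_complete (R : realType) (F : set_system R[i]^o) :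
  ProperFilter F -> cauchy F -> cvg F.
Proof.
move=> FF /cauchyP Fc.
have part (p : R[i]^o -> R) : (forall z w, `|p z - p w| <= rnorm (z - w)) ->
    exists l : R, p @ F --> l.
  move=> pl; exists (lim (p @ F)); apply: cauchy_cvg; apply/cauchyP => e e0.
  have e0' : 0 < e%:C :> R[i] by rewrite ltcE /= eqxx.
  have [z Fz] := Fc e%:C e0'; exists (p z).
  suff : F [set w | ball (p z) e (p w)] by [].
  apply: filterS Fz => w; rewrite -!ball_normE /= => zw.
  apply: le_lt_trans (pl _ _) _.
  by move: zw; rewrite ltcE => /andP[].
have [a ra] : exists a : R, (@complex.Re R : R[i]^o -> R) @ F --> a.
  apply: part => z w; apply: le_trans (Re_line_norm _).
  by case: z w => ? ? [? ?].
have [b rb] : exists b : R, (@complex.Im R : R[i]^o -> R) @ F --> b.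
  apply: part => z w; apply: le_trans (Im_line_norm _).
  by case: z w => ? ? [? ?].
apply/cvg_ex; exists ((a +i* b)%C : R[i]^o); rewrite -[F]/(id @ F).
apply/cvg_rnormP => e e0; have e2 : 0 < e / 2 by rewrite divr_gt0.
move/cvgrPdist_le : ra => /(_ _ e2) ra; move/cvgrPdist_le : rb => /(_ _ e2) rb.
near=> z; apply: le_trans (line_norm_parts _) _; rewrite [leRHS]splitr.
apply: lerD; [rewrite (_ : complex.Re _ = complex.Re z - a)|
              rewrite (_ : complex.Im _ = complex.Im z - b)]; try by case: (z).
- by rewrite distrC; near: z.
- by rewrite distrC; near: z.
Unshelve. all: by end_near. Qed.

Definition cline (R : realType) : Type := R[i]^o.
HB.instance Definition _ (R : realType) := NormedModule.copy (cline R) R[i]^o.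
HB.instance Definition _ (R : realType) :=
  Uniform_isComplete.Build (cline R) (@complex_line_complete R).

Lemma rnorm_line (R : realType) (r : R) : rnorm (r%:C : cline R) = `|r|.
Proof. by rewrite /rnorm [X in complex.Re X]realC_norm. Qed.

Lemma rnorm_line1 (R : realType) : rnorm (1 : cline R) = 1.
Proof. by rewrite /rnorm [X in complex.Re X]normr1. Qed.

Lemma line_scale1 (R : realType) (c : cline R) : (c : R[i]) *: (1 : cline R) = c.
Proof. exact: mulr1. Qed.

(** * Calculus of scalar inputs *)

Section LineParts.
Context (R : realType).
Implicit Types (z w : cline R) (r : R).

Lemma Re_lineD z w : complex.Re (z + w) = complex.Re z + complex.Re w.
Proof. by case: z w => ? ? [? ?]. Qed.

Lemma Im_lineD z w : complex.Im (z + w) = complex.Im z + complex.Im w.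
Proof. by case: z w => ? ? [? ?]. Qed.

Lemma Re_lineZ r z : complex.Re (r%:C *: z) = r * complex.Re z.
Proof. by case: z => a b /=; rewrite mul0r subr0. Qed.

Lemma Im_lineZ r z : complex.Im (r%:C *: z) = r * complex.Im z.
Proof. by case: z => a b /=; rewrite mul0r addr0. Qed.

End LineParts.

Section ScalarCalculus.
Context (R : realType).
Notation mu := (@lebesgue_measure R).
Notation rc k := (fun t : R => (k t)%:C : cline R).

Section Vector.
Context (V : completeNormedModType R[i]).
Implicit Types (v w : R -> V) (k : R -> R) (J : set R).

Lemma rc_lin (k k' : R -> R) (s t : R) :
  rnorm (rc k s - rc k t - (s - t)%:C *: rc k' t) = `|k s - k t - (s - t) * k' t|.
Proof. by rewrite -rnorm_line !rmorphB rmorphM !rmorphB. Qed.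

Lemma cont_on_scale J k v : cont_on J (rc k) -> cont_on J v ->
  cont_on J (fun t => (k t)%:C *: v t).
Proof.
move=> kc vc t Jt e e0.
have A0 : 0 < 2 * (`|k t| + 1) by rewrite mulr_gt0// ltr_pwDr.
have B0 : 0 < 2 * (rnorm (v t) + 1) by rewrite mulr_gt0// ltr_pwDr ?rnorm_ge0.
have [d1 d10 h1] := vc t Jt _ (divr_gt0 e0 A0).
have m0 : 0 < Num.min 1 (e / (2 * (rnorm (v t) + 1))) by rewrite lt_min ltr01 divr_gt0.
have [d2 d20 h2] := kc t Jt _ m0.
exists (Num.min d1 d2); first by rewrite lt_min d10.
move=> s Js; rewrite lt_min => /andP[sd1 sd2].
have := h2 s Js sd2; rewrite -rmorphB rnorm_line le_min => /andP[k1 k2].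
have -> : (k s)%:C *: v s - (k t)%:C *: v t =
  (k s)%:C *: (v s - v t) + (k s - k t)%:C *: v t.
  by rewrite rmorphB scalerBl scalerBr addrA subrK.
rewrite (le_trans (ler_rnormD _ _))// !rnormZr (splitr e) lerD//.
  rewrite (@le_trans _ _ ((`|k t| + 1) * (e / (2 * (`|k t| + 1)))))//.
    rewrite ler_pM ?rnorm_ge0// ?h1// -(subrK (k t) (k s)).
    by rewrite (le_trans (ler_normD _ _))// addrC lerD2l.
  by rewrite le_eqVlt; apply/predU1P; left; field; rewrite gt_eqF// ltr_pwDr.
rewrite (@le_trans _ _ (e / (2 * (rnorm (v t) + 1)) * (rnorm (v t) + 1)))//.
  by rewrite ler_pM ?rnorm_ge0// lerDl.
by rewrite le_eqVlt; apply/predU1P; left; field; rewrite gt_eqF// ltr_pwDr ?rnorm_ge0.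
Qed.

Lemma deriv_on_scale J k k' v v' : deriv_on J (rc k) (rc k') -> deriv_on J v v' ->
  deriv_on J (fun t => (k t)%:C *: v t)
             (fun t => (k' t)%:C *: v t + (k t)%:C *: v' t).
Proof.
move=> dk dv t Jt e e0; have vc := deriv_on_cont dv.
have A0 : 0 < 3 * (`|k t| + 1) by rewrite mulr_gt0// ltr_pwDr.
have C0 : 0 < 3 * (`|k' t| + 1) by rewrite mulr_gt0// ltr_pwDr.
have B0 : 0 < 3 * (rnorm (v t) + 1) by rewrite mulr_gt0// ltr_pwDr ?rnorm_ge0.
have [d1 d10 h1] := dv t Jt _ (divr_gt0 e0 A0).
have [d2 d20 h2] := dk t Jt _ (divr_gt0 e0 B0).
have [d3 d30 h3] := vc t Jt _ (divr_gt0 e0 C0).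
have [d4 d40 h4] := vc t Jt _ ltr01.
exists (Num.min (Num.min d1 d2) (Num.min d3 d4)); first by rewrite !lt_min d10 d20 d30 d40.
move=> s Js; rewrite !lt_min => /andP[/andP[sd1 sd2] /andP[sd3 sd4]].
have := h2 s Js sd2; rewrite rc_lin => {}h2.
have -> : (k s)%:C *: v s - (k t)%:C *: v t -
    (s - t)%:C *: ((k' t)%:C *: v t + (k t)%:C *: v' t) =
  (k t)%:C *: (v s - v t - (s - t)%:C *: v' t) +
  (k s - k t - (s - t) * k' t)%:C *: v s + ((s - t) * k' t)%:C *: (v s - v t).
  rewrite scalerDr !scalerBr !scalerA !rmorphB !rmorphM/= !scalerBl.
  rewrite !rmorphB [(k t)%:C * _]mulrC opprD !addrA.
  by rewrite [RHS](ACl (4*2*8*3*(1*5)*(7*6)))/= !subrr !addr0.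
rewrite (le_trans (ler_rnormD _ _))// (_ : e * `|s - t| =
  e / 3 * `|s - t| + e / 3 * `|s - t| + e / 3 * `|s - t|); last by field.
rewrite lerD//.
  rewrite (le_trans (ler_rnormD _ _))// !rnormZr lerD//.
    rewrite (@le_trans _ _ ((`|k t| + 1) * (e / (3 * (`|k t| + 1)) * `|s - t|)))//.
      by rewrite ler_pM ?rnorm_ge0 ?h1// lerDl.
    by rewrite le_eqVlt; apply/predU1P; left; field; rewrite gt_eqF// ltr_pwDr.
  rewrite (@le_trans _ _ (e / (3 * (rnorm (v t) + 1)) * `|s - t| * (rnorm (v t) + 1)))//.
    rewrite ler_pM ?rnorm_ge0// -(subrK (v t) (v s)) (le_trans (ler_rnormD _ _))//.
    by rewrite addrC lerD2l h4.
  by rewrite le_eqVlt; apply/predU1P; left; field; rewrite gt_eqF// ltr_pwDr ?rnorm_ge0.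
rewrite [leRHS]mulrC rnormZr normrM -[leLHS]mulrA.
rewrite ler_wpM2l// (@le_trans _ _ ((`|k' t| + 1) * (e / (3 * (`|k' t| + 1)))))//.
  by rewrite ler_pM ?rnorm_ge0 ?h3// lerDl.
by rewrite le_eqVlt; apply/predU1P; left; field; rewrite gt_eqF// ltr_pwDr.
Qed.

Lemma deriv_on_reverse v v' (t : R) : deriv_on (@half_line R) v v' ->
  deriv_on `[0, t]%classic (fun s => v (t - s)) (fun s => - v' (t - s)).
Proof.
move=> dv s; rewrite /= in_itv /= => /andP[s0 st] e e0.
have ts : half_line (t - s) by rewrite /half_line /= subr_ge0.
have [d d0 hd] := dv (t - s) ts e e0; exists d => // r.
rewrite in_itv /= => /andP[r0 rt] rs.
have tr : half_line (t - r) by rewrite /half_line /= subr_ge0.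
have rsE : t - r - (t - s) = - (r - s) by ring.
have := hd (t - r) tr; rewrite rsE normrN => /(_ rs).
by rewrite rmorphN scaleNr scalerN.
Qed.

(** The boundary terms vanish because both [w] and [k] start from zero. *)
Lemma vconv_by_parts w v k k' t : 0 <= t ->
  deriv_on (@half_line R) w v -> cont_on (@half_line R) v -> w 0 = 0 ->
  deriv_on (@half_line R) (rc k) (rc k') -> cont_on (@half_line R) (rc k') -> k 0 = 0 ->
  loc_bounded k -> loc_bounded k' -> vconv w k' t = vconv v k t.
Proof.
move=> t0 dw vc w0 dk kc' k0 bk bk'.
have wc := deriv_on_cont dw.
have sub := @half_line_segment R t.
have dkt := deriv_onW sub dk.
have dwr := @deriv_on_reverse _ _ t dw.
have cc : cont_on `[0, t]%classic
    (fun s => (k' s)%:C *: w (t - s) + (k s)%:C *: - v (t - s)).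
  apply: cont_onD.
    exact: cont_on_scale (cont_onW sub kc') (cont_on_reverse wc).
  apply: cont_on_scale (cont_onW sub (deriv_on_cont dk)) _.
  apply: rlinear_cont_on (@opp_rlinear _ _) (@opp_rbounded _ _) _.
  exact: cont_on_reverse.
have := Bint_FTC t0 (deriv_on_scale dkt dwr) cc.
rewrite subrr w0 k0 scaler0 scale0r subrr => h.
have mI := measurable_itv `[0, t]; have fin := segment_lty 0 t.
apply/eqP; rewrite -subr_eq0; apply/eqP.
apply: (Bint_unique mI fin _ (BintB mI fin (vconvP t wc bk') (vconvP t vc bk)) h).
by move=> s _ /=; rewrite scalerN.
Qed.

(** The derivative of a convolution may fall on a smooth input that starts
    from zero, even for a kernel that is only continuous. *)
Lemma vconv_deriv_input v k k' : cont_on (@half_line R) v ->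
  deriv_on (@half_line R) (rc k) (rc k') -> cont_on (@half_line R) (rc k') -> k 0 = 0 ->
  loc_bounded k -> loc_bounded k' ->
  deriv_on (@half_line R) (vconv v k) (vconv v k').
Proof.
move=> vc dk kc' k0 bk bk'.
have dw := primitive_deriv vc; have w0 := primitive0 vc.
have h := vconv_deriv dw vc w0 bk'.
by apply: deriv_on_ext h => // t t0; exact: (vconv_by_parts t0 dw vc w0 dk kc' k0 bk bk').
Qed.

End Vector.

Lemma Bint_scalar (V : completeNormedModType R[i]) (D : set R) (q : R -> R) (K : R) (e : V) :
  measurable D -> (mu D < +oo)%E -> measurable_fun setT q ->
  (forall s, D s -> `|q s| <= K) ->
  Bint D (fun s => (q s)%:C *: e) ((\int[mu]_(s in D) q s)%:C *: e).
Proof.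
move=> mD Dfin mq qK.
have s1 : simplifiable D (fun=> 1 : cline R).
  have /Bint_simplifiable := Bint_indic_cst D (1 : cline R) mD.
  by apply: simplifiable_ext => s /mem_set ->.
have [z hz] := Bint_exists mD Dfin (simplifiable_scale mq qK s1).
have rez := Bint_real (M := 1) mD Dfin ltr01 (@Re_lineD R) (@Re_lineZ R) _ hz.
have imz := Bint_real (M := 1) mD Dfin ltr01 (@Im_lineD R) (@Im_lineZ R) _ hz.
have zE : z = (\int[mu]_(s in D) q s)%:C.
  rewrite (complexE z) (rez _).2; last by move=> x; rewrite mul1r Re_line_norm.
  rewrite (imz _).2; last by move=> x; rewrite mul1r Im_line_norm.
  rewrite [X in _ + 'i * X%:C](_ : _ = 0).
    rewrite rmorph0 mulr0 addr0; congr (_%:C); apply: eq_Rintegral => s _.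
    by rewrite Re_lineZ /= mulr1.
  rewrite -[RHS](mul0r (fine (mu D))) -(Rintegral_cst mu mD); apply: eq_Rintegral => s _.
  by rewrite Im_lineZ /= mulr0.
rewrite zE in hz.
have bL : rbounded (fun z : cline R => (z : R[i]) *: e).
  exists (rnorm e + 1) => [|a]; first by rewrite ltr_pwDr ?rnorm_ge0.
  have -> : rnorm ((a : R[i]) *: e) = rnorm e * rnorm a by rewrite rnormZ mulrC.
  by rewrite ler_wpM2r ?rnorm_ge0// lerDl.
have lL : rlinear (fun z : cline R => (z : R[i]) *: e).
  by split=> [a b|r a]; rewrite ?scalerDl ?scalerA.
apply: Bint_ext (Bint_map lL bL hz) => s _.
by congr (_ *: e); exact: mulr1.
Qed.

End ScalarCalculus.

(** * Limits of antiderivatives *)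

Section DerivativeLimit.
Context (R : realType) (V : completeNormedModType R[i]).

Lemma subrACA (a b c d : V) : (a - b) - (c - d) = (a - c) - (b - d).
Proof. by rewrite !opprD addrACA. Qed.

(** An increment over a step [h] nearly equals [h] times the derivative, so a
    small function with a Lipschitz derivative has a small derivative. *)
Lemma derivative_interpolation (g g' : R -> V) (t h L e : R) :
  deriv_on (@half_line R) g g' -> cont_on (@half_line R) g' ->
  0 <= t -> 0 < h -> 0 <= L ->
  (forall s, t < s <= t + h -> rnorm (g' s - g' t) <= L * (s - t)) ->
  rnorm (g t) <= e -> rnorm (g (t + h)) <= e ->
  rnorm (g' t) <= (e + e) / h + L * h.
Proof.
move=> dg gc t0 h0 L0 lip e1 e2.
have th : t <= t + h by rewrite lerDl ltW.
have sub := @half_line_segment R (t + h).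
have Lh0 : 0 <= L * h by rewrite mulr_ge0// ltW.
have inc := @deriv_on_increment _ _ g g' _ t (t + h) (L * h) (g' t) t0 th (lexx _) Lh0
  (deriv_onW sub dg) (cont_onW sub gc) _.
have {inc} : rnorm (g (t + h) - g t - (t + h - t)%:C *: g' t) <= L * h * (t + h - t).
  apply: inc => s /[dup] sth /andP[ts sh]; rewrite (le_trans (lip s sth))//.
  by rewrite ler_wpM2l// lerBlDl.
rewrite [t + h]addrC addrK => inc.
rewrite -(ler_pM2l h0) mulrDr mulrCA divff ?gt_eqF// mulr1 mulrC.
have -> : h * (L * h) = L * h * h by rewrite mulrC.
have -> : rnorm (g' t) * h = rnorm (h%:C *: g' t) by rewrite rnormZr gtr0_norm// mulrC.
have -> : h%:C *: g' t = (g (h + t) - g t) - (g (h + t) - g t - h%:C *: g' t).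
  by rewrite subKr.
rewrite (le_trans (ler_rnormB _ _))// lerD//.
by rewrite (le_trans (ler_rnormB _ _))// lerD// addrC.
Qed.

Definition unif_cvg (f : nat -> R -> V) (g : R -> V) := forall T e : R, 0 < e ->
  exists N, forall n t, (N <= n)%N -> 0 <= t <= T -> rnorm (f n t - g t) <= e.

Definition lipschitz_by (f : R -> V) (L : R -> R) := forall T s t : R,
  0 <= s <= T -> 0 <= t <= T -> rnorm (f s - f t) <= L T * `|s - t|.

Lemma lipschitz_by_cont f L : (forall T, 0 <= L T) -> lipschitz_by f L ->
  cont_on (@half_line R) f.
Proof.
move=> L0 fl t t0 e e0; rewrite /half_line/= in t0.
have L1 : 0 < L (t + 1) + 1 by rewrite ltr_pwDr.
exists (Num.min 1 (e / (L (t + 1) + 1))); first by rewrite lt_min ltr01 divr_gt0.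
move=> s s0; rewrite lt_min => /andP[s1 se].
apply: le_trans (fl (t + 1) s t _ _) _.
- rewrite s0 /= -lerBlDl (le_trans (ler_norm _))//; exact: ltW.
- by rewrite t0 lerDl /=.
move: se; rewrite ltr_pdivlMr// mulrC => /ltW; apply: le_trans.
by rewrite ler_wpM2r// lerDl.
Qed.

Lemma lipschitz_by_increment f f' L (T s t : R) : (forall T, 0 <= L T) ->
  deriv_on (@half_line R) f f' -> lipschitz_by f' L ->
  0 <= s <= T -> 0 <= t <= T ->
  rnorm (f s - f t - (s - t)%:C *: f' t) <= L T * `|s - t| * `|s - t|.
Proof.
move=> L0 df lf sT tT; have fc := lipschitz_by_cont L0 lf.
have sub := @half_line_segment R T.
have [s0 sT'] := andP sT; have [t0 tT'] := andP tT.
have [ts|/ltW st] := leP t s.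
  rewrite [X in _ * X](ger0_norm (x := s - t)) ?subr_ge0//.
  apply: (deriv_on_increment t0 ts sT' _ (deriv_onW sub df) (cont_onW sub fc)) => [|r].
    by rewrite mulr_ge0.
  move=> /andP[/ltW tr rs]; apply: le_trans (lf T r t _ tT) _.
    by rewrite (le_trans t0)//= (le_trans rs).
  by rewrite ler_wpM2l// !ger0_norm ?subr_ge0// lerD2r.
have -> : f s - f t - (s - t)%:C *: f' t = - (f t - f s - (t - s)%:C *: f' t).
  by rewrite !opprD !opprK -scaleNr -rmorphN opprB [f s - _]addrC.
rewrite rnormN distrC [X in _ * X](ger0_norm (x := t - s)) ?subr_ge0//.
apply: (deriv_on_increment s0 st tT' _ (deriv_onW sub df) (cont_onW sub fc)) => [|r].
  by rewrite mulr_ge0.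
move=> /andP[/ltW sr rt]; apply: le_trans (lf T r t _ tT) _.
  by rewrite (le_trans s0)//= (le_trans rt).
rewrite ler_wpM2l// (distrC r t) (ger0_norm (x := t - r)) ?subr_ge0//.
by rewrite (ger0_norm (x := t - s)) ?subr_ge0// lerD2l lerN2.
Qed.

(** By [derivative_interpolation] the derivatives form a uniform Cauchy
    sequence on bounded times. *)
Lemma derivative_limit (f f' : nat -> R -> V) (g : R -> V) (L : R -> R) :
  (forall T, 0 <= L T) ->
  (forall n, deriv_on (@half_line R) (f n) (f' n)) ->
  (forall n, lipschitz_by (f' n) L) -> unif_cvg f g ->
  exists g', [/\ deriv_on (@half_line R) g g', unif_cvg f' g' & lipschitz_by g' L].
Proof.
move=> L0 df lf fg.
have fc n := lipschitz_by_cont L0 (lf n).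
have cau (T e : R) : 0 < e -> exists N, forall m n t, (N <= m)%N -> (N <= n)%N ->
    0 <= t <= T -> rnorm (f' m t - f' n t) <= e.
  move=> e0; set LT := L (T + 1); have LT0 : 0 <= LT := L0 _.
  have LL0 : 0 < LT + LT + 1 by rewrite ltr_pwDr// addr_ge0.
  pose h := Num.min 1 (e / 2 / (LT + LT + 1)).
  have h0 : 0 < h by rewrite lt_min ltr01 !divr_gt0.
  have h1 : h <= 1 by rewrite ge_min lexx.
  have d0 : 0 < e * h / 8 by rewrite divr_gt0// mulr_gt0.
  have [N hN] := fg (T + 1) _ d0; exists N => m n t Nm Nn /andP[t0 tT].
  have close s : 0 <= s <= T + 1 -> rnorm (f m s - f n s) <= e * h / 4.
    move=> sT; rewrite (le_trans (ler_rdistD (g s) _ _))//.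
    have -> : e * h / 4 = e * h / 8 + e * h / 8 by field.
    by rewrite lerD ?hN// rnorm_distC hN.
  have dmn : deriv_on (@half_line R) (fun s => f m s - f n s) (fun s => f' m s - f' n s).
    apply: deriv_onD (df m) _.
    exact: rlinear_deriv_on (@opp_rlinear _ _) (@opp_rbounded _ _) (df n).
  have cmn : cont_on (@half_line R) (fun s => f' m s - f' n s).
    apply: cont_onD (fc m) _.
    exact: rlinear_cont_on (@opp_rlinear _ _) (@opp_rbounded _ _) (fc n).
  have th : t + h <= T + 1 by rewrite lerD.
  apply: le_trans (derivative_interpolation dmn cmn t0 h0 (addr_ge0 LT0 LT0)
    (e := e * h / 4) _ _ _) _.
  - move=> s /andP[/ltW ts sh]; have sT : 0 <= s <= T + 1.
      by rewrite (le_trans t0)//= (le_trans sh).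
    have tT1 : 0 <= t <= T + 1 by rewrite t0 (le_trans tT)// lerDl.
    rewrite subrACA (le_trans (ler_rnormB _ _))// mulrDl.
    have -> : s - t = `|s - t| by rewrite ger0_norm// subr_ge0.
    by rewrite lerD// lf.
  - by apply: close; rewrite t0 (le_trans tT)// lerDl.
  - by apply: close; rewrite th addr_ge0// ltW.
  have -> : (e * h / 4 + e * h / 4) / h = e / 2 by field; rewrite gt_eqF.
  rewrite [leRHS]splitr lerD2l.
  have : h <= e / 2 / (LT + LT + 1) by rewrite ge_min lexx orbT.
  rewrite ler_pdivlMr// mulrC; apply: le_trans.
  by rewrite ler_wpM2r ?lerDl// ltW.
have [g' hg'] : exists g' : R -> V, forall t, 0 <= t -> forall e : R, 0 < e ->
    exists N, forall n, (N <= n)%N -> rnorm (f' n t - g' t) <= e.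
  have : forall t, exists l, 0 <= t -> forall e : R, 0 < e ->
      exists N, forall n, (N <= n)%N -> rnorm (f' n t - l) <= e.
    move=> t; have [t0|] := boolP (0 <= t); last by exists 0.
    have [|l hl] := @rcauchy_cvg R V (fun n => f' n t).
      move=> e e0; have [N hN] := cau t e e0; exists N => m n Nm Nn.
      by rewrite hN// t0 lexx.
    by exists l.
  by move=> /choice[g' hg']; exists g'.
have ucv : unif_cvg f' g'.
  move=> T e e0; have [N hN] := cau T _ e0; exists N => n t Nn tT.
  apply/ler_addgt0Pr => d d0; have [t0 _] := andP tT.
  have [M hM] := hg' t t0 d d0.
  rewrite (le_trans (ler_rdistD (f' (maxn N M) t) _ _))// lerD ?hM ?leq_maxr//.
  by rewrite hN// leq_maxl.
exists g'; split => //.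
- move=> t t0 e e0; rewrite /half_line/= in t0.
  have L1 : 0 < L (t + 1) + 1 by rewrite ltr_pwDr.
  exists (Num.min 1 (e / (L (t + 1) + 1))); first by rewrite lt_min ltr01 divr_gt0.
  move=> s s0; rewrite lt_min => /andP[s1 se].
  have sT : 0 <= s <= t + 1.
    by rewrite s0 /= -lerBlDl (le_trans (ler_norm _))//; exact: ltW.
  have tT : 0 <= t <= t + 1 by rewrite t0 lerDl /=.
  apply: (@le_trans _ _ (L (t + 1) * `|s - t| * `|s - t|)); last first.
    rewrite ler_wpM2r//; move: se; rewrite ltr_pdivlMr// mulrC => /ltW; apply: le_trans.
    by rewrite ler_wpM2r// lerDl.
  apply/ler_addgt0Pr => d d0; have d3 : 0 < d / 3 by rewrite divr_gt0.
  have [N1 h1] := fg (t + 1) _ d3; have [N2 h2] := ucv (t + 1) _ d3.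
  pose n := maxn N1 N2.
  have inc := lipschitz_by_increment L0 (df n) (lf n) sT tT.
  have -> : g s - g t - (s - t)%:C *: g' t =
      (f n s - f n t - (s - t)%:C *: f' n t) - ((f n s - g s) - (f n t - g t)
       - (s - t)%:C *: (f' n t - g' t)).
    rewrite scalerBr [f n s - g s - _]subrACA.
    by rewrite [_ - (g s - g t) - _]subrACA subKr.
  rewrite (le_trans (ler_rnormB _ _))// lerD//.
  have -> : d = d / 3 + d / 3 + d / 3 by field.
  rewrite (le_trans (ler_rnormB _ _))// lerD//.
    by rewrite (le_trans (ler_rnormB _ _))// lerD// h1// leq_maxl.
  rewrite rnormZr -[leRHS]mul1r ler_pM ?rnorm_ge0//; first exact: ltW.
  by rewrite h2// leq_maxr.
- move=> T s t sT tT; apply/ler_addgt0Pr => d d0.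
  have d2 : 0 < d / 2 by rewrite divr_gt0.
  have [N hN] := ucv T _ d2.
  have -> : L T * `|s - t| + d = d / 2 + (L T * `|s - t| + d / 2) by field.
  rewrite (le_trans (ler_rdistD (f' N s) _ _))// lerD//.
    by rewrite rnorm_distC hN.
  by rewrite (le_trans (ler_rdistD (f' N t) _ _))// lerD ?hN ?lf.
Qed.

End DerivativeLimit.

(** * Primitives of bounded inputs *)

Section BoundedInputs.
Context (R : realType).
Notation mu := (@lebesgue_measure R).
Notation rc k := (fun t : R => (k t)%:C : cline R).

Lemma cont_loc_bounded (k : R -> R) : cont_on setT (rc k) -> loc_bounded k.
Proof.
move=> kc; split.
  apply: continuous_measurable_fun => t; apply/cvgrPdist_le => e e0.
  have [d d0 hd] := kc t Logic.I e e0; apply/nbhs_ballP; exists d => //= s ts.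
  have := hd s Logic.I; rewrite -rmorphB rnorm_line (distrC (k s)); apply.
  by rewrite distrC.
move=> T; have [M M0 hM] := cont_on_bounded T (cont_onW (@subsetT _ _) kc).
by exists M => s /hM; rewrite rnorm_line.
Qed.

Lemma Bint_dominated (V : normedModType R[i]) (D : set R) (f : R -> V) v (p : R -> R) I :
  measurable D -> (mu D < +oo)%E -> measurable_fun D p ->
  Bint D f v -> Bint D (rc p) (I%:C) -> (forall s, D s -> rnorm (f s) <= p s) ->
  rnorm v <= I.
Proof.
move=> mD Dfin mp hf hp fp; rewrite -lee_fin (le_trans (Bint_le mD Dfin hf mp fp))//.
have := Bint_real (M := 1) mD Dfin ltr01 (@Re_lineD R) (@Re_lineZ R) _ hp.
case=> [z|ip Ip]; first by rewrite mul1r Re_line_norm.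
by rewrite (_ : I = \int[mu]_(x in D) p x)// /Rintegral fineK// integrable_fin_num.
Qed.

Definition rprim (k : R -> R) (t : R) : R := \int[mu]_(s in `[0, t]) k s.

Lemma rprimP (V : completeNormedModType R[i]) (k : R -> R) (t : R) (e : V) : loc_bounded k ->
  Bint `[0, t]%classic (fun s => (k s)%:C *: e) ((rprim k t)%:C *: e).
Proof.
move=> [mk /(_ t)[K hK]]; apply: (@Bint_scalar _ _ _ _ K) => //.
exact: segment_lty.
Qed.

Lemma rprim0 (k : R -> R) : loc_bounded k -> rprim k 0 = 0.
Proof.
move=> bk; have := Bint_segment0 (@rprimP (cline R) k 0 1 bk).
by rewrite /GRing.scale /= mulr1 => -[].
Qed.

Lemma rprim_lt0 (k : R -> R) t : t < 0 -> rprim k t = 0.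
Proof. by move=> t0; rewrite /rprim set_itv_ge ?Rintegral_set0// -ltNge. Qed.

Section Increments.
Context (V : completeNormedModType R[i]).

Lemma scaled_increment (v : R -> V) (c : V) k (T a b K e : R) z1 z2 :
  loc_bounded k -> (forall s, 0 <= s <= T -> `|k s| <= K) -> 0 <= e ->
  0 <= a -> a <= b -> b <= T ->
  Bint `[0, a]%classic (fun s => (k s)%:C *: v s) z1 ->
  Bint `[0, b]%classic (fun s => (k s)%:C *: v s) z2 ->
  (forall s, a < s <= b -> rnorm (v s - c) <= e) ->
  rnorm (z2 - z1 - (rprim k b - rprim k a)%:C *: c) <= K * e * (b - a).
Proof.
move=> bk hK e0 a0 ab bT h1 h2 hc.
have K0 : 0 <= K by apply: le_trans (hK a _); rewrite ?a0//= (le_trans ab).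
have mI (x : R) : measurable (`[0, x]%classic : set R) by exact: measurable_itv.
have fin (x : R) := @segment_lty R 0 x.
have g1 := BintB (mI _) (fin _) h1 (rprimP a c bk).
have g2 := BintB (mI _) (fin _) h2 (rprimP b c bk).
have -> : z2 - z1 - (rprim k b - rprim k a)%:C *: c =
    z2 - (rprim k b)%:C *: c - (z1 - (rprim k a)%:C *: c) - (b - a)%:C *: 0.
  by rewrite scaler0 subr0 rmorphB scalerBl subrACA.
apply: (Bint_increment a0 ab _ g1 g2) => [|s /[dup] sab /andP[/ltW as_ sb]].
  by rewrite mulr_ge0.
rewrite subr0 -scalerBr rnormZr ler_pM ?rnorm_ge0 ?hc ?hK//.
by rewrite (le_trans a0)//= (le_trans sb).
Qed.

End Increments.

Lemma rprim_lip (k : R -> R) (T K s t : R) : loc_bounded k ->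
  (forall s, 0 <= s <= T -> `|k s| <= K) -> 0 <= s <= T -> 0 <= t <= T ->
  `|rprim k s - rprim k t| <= K * `|s - t|.
Proof.
move=> bk hK; wlog ts : s t / t <= s.
  move=> h sT tT; have [ts|/ltW st] := leP t s; first exact: h.
  by rewrite distrC [`|s - t|]distrC h.
move=> /andP[s0 sT] /andP[t0 tT]; rewrite [X in _ * X]ger0_norm ?subr_ge0//.
have K0 : 0 <= K by apply: le_trans (hK t _); rewrite ?t0.
have hb x : Bint `[0, x]%classic (fun s => (k s)%:C *: (1 : cline R)) (rprim k x)%:C.
  by have := @rprimP (cline R) k x 1 bk; rewrite {2}/GRing.scale /= mulr1.
have := Bint_increment (c := 0) t0 ts K0 (hb t) (hb s).
rewrite scaler0 subr0 -rmorphB rnorm_line; apply => r /andP[/ltW tr rs].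
rewrite subr0 rnormZr rnorm_line1 mulr1 hK// (le_trans t0)//=.
exact: le_trans sT.
Qed.

Lemma rprim_cont (k : R -> R) : loc_bounded k -> cont_on setT (rc (rprim k)).
Proof.
move=> bk t _ e e0; have [K K0 hK] := loc_bounded_gt0 (`|t| + 1) bk.
exists (Num.min 1 (e / K)); first by rewrite lt_min ltr01 divr_gt0.
move=> s _; rewrite lt_min => /andP[s1 sK].
rewrite -rmorphB rnorm_line.
have neg r : rprim k r = rprim k (Num.max 0 r).
  by have [//|r0] := leP 0 r; rewrite rprim_lt0// rprim0.
rewrite neg (neg t) (le_trans (rprim_lip (T := `|t| + 1) bk hK _ _))//.
- rewrite le_max lexx /= ge_max addr_ge0//=.
  rewrite -(subrK t s) (le_trans (ler_norm _))// (le_trans (ler_normD _ _))//.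
  by rewrite addrC lerD2l ltW.
- by rewrite le_max lexx /= ge_max addr_ge0//= (le_trans (ler_norm _))// lerDl.
move: sK; rewrite ltr_pdivlMr// mulrC => /ltW; apply: le_trans.
rewrite ler_wpM2l ?(ltW K0)//.
have h1 := ler_norm (s - t); have h2 := ler_norm (t - s); rewrite distrC in h2.
by have [s0|s0] := leP 0 s; have [t0|t0] := leP 0 t; rewrite ?ler_norml; apply/andP; split; lra.
Qed.

Lemma rprim_loc_bounded (k : R -> R) : loc_bounded k -> loc_bounded (rprim k).
Proof. by move=> /rprim_cont/cont_loc_bounded. Qed.

(** The primitive of a bounded function need not be differentiable, so parts
    are integrated by showing that the difference of both sides, as a function
    of the upper limit, has derivative zero everywhere. *)
Lemma Bint_by_parts (V : completeNormedModType R[i]) (v v' : R -> V) k (T : R) z1 z2 :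
  0 <= T -> loc_bounded k ->
  deriv_on `[0, T]%classic v v' -> cont_on `[0, T]%classic v' ->
  Bint `[0, T]%classic (fun s => (k s)%:C *: v s) z1 ->
  Bint `[0, T]%classic (fun s => (rprim k s)%:C *: v' s) z2 ->
  z1 + z2 = (rprim k T)%:C *: v T.
Proof.
move=> T0 bk dv vc' hz1 hz2.
have [K K0 hK] := loc_bounded_gt0 T bk.
have mI (x : R) : measurable (`[0, x]%classic : set R) by exact: measurable_itv.
have fin (x : R) := @segment_lty R 0 x.
have vc := deriv_on_cont dv.
have Dc : cont_on `[0, T]%classic (fun s => (rprim k s)%:C *: v' s).
  exact: cont_on_scale (cont_onW (@subsetT _ _) (rprim_cont bk)) vc'.
have : forall x, exists z, 0 <= x <= T -> Bint `[0, x]%classic (fun s => (k s)%:C *: v s) z.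
  move=> x; have [/andP[x0 xT]|] := boolP (0 <= x <= T); last by exists 0.
  have kx s : `[0, x]%classic s -> `|k s| <= K.
    by rewrite /= in_itv /= => /andP[s0 sx]; rewrite hK// s0 (le_trans sx).
  have [z hz] := Bint_exists (mI x) (fin x) (simplifiable_scale bk.1 kx
    (cont_on_simplifiable (cont_onW (segment_sub xT) vc))).
  by exists z.
move=> /choice[B1 hB1].
have : forall x, exists z, 0 <= x <= T ->
    Bint `[0, x]%classic (fun s => (rprim k s)%:C *: v' s) z.
  move=> x; have [/andP[x0 xT]|] := boolP (0 <= x <= T); last by exists 0.
  have [z hz] := Bint_exists (mI x) (fin x)
    (cont_on_simplifiable (cont_onW (segment_sub xT) Dc)).
  by exists z.
move=> /choice[B2 hB2].
have dB2 := Bint_primitive Dc hB2.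
pose E x := B1 x + B2 x - (rprim k x)%:C *: v x.
have dE : deriv_on `[0, T]%classic E (fun=> 0).
  move=> t tT e e0; have tT' : 0 <= t <= T by move: tT; rewrite /= in_itv.
  set W := rnorm (v' t) + 1; have W0 : 0 < W by rewrite ltr_pwDr// rnorm_ge0.
  have KT0 : 0 < K * T + 1 by rewrite ltr_pwDr// mulr_ge0// ltW.
  have [d1 d10 h1] := vc t tT _ (divr_gt0 e0 (mulr_gt0 (ltr0n _ 4) K0)).
  have [d2 d20 h2] := dB2 t tT _ (divr_gt0 e0 (ltr0n _ 4)).
  have [d3 d30 h3] := dv t tT _ (divr_gt0 e0 (mulr_gt0 (ltr0n _ 4) KT0)).
  have d40 : 0 < e / (4 * (K * W)) by rewrite divr_gt0// !mulr_gt0.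
  exists (Num.min (Num.min d1 d2) (Num.min d3 (e / (4 * (K * W))))).
    by rewrite !lt_min d10 d20 d30.
  move=> s sT; have sT' : 0 <= s <= T by move: sT; rewrite /= in_itv.
  rewrite !lt_min => /andP[/andP[sd1 sd2] /andP[sd3 sd4]].
  have i1 : rnorm (B1 s - B1 t - (rprim k s - rprim k t)%:C *: v t) <= e / 4 * `|s - t|.
    have e40 : 0 <= e / (4 * K) by rewrite ltW// divr_gt0// mulr_gt0.
    have -> : e / 4 = K * (e / (4 * K)) by field; rewrite gt_eqF.
    have [t0 tT1] := andP tT'; have [s0 sT1] := andP sT'.
    have [ts|/ltW st] := leP t s.
      rewrite [X in _ * X]ger0_norm ?subr_ge0//.
      apply: (scaled_increment bk hK e40 t0 ts sT1 (hB1 _ tT') (hB1 _ sT')).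
      move=> r /andP[/ltW tr rs]; apply: h1.
        by rewrite /= in_itv /= (le_trans t0)//= (le_trans rs).
      by apply: le_lt_trans sd1; rewrite !ger0_norm ?subr_ge0// lerD2r.
    have -> : B1 s - B1 t - (rprim k s - rprim k t)%:C *: v t =
        - (B1 t - B1 s - (rprim k t - rprim k s)%:C *: v t).
      by rewrite !opprD !opprK -scaleNr -rmorphN opprB [B1 s - _]addrC.
    rewrite rnormN distrC [X in _ * X]ger0_norm ?subr_ge0//.
    apply: (scaled_increment bk hK e40 s0 st tT1 (hB1 _ sT') (hB1 _ tT')).
    move=> r /andP[/ltW sr rt]; apply: h1.
      by rewrite /= in_itv /= (le_trans s0)//= (le_trans rt).
    apply: le_lt_trans sd1; rewrite distrC [leRHS]distrC !ger0_norm ?subr_ge0//.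
    by rewrite lerD2l lerN2.
  have i3 : rnorm ((rprim k s)%:C *: (v s - v t - (s - t)%:C *: v' t)) <= e / 4 * `|s - t|.
    rewrite rnormZr (@le_trans _ _ ((K * T + 1) * (e / (4 * (K * T + 1)) * `|s - t|)))//.
      rewrite ler_pM ?rnorm_ge0 ?h3//.
      have := rprim_lip bk hK sT' (_ : 0 <= 0 <= T); rewrite rprim0// !subr0 lexx => /(_ T0).
      move/le_trans; apply; rewrite ler_wpDr// ler_wpM2l ?(ltW K0)//.
      by case/andP: sT' => s0 sT'; rewrite ger0_norm.
    by rewrite le_eqVlt; apply/predU1P; left; field; rewrite gt_eqF.
  have i4 : rnorm (((rprim k s - rprim k t) * (s - t))%:C *: v' t) <= e / 4 * `|s - t|.
    rewrite rnormZr normrM (@le_trans _ _ (K * `|s - t| * `|s - t| * W))//.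
      rewrite ler_pM ?rnorm_ge0 ?mulr_ge0//; last by rewrite lerDl.
      by rewrite ler_wpM2r// (rprim_lip bk hK sT' tT').
    rewrite mulrAC ler_wpM2r// mulrAC -ler_pdivlMl ?mulr_gt0// ltW//.
    by rewrite (lt_le_trans sd4)// le_eqVlt; apply/predU1P; left; field; rewrite !gt_eqF.
  have -> : E s - E t - (s - t)%:C *: 0 =
      (B1 s - B1 t - (rprim k s - rprim k t)%:C *: v t) +
      (B2 s - B2 t - (s - t)%:C *: ((rprim k t)%:C *: v' t)) -
      ((rprim k s)%:C *: (v s - v t - (s - t)%:C *: v' t) +
       ((rprim k s - rprim k t) * (s - t))%:C *: v' t).
    have -> : (rprim k s)%:C *: (v s - v t - (s - t)%:C *: v' t) +
        ((rprim k s - rprim k t) * (s - t))%:C *: v' t =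
        (rprim k s)%:C *: v s - (rprim k s)%:C *: v t - (s - t)%:C *: ((rprim k t)%:C *: v' t).
      rewrite !scalerBr !scalerA -!rmorphM mulrBl rmorphB scalerBl addrA.
      by rewrite [rprim k t * _]mulrC subrK.
    rewrite scaler0 subr0 rmorphB scalerBl /E !opprD !opprK !addrA.
    by rewrite [RHS](ACl (1*5*8*2*6*4*(3*9)*(7*10)))/= !addNr !addr0.
  have -> : e * `|s - t| = e / 4 * `|s - t| + e / 4 * `|s - t| +
     (e / 4 * `|s - t| + e / 4 * `|s - t|) by field.
  rewrite (le_trans (ler_rnormB _ _))// lerD// (le_trans (ler_rnormD _ _))// lerD//.
  exact: h2.
have TT : 0 <= T <= T by rewrite T0 lexx.
have ZT : 0 <= (0 : R) <= T by rewrite lexx T0.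
have := deriv_on0_cst dE TT; rewrite /E rprim0// scale0r subr0.
rewrite (Bint_segment0 (hB1 _ ZT)) (Bint_segment0 (hB2 _ ZT)) addr0 => /eqP.
rewrite subr_eq0 => /eqP <-.
by rewrite (Bint_unique (mI T) (fin T) (fun _ _ => erefl) hz1 (hB1 _ TT))
           (Bint_unique (mI T) (fin T) (fun _ _ => erefl) hz2 (hB2 _ TT)).
Qed.

End BoundedInputs.

(** * Smoothing of inputs *)

Section Smoothing.
Context (R : realType).
Notation mu := (@lebesgue_measure R).
Notation rc k := (fun t : R => (k t)%:C : cline R).

(** [sg 0] rises smoothly from 0 to 1 on a segment inside [0, d], and [sg m] is
    its derivative of order [m]; in particular [sg 1] is a mollifier. *)
Definition smooth_step (d : R) (sg : nat -> R -> R) :=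
  [/\ forall m, deriv_on setT (rc (sg m)) (rc (sg m.+1)),
      forall r, 0 <= sg 0 r <= 1, forall r, 0 <= sg 1 r,
      exists2 a, 0 < a & forall m r, r <= a -> sg m r = 0 &
      forall r, d <= r -> sg 0 r = 1 /\ forall m, sg m.+1 r = 0].

Definition rconv (q k : R -> R) (t : R) : R := \int[mu]_(s in `[0, t]) (k s * q (t - s)).

Lemma rconv_vconv (V : completeNormedModType R[i]) (e : V) q k t :
  cont_on setT (rc q) -> loc_bounded k ->
  vconv (fun r => (q r)%:C *: e) k t = (rconv q k t)%:C *: e.
Proof.
move=> qc bk; have bq := cont_loc_bounded qc.
have qec : cont_on (@half_line R) (fun r => (q r)%:C *: e).
  apply: cont_on_scale (cont_onW (@subsetT _ _) qc) _; exact: cont_on_cst.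
have mI := measurable_itv `[0, t]; have fin := segment_lty 0 t.
have [K K0 hK] := loc_bounded_gt0 t bk; have [Q Q0 hQ] := loc_bounded_gt0 t bq.
apply: (Bint_unique mI fin _ (vconvP t qec bk)); last first.
  apply: (@Bint_scalar _ _ _ (fun s => k s * q (t - s)) (K * Q)) => //.
    apply: measurable_funM; first exact: bk.1.
    apply: measurableT_comp; first exact: bq.1.
    exact: measurable_funB.
  move=> s; rewrite /= in_itv /= => /andP[s0 st]; rewrite normrM ler_pM ?hK ?s0//.
  by rewrite hQ// subr_ge0 st lerBlDr lerDl.
by move=> s _ /=; rewrite scalerA -rmorphM.
Qed.

Lemma rconv_line q k t : cont_on setT (rc q) -> loc_bounded k ->
  (rconv q k t)%:C = vconv (rc q) k t :> cline R.
Proof.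
move=> qc bk.
have -> : rc q = (fun r => (q r)%:C *: (1 : cline R)).
  by apply/funext => r; exact/esym/line_scale1.
have e := rconv_vconv (1 : cline R) t qc bk.
by apply/esym; apply: (etrans e); exact: line_scale1.
Qed.

Lemma rconv_lt0 q k t : t < 0 -> rconv q k t = 0.
Proof. by move=> t0; rewrite /rconv set_itv_ge ?Rintegral_set0// -ltNge. Qed.

Lemma rconv_eq0 q k t : (forall s, 0 <= s <= t -> k s * q (t - s) = 0) -> rconv q k t = 0.
Proof.
move=> h; transitivity (\int[mu]_(s in `[0, t]) (0 : R)); last first.
  by rewrite Rintegral_cst ?mul0r//; exact: measurable_itv.
by apply: eq_Rintegral => s; rewrite in_set_itv in_itv; exact: h.
Qed.

(** Functions vanishing before a positive time are as smooth on the line as on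
    the half-line. *)
Lemma deriv_on_extend (V : normedModType R[i]) (f f' : R -> V) (a : R) : 0 < a ->
  (forall r, r <= a -> f r = 0) -> (forall r, r <= a -> f' r = 0) ->
  deriv_on (@half_line R) f f' -> deriv_on setT f f'.
Proof.
move=> a0 f0 f'0 df t _ e e0; have [ta|at_] := ltP t a.
  exists (a - t); first by rewrite subr_gt0.
  move=> s _ st; have sa : s <= a.
    by rewrite -(lerD2r (- t)) ltW// (le_lt_trans (ler_norm _)).
  by rewrite (f0 _ sa) (f0 _ (ltW ta)) (f'0 _ (ltW ta)) scaler0 !subr0 rnorm0 mulr_ge0// ltW.
have t0 : half_line t by rewrite /half_line /= (le_trans _ at_)// ltW.
have [d d0 hd] := df t t0 e e0; exists (Num.min d a); first by rewrite lt_min d0.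
move=> s _; rewrite lt_min => /andP[sd sa]; apply: hd => //.
have := ler_norm (- (s - t)); rewrite normrN /half_line /= => h.
by move: (le_lt_trans h sa) at_; clear; lra.
Qed.

Section Step.
Variables (d : R) (sg : nat -> R -> R) (k : R -> R) (K T : R).
Hypotheses (stp : smooth_step d sg) (bk : loc_bounded k) (K0 : 0 <= K) (d0 : 0 < d).
Hypotheses (kK : forall s, `|k s| <= K) (kT : forall s, T < s -> k s = 0).

Lemma step_cont m : cont_on setT (rc (sg m)).
Proof. by case: stp => ds _ _ _ _; exact: deriv_on_cont (ds m). Qed.

Lemma step_neg m r : r <= 0 -> sg m r = 0.
Proof.
by case: stp => _ _ _ [a a0 ha] _ r0; rewrite ha// (le_trans r0)// ltW.
Qed.

Lemma rconv_step_early : exists2 a, 0 < a & forall m r, r <= a -> rconv (sg m) k r = 0.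
Proof.
case: stp => _ _ _ [a a0 ha] _; exists a => // m r ra.
apply: rconv_eq0 => s /andP[s0 sr]; rewrite ha ?mulr0//.
by rewrite lerBlDr (le_trans ra)// lerDl.
Qed.

Lemma rconv_step_deriv m : deriv_on setT (rc (rconv (sg m) k)) (rc (rconv (sg m.+1) k)).
Proof.
have [a a0 ha] := rconv_step_early.
apply: (deriv_on_extend a0) => [r ra|r ra|]; rewrite ?ha//.
case: stp => ds _ _ _ _; have sub := @subsetT _ (@half_line R).
have h := @vconv_deriv _ _ _ _ k (deriv_onW sub (ds m)) (cont_onW sub (step_cont m.+1)) _ bk.
have {h} : deriv_on (@half_line R) (vconv (rc (sg m)) k) (vconv (rc (sg m.+1)) k).
  by apply: h; rewrite step_neg.
by congr deriv_on; apply/funext => t; rewrite rconv_line//; exact: step_cont.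
Qed.

Lemma rconv_step_cont m : cont_on setT (rc (rconv (sg m) k)).
Proof. exact: deriv_on_cont (rconv_step_deriv m). Qed.

Lemma rconv_step_bounded m : loc_bounded (rconv (sg m) k).
Proof. exact: cont_loc_bounded (rconv_step_cont m). Qed.

Lemma rconv_step0 m : rconv (sg m) k 0 = 0.
Proof. by have [a /ltW a0 ->] := rconv_step_early. Qed.

Lemma rconv_step_late m r : T + d < r -> rconv (sg m.+1) k r = 0.
Proof.
move=> Tr; apply: rconv_eq0 => s /andP[s0 sr]; have [Ts|sT] := ltP T s.
  by rewrite kT// mul0r.
have dsr : d <= r - s by rewrite lerBrDr (le_trans _ (ltW Tr))// addrC lerD2r.
by case: stp => _ _ _ _ /(_ _ dsr)[_ ->]; rewrite mulr0.
Qed.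

(** The mollifier is nonnegative with integral at most one, so mollifying does
    not enlarge the input. *)
Lemma rconv_step_le r : `|rconv (sg 1) k r| <= K.
Proof.
have [r0|r0] := ltP r 0; first by rewrite rconv_lt0// normr0.
have mI := measurable_itv `[0, r]; have fin := segment_lty 0 r.
have sub := @subsetT _ (@half_line R).
case: (stp) => ds s01 s10 _ _; have c1 := step_cont 1.
have h1 := vconvP r (cont_onW sub c1) bk; rewrite -rconv_line// in h1.
have h2 : Bint `[0, r]%classic (rc (fun s => K * sg 1 (r - s))) (K * sg 0 r)%:C.
  have dr := @deriv_on_reverse _ _ _ _ r (deriv_onW sub (ds 0)).
  have cr : cont_on `[0, r]%classic (fun s => - rc (sg 1) (r - s)).
    apply: rlinear_cont_on (@opp_rlinear _ _) (@opp_rbounded _ _) _.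
    exact: cont_on_reverse (cont_onW sub c1).
  have := BintZ (- K) mI fin (Bint_FTC r0 dr cr).
  rewrite subrr subr0 (step_neg 0 (lexx 0)) sub0r => h.
  have -> : (K * sg 0 r)%:C = (- K)%:C *: (- (sg 0 r)%:C) :> cline R.
    by rewrite scalerN -scaleNr -rmorphN opprK rmorphM.
  by apply: Bint_ext h => s _; rewrite scalerN -scaleNr -rmorphN opprK rmorphM.
rewrite -rnorm_line; apply: le_trans (_ : K * sg 0 r <= K); last first.
  by rewrite ler_piMr//; case/andP: (s01 r).
apply: (Bint_dominated mI fin _ h1 h2).
  apply: measurable_funTS; apply: measurable_funM => //.
  apply: measurableT_comp; first exact: (cont_loc_bounded c1).1.
  exact: measurable_funB.
move=> s _; rewrite rnormZr rnorm_line (ger0_norm (s10 _)) ler_wpM2r//.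
Qed.

(** The step and the constant one differ only during the first [d] units of
    time. *)
Lemma rconv_step_close r : 0 <= r -> `|rconv (sg 0) k r - rprim k r| <= K * d.
Proof.
move=> r0; case: (stp) => ds s01 s10 _ late; have c0 := step_cont 0.
have mI := measurable_itv `[0, r]; have fin := segment_lty 0 r.
have sub := @subsetT _ (@half_line R).
have h1 := vconvP r (cont_onW sub c0) bk; rewrite -rconv_line// in h1.
have h2 := @rprimP _ (cline R) k r 1 bk; rewrite line_scale1 in h2.
have h := BintB mI fin h1 h2; rewrite -rmorphB in h; rewrite -rnorm_line.
pose w s : cline R := if s <= r then (sg 0 (r - s) - 1)%:C else 0.
have {}h : Bint `[0, r]%classic (fun s => (k s)%:C *: w s) (rconv (sg 0) k r - rprim k r)%:C.
  apply: Bint_ext h => s; rewrite /= in_itv /= /w => /andP[_ ->].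
  by rewrite -scalerBr rmorphB.
have w1 s : rnorm (w s) <= 1.
  rewrite /w; case: ifP => _; last by rewrite rnorm0.
  rewrite rnorm_line; case/andP: (s01 (r - s)) => h0 h1'.
  by rewrite ler0_norm ?subr_le0// opprB lerBlDr lerDl.
have [rd|dr] := leP r d.
  apply: le_trans (Bint_le_cst mI fin (M := K) h _) _.
    by move=> s _; rewrite rnormZr -[leRHS]mulr1 ler_pM ?rnorm_ge0.
  by rewrite fine_segment// ler_wpM2l.
have lo0 : 0 <= r - d by rewrite subr_ge0 ltW.
have lohi : r - d <= r by rewrite lerBlDr lerDl ltW.
have := Bint_scaled_le_step (T := r) lo0 lohi (lexx r) K0 (lexx 0) ler01 (fun s _ => kK s) h _ _ _.
rewrite mulr0 mul0r add0r mulr1 subKr; apply.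
- move=> s _ srd; rewrite /w (le_trans srd lohi) rnorm_line (late (r - s) _).1 ?subrr ?normr0//.
  by rewrite lerBrDr -lerBrDl.
- by move=> s _ _; exact: w1.
- by move=> s rs; rewrite /w leNgt rs.
Qed.

End Step.
End Smoothing.

(** * A smooth step *)

Section SmoothStep.
Context (R : realType).
Notation mu := (@lebesgue_measure R).
Notation rc k := (fun t : R => (k t)%:C : cline R).
Import GRing.

Let q (x : R) : R := x * (1 - x).

(** All derivatives of [exp (- 1 / (x (1 - x)))] on the unit interval have this
    form. *)
Definition bump_fun (N : {poly R}) (j : nat) (x : R) : R :=
  if 0 < x < 1 then N.[x] * ((q x)^-1 ^+ j * expR (- (q x)^-1)) else 0.

Definition bump_step (N : {poly R}) (j : nat) : {poly R} :=
  N^`() * ('X * (1 - 'X)) ^+ 2 + N * (1 - 'X *+ 2) * (1 - (j%:R)%:P * ('X * (1 - 'X))).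

Let q_gt0 x : 0 < x < 1 -> 0 < q x.
Proof. by move=> /andP[x0 x1]; rewrite mulr_gt0// subr_gt0. Qed.

Lemma expR_inv_le (y : R) n : 0 <= y -> y ^+ n * expR (- y) <= n%:R ^+ n.
Proof.
move=> y0; rewrite expRN ler_pdivrMr ?expR_gt0//.
case: n => [|n]; first by rewrite !expr0 mul1r -expR0 ler_expR.
have n0 : 0 < n.+1%:R :> R by [].
have -> : expR y = expR (y / n.+1%:R) ^+ n.+1 by rewrite -expRM_natl mulrC divfK// gt_eqF.
rewrite -exprMn lerXn2r ?nnegrE ?mulr_ge0 ?expR_ge0//.
rewrite mulrC -ler_pdivrMr// (le_trans _ (expR_ge1Dx _))// lerDr//.
Qed.

(** The exponential beats every power of [1 / (x (1 - x))]; the two spare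
    powers make the function differentiable at the ends of the unit interval,
    with derivative zero. *)
Lemma bump_fun_small N j : exists2 C, 0 < C & forall x, 0 < x < 1 ->
  `|bump_fun N j x| <= C * q x ^+ 2.
Proof.
exists (\sum_(i < size N) `|N`_i| * (j.+2%:R ^+ j.+2) + 1).
  by rewrite ltr_pwDr// sumr_ge0// => i _; rewrite mulr_ge0 ?exprn_ge0.
move=> x x01; rewrite /bump_fun x01; have q0 := q_gt0 x01.
have y0 : 0 <= (q x)^-1 by rewrite invr_ge0 ltW.
rewrite -ler_pdivrMr ?exprn_gt0// !normrM.
rewrite (ger0_norm (exprn_ge0 _ y0)) (ger0_norm (expR_ge0 _)) -exprVn.
have reorder (a E Y : R) : a * (Y ^+ j * E) * Y ^+ 2 = a * (Y ^+ j.+2 * E).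
  by rewrite -[j.+2]addn2 exprD; ring.
rewrite reorder.
apply: (@le_trans _ _ ((\sum_(i < size N) `|N`_i|) * (j.+2%:R ^+ j.+2))).
  apply: ler_pM => //; first by rewrite mulr_ge0 ?expR_ge0 ?exprn_ge0.
    rewrite horner_coef (le_trans (ler_norm_sum _ _ _))// ler_sum// => i _.
    rewrite normrM ler_piMr// normrX exprn_ile1//.
    by case/andP: x01 => x0 x1; rewrite gtr0_norm ?ltW.
  exact: expR_inv_le.
by rewrite mulr_suml lerDl.
Qed.

Lemma is_derive_eps (f : R -> R) (x df e : R) : is_derive x 1 f df -> 0 < e ->
  exists2 d : R, 0 < d & forall s, `|s - x| < d ->
    `|f s - f x - (s - x) * df| <= e * `|s - x|.
Proof.
move=> [dx <-] e0.
have /cvgrPdist_le/(_ e e0) : h^-1 *: ((f \o shift x) (h *: 1) - f x) @[h --> 0^'] --> 'D_1 f x.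
  exact: dx.
rewrite /dnbhs near_withinE => /nbhs_ballP[d /= d0 hd].
exists d => // s sx; have [->|sx0] := eqVneq s x.
  by rewrite !subrr mul0r subr0 normr0 mulr0.
have h0 : s - x != 0 by rewrite subr_eq0.
have := hd (s - x); rewrite -ball_normE /ball_ /= sub0r normrN => /(_ sx h0).
rewrite /scale /= mulr1 subrK -ler_pdivrMr ?normr_gt0// -normfV -normrM.
by rewrite distrC mulrBl mulrAC divff// mul1r [_ * (_ - _)]mulrC.
Qed.

Lemma bump_fun_derive (N : {poly R}) j (x : R) : 0 < x < 1 ->
  is_derive x 1 (fun x : R => N.[x] * ((q x)^-1 ^+ j * expR (- (q x)^-1)))
    (bump_fun (bump_step N j) j.+2 x).
Proof.
move=> x01; have q0 := q_gt0 x01; have qn0 : q x != 0 by rewrite gt_eqF.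
have dq : is_derive x 1 q (1 - x *+ 2).
  have -> : q = (id : R -> R) * (cst 1 - id) by [].
  by apply: is_derive_eq; rewrite !fctE /scale /=; ring.
pose y z := (q z)^-1.
have dy : is_derive x 1 y (- (1 - x *+ 2) * (q x)^-1 ^+ 2).
  by apply: is_derive_eq (is_deriveV qn0 dq) _; rewrite /scale /= exprVn; ring.
have dE : is_derive x 1 (expR \o - y) (expR (- y x) * ((1 - x *+ 2) * (q x)^-1 ^+ 2)).
  apply: is_derive1_comp; rewrite (_ : _ * _ = - (- (1 - x *+ 2) * (q x)^-1 ^+ 2)); last by ring.
  exact: is_deriveN.
have -> : (fun z => N.[z] * ((q z)^-1 ^+ j * expR (- (q z)^-1))) =
    horner N * (y ^+ j * (expR \o - y)).
  by apply/funext => z; rewrite /= !fctE.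
apply: is_derive_eq (is_deriveM (is_derive_poly N x) (is_deriveM (is_deriveX j dy) dE)) _.
have yq : y x * q x = 1 by rewrite /y mulVf.
have bs : (bump_step N j).[x] =
    N^`().[x] * q x ^+ 2 + N.[x] * (1 - x *+ 2) * (1 - j%:R * q x).
  by rewrite /bump_step !hornerE /q; ring.
have pred_pow : j%:R * y x ^+ j.-1 = j%:R * (y x ^+ j * q x).
  by case: (j) => [|m]; rewrite ?mul0r// succnK exprSr -mulrA yq mulr1.
rewrite !fctE /scale /= pred_pow /bump_fun x01 bs -/(y x) -[j.+2]addn2 exprD.
set Y := y x ^+ j; set E := expR _; set d := 1 - x *+ 2.
rewrite -/(y x); move: yq; set z := y x; set w := q x => yq.
have -> : Y * E * N^`().[x] = Y * E * N^`().[x] * (z * w) ^+ 2.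
  by rewrite yq expr1n mulr1.
ring.
Qed.

Lemma bump_fun_deriv_on N j :
  deriv_on setT (rc (bump_fun N j)) (rc (bump_fun (bump_step N j) j.+2)).
Proof.
move=> x _ e e0; have [x01|x01] := boolP (0 < x < 1).
  have [d d0 hd] := is_derive_eps (bump_fun_derive N j x01) e0.
  exists (Num.min d (Num.min x (1 - x))).
    by case/andP: x01 => x0 x1; rewrite !lt_min d0 x0 subr_gt0.
  move=> s _; rewrite !lt_min => /andP[sd /andP[sx s1x]].
  rewrite rc_lin; have s01 : 0 < s < 1.
    have h1 := ler_norm (s - x); have h2 := ler_norm (x - s); rewrite distrC in h2.
    by apply/andP; split; lra.
  by have := hd s sd; rewrite /bump_fun x01 s01.
have [C C0 hC] := bump_fun_small N j.
exists (e / C); first by rewrite divr_gt0.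
move=> s _ sx; rewrite rc_lin.
rewrite {2 3}/bump_fun (negPf x01) mulr0 !subr0.
have [s01|s01] := boolP (0 < s < 1); last by rewrite /bump_fun (negPf s01) normr0 mulr_ge0// ltW.
have qs : q s <= `|s - x|.
  have h1 := ler_norm (s - x); have h2 := ler_norm (x - s); rewrite distrC in h2.
  have /andP[s0 s1] := s01; rewrite /q.
  by move: x01; rewrite negb_and -!leNgt => /orP[x0|x1]; nra.
apply: le_trans (hC s s01) _; have q0 := q_gt0 s01.
rewrite expr2 mulrA ler_pM ?(ltW q0) ?(mulr_ge0 (ltW C0) (ltW q0))//.
by rewrite mulrC -ler_pdivlMr// (le_trans qs)// ltW.
Qed.

Lemma bump_fun_out N j x : ~~ (0 < x < 1) -> bump_fun N j x = 0.
Proof. by rewrite /bump_fun => /negPf ->. Qed.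

Fixpoint bump_poly (m : nat) : {poly R} :=
  if m is n.+1 then bump_step (bump_poly n) n.*2 else 1.

Let bump m := bump_fun (bump_poly m) m.*2.

Let bump0_gt0 x : 0 < x < 1 -> 0 < bump 0 x.
Proof. by move=> x01; rewrite /bump /bump_fun x01 hornerC expr0 !mul1r expR_gt0. Qed.

Lemma deriv_on_affine (f f' : R -> R) (a : R) : 0 < a ->
  deriv_on setT (rc f) (rc f') ->
  deriv_on setT (rc (fun r => f ((r - a) / a))) (rc (fun r => f' ((r - a) / a) / a)).
Proof.
move=> a0 df t _ e e0; have [d d0 hd] := df ((t - a) / a) Logic.I _ (mulr_gt0 e0 a0).
exists (d * a); first by rewrite mulr_gt0.
move=> s _ st; have E : (s - a) / a - (t - a) / a = (s - t) / a by field; rewrite gt_eqF.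
have := hd ((s - a) / a) Logic.I; rewrite (rc_lin f f') (rc_lin (fun r => f ((r - a) / a)) (fun r => f' ((r - a) / a) / a)).
rewrite E normrM normfV (gtr0_norm a0).
rewrite ltr_pdivrMr// => /(_ st).
have -> : e * a * (`|s - t| / a) = e * `|s - t| by field; rewrite gt_eqF.
by congr (`|_| <= _); field; rewrite gt_eqF.
Qed.

Lemma deriv_on_cstM (f f' : R -> R) (c : R) :
  deriv_on setT (rc f) (rc f') ->
  deriv_on setT (rc (fun r => c * f r)) (rc (fun r => c * f' r)).
Proof.
move=> df t _ e e0; have c0 : 0 < `|c| + 1 by rewrite ltr_pwDr.
have [d d0 hd] := df t Logic.I _ (divr_gt0 e0 c0); exists d => // s _ st.
have := hd s Logic.I st.
rewrite (rc_lin f f') (rc_lin (fun r => c * f r) (fun r => c * f' r)).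
have -> : c * f s - c * f t - (s - t) * (c * f' t) = c * (f s - f t - (s - t) * f' t) by ring.
rewrite normrM => h; apply: (@le_trans _ _ ((`|c| + 1) * (e / (`|c| + 1) * `|s - t|))).
  by rewrite ler_pM// lerDl.
by rewrite le_eqVlt; apply/predU1P; left; field; rewrite gt_eqF.
Qed.

Lemma loc_bounded_integrable (k : R -> R) (t : R) : loc_bounded k ->
  mu.-integrable `[0, t]%classic (EFin \o k).
Proof.
move=> bk; have [K K0 hK] := loc_bounded_gt0 t bk.
apply: measurable_bounded_integrable => //.
- exact: segment_lty.
- exact: measurable_funTS bk.1.
- exists K; split; first exact: num_real.
  move=> x Kx y; rewrite /= in_itv /= => /hK h; exact: le_trans h (ltW Kx).
Qed.

Lemma rprim_increment (k : R -> R) (s t : R) : loc_bounded k -> 0 <= s -> s <= t ->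
  rprim k t - rprim k s = \int[mu]_(r in `]s, t]) k r.
Proof.
move=> bk s0 st.
by rewrite (Rintegral_itvB (loc_bounded_integrable t bk)) ?bnd_simp.
Qed.

Lemma rprim_mono (k : R -> R) (s t : R) : loc_bounded k -> (forall r, 0 <= k r) ->
  0 <= s -> s <= t -> rprim k s <= rprim k t.
Proof.
move=> bk k0 s0 st; rewrite -subr_ge0 rprim_increment//.
by apply: Rintegral_ge0 => x _.
Qed.

Lemma rprim_deriv (k : R -> R) : cont_on setT (rc k) ->
  deriv_on (@half_line R) (rc (rprim k)) (rc k).
Proof.
move=> kc; have bk := cont_loc_bounded kc.
apply: deriv_on_segments => T; apply: Bint_primitive => [|t _].
  by apply: cont_onW kc; exact: subsetT.
have := @rprimP _ (cline R) k t 1 bk; rewrite line_scale1.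
by apply: Bint_ext => s _; exact: line_scale1.
Qed.

(** The normalised primitive of a bump. *)
Lemma smooth_step_exists (d : R) : 0 < d -> exists sg, smooth_step d sg.
Proof.
move=> d0; pose a := d / 2; have a0 : 0 < a by rewrite divr_gt0.
have ad : a + a = d by rewrite /a; field.
pose beta m r := a^-1 ^+ m * bump m ((r - a) / a).
have out m r : (r <= a) || (d <= r) -> beta m r = 0.
  move=> h; rewrite /beta /bump bump_fun_out ?mulr0//.
  rewrite negb_and -!leNgt; case/orP: h => h.
    by rewrite ler_pdivrMr// mul0r subr_le0 h.
  by rewrite ler_pdivlMr// mul1r lerBrDr ad h orbT.
have dbeta m : deriv_on setT (rc (beta m)) (rc (beta m.+1)).
  have := deriv_on_cstM (a^-1 ^+ m) (deriv_on_affine a0 (bump_fun_deriv_on (bump_poly m) m.*2)).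
  apply: deriv_on_ext => // r _; rewrite /beta /bump doubleS exprSr; congr (_%:C); ring.
have b0 := cont_loc_bounded (deriv_on_cont (dbeta 0%N)).
have bge0 r : 0 <= beta 0%N r.
  rewrite /beta expr0 mul1r; have [x01|x01] := boolP (0 < (r - a) / a < 1).
    exact/ltW/bump0_gt0.
  by rewrite /bump bump_fun_out.
pose c0 := rprim (beta 0%N) d.
have early r : r <= a -> rprim (beta 0%N) r = 0.
  move=> ra; have [r0|r0] := ltP r 0; first exact: rprim_lt0.
  rewrite /rprim; transitivity (\int[mu]_(s in `[0, r]) (0 : R)); last first.
    by rewrite Rintegral_cst ?mul0r//; exact: measurable_itv.
  apply: eq_Rintegral => s; rewrite in_set_itv in_itv => /andP[_ sr].
  by rewrite out// (le_trans sr ra).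
have dP : deriv_on setT (rc (rprim (beta 0%N))) (rc (beta 0%N)).
  apply: (deriv_on_extend a0) => [r ra|r ra|]; rewrite ?early// ?out ?ra//.
  exact: rprim_deriv (deriv_on_cont (dbeta 0%N)).
have c0_gt0 : 0 < c0.
  pose t := a + a / 2.
  have ta : (t - a) / a = 2^-1 by rewrite /t; field; rewrite gt_eqF.
  have bt : 0 < beta 0%N t.
    rewrite /beta expr0 mul1r bump0_gt0// ta; lra.
  have [e e0 he] := dP t Logic.I _ (divr_gt0 bt (ltr0n _ 2)).
  pose h := Num.min (e / 2) (a / 2); have h0 : 0 < h by rewrite lt_min !divr_gt0.
  have := he (t + h) Logic.I; rewrite rc_lin [t + h]addrC addrK gtr0_norm//.
  have he2 : h < e.
    rewrite (le_lt_trans (_ : h <= e / 2)) ?ge_min ?lexx// ltr_pdivrMr//.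
    by rewrite ltr_pMr// ltr1n.
  move=> /(_ he2); rewrite ler_norml => /andP[lo _].
  have t0 : 0 <= t by rewrite /t addr_ge0 ?divr_ge0// ltW.
  have Pt : 0 <= rprim (beta 0%N) t by rewrite -(rprim0 b0) rprim_mono.
  have hd : h + t <= d.
    rewrite -ad /t; have : h <= a / 2 by rewrite ge_min lexx orbT.
    by lra.
  have := rprim_mono b0 bge0 (addr_ge0 (ltW h0) t0) hd; rewrite -/c0.
  have hb : 0 < h * beta 0%N t by rewrite mulr_gt0.
  by move: lo hb; lra.
have late r : d <= r -> rprim (beta 0%N) r = c0.
  move=> dr; apply/eqP; rewrite -subr_eq0 rprim_increment// ?(ltW d0)//.
  apply/eqP; transitivity (\int[mu]_(s in `]d, r]) (0 : R)); last first.
    by rewrite Rintegral_cst ?mul0r//; exact: measurable_itv.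
  apply: eq_Rintegral => s; rewrite in_set_itv in_itv => /andP[ds _].
  by rewrite out// (ltW ds) orbT.
exists (fun m r => c0^-1 * (if m is n.+1 then beta n r else rprim (beta 0%N) r)).
split.
- by case=> [|m]; apply: deriv_on_cstM; [exact: dP|exact: dbeta].
- move=> r; have [r0|r0] := ltP r 0; first by rewrite rprim_lt0// mulr0 lexx ler01.
  have -> : 0 <= c0^-1 * rprim (beta 0%N) r.
    rewrite mulr_ge0 ?invr_ge0 ?(ltW c0_gt0)//.
    by rewrite -(rprim0 b0) rprim_mono.
  rewrite mulrC ler_pdivrMr// mul1r.
  have [dr|/ltW rd] := leP d r; first by rewrite late// lexx.
  by rewrite /c0 rprim_mono.
- by move=> r; rewrite mulr_ge0// invr_ge0 ltW.
- exists a => // -[|m] r ra; first by rewrite early// mulr0.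
  by rewrite out ?ra// mulr0.
- move=> r dr; rewrite late// mulVf ?gt_eqF//; split=> // m.
  by rewrite out ?dr ?orbT// mulr0.
Qed.

End SmoothStep.

(** * Kernels that are bounded on smooth inputs *)

Section Kernel.
Context (R : realType) (V : completeNormedModType R[i]).
Notation mu := (@lebesgue_measure R).
Notation rc k := (fun t : R => (k t)%:C : cline R).
Implicit Types (H f p : R -> V) (k : R -> R).

(** The input [phi 0] enters through its second derivative because the kernels
    below are responses to ramps. *)
Definition smooth_bound H (c : R) := forall (phi : nat -> R -> R) (K : R),
  (forall m, deriv_on setT (rc (phi m)) (rc (phi m.+1))) ->
  (exists a b : R, 0 < a /\ forall r, (r < a) || (b < r) -> phi 0%N r = 0) ->
  (forall r, `|phi 0%N r| <= K) ->
  forall t, 0 <= t -> rnorm (vconv H (phi 2%N) t) <= c * K.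

(** A segment of positive length contains increments at each of its points,
    which determine the one-sided derivatives. *)
Lemma deriv_on_val_unique f f1 f2 (T : R) : 0 < T ->
  deriv_on `[0, T]%classic f f1 -> deriv_on `[0, T]%classic f f2 ->
  forall t, 0 <= t <= T -> f1 t = f2 t.
Proof.
move=> T0 d1 d2 t tT; apply: rnorm_eq_le => e e0.
have tT' : `[0, T]%classic t by rewrite /= in_itv.
have e2 : 0 < e / 2 by rewrite divr_gt0.
have [x1 x10 h1] := d1 t tT' _ e2; have [x2 x20 h2] := d2 t tT' _ e2.
pose x := Num.min (Num.min x1 x2) (T / 2).
have x0 : 0 < x by rewrite !lt_min x10 x20 divr_gt0.
have [xx1 xx2 xT] : [/\ x <= x1, x <= x2 & x <= T / 2].
  by rewrite !ge_min !lexx !orbT.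
pose s := if t <= T / 2 then t + x / 2 else t - x / 2.
have sx : `|s - t| = x / 2.
  rewrite /s; case: ifP => _; first by rewrite addrC addKr gtr0_norm// divr_gt0.
  by rewrite addrC addKr normrN gtr0_norm// divr_gt0.
have sT : `[0, T]%classic s.
  rewrite /= in_itv /= /s; case/andP: tT => t0 tT; case: (leP t (T / 2)) => tt; apply/andP; split; lra.
have sx1 : `|s - t| < x1 by rewrite sx; lra.
have sx2 : `|s - t| < x2 by rewrite sx; lra.
have st0 : 0 < `|s - t| by rewrite sx divr_gt0.
rewrite -(ler_pM2l st0) -rnormZr scalerBr.
have -> : (s - t)%:C *: f1 t - (s - t)%:C *: f2 t =
   (f s - f t - (s - t)%:C *: f2 t) - (f s - f t - (s - t)%:C *: f1 t).
  by rewrite subrACA subrr sub0r opprB.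
rewrite (le_trans (ler_rnormB _ _))// mulrC (splitr e) mulrDl lerD//; [exact: h2|exact: h1].
Qed.

Lemma deriv_on_lipschitz f f' (T M s t : R) : 0 <= M ->
  deriv_on `[0, T]%classic f f' -> cont_on `[0, T]%classic f' ->
  (forall r, 0 <= r <= T -> rnorm (f' r) <= M) ->
  0 <= s <= T -> 0 <= t <= T -> rnorm (f s - f t) <= M * `|s - t|.
Proof.
move=> M0 df fc hM; wlog ts : s t / t <= s.
  move=> h sT tT; have [ts|/ltW st] := leP t s; first exact: h.
  by rewrite rnorm_distC distrC h.
move=> /andP[s0 sT] /andP[t0 tT]; rewrite [X in _ * X]ger0_norm ?subr_ge0//.
have := deriv_on_increment (c := 0) t0 ts sT M0 df fc.
rewrite scaler0 subr0; apply => r /andP[/ltW tr rs]; rewrite subr0 hM//.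
by rewrite (le_trans t0)//= (le_trans rs).
Qed.

(** By parts, convolution with the primitive of the input is convolution with
    the primitive of the kernel, which is differentiable. *)
Lemma vconv_rprim H k : cont_on (@half_line R) H -> loc_bounded k ->
  deriv_on (@half_line R) (vconv H (rprim k)) (vconv H k).
Proof.
move=> Hc bk; have dH := primitive_deriv Hc.
have h := vconv_deriv dH Hc (primitive0 Hc) bk.
apply: deriv_on_ext h => [t t0|t _ //]; rewrite /half_line /= in t0.
have bD := rprim_loc_bounded bk; have Pc := deriv_on_cont dH.
have mI := measurable_itv `[0, t]; have fin := segment_lty 0 t.
have h1 := vconvP t Pc bk; have h2 := BintN mI fin (vconvP t Hc bD).
have cr : cont_on `[0, t]%classic (fun s => - H (t - s)).
  exact: rlinear_cont_on (@opp_rlinear _ _) (@opp_rbounded _ _) (cont_on_reverse Hc).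
have := Bint_by_parts t0 bk (@deriv_on_reverse _ _ _ _ t dH) cr h1 _.
move=> /(_ (- vconv H (rprim k) t)); rewrite subrr primitive0// scaler0.
move=> /(_ _)/eqP; rewrite subr_eq0 => hh; apply/eqP; apply: hh.
by apply: Bint_ext h2 => s _; rewrite scalerN.
Qed.

Section Bounded.
Variables (H : R -> V) (c : R).
Hypotheses (Hc : cont_on (@half_line R) H) (c0 : 0 <= c) (Hb : smooth_bound H c).

(** Mollified inputs are smooth and not larger than the input, so the second
    derivatives of their responses are bounded; the responses converge, and so
    do their derivatives, which are equi-Lipschitz. *)
Lemma bounded_kernel_global k (K T : R) : loc_bounded k -> 0 <= K ->
  (forall s, `|k s| <= K) -> (forall s, T < s -> k s = 0) ->
  exists p, [/\ deriv_on (@half_line R) (vconv H k) p, p 0 = 0 &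
    lipschitz_by p (fun=> c * K)].
Proof.
move=> bk K0 kK kT.
have d0 n : 0 < n.+1%:R^-1 :> R by rewrite invr_gt0.
have [sg hsg] := choice (fun n => smooth_step_exists (d0 n)).
pose Phi n m := rconv (sg n m) k.
have sub := @subsetT _ (@half_line R).
have dPhi n m : deriv_on (@half_line R) (vconv H (Phi n m)) (vconv H (Phi n m.+1)).
  apply: vconv_deriv_input => //.
  - exact: deriv_onW sub (rconv_step_deriv (hsg n) bk m).
  - exact: cont_onW sub (rconv_step_cont (hsg n) bk m.+1).
  - exact: rconv_step0 (hsg n) m.
  - exact: rconv_step_bounded (hsg n) bk m.
  - exact: rconv_step_bounded (hsg n) bk m.+1.
have PhiC n m := deriv_on_cont (dPhi n m).
have Phi0 n m : vconv H (Phi n m) 0 = 0.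
  by apply: vconv0 => //; exact: rconv_step_bounded (hsg n) bk m.
have cK0 : 0 <= c * K by rewrite mulr_ge0.
have Q n t : 0 <= t -> rnorm (vconv H (Phi n 3) t) <= c * K.
  move=> t0; apply: (Hb (phi := fun m => Phi n m.+1)) => //.
  - by move=> m; exact: rconv_step_deriv (hsg n) bk m.+1.
  - have [a a0 ha] := rconv_step_early k (hsg n).
    exists a, (T + n.+1%:R^-1); split => // r /orP[/ltW ra|]; first exact: ha.
    exact: (rconv_step_late (hsg n) kT 0%N).
  - by move=> r; exact: rconv_step_le (hsg n) bk K0 kK r.
have lip2 n : lipschitz_by (vconv H (Phi n 2)) (fun=> c * K).
  move=> T' s t sT tT; have sb := @half_line_segment R T'.
  apply: (deriv_on_lipschitz cK0 (deriv_onW sb (dPhi n 2)) (cont_onW sb (PhiC n 3)) _ sT tT).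
  by move=> r /andP[r0 _]; exact: Q.
have lip1 n : lipschitz_by (vconv H (Phi n 1)) (fun T => c * K * `|T|).
  move=> T' s t sT tT; have sb := @half_line_segment R T'.
  have T'0 : 0 <= T' by case/andP: sT => /le_trans; apply.
  have M0 : 0 <= c * K * `|T'| by rewrite mulr_ge0.
  apply: (deriv_on_lipschitz M0 (deriv_onW sb (dPhi n 1)) (cont_onW sb (PhiC n 2)) _ sT tT).
  move=> r /andP[r0 rT]; rewrite -[vconv _ _ r]subr0 -(Phi0 n 2%N).
  have r0T : 0 <= r <= T' by rewrite r0.
  have ZT : 0 <= (0 : R) <= T' by rewrite lexx T'0.
  apply: le_trans (lip2 n T' r 0 r0T ZT) _.
  by rewrite subr0 ler_wpM2l// !ger0_norm.
have cv : unif_cvg (fun n => vconv H (Phi n 0)) (vconv H (rprim k)).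
  move=> T' e e0; have [M M0 hM] := cont_on_bounded T' Hc.
  pose A := K * M * `|T'| + 1; have A0 : 0 < A.
    by rewrite ltr_pwDr// !mulr_ge0// ltW.
  exists (Num.truncn (A / e)) => n t Nn /andP[t0 tT].
  have mI := measurable_itv `[0, t]; have fin := segment_lty 0 t.
  have h := BintB mI fin (vconvP t Hc (rconv_step_bounded (hsg n) bk 0))
    (vconvP t Hc (rprim_loc_bounded bk)).
  apply: le_trans (Bint_le_cst mI fin (M := K * n.+1%:R^-1 * M) h _) _.
    move=> s; rewrite /= in_itv /= => /andP[s0 st].
    rewrite -scalerBl -rmorphB rnormZr ler_pM ?rnorm_ge0//.
      exact: rconv_step_close (hsg n) bk K0 (d0 n) kK s s0.
    by rewrite hM// subr_ge0 st (le_trans _ tT)// lerBlDr lerDl.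
  rewrite fine_segment//; have An : A / e <= n.+1%:R.
    by rewrite (le_trans (ltW (truncnS_gt _)))// ler_nat.
  rewrite ler_pdivrMr// in An; rewrite mulrAC [K * _]mulrC -!mulrA.
  rewrite mulrC ler_pdivrMr// (le_trans _ (le_trans An _))//; last by rewrite mulrC.
  rewrite /A [t * M]mulrC mulrA ler_wpDr//.
  rewrite ler_wpM2l ?mulr_ge0 ?(ltW M0)//.
  by rewrite (le_trans tT)// ler_norm.
have [G1 [dG1 cvG1 _]] := derivative_limit (fun T => mulr_ge0 cK0 (normr_ge0 T))
  (fun n => dPhi n 0%N) lip1 cv.
have [p [dp cvp lp]] := derivative_limit (fun _ => cK0) (fun n => dPhi n 1%N) lip2 cvG1.
exists p; split => //.
- apply: deriv_on_ext dp => [t t0|t _ //]; rewrite /half_line /= in t0.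
  have T0 : 0 < t + 1 by rewrite ltr_pwDr.
  have sb := @half_line_segment R (t + 1).
  apply: (deriv_on_val_unique T0 (deriv_onW sb dG1) (deriv_onW sb (vconv_rprim Hc bk))).
  by rewrite t0 lerDl /=.
- apply: rnorm_eq_le => e e0; have [N hN] := cvp 0 e e0.
  by rewrite rnorm_distC -(Phi0 N 2%N) hN// lexx.
Qed.

Lemma vconv_ae k k' (t : R) : loc_bounded k' ->
  {ae mu, forall s, 0 <= s <= t -> k s = k' s} -> vconv H k t = vconv H k' t.
Proof.
move=> bk' kk; rewrite [LHS]/vconv.
apply: (Bint_bochner_integral (measurable_itv _) (segment_lty 0 t) (vconvP t Hc bk')).
by apply: ae_imp kk => s h; rewrite /= in_itv /= => /h ->.
Qed.

(** Causality: the response on [0, T] depends only on the input there, up to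
    null sets, so the input may be truncated in size and in time. *)
Lemma bounded_kernel_local k (K T : R) : loc_bounded k -> 0 <= K ->
  {ae mu, forall s, 0 <= s <= T -> `|k s| <= K} ->
  exists p, [/\ deriv_on `[0, T]%classic (vconv H k) p, p 0 = 0 &
    forall s t, 0 <= s <= T -> 0 <= t <= T -> rnorm (p s - p t) <= c * K * `|s - t|].
Proof.
move=> bk K0 kK.
pose k' s := \1_(`]-oo, T]%classic) s * Num.max (- K) (Num.min K (k s)).
have k'K s : `|k' s| <= K.
  rewrite /k' normrM indicE; case: (_ \in _); last by rewrite normr0 mul0r.
  rewrite normr1 mul1r ler_norml le_max lexx /= ge_max ge_min lexx andbT.
  by rewrite lerNl (le_trans _ K0)// oppr_le0.
have bk' : loc_bounded k'.
  split; last by move=> T'; exists K.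
  apply: measurable_funM; first exact: measurable_indic.
  by apply: measurable_maxr => //; apply: measurable_minr => //; exact: bk.1.
have k'T s : T < s -> k' s = 0.
  move=> Ts; rewrite /k' indicE (_ : (_ \in _) = false) ?mul0r//.
  by rewrite in_set_itv in_itv /= leNgt Ts.
have [p [dp p0 lp]] := bounded_kernel_global bk' K0 k'K k'T.
exists p; split=> //; last by move=> s t sT tT; exact: (lp T).
apply: deriv_on_ext (deriv_onW (@half_line_segment R T) dp) => [t|t _ //].
rewrite /= in_itv /= => /andP[t0 tT]; apply/esym/vconv_ae => //.
apply: ae_imp kK => s h /andP[s0 st]; have sT := le_trans st tT.
have := h; rewrite s0 sT => /(_ isT); rewrite ler_norml => /andP[lo hi].
rewrite /k' indicE (_ : (_ \in _) = true) ?mul1r; last by rewrite in_set_itv in_itv.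
by rewrite (min_idPr hi) (max_idPr lo).
Qed.

(** The derivatives found on the segments agree, since derivatives are unique. *)
Lemma bounded_kernel k : loc_bounded k ->
  exists p, [/\ deriv_on (@half_line R) (vconv H k) p, p 0 = 0 &
    forall T K s t, 0 < T -> 0 <= K -> {ae mu, forall s, 0 <= s <= T -> `|k s| <= K} ->
      0 <= s <= T -> 0 <= t <= T -> rnorm (p s - p t) <= c * K * `|s - t|].
Proof.
move=> bk.
have : forall t, exists v, 0 <= t -> forall e : R, 0 < e ->
    exists2 d : R, 0 < d & forall s, half_line s -> `|s - t| < d ->
    rnorm (vconv H k s - vconv H k t - (s - t)%:C *: v) <= e * `|s - t|.
  move=> t; have [t0|_] := boolP (0 <= t); last by exists 0.
  have [K K0 hK] := loc_bounded_gt0 (t + 1) bk.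
  have [p [dp _ _]] := bounded_kernel_local bk (ltW K0) (ae_all hK).
  exists (p t) => _ e e0; have tT : `[0, t + 1]%classic t by rewrite /= in_itv /= t0 lerDl /=.
  have [d d0 hd] := dp t tT e e0; exists (Num.min d 1); first by rewrite lt_min d0 ltr01.
  move=> s s0; rewrite lt_min => /andP[sd s1]; apply: hd => //.
  rewrite /= in_itv /=; apply/andP; split; first exact: s0.
  by rewrite -lerBlDl (le_trans (ler_norm _))// ltW.
move=> /choice[p hp].
have dp : deriv_on (@half_line R) (vconv H k) p by move=> t t0; exact: hp.
have pE T q : 0 < T -> deriv_on `[0, T]%classic (vconv H k) q ->
    forall t, 0 <= t <= T -> p t = q t.
  by move=> T0 dq; exact: deriv_on_val_unique T0 (deriv_onW (@half_line_segment R T) dp) dq.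
exists p; split => //.
  have [K K0 hK] := loc_bounded_gt0 1 bk.
  have [q [dq q0 _]] := bounded_kernel_local bk (ltW K0) (ae_all hK).
  by rewrite (pE 1 q ltr01 dq) ?lexx ?ler01.
move=> T K s t T0 K0 hK sT tT; have [q [dq _ lq]] := bounded_kernel_local bk K0 hK.
by rewrite !(pE T q T0 dq)// lq.
Qed.

End Bounded.
End Kernel.

(** * Densities of Lipschitz functions *)

Section Density.
Context (R : realType).
Notation mu := (@lebesgue_measure R).

Let clip (T x : R) : R := Num.max 0 (Num.min x T).

Let clip_in T x : 0 <= T -> 0 <= clip T x <= T.
Proof. by move=> T0; rewrite /clip le_max lexx /= ge_max T0 ge_min lexx orbT. Qed.

Let clip_id T x : 0 <= x <= T -> clip T x = x.
Proof. by move=> /andP[x0 xT]; rewrite /clip (min_idPl xT) (max_idPr x0). Qed.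

Let clip_lip T x y : x <= y -> `|clip T y - clip T x| <= y - x.
Proof.
move=> xy; rewrite ler_norml /clip.
case: (leP x T) => xT; case: (leP y T) => yT; case: (leP 0 x) => x0;
  case: (leP 0 y) => y0; case: (leP 0 T) => T0; by apply/andP; split; lra.
Qed.

(** Adding a multiple of the identity to a Lipschitz function makes it
    monotone; its Lebesgue-Stieltjes measure is then dominated by Lebesgue
    measure, and the Radon-Nikodym derivative is the density. *)
Lemma lipschitz_radon_nikodym (p : R -> R) (L T : R) : 0 <= L -> 0 < T ->
  (forall s t, 0 <= s <= T -> 0 <= t <= T -> `|p s - p t| <= L * `|s - t|) ->
  exists g, [/\ measurable_fun setT g, mu.-integrable `[0, T]%classic (EFin \o g) &
    forall t, 0 <= t <= T -> p t - p 0 = rprim g t].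
Proof.
move=> L0 T0 lp; have T0' := ltW T0.
pose F x := p (clip T x) + L * x.
have PL x y : x <= y -> `|p (clip T y) - p (clip T x)| <= L * (y - x).
  move=> xy; apply: le_trans (lp _ _ (clip_in _ T0') (clip_in _ T0')) _.
  by rewrite ler_wpM2l// clip_lip.
have Fle x y : x <= y -> 0 <= F y - F x <= (L + L) * (y - x).
  move=> xy; have := PL x y xy; rewrite ler_norml /F mulrBr mulrDl => /andP[h1 h2].
  by apply/andP; split; lra.
have Fnd : {homo F : x y / x <= y}.
  by move=> x y xy; rewrite -subr_ge0; case/andP: (Fle x y xy).
have L1 : 0 < L + L + 1 by rewrite ltr_pwDr// addr_ge0.
have Fc : right_continuous F.
  apply: right_continuousW => x; apply/cvgrPdist_le => e e0.
  apply/nbhs_ballP; exists (e / (L + L + 1)); first by rewrite /= divr_gt0.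
  move=> y; rewrite /ball_ /= ltr_pdivlMr// => /ltW; apply: le_trans.
  rewrite mulrC; have [xy|/ltW yx] := leP x y.
    rewrite distrC [`|x - y|]distrC.
    case/andP: (Fle x y xy) => h1 h2; rewrite ger0_norm// (le_trans h2)//.
    by rewrite [`|y - x|]ger0_norm ?subr_ge0// ler_wpM2r ?subr_ge0// lerDl.
  case/andP: (Fle y x yx) => h1 h2; rewrite ger0_norm// (le_trans h2)//.
  by rewrite ger0_norm ?subr_ge0// ler_wpM2r ?subr_ge0// lerDl.
pose mF : isCumulative R _ R F := isCumulative.Build R _ R F Fnd Fc.
pose cF : cumulative R R := HB.pack F mF.
pose nu : {measure set (measurableTypeR R) -> \bar R} := lebesgue_stieltjes_measure cF.
have wl (I : set (ocitv_type R)) : ocitv I ->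
    (wlength F I <= (L + L + 1)%:E * wlength idfun I)%E.
  move=> /ocitvP[->|[[a b] /= ab ->]]; first by rewrite !wlength0 mule0.
  rewrite !wlength_itv_bnd ?(ltW ab)// -EFinM lee_fin.
  case/andP: (Fle a b (ltW ab)) => _ /le_trans; apply.
  by rewrite ler_wpM2r ?subr_ge0 ?(ltW ab)// lerDl.
have nule A : (nu A <= (L + L + 1)%:E * mu A)%E.
  rewrite /nu /lebesgue_measure /lebesgue_stieltjes_measure /measure_extension /mu_ext.
  rewrite -ereal_inf_pZl//; apply: le_ereal_inf_tmp => _ [_ [B [mB AB] <-] <-].
  apply: (@le_trans _ _ (\big[+%E/0%E]_(0 <= k <oo) wlength F (B k))%E).
    by apply: ereal_inf_lbound; exists B.
  rewrite -nneseriesZl; last by move=> i _; exact: wlength_ge0.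
  apply: lee_nneseries => [i _ _|i _]; first exact: (wlength_ge0 cF).
  exact/wl/mB.
have mD : measurable (`[0, T]%classic : set (measurableTypeR R)) by exact: measurable_itv.
have nuD : (nu (`[0%R, T]%classic : set (measurableTypeR R)) < +oo)%E.
  apply: le_lt_trans (nule _) _; rewrite lte_mul_pinfty ?lee_fin ?(ltW L1)//.
  exact: segment_lty.
pose nuT : {finite_measure set (measurableTypeR R) -> \bar R} := mfrestr mD nuD.
have dom : nuT `<< mu.
  move=> A nA B mB BA; apply/eqP; rewrite eq_le measure_ge0 andbT.
  apply: le_trans (nule _) _; rewrite (nA (B `&` `[0, T]%classic)) ?mule0//.
    exact: measurableI.
  by move=> x [Bx _]; exact: BA.
have [g [g0 gfin gint gE]] := radon_nikodym_sigma_finite dom.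
have mg : measurable_fun setT (fine \o g).
  by apply: measurableT_comp => //; exact: measurable_int gint.
have gfine : EFin \o (fine \o g) = g by apply/funext => x /=; rewrite fineK.
have fint t : mu.-integrable `[0, t]%classic (EFin \o (fine \o g)).
  by rewrite gfine; exact: integrableS gint.
have cint t : mu.-integrable `[0, t]%classic (EFin \o (fun=> L : R)).
  by apply: loc_bounded_integrable; split => // T1; exists `|L|.
exists (fun x => fine (g x) - L); split.
- exact: measurable_funB.
- have := integrableB mD (fint T) (cint T); apply: eq_integrable => // x _.
move=> t /[dup] tT' /andP[t0 tT].
have int0 : mu.-integrable `]0, t]%classic (EFin \o (fine \o g)).
  by rewrite gfine; exact: integrableS gint.
rewrite /rprim RintegralB//.
rewrite (Rintegral_cst mu (measurable_itv `[0, t]) L) fine_segment//.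
rewrite -(Rintegral_itv_obnd_cbnd int0) /Rintegral.
have -> : (\int[mu]_(x in `]0%R, t]) ((fine \o g) x)%:E = (F t - F 0)%:E)%E.
  rewrite (eq_integral g); last by move=> x _; rewrite /= fineK.
  rewrite -gE; last exact: measurable_itv.
  transitivity (nu (`]0, t]%classic `&` `[0, T]%classic)); first by [].
  rewrite setIidl; last first.
    by move=> x; rewrite /= !in_itv /= => /andP[/ltW -> /le_trans]; apply.
  transitivity (wlength F `]0, t]%classic); last by rewrite wlength_itv_bnd.
  exact: (@measurable_mu_extE _ R _ (wlength cF) _ (is_ocitv 0 t)).
rewrite /= /F !clip_id ?lexx ?T0'//; ring.
Qed.

(** The density is the limit of difference quotients wherever it exists, so it
    inherits every local Lipschitz bound pointwise. *)
Lemma lipschitz_density (p : R -> R) : p 0 = 0 ->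
  (forall T, exists2 L, 0 <= L & forall s t, 0 <= s <= T -> 0 <= t <= T ->
     `|p s - p t| <= L * `|s - t|) ->
  exists f, [/\ loc_bounded f, forall t, 0 <= t -> p t = rprim f t &
    forall T L, (forall s t, 0 <= s <= T -> 0 <= t <= T -> `|p s - p t| <= L * `|s - t|) ->
      forall s, 0 <= s < T -> `|f s| <= L].
Proof.
move=> p0 lp.
pose q x := p (Num.max 0 x).
pose u (m : nat) (x : R) := m.+1%:R * (q (x + m.+1%:R^-1) - q x).
have lpT (n : nat) : exists g, [/\ measurable_fun setT g,
    mu.-integrable `[0, n.+1%:R]%classic (EFin \o g) &
    forall t, 0 <= t <= n.+1%:R -> p t - p 0 = rprim g t].
  have [L L0 hL] := lp n.+1%:R; exact: lipschitz_radon_nikodym L0 _ hL.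
have [g hg] := choice lpT.
have good n : {ae mu, forall x, 0 < x < n.+1%:R -> u ^~ x @ \oo --> g n x}.
  have [mg ig pg] := hg n; have mD := measurable_itv `[(0 : R), n.+1%:R].
  pose G := g n \_ `[0, n.+1%:R]%classic.
  have iG A : measurable A -> mu.-integrable A (EFin \o G).
    move=> mA; apply: (integrableS measurableT) => //.
    rewrite /G -restrict_EFin; exact: ((integrable_mkcond (EFin \o g n) mD).1 ig).
  have := FTC1 (a := BLeft 0) (fun y => iG _ (measurable_itv _))
    (integrable_locally mD ig).
  apply: ae_imp => x hx /andP[x0 xn]; have [dF FE] := hx x0; have {}x0 := ltW x0.
  have := derivableP dF; rewrite -derive1E FE => {}dF {FE}.
  have Gx : G x = g n x by rewrite /G patchE in_set_itv in_itv /= x0 (ltW xn).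
  have FE t : 0 <= t <= n.+1%:R -> \int[mu]_(y in `[0, t]) G y = p t.
    move=> /[dup] tn /andP[t0 tn'].
    have -> : p t = rprim (g n) t by rewrite -pg// p0 subr0.
    apply: eq_Rintegral => y; rewrite in_set_itv in_itv /= => /andP[y0 yt].
    by rewrite /G patchE in_set_itv in_itv /= y0 (le_trans yt tn').
  apply/cvgrPdist_le => e e0; have [d d0 hd] := is_derive_eps dF e0.
  have m0 : 0 < Num.min d (n.+1%:R - x) by rewrite lt_min d0 subr_gt0.
  exists (Num.truncn (Num.min d (n.+1%:R - x))^-1) => // m /= Nm.
  pose h : R := m.+1%:R^-1; have h0 : 0 < h by rewrite invr_gt0.
  have : h < Num.min d (n.+1%:R - x).
    rewrite -[ltRHS]invrK ltf_pV2 ?posrE ?invr_gt0//.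
    by rewrite (lt_le_trans (truncnS_gt _))// ler_nat.
  rewrite lt_min => /andP[hdd hn].
  have xh0 : 0 <= x + h by rewrite addr_ge0// ltW.
  have xhn : x + h <= n.+1%:R by rewrite addrC -lerBrDr ltW.
  have := hd (x + h); rewrite [x + h]addrC addrK gtr0_norm// => /(_ hdd).
  rewrite [h + x]addrC !FE ?x0 ?xh0 ?(ltW xn)// Gx => hh.
  rewrite /u /q (max_r x0) (max_r xh0) distrC -/h.
  have -> : m.+1%:R * (p (x + h) - p x) - g n x = h^-1 * (p (x + h) - p x - h * g n x).
    by rewrite /h invrK; field.
  by rewrite normrM (gtr0_norm (x := h^-1)) ?invr_gt0// ler_pdivrMl// [h * e]mulrC.
have [N [mN N0 hN]] := ae_foralln good.
have lim_g x n : ~ N x -> 0 < x < n.+1%:R -> u ^~ x @ \oo --> g n x.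
  by move=> Nx; have /contrapT := contra_not (@hN x) Nx; apply.
pose E := ~` N `&` `](0 : R), +oo[%classic.
have mE : measurable E by apply: measurableI; [exact: measurableC|exact: measurable_itv].
pose f x := if x \in E then g (Num.truncn x) x else 0.
have cvf x : (fun m => \1_E x * u m x) @ \oo --> f x.
  rewrite /f indicE; case: ifPn => [/set_mem[Nx]|_]; last first.
    by under eq_fun do rewrite mul0r; exact: cvg_cst.
  rewrite /= in_itv /= andbT => x0; under eq_fun do rewrite mul1r.
  by apply: lim_g => //; rewrite x0 truncnS_gt.
have qc : cont_on setT (fun x => (q x)%:C : cline R).
  move=> t _ e e0; have [L L0 hL] := lp (`|t| + 1).
  have L1 : 0 < L + 1 by rewrite ltr_pwDr.
  exists (Num.min 1 (e / (L + 1))); first by rewrite lt_min ltr01 divr_gt0.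
  move=> s _; rewrite lt_min ltr_pdivlMr// => /andP[s1 sK].
  rewrite -rmorphB rnorm_line; apply: le_trans (hL _ _ _ _) _.
  - rewrite le_max lexx /= ge_max addr_ge0//=.
    rewrite -(subrK t s) (le_trans (ler_norm _))// (le_trans (ler_normD _ _))//.
    by rewrite addrC lerD2l ltW.
  - by rewrite le_max lexx /= ge_max addr_ge0//= (le_trans (ler_norm _))// lerDl.
  have h3 : `|Num.max 0 s - Num.max 0 t| <= `|s - t|.
    have h1 := ler_norm (s - t); have h2 := ler_norm (t - s); rewrite distrC in h2.
    by have [s0|s0] := leP 0 s; have [t0|t0] := leP 0 t; rewrite ?ler_norml; apply/andP; split; lra.
  apply: le_trans (ltW sK); rewrite mulrC; apply: ler_pM => //; by rewrite lerDl.
have mq := (cont_loc_bounded qc).1.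
have mf : measurable_fun setT f.
  apply: measurable_fun_cvg (fun x _ => cvf x) => m.
  apply: measurable_funM; first exact: measurable_indic.
  apply: measurable_funM => //; apply: measurable_funB => //.
  by apply: measurableT_comp => //; exact: measurable_funD.
have fL T L : (forall s t, 0 <= s <= T -> 0 <= t <= T -> `|p s - p t| <= L * `|s - t|) ->
    forall s, 0 <= s < T -> `|f s| <= L.
  move=> hL s /andP[s0 sT]; have T0 := le_lt_trans s0 sT.
  have sub0 : 0 < T - s by rewrite subr_gt0.
  have uL m : (Num.truncn (T - s)^-1 <= m)%N -> `|u m s| <= L.
    move=> Nm; pose h : R := m.+1%:R^-1; have h0 : 0 < h by rewrite invr_gt0.
    have hT : h < T - s.
      rewrite -[ltRHS]invrK ltf_pV2 ?posrE ?invr_gt0//.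
      by rewrite (lt_le_trans (truncnS_gt _))// ler_nat.
    have sh0 : 0 <= s + h by rewrite addr_ge0// ltW.
    have shT : s + h <= T by rewrite addrC -lerBrDr ltW.
    rewrite /u /q (max_r s0) (max_r sh0) normrM ger0_norm// -/h.
    rewrite -ler_pdivlMl// mulrC -/h.
    have := hL (s + h) s; rewrite sh0 shT s0 (ltW sT) => /(_ isT isT).
    by rewrite [s + h]addrC addrK (gtr0_norm (x := h)).
  have L0 : 0 <= L.
    exact: le_trans (normr_ge0 _) (uL _ (leqnn _)).
  rewrite /f; case: ifPn => [/set_mem[Nx]|_]; last by rewrite normr0.
  rewrite /= in_itv /= andbT => s_gt0.
  have cv := lim_g s (Num.truncn s) Nx; rewrite s_gt0 truncnS_gt in cv.
  have {}cv := cv isT; apply/ler_addgt0Pr => e e0.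
  move/cvgrPdist_le : cv => /(_ e e0)[M _ hM].
  pose m := maxn M (Num.truncn (T - s)^-1).
  have h1 := hM m (leq_maxl _ _); have h2 := uL m (leq_maxr _ _).
  rewrite -(subrK (u m s) (g _ s)) (le_trans (ler_normD _ _))// addrC lerD//.
have bf : loc_bounded f.
  split => // T; have [L L0 hL] := lp (T + 1); exists L => s /andP[s0 sT].
  by apply: (fL (T + 1) L hL); rewrite s0 (le_lt_trans sT)// ltrDl.
exists f; split => // t t0; have [mg ig pg] := hg (Num.truncn t).
have tn := truncnS_gt t.
have -> : p t = rprim (g (Num.truncn t)) t by rewrite -pg ?t0 ?(ltW tn)// p0 subr0.
rewrite /rprim /Rintegral; congr fine; apply: ae_eq_integral.
- exact: measurable_itv.
- by apply/measurable_EFinP; exact: measurable_funTS.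
- by apply/measurable_EFinP; exact: measurable_funTS.
exists (N `|` [set 0]); split.
- by apply: measurableU => //; exact: measurable_set1.
- apply/eqP; rewrite eq_le measure_ge0 andbT.
  rewrite (le_trans (measureU2 _ _ _))//= N0 lebesgue_measure_set1 adde0//.
move=> x /= hx; apply: contrapT => /not_orP[Nx xn0]; apply: hx.
rewrite in_itv /= => /andP[x0 xt]; congr (_%:E).
have {}x0 : 0 < x by rewrite lt_neqAle x0 andbT eq_sym; apply/eqP.
rewrite /f mem_set; last by split => //=; rewrite in_itv /= x0.
apply: (cvg_unique _ (lim_g x _ Nx _) (lim_g x _ Nx _)) => //.
  by rewrite x0 (le_lt_trans xt).
by rewrite x0 truncnS_gt.
Qed.

End Density.

(** * Real coordinates *)

Section RealCoordinates.
Context (R : realType) (V : normedModType R[i]).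

Definition real_comb (m : nat) (f : 'I_m -> V) (c : 'I_m -> R) : V :=
  \sum_(i < m) (c i)%:C *: f i.

Definition real_coordinates (m : nat) (f : 'I_m -> V) (l : 'I_m -> V -> R) :=
  [/\ forall v, v = real_comb f (l ^~ v),
      forall i v w, l i (v + w) = l i v + l i w,
      forall i (r : R) v, l i (r%:C *: v) = r * l i v &
      exists2 K, 0 < K & forall i v, `|l i v| <= K * rnorm v].

Let spans m (f : 'I_m -> V) := forall v, exists c, v = real_comb f c.

Let real_combD m (f : 'I_m -> V) c c' :
  real_comb f (fun i => c i + c' i) = real_comb f c + real_comb f c'.
Proof.
by rewrite -big_split /=; apply: eq_bigr => i _; rewrite rmorphD scalerDl.
Qed.

Let real_combZ m (f : 'I_m -> V) c (r : R) :
  real_comb f (fun i => r * c i) = r%:C *: real_comb f c.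
Proof.
by rewrite scaler_sumr; apply: eq_bigr => i _; rewrite rmorphM scalerA.
Qed.

Lemma real_span : finite_dimensional V -> exists m (f : 'I_m -> V), spans f.
Proof.
move=> [n [e he]]; exists (n + n)%N.
exists (fun i => match fintype.split i with inl j => e j | inr j => 'i *: e j end) => v.
have [c ->] := he v.
exists (fun i => match fintype.split i with inl j => complex.Re (c j) | inr j => complex.Im (c j) end).
rewrite /real_comb big_split_ord /= -big_split /=; apply: eq_bigr => i _.
rewrite (unsplitK (inl i) : fintype.split (lshift n i) = inl i).
rewrite (unsplitK (inr i) : fintype.split (rshift n i) = inr i).
by rewrite scalerA -scalerDl {1}(complexE (c i)) [_ * 'i]mulrC.
Qed.

(** A real spanning family of least size is free. *)
Lemma real_basis : finite_dimensional V -> exists m (f : 'I_m -> V),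
  spans f /\ forall c, real_comb f c = 0 -> forall i, c i = 0.
Proof.
move=> /real_span[m0 [f0 s0]].
have ex : exists m, `[< exists f : 'I_m -> V, spans f >].
  by exists m0; apply/asboolP; exists f0.
case: (ex_minnP ex) => m /asboolP[f sf] mmin; exists m, f; split => // c c0 j.
apply: contrapT => /eqP cj; case: m f sf mmin c c0 j cj => [|m] f sf mmin c c0 j cj.
  by case: j {cj}.
suff : (m.+1 <= m)%N by rewrite ltnn.
apply: mmin; apply/asboolP; exists (f \o lift j) => v; have [d ->] := sf v.
exists (fun i => d (lift j i) - d j / c j * c (lift j i)).
have red (b : 'I_m.+1 -> R) : b j = 0 ->
    real_comb f b = real_comb (f \o lift j) (fun i => b (lift j i)).
  by move=> bj; rewrite /real_comb (bigD1_ord j)//= bj scale0r add0r.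
rewrite -(red (fun i => d i - d j / c j * c i)); last by rewrite divfK// subrr.
have -> : (fun i => d i - d j / c j * c i) = (fun i => d i + (- (d j / c j)) * c i).
  by apply/funext => i; rewrite mulNr.
by rewrite real_combD real_combZ c0 scaler0 addr0.
Qed.

(** The norm of a combination with largest coefficient one is bounded below,
    by compactness. *)
Lemma real_comb_lower m (f : 'I_m -> V) (j : 'I_m) :
  (forall c, real_comb f c = 0 -> forall i, c i = 0) ->
  exists2 d, 0 < d & forall c, (forall i, `|c i| <= `|c j|) ->
    d * `|c j| <= rnorm (real_comb f c).
Proof.
move=> free; pose A (i : 'I_m) : set R := if i == j then [set 1] else `[-1, 1]%classic.
have cA : compact [set v : 'rV[R]_m | forall i, A i (v ord0 i)].
  by apply: rV_compact => i; rewrite /A; case: ifP => _; [exact: compact_set1|exact: segment_compact].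
pose F (v : 'rV[R]_m) := rnorm (real_comb f (fun i => v ord0 i)).
have cF : continuous F.
  move=> v; apply/(@cvgrPdist_le _ _ _ (nbhs v) (nbhs_filter v)) => e e0.
  have S0 : 0 < \sum_i rnorm (f i) + 1.
    by rewrite ltr_pwDr// sumr_ge0// => i _; exact: rnorm_ge0.
  apply/nbhs_ballP; exists (e / (\sum_i rnorm (f i) + 1)); first by rewrite /= divr_gt0.
  move=> w vw; rewrite /F; apply: le_trans (ler_rnorm_dist _ _) _.
  have -> : real_comb f (fun i => v ord0 i) - real_comb f (fun i => w ord0 i) =
      real_comb f (fun i => v ord0 i - w ord0 i).
    by rewrite -sumrB; apply: eq_bigr => i _; rewrite rmorphB scalerBl.
  apply: le_trans (ler_rnorm_sum _ _ _) _.
  apply: (@le_trans _ _ (\sum_i e / (\sum_i rnorm (f i) + 1) * rnorm (f i))).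
    apply: ler_sum => i _; rewrite rnormZr ler_wpM2r ?rnorm_ge0// ltW//.
    by case: vw => _ /(_ ord0 i); rewrite -ball_normE.
  by rewrite -mulr_sumr mulrAC ler_pdivrMr// ler_wpM2l ?lerDl// ltW.
have A0 : [set v : 'rV[R]_m | forall i, A i (v ord0 i)] !=set0.
  exists (const_mx 1) => i /=; rewrite mxE /A; case: ifP => // _.
  by rewrite /= in_itv /= lexx andbT; lra.
have [c cin cmin] := EVT_min_rV A0 cA (continuous_subspaceT cF).
have cj : c ord0 j = 1 by have := set_mem cin j; rewrite /A eqxx.
exists (F c).
  rewrite lt_neqAle rnorm_ge0 andbT eq_sym; apply/eqP => /rnorm0_eq0/free/(_ j)/eqP.
  by rewrite cj oner_eq0.
move=> b bj; have [bj0|bj0] := eqVneq (b j) 0; first by rewrite bj0 normr0 mulr0 rnorm_ge0.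
have nb : 0 < `|b j| by rewrite normr_gt0.
rewrite -ler_pdivlMr//.
have -> : rnorm (real_comb f b) / `|b j| = F (\row_i (b i / b j)).
  rewrite /F mulrC -normfV -rnormZr -real_combZ; congr rnorm; apply: eq_bigr => i _.
  by rewrite mxE mulrC.
apply: cmin; apply/mem_set => i; rewrite mxE /A; case: eqP => [->|_].
  by rewrite /= divff.
by rewrite /= in_itv /= -ler_norml normrM normfV ler_pdivrMr// mul1r.
Qed.

(** Coordinates in a free real spanning family; their bound is the lower bound
    of the norm on normalised combinations. *)
Lemma real_coordinates_exist : finite_dimensional V ->
  exists m (f : 'I_m -> V) l, real_coordinates f l.
Proof.
move=> /real_basis[m [f [sf free]]]; have [l hl] := choice sf.
have uniq v c : v = real_comb f c -> forall i, l v i = c i.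
  move=> vc i; apply/eqP; rewrite -subr_eq0; apply/eqP.
  apply: (free (fun i => l v i - c i)); rewrite /real_comb.
  under eq_bigr do rewrite rmorphB scalerBl.
  by rewrite sumrB -[X in X - _](hl v) {1}vc subrr.
exists m, f, (fun i v => l v i); split.
- exact: hl.
- move=> i v w; apply: (uniq _ (fun i => l v i + l w i)).
  by rewrite real_combD -!hl.
- by move=> i r v; apply: (uniq _ (fun i => r * l v i)); rewrite real_combZ -hl.
have [d hd] : exists d : 'I_m -> R, forall j, 0 < d j /\
    forall c, (forall i, `|c i| <= `|c j|) -> d j * `|c j| <= rnorm (real_comb f c).
  have : forall j : 'I_m, exists d, 0 < d /\
    forall c, (forall i, `|c i| <= `|c j|) -> d * `|c j| <= rnorm (real_comb f c).
    by move=> j; have [d d0 hd] := real_comb_lower j free; exists d.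
  by move=> /choice[d hd]; exists d.
exists (\sum_j (d j)^-1 + 1).
  by rewrite ltr_pwDr// sumr_ge0// => j _; rewrite invr_ge0 ltW// (hd j).1.
move=> i v; pose j := [arg max_(j > i) `|l v j|]%O.
have jmax k : `|l v k| <= `|l v j|.
  by rewrite /j; case: arg_maxP => // a _; apply.
have [dj0 hj] := hd j.
apply: le_trans (jmax i) _; have := hj (l v) jmax; rewrite -hl -ler_pdivlMl// => /le_trans.
apply; rewrite ler_wpM2r ?rnorm_ge0// (bigD1 j)//= -addrA lerDl.
by rewrite addr_ge0// sumr_ge0// => k _; rewrite invr_ge0 ltW// (hd k).1.
Qed.

End RealCoordinates.

(** * Essential bounds *)

Section EssentialBounds.
Context (R : realType).
Notation mu := (@lebesgue_measure R).
Notation rc k := (fun t : R => (k t)%:C : cline R).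

Section Norm.
Context (V : normedModType R[i]).
Implicit Types (f : R -> V) (D : set R).

Lemma ae_le_Linf_norm D f :
  {ae mu, forall t, D t -> ((rnorm (f t))%:E <= Linf_norm D f)%E}.
Proof.
have := ess_sup_ge mu ((fun t : R => (rnorm (f t))%:E) \_ D).
by apply: ae_imp => t h Dt; move: h; rewrite patchE mem_set.
Qed.

Lemma Linf_norm_le D f (M : R) : 0 <= M ->
  {ae mu, forall t, D t -> rnorm (f t) <= M} -> (Linf_norm D f <= M%:E)%E.
Proof.
move=> M0 h; apply/ess_supP; apply: ae_imp h => t h.
by rewrite patchE; case: ifPn => [/set_mem/h|_]; rewrite lee_fin.
Qed.

Lemma Linf_norm_ge0 D f : (0 <= Linf_norm D f)%E.
Proof.
apply: ess_sup_gee; last first.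
  by apply: ae_all => t; rewrite patchE; case: ifP => _; rewrite lee_fin// rnorm_ge0.
apply: (@lt_le_trans _ _ (mu `[(0 : R), 1]%classic)); last by apply: le_measure; rewrite ?inE.
by rewrite lebesgue_measure_itv /= lte_fin ltr01 sube0 lte_fin ltr01.
Qed.

(** A continuous function obeys its essential bound everywhere, since every
    neighbourhood of a time meets the complement of a null set. *)
Lemma Linf_norm_cont f (M : R) : cont_on (@half_line R) f ->
  (Linf_norm (@half_line R) f <= M%:E)%E -> forall t, 0 <= t -> rnorm (f t) <= M.
Proof.
move=> fc /[dup] fM _ t t0; apply/ler_addgt0Pr => e e0.
have [d d0 hd] := fc t t0 e e0.
have [N [mN N0 hN]] := ae_le_Linf_norm (@half_line R) f.
have [s [ss Ns]] : exists s, t < s < t + d /\ ~ N s.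
  apply: contrapT => nex.
  have sub : `]t, t + d[%classic `<=` N.
    move=> s; rewrite /= in_itv /= => sd; apply: contrapT => Ns.
    by apply: nex; exists s.
  have : (mu `]t, (t + d)%R[%classic <= mu N)%E by rewrite le_measure ?inE.
  rewrite N0 lebesgue_measure_itv /= lte_fin ltrDl d0 -EFinD lee_fin.
  by rewrite addrAC subrr add0r leNgt d0.
have s0 : half_line s by rewrite /half_line /= (le_trans t0)// ltW; case/andP: ss.
have fs : rnorm (f s) <= M.
  have /contrapT := contra_not (@hN s) Ns => /(_ s0) h.
  by rewrite -lee_fin (le_trans h).
rewrite -(subrK (f s) (f t)) (le_trans (ler_rnormD _ _))// addrC lerD//.
rewrite rnorm_distC hd//; case/andP: ss => ts sd.
by rewrite gtr0_norm ?subr_gt0// ltrBlDl.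
Qed.

Lemma real_lipschitz (l : V -> R) (K : R) :
  (forall v w, l (v + w) = l v + l w) -> (forall (r : R) v, l (r%:C *: v) = r * l v) ->
  (forall v, `|l v| <= K * rnorm v) ->
  forall v w, `|l v - l w| <= K * rnorm (v - w).
Proof.
move=> lD lZ lK v w; rewrite (_ : l v - l w = l (v - w))// lD; congr (_ + _).
have l0 : l 0 = 0 by have := lZ 0 0; rewrite scaler0 mul0r.
by apply/esym/eqP; rewrite -addr_eq0 -lD addNr l0.
Qed.

(** The limit of the coordinates of simple functions is Borel where the
    convergence holds; the coordinate is set to zero on a null set outside of
    which the convergence and all the essential bounds on [0, n] hold. *)
Lemma coordinate_input (l : V -> R) (K : R) (u : R -> V) :
  (forall v w, l (v + w) = l v + l w) -> (forall (r : R) v, l (r%:C *: v) = r * l v) ->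
  0 < K -> (forall v, `|l v| <= K * rnorm v) -> Linf_loc u ->
  exists2 k, loc_bounded k & {ae mu, forall t, 0 <= t -> k t = l (u t)}.
Proof.
move=> lD lZ K0 lK [[s us] ub].
have lip := real_lipschitz lD lZ lK.
have bd : {ae mu, forall t, forall n : nat,
    `[0, n.+1%:R]%classic t -> ((rnorm (u t))%:E <= Linf_norm `[0%R, n.+1%:R]%classic u)%E}.
  by apply: ae_foralln => n; exact: ae_le_Linf_norm.
have [N [mN N0 hN]] := ae_and us bd.
pose E : set R := ~` N `&` `[(0 : R), +oo[%classic.
have mE : measurable E by apply: measurableI; [exact: measurableC|exact: measurable_itv].
have good t : E t -> [/\ 0 <= t, simple_eval (s n) t @[n --> \oo] --> u t &
    forall n : nat, t <= n.+1%:R -> ((rnorm (u t))%:E <= Linf_norm `[0%R, n.+1%:R]%classic u)%E].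
  move=> [Nt]; rewrite /= in_itv /= andbT => t0.
  have /contrapT[h1 h2] := contra_not (@hN t) Nt; split => //; first exact: h1.
  by move=> n tn; apply: h2; rewrite /= in_itv /= t0.
pose k (t : R) : R := if t \in E then l (u t) else 0.
have mk : measurable_fun setT k.
  apply: (measurable_fun_cvg (h := fun n t => \1_E t * l (simple_eval (s n) t))).
    move=> n; apply: measurable_funM; first exact: measurable_indic.
    have -> : (fun t => l (simple_eval (s n) t)) =
        (fun t => l (@atom_val _ _ (s n) (@atoms _ _ (s n) t))).
      by apply/funext => t; rewrite simple_evalE.
    have ml := @labelling_measurable R _ _ (fun A => l (@atom_val R V (s n) A)) setT
      measurableT (@labelling_atoms R V (s n)).
    exact: ml.
  move=> t _; rewrite /k indicE; case: ifPn => [/set_mem/good[_ cv _]|_]; last first.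
    by under eq_fun do rewrite mul0r; exact: cvg_cst.
  under eq_fun do rewrite mul1r.
  apply/cvgrPdist_le => e e0; move/cvg_rnormP : cv => /(_ _ (divr_gt0 e0 K0)).
  apply: filterS => n h; rewrite distrC (le_trans (lip _ _))// mulrC -ler_pdivlMr//.
exists k; last first.
  exists N; split => // t /= hk; apply: contrapT => Nt; apply: hk => t0.
  by rewrite /k mem_set//; split => //=; rewrite in_itv /= t0.
split => // T; pose n := Num.truncn T.
exists (K * fine (Linf_norm `[0%R, n.+1%:R]%classic u)) => t /andP[t0 tT].
have tn : t <= n.+1%:R by rewrite (le_trans tT)// ltW// truncnS_gt.
have fn : (Linf_norm `[0%R, n.+1%:R]%classic u \is a fin_num).
  by rewrite ge0_fin_numE ?Linf_norm_ge0// ub.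
rewrite /k; case: ifPn => [/set_mem/good[_ _ /(_ n tn) h]|_]; last first.
  by rewrite normr0 mulr_ge0 ?(ltW K0)// fine_ge0// Linf_norm_ge0.
by rewrite (le_trans (lK _))// ler_pM2l// -lee_fin fineK.
Qed.

End Norm.

(** Approximate within [1 / (n + 1)] on [0, n]. *)
Lemma strongly_measurable_comb (V : completeNormedModType R[i]) m (e : 'I_m -> V)
    (k : 'I_m -> R -> R) : (forall i, loc_bounded (k i)) ->
  strongly_measurable (@half_line R) (fun t => real_comb e (fun i => k i t)).
Proof.
move=> bk; have : forall n : nat, exists s : simple_fun V, forall t,
    0 <= t <= n%:R -> rnorm (real_comb e (fun i => k i t) - simple_eval s t) <= n.+1%:R^-1.
  move=> n; have mI := measurable_itv `[(0 : R), n%:R]; have fin := @segment_lty R 0 n%:R.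
  have h : Bint `[0, n%:R]%classic (fun t => real_comb e (fun i => k i t))
      (\sum_(i < m) (rprim (k i) n%:R)%:C *: e i).
    by apply: Bint_sum => // i; exact: rprimP.
  have n0 : 0 < n.+1%:R^-1 :> R by rewrite invr_gt0.
  have [T [g [w [mg fg _]]]] := h _ n0.
  have [s [sE _]] := labelled_simple mI fin w mg.
  exists s => t tn; have tn' : `[0, n%:R]%classic t by rewrite /= in_itv.
  by rewrite sE// fg.
move=> /choice[s hs]; exists s; apply: ae_all => t t0.
rewrite /half_line /= in t0; apply/cvg_rnormP_ltn => d d0.
exists (maxn (Num.truncn t).+1 (Num.truncn d^-1)) => n.
rewrite geq_max => /andP[n1 n2]; rewrite rnorm_distC.
apply: le_trans (hs n t _) _.
  by rewrite t0 (le_trans (ltW (truncnS_gt t)))// ler_nat.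
rewrite -[leRHS]invrK lef_pV2 ?posrE ?invr_gt0//.
by rewrite (le_trans (ltW (truncnS_gt _)))// ler_nat.
Qed.

Lemma Rintegral_segment (T : R) (p : R -> R) : (forall t, T < t -> p t = 0) ->
  \int[mu]_(t in @half_line R) p t = \int[mu]_(t in `[0, T]) p t.
Proof.
move=> pT.
rewrite -[X in _ = \int[mu]_(t in X) _](_ : @half_line R `&` `[0, T]%classic = _).
  rewrite Rintegral_mkcondr; apply: eq_Rintegral => t /set_mem t0.
  rewrite patchE; case: ifPn => //; rewrite in_set_itv in_itv /= negb_and -!ltNge.
  by move: t0; rewrite /half_line /= => t0 /orP[|/pT ->//]; rewrite ltNge t0.
by apply/seteqP; split=> t; rewrite /= in_itv /=; [case|case/andP=> t0 tT; rewrite /half_line/= t0].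
Qed.

Lemma complex_integral_Bint (T : R) (g : R -> cline R) v :
  Bint `[0, T]%classic g v -> (forall t, T < t -> g t = 0) ->
  complex_integral (@half_line R) g = v.
Proof.
move=> h gT; have mI := measurable_itv `[0, T]; have fin := segment_lty 0 T.
rewrite /complex_integral !(@Rintegral_segment T) => [|t /gT ->|t /gT ->]//.
have [z|_ <-] := Bint_real (M := 1) mI fin ltr01 (@Re_lineD R) (@Re_lineZ R) _ h.
  by rewrite mul1r Re_line_norm.
have [z|_ <-] := Bint_real (M := 1) mI fin ltr01 (@Im_lineD R) (@Im_lineZ R) _ h.
  by rewrite mul1r Im_line_norm.
by case: (v).
Qed.

End EssentialBounds.

(** * Classical solutions with smooth scalar inputs *)

Section SmoothInputs.
Context (R : realType).
Notation rc k := (fun t : R => (k t)%:C : cline R).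

Lemma deriv_on_line (V : completeNormedModType R[i]) J (k k' : R -> R) (e : V) :
  deriv_on J (rc k) (rc k') ->
  deriv_on J (fun t => (k t)%:C *: e) (fun t => (k' t)%:C *: e).
Proof.
move=> dk; have dc : deriv_on J (fun=> e) (fun=> 0).
  by move=> t _ d d0; exists 1 => // s _ _; rewrite subrr sub0r scaler0 oppr0 rnorm0 mulr_ge0// ltW.
apply: deriv_on_ext (deriv_on_scale dk dc) => // t _.
by rewrite scaler0 addr0.
Qed.

Lemma cont_on_line (V : completeNormedModType R[i]) J (k : R -> R) (e : V) :
  cont_on J (rc k) -> cont_on J (fun t => (k t)%:C *: e).
Proof. by move=> kc; apply: cont_on_scale kc _; exact: cont_on_cst. Qed.

Variable phi : nat -> R -> R.
Hypothesis dphi : forall m, deriv_on setT (rc (phi m)) (rc (phi m.+1)).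
Variable a : R.
Hypotheses (a0 : 0 < a) (phi_early : forall r, r < a -> phi 0%N r = 0).

Lemma smooth_input0 m : phi m 0 = 0.
Proof.
have a20 : 0 < a / 2 by rewrite divr_gt0.
suff h : forall t, 0 <= t <= a / 2 -> phi m t = 0 by apply: h; rewrite lexx ltW.
elim: m => [|m IHm] t tT; first by apply: phi_early; case/andP: tT => _; lra.
have sub := @subsetT _ `[0, a / 2]%classic.
have d0 : deriv_on `[0, a / 2]%classic (rc (phi m)) (fun=> 0 : cline R).
  have dz : deriv_on `[0, a / 2]%classic (fun=> 0 : cline R) (fun=> 0).
    by move=> r _ d d0; exists 1 => // s _ _; rewrite subrr sub0r scaler0 oppr0 rnorm0 mulr_ge0// ltW.
  apply: deriv_on_ext dz => // r; rewrite /= in_itv /= => /IHm ->.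
  by rewrite rmorph0.
have := deriv_on_val_unique a20 (deriv_onW sub (dphi m)) d0 tT.
by move/(congr1 (@complex.Re R)).
Qed.

Lemma smooth_input_cont m : cont_on setT (rc (phi m)).
Proof. exact: deriv_on_cont (dphi m). Qed.

Lemma smooth_input_bounded m : loc_bounded (phi m).
Proof. exact: cont_loc_bounded (smooth_input_cont m). Qed.

(** The ramp is the fundamental solution of the second derivative. *)
Lemma vconv_ramp_smooth (V : completeNormedModType R[i]) (e : V) t : 0 <= t ->
  vconv (fun r => r%:C *: e) (phi 2%N) t = (phi 0%N t)%:C *: e.
Proof.
move=> t0; have sub := @subsetT _ (@half_line R).
have bk := smooth_input_bounded 2.
have ec : cont_on (@half_line R) (fun=> e) by exact: cont_on_cst.
have r0 : 0%:C *: e = 0 by rewrite scale0r.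
have d1 := vconv_deriv (@ramp_deriv R V (@half_line R) e) ec r0 bk.
apply: (@deriv_on_unique _ _ _ (fun t => (phi 0%N t)%:C *: e) (fun t => (phi 1%N t)%:C *: e) _ _ _ t t0).
- apply: deriv_on_ext d1 => // s s0; rewrite /half_line /= in s0.
  have sb := @subsetT _ `[0, s]%classic.
  have h := Bint_FTC s0 (deriv_onW sb (deriv_on_line e (dphi 1%N)))
    (cont_onW sb (cont_on_line e (smooth_input_cont 2))).
  rewrite smooth_input0 scale0r subr0 in h.
  exact: (Bint_unique (measurable_itv _) (segment_lty 0 s) (fun _ _ => erefl) (vconvP s ec bk) h).
- exact: deriv_onW sub (deriv_on_line e (dphi 0%N)).
- rewrite vconv0//; first by rewrite smooth_input0 scale0r.
  exact: ramp_cont.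
Qed.

End SmoothInputs.

Section SmoothResponse.
Context (R : realType) (U X Y : completeNormedModType R[i]) (S : system_node U X Y).

(** A smooth scalar input drives the node along a classical solution whose
    output is the ramp response convolved with the second derivative. *)
Lemma Cinf_smooth_bound (c : R) (e : U) : 0 < c ->
  (forall u x y, classical_solution S u x y -> x 0 = 0 -> Cc_infty u ->
    (Linf_norm (@half_line R) y <= c%:E * Linf_norm (@half_line R) u)%E) ->
  smooth_bound (ramp_out S e) (c * rnorm e).
Proof.
move=> c0 bibo phi K dphi [a [b [a0 supp]]] phiK t t0.
have early r : r < a -> phi 0%N r = 0 by move=> ra; apply: supp; rewrite ra.
have b2 := smooth_input_bounded dphi 2%N.
have sub := @subsetT _ (@half_line R).
pose u t := (phi 0%N t)%:C *: e.
have c1 := resp1_cont S e; have c2 := deriv_on_cont (resp2_deriv S e).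
have yc := vconv_cont (ramp_out_cont S e) b2.
have st s : 0 <= s -> sn_Am1 S (vconv (resp2 S e) (phi 2%N) s) + sn_B S (u s) =
    sn_j S (vconv (resp1 S e) (phi 2%N) s).
  by move=> s0; rewrite /u -(vconv_ramp_smooth dphi a0 early e s0); exact: state_eq.
have sol : classical_solution S u (vconv (resp2 S e) (phi 2%N)) (vconv (ramp_out S e) (phi 2%N)).
  split.
  - apply/cont_onP; exact: cont_onW sub (cont_on_line e (smooth_input_cont dphi 0%N)).
  - exact/cont_onP.
  - by move=> s s0; exists (vconv (resp1 S e) (phi 2%N) s); exact: st.
  - exists (vconv (resp1 S e) (phi 2%N)); split.
    + by apply/cont_onP; exact: vconv_cont.
    + by apply/has_derivative_onP; exact: vconv_resp2_deriv.
    + by move=> s s0; exact/esym/st.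
  - move=> s s0; rewrite (CD_formula (st s s0)) -vconv_ramp_out//.
    by rewrite (vconv_ramp_smooth dphi a0 early e s0).
have cu : Cc_infty u.
  split.
    exists (fun m t => (phi m t)%:C *: e); split => // m.
    apply/has_derivative_onP; apply: deriv_on_line.
    by apply: deriv_onW (dphi m); exact: subsetT.
  by exists a, b; split => // s s0 /supp h; rewrite /u h scale0r.
have x0 : vconv (resp2 S e) (phi 2%N) 0 = 0 by exact: vconv0.
have K0 : 0 <= K := le_trans (normr_ge0 _) (phiK 0).
apply: (Linf_norm_cont yc) => //; apply: le_trans (bibo _ _ _ sol x0 cu) _.
rewrite -mulrA EFinM lee_pmul2l ?lte_fin//; apply: Linf_norm_le.
  by rewrite mulr_ge0 ?rnorm_ge0.
by apply: ae_all => s _; rewrite rnormZr mulrC ler_wpM2l ?rnorm_ge0.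
Qed.

End SmoothResponse.

(** * Outputs of generalised solutions *)

Lemma Bint_double_primitive (R : realType) (V : completeNormedModType R[i])
    (W Z v : R -> V) t :
  deriv_on (@half_line R) W v -> deriv_on (@half_line R) Z W ->
  cont_on (@half_line R) v -> W 0 = 0 -> Z 0 = 0 -> 0 <= t ->
  Bint `[0, t]%classic (fun s => (t - s)%:C *: v s) (Z t).
Proof.
move=> dW dZ vc W0 Z0 t0; have sub := @half_line_segment R t.
have dr : deriv_on `[0, t]%classic (fun s => (t - s)%:C : cline R) (fun=> (-1)%:C).
  move=> r _ d d0; exists 1 => // s _ _; rewrite -rmorphB.
  have -> : t - s - (t - r) = (s - r) * -1 by ring.
  by rewrite rmorphM subrr rnorm0 mulr_ge0// ltW.
have xc := cont_on_scale (deriv_on_cont dr) (cont_onW sub vc).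
have dF : deriv_on `[0, t]%classic (fun s => (t - s)%:C *: W s + Z s)
    (fun s => (t - s)%:C *: v s).
  apply: deriv_on_ext (deriv_onD (deriv_on_scale dr (deriv_onW sub dW)) (deriv_onW sub dZ)) => // s _.
  by rewrite rmorphN scaleNr scale1r addrAC addNr add0r.
have := Bint_FTC t0 dF xc.
by rewrite subrr scale0r add0r subr0 W0 Z0 scaler0 addr0 subr0.
Qed.

Section InputCoordinates.
Context (R : realType) (U X Y : completeNormedModType R[i]) (S : system_node U X Y).
Notation mu := (@lebesgue_measure R).
Variables (m : nat) (e : 'I_m -> U) (k : 'I_m -> R -> R) (u : R -> U).
Hypothesis bk : forall j, loc_bounded (k j).
Hypothesis uk : {ae mu, forall t, 0 <= t -> u t = real_comb e (k ^~ t)}.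

Lemma bochner_vconv (W : completeNormedModType R[i]) (P : R -> U -> W) t :
  (forall r, 0 <= r -> rlinear (P r)) ->
  (forall j, cont_on (@half_line R) (fun r => P r (e j))) ->
  bochner_integral `[0, t]%classic (fun s => P (t - s) (u s)) =
  \sum_(j < m) vconv (fun r => P r (e j)) (k j) t.
Proof.
move=> lP cP; have mI := measurable_itv `[0, t]; have fin := segment_lty 0 t.
have h := Bint_sum mI fin (index_enum 'I_m) (fun j => vconvP t (cP j) (bk j)).
apply: (Bint_bochner_integral mI fin h); apply: ae_imp uk => s us.
rewrite /= in_itv /= => /andP[s0 st]; rewrite us//.
have ts : 0 <= t - s by rewrite subr_ge0.
rewrite /real_comb (rlinear_sum _ _ _ (lP _ ts)); apply: eq_bigr => j _.
by case: (lP _ ts) => _ ->.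
Qed.

Lemma CDm1_j x v : CDm1 (S := S) (sn_j S x) v = CD S x v.
Proof.
rewrite /CDm1; congr CD.
have h : [set y | sn_j S y = sn_j S x] (xget 0 [set y | sn_j S y = sn_j S x]).
  by apply: xgetPex; exists x.
exact: j_inj h.
Qed.

(** Integrating the state twice brings it back into the state space, where it
    is the response to a combination of ramps. *)
Lemma state_double_primitive j t : 0 <= t ->
  Bint `[0, t]%classic
    (fun s => (t - s)%:C *: vconv (fun r => sn_Tm1 S r (sn_B S (e j))) (k j) s)
    (sn_j S (vconv (resp2 S (e j)) (k j) t)).
Proof.
move=> t0; have dW := j_vconv_resp1_deriv S (e j) (bk j).
have dZ := rlinear_deriv_on (linear_rlinear (sn_j S)) (j_rbounded S)
  (vconv_resp2_deriv S (e j) (bk j)).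
apply: Bint_double_primitive dW dZ _ _ _ t0.
- by apply: vconv_cont (bk j); exact: orbit_cont.
- by rewrite (vconv0 (resp1_cont S (e j)) (bk j)) linear0.
- by rewrite (vconv0 (deriv_on_cont (resp2_deriv S (e j))) (bk j)) linear0.
Qed.

Lemma generalised_output (x : R -> sn_Xm1 S) :
  (forall t, 0 <= t ->
     x t = bochner_integral `[0, t]%classic (fun s => sn_Tm1 S (t - s) (sn_B S (u s)))) ->
  forall t, 0 <= t ->
  CDm1 (bochner_integral `[0, t]%classic (fun s => (t - s)%:C *: x s))
       (bochner_integral `[0, t]%classic (fun s => (t - s)%:C *: u s)) =
  \sum_(j < m) vconv (ramp_out S (e j)) (k j) t.
Proof.
move=> hx t t0; have mI := measurable_itv `[0, t]; have fin := segment_lty 0 t.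
have xE s : 0 <= s -> x s =
    \sum_(j < m) vconv (fun r => sn_Tm1 S r (sn_B S (e j))) (k j) s.
  move=> s0; rewrite hx//.
  apply: (bochner_vconv (P := fun r v => sn_Tm1 S r (sn_B S v))) => [r r0|j].
    have [a b] := linear_rlinear (sn_B S); have [a' b'] := sg_rlinear (sn_Tm1 S) r.
    by split=> *; rewrite ?a ?a' ?b ?b'.
  exact: orbit_cont.
have -> : bochner_integral `[0, t]%classic (fun s => (t - s)%:C *: x s) =
    sn_j S (\sum_(j < m) vconv (resp2 S (e j)) (k j) t).
  rewrite linear_sum.
  have h := Bint_sum mI fin (index_enum 'I_m) (fun j => state_double_primitive j t0).
  apply: (Bint_bochner_integral mI fin h); apply: ae_all => s.
  by rewrite /= in_itv /= => /andP[s0 _]; rewrite xE// scaler_sumr.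
have -> : bochner_integral `[0, t]%classic (fun s => (t - s)%:C *: u s) =
    \sum_(j < m) vconv (fun r => r%:C *: e j) (k j) t.
  apply: (bochner_vconv (P := fun r v => r%:C *: v)) => [r r0|j]; last exact: ramp_cont.
  by split=> *; rewrite ?scalerDr// !scalerA mulrC.
rewrite CDm1_j (CD_formula (w := \sum_(j < m) vconv (resp1 S (e j)) (k j) t)).
  rewrite scaler_sumr -sumrB (rlinear_sum _ _ _ (CR_rlinear S)) (rlinear_sum _ _ _ (G_rlinear S)).
  by rewrite -big_split /=; apply: eq_bigr => j _; have E := vconv_ramp_out S (e j) (bk j) t0; exact: E.
rewrite !linear_sum -big_split /=; apply: eq_bigr => j _.
exact: (state_eq S (e j) (bk j) t0).
Qed.

End InputCoordinates.

(** * Pairing with test functions *)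

Section TestFunctions.
Context (R : realType) (Y : completeNormedModType R[i]).
Notation mu := (@lebesgue_measure R).
Notation rc k := (fun t : R => (k t)%:C : cline R).

Lemma op_norm_ge (V W : normedModType R[i]) (f : V -> W) v : rnorm v <= 1 ->
  ((rnorm (f v))%:E <= op_norm f)%E.
Proof. by move=> v1; apply: ereal_sup_ubound; exists v. Qed.

(** Differentiability in operator norm implies differentiability at each
    vector, after scaling the vector into the unit ball. *)
Lemma test_function_deriv (phi : test_function Y) n (y : Y) :
  deriv_on (@half_line R) (fun t => phi n t y : cline R) (phi n.+1 ^~ y).
Proof.
apply/has_derivative_onP => t t0; apply/cvg_rnormP => d d0.
have y0 : 0 < rnorm y + 1 by rewrite ltr_pwDr ?rnorm_ge0.
have /fine_cvgP[fin /cvgrPdist_le/(_ _ (divr_gt0 d0 y0)) cv] := tf_derivative phi n t0.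
near=> h.
have hfin : op_norm (fun y => (h^-1)%:C *: (phi n (t + h) y - phi n t y) - phi n.+1 t y)
    \is a fin_num by near: h; exact: fin.
have : `|0 - fine (op_norm (fun y => (h^-1)%:C *: (phi n (t + h) y - phi n t y) -
    phi n.+1 t y))| <= d / (rnorm y + 1) by near: h; exact: cv.
rewrite sub0r normrN => /(le_trans (ler_norm _)) hle.
pose v := ((rnorm y + 1)^-1)%:C *: y.
have v1 : rnorm v <= 1.
  by rewrite rnormZr ger0_norm ?invr_ge0 ?(ltW y0)// ler_pdivrMl// mulr1 lerDl.
have := op_norm_ge (fun y => (h^-1)%:C *: (phi n (t + h) y - phi n t y) - phi n.+1 t y : R[i]^o) v1.
rewrite -(fineK hfin) lee_fin => /le_trans/(_ hle).
have -> : (h^-1)%:C *: (phi n (t + h) v - phi n t v) - phi n.+1 t v =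
   ((rnorm y + 1)^-1)%:C *: ((h^-1)%:C *: (phi n (t + h) y - phi n t y) - phi n.+1 t y).
  have Z i s a : phi i s (a *: y) = a *: phi i s y by exact: linearZ.
  by rewrite /v !Z -[X in _ *: X - _]scalerBr scalerA [(h^-1)%:C * _]mulrC -scalerA -scalerBr.
rewrite rnormZr ger0_norm ?invr_ge0 ?(ltW y0)//.
by rewrite [d / _]mulrC ler_pM2l// invr_gt0.
Unshelve. all: by end_near. Qed.

Lemma deriv_on_late0 (V : normedModType R[i]) (g g' : R -> V) (M : R) : 0 <= M ->
  deriv_on (@half_line R) g g' -> (forall t, M < t -> g t = 0) ->
  forall t, M < t -> g' t = 0.
Proof.
move=> M0 dg gM t Mt; apply: rnorm_eq_le => d d0; rewrite subr0.
have t0 : half_line t by rewrite /half_line /= (le_trans M0)// ltW.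
have [x x0 hx] := dg t t0 d d0; have x2 : 0 < x / 2 by rewrite divr_gt0.
have ts : t < t + x / 2 by rewrite ltrDl.
have := hx (t + x / 2); rewrite [t + x / 2]addrC addrK gtr0_norm//.
rewrite !gM// ?subrr ?sub0r ?rnormN; last by rewrite addrC (lt_trans Mt).
rewrite rnormZr (gtr0_norm x2) [d * _]mulrC ler_pM2l//; apply.
  by rewrite /half_line /= addr_ge0 ?(ltW x2).
by rewrite ltr_pdivrMr// ltr_pMr// ltr1n.
Qed.

(** Two integrations by parts: the primitives vanish at time 0, and the test
    function with all its derivatives vanishes at [T]. *)
Lemma double_primitive_pairing (z : nat -> R -> cline R) (f : R -> R) (M T : R) :
  0 <= M -> M < T -> (forall n, deriv_on (@half_line R) (z n) (z n.+1)) ->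
  (forall t, M < t -> z 0%N t = 0) -> loc_bounded f ->
  exists v, Bint `[0, T]%classic (fun t => (rprim (rprim f) t)%:C *: z 2%N t) v /\
            Bint `[0, T]%classic (fun t => (f t)%:C *: z 0%N t) v.
Proof.
move=> M0 MT dz zM bf; have T0 := le_trans M0 (ltW MT).
have zc n := deriv_on_cont (dz n).
have late n t : M < t -> z n t = 0.
  elim: n t => [//|n IHn] t Mt; exact: deriv_on_late0 M0 (dz n) IHn t Mt.
have sub := @half_line_segment R T.
have mI := measurable_itv `[0, T]; have fin := segment_lty 0 T.
have bp := rprim_loc_bounded bf.
have ex (k : R -> R) n : loc_bounded k -> exists v, Bint `[0, T]%classic (fun t => (k t)%:C *: z n t) v.
  move=> bk; have [K K0 hK] := loc_bounded_gt0 T bk.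
  have kT s : `[0, T]%classic s -> `|k s| <= K by rewrite /= in_itv; exact: hK.
  have zs := cont_on_simplifiable (cont_onW sub (zc n)).
  by have [v hv] := Bint_exists mI fin (simplifiable_scale bk.1 kT zs); exists v.
have [v0 h0] := ex f 0%N bf; have [v1 h1] := ex (rprim f) 1%N bp.
have [v2 h2] := ex (rprim (rprim f)) 2%N (rprim_loc_bounded bp).
have e1 := Bint_by_parts T0 bf (deriv_onW sub (dz 0%N)) (cont_onW sub (zc 1%N)) h0 h1.
have e2 := Bint_by_parts T0 bp (deriv_onW sub (dz 1%N)) (cont_onW sub (zc 2%N)) h1 h2.
rewrite !late// scaler0 in e1 e2.
exists v0; split => //; suff <- : v2 = v0 by [].
by rewrite scaler0 in e2; apply: (addrI v1); rewrite e2 addrC e1.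
Qed.

End TestFunctions.

(** * From smooth inputs to essentially bounded inputs *)

Section OutputDensity.
Context (R : realType) (Y : completeNormedModType R[i]).
Notation rc k := (fun t : R => (k t)%:C : cline R).
Variables (m : nat) (f : 'I_m -> Y).

Let lipschitz_to (q : R -> Y) (T L : R) := forall s t, 0 <= s <= T -> 0 <= t <= T ->
  rnorm (q s - q t) <= L * `|s - t|.

(** Each real coordinate of [q] is Lipschitz, hence the primitive of a
    density; the coordinates of [z] integrate twice to the same values by
    uniqueness of primitives. *)
Lemma double_primitive_density (l : 'I_m -> Y -> R) (K : R) (z q : R -> Y) :
  (forall v, v = real_comb f (l ^~ v)) -> (forall i v w, l i (v + w) = l i v + l i w) ->
  (forall i (r : R) v, l i (r%:C *: v) = r * l i v) ->
  0 < K -> (forall i v, `|l i v| <= K * rnorm v) ->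
  deriv_on (@half_line R) z q -> z 0 = 0 -> q 0 = 0 ->
  (forall T, exists2 L, 0 <= L & lipschitz_to q T L) ->
  exists g : 'I_m -> R -> R, [/\ forall i, loc_bounded (g i),
    forall t, 0 <= t -> z t = real_comb f (fun i => rprim (rprim (g i)) t) &
    forall T L, lipschitz_to q T L -> forall s, 0 <= s < T ->
      rnorm (real_comb f (g ^~ s)) <= (\sum_(i < m) rnorm (f i)) * (K * L)].
Proof.
move=> lf lD lZ K0 lK dz z0 q0 ql.
have l0 i : l i 0 = 0 by have := lZ i 0 0; rewrite scaler0 mul0r.
have lip i T L : lipschitz_to q T L -> forall s t, 0 <= s <= T -> 0 <= t <= T ->
    `|l i (q s) - l i (q t)| <= K * L * `|s - t|.
  move=> qL s t sT tT; rewrite (le_trans (real_lipschitz (lD i) (lZ i) (lK i) _ _))//.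
  by rewrite -mulrA ler_pM2l// qL.
have : forall i, exists g, [/\ loc_bounded g, forall t, 0 <= t -> l i (q t) = rprim g t &
    forall T L, (forall s t, 0 <= s <= T -> 0 <= t <= T ->
      `|l i (q s) - l i (q t)| <= L * `|s - t|) -> forall s, 0 <= s < T -> `|g s| <= L].
  move=> i; apply: (lipschitz_density (p := fun t => l i (q t))) => [|T]; first by rewrite q0.
  have [L L0 qL] := ql T; exists (K * L); first by rewrite mulr_ge0// ltW.
  exact: lip.
move=> /choice[g hg]; exists g; split => [i|t t0|T L qL s sT]; first by case: (hg i).
  rewrite [LHS]lf; apply: eq_bigr => i _; congr (_ *: _).
  have [bg qg _] := hg i.
  have lin : rlinear (fun v : Y => (l i v)%:C : cline R).
    by split=> *; rewrite ?lD ?lZ ?rmorphD ?rmorphM.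
  have lb : rbounded (fun v : Y => (l i v)%:C : cline R).
    by exists K => // v; rewrite rnorm_line.
  have d1 : deriv_on (@half_line R) (rc (fun t => l i (z t))) (rc (rprim (g i))).
    apply: deriv_on_ext (rlinear_deriv_on lin lb dz) => // r r0.
    by rewrite qg.
  have d2 := rprim_deriv (rprim_cont bg).
  apply: (deriv_on_unique d1 d2) => //.
  by rewrite z0 l0 rprim0 //; exact: rprim_loc_bounded.
rewrite (le_trans (ler_rnorm_sum _ _ _))// mulr_suml ler_sum// => i _.
rewrite rnormZr mulrC ler_wpM2l ?rnorm_ge0//.
by have [_ _ h] := hg i; apply: h sT; exact: lip.
Qed.

Lemma pairing_density (g : 'I_m -> R -> R) (z : R -> Y) (phi : test_function Y) :
  (forall i, loc_bounded (g i)) ->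
  (forall t, 0 <= t -> z t = real_comb f (fun i => rprim (rprim (g i)) t)) ->
  complex_integral (@half_line R) (fun t => phi 2%N t (z t)) =
  complex_integral (@half_line R) (fun t => phi 0%N t (real_comb f (g ^~ t))).
Proof.
move=> bg zE; have [M hM] := tf_support phi; pose M0 := Num.max 0 M; pose T := M0 + 1.
have M00 : 0 <= M0 by rewrite le_max lexx.
have MT : M0 < T by rewrite ltrDl.
have dphi i n := test_function_deriv phi n (f i).
have late0 i t : M0 < t -> phi 0%N t (f i) = 0.
  by rewrite gt_max => /andP[_ /hM].
have late i n t : M0 < t -> (phi n t (f i) : cline R) = 0.
  elim: n t => [|n IHn] t; first exact: late0.
  exact: deriv_on_late0 M00 (dphi i n) IHn t.
have : forall i, exists v,
    Bint `[0, T]%classic (fun t => (rprim (rprim (g i)) t)%:C *: (phi 2%N t (f i) : cline R)) v /\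
    Bint `[0, T]%classic (fun t => (g i t)%:C *: (phi 0%N t (f i) : cline R)) v.
  move=> i; exact: (double_primitive_pairing (z := fun n t => phi n t (f i))
    M00 MT (dphi i) (late0 i) (bg i)).
move=> /choice[v hv].
suff pairing n (h : 'I_m -> R -> R) (w : R -> Y) :
    (forall t, 0 <= t -> w t = real_comb f (h ^~ t)) ->
    (forall i, Bint `[0, T]%classic (fun t => (h i t)%:C *: (phi n t (f i) : cline R)) (v i)) ->
    complex_integral (@half_line R) (fun t => phi n t (w t)) = \sum_(i < m) v i.
  rewrite (pairing 2%N (fun i => rprim (rprim (g i))))//; last by move=> i; case: (hv i).
  by rewrite (pairing 0%N g)// => i; case: (hv i).
move=> wE hB.
have sum := Bint_sum (measurable_itv `[0, T]) (segment_lty 0 T) (index_enum 'I_m) hB.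
rewrite -(complex_integral_Bint sum) => [|t tT]; last first.
  by rewrite big1// => i _; rewrite late ?scaler0// (lt_trans MT).
have E t : t \in @half_line R ->
    phi n t (w t) = \sum_(i < m) (h i t)%:C *: (phi n t (f i) : cline R).
  move=> /set_mem t0; rewrite wE// /real_comb linear_sum; apply: eq_bigr => i _.
  exact: linearZ.
by rewrite /complex_integral; congr (_ +i* _); apply: eq_Rintegral => t /E ->.
Qed.

End OutputDensity.

Section SmoothToBounded.
Context (R : realType) (U X Y : completeNormedModType R[i]) (S : system_node U X Y).
Notation mu := (@lebesgue_measure R).

(** Finitely many exceptional sets are discarded at once. *)
Lemma input_coordinates m (e : 'I_m -> U) (l : 'I_m -> U -> R) (K : R) (u : R -> U) :
  (forall v, v = real_comb e (l ^~ v)) -> (forall i v w, l i (v + w) = l i v + l i w) ->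
  (forall i (r : R) v, l i (r%:C *: v) = r * l i v) ->
  0 < K -> (forall i v, `|l i v| <= K * rnorm v) -> Linf_loc u ->
  exists k : 'I_m -> R -> R, [/\ forall j, loc_bounded (k j),
    {ae mu, forall t, 0 <= t -> u t = real_comb e (k ^~ t)} &
    forall j, {ae mu, forall t, 0 <= t -> `|k j t| <= K * rnorm (u t)}].
Proof.
move=> le lD lZ K0 lK ub.
have : forall j, exists k, loc_bounded k /\ {ae mu, forall t, 0 <= t -> k t = l j (u t)}.
  by move=> j; have [k bk ku] := coordinate_input (lD j) (lZ j) K0 (lK j) ub; exists k.
move=> /choice[k hk]; exists k; split => [j||j]; first by case: (hk j).
  pose P (n : nat) t := forall j : 'I_m, n = j :> nat -> 0 <= t -> k j t = l j (u t).
  have : {ae mu, forall t, forall n, P n t}.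
    apply: ae_foralln => n; have [nm|mn] := ltnP n m; last first.
      by apply: ae_all => t j nj; move: (ltn_ord j); rewrite -nj ltnNge mn.
    apply: ae_imp (hk (Ordinal nm)).2 => t h j nj.
    by rewrite (_ : j = Ordinal nm)//; apply: val_inj.
  apply: ae_imp => t h t0; rewrite [LHS]le; apply: eq_bigr => j _.
  by rewrite (h j j).
by apply: ae_imp (hk j).2 => t h t0; rewrite h.
Qed.

Lemma deriv_on_sum (V : normedModType R[i]) m (J : set R) (F F' : 'I_m -> R -> V) :
  (forall j, deriv_on J (F j) (F' j)) ->
  deriv_on J (fun t => \sum_(j < m) F j t) (fun t => \sum_(j < m) F' j t).
Proof.
move=> dF; elim: (index_enum 'I_m) => [|j r IHr].
  apply: (@deriv_on_ext _ _ _ (fun=> 0) (fun=> 0)) => [t _|t _|]; rewrite ?big_nil//.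
  by move=> t _ d d0; exists 1 => // s _ _; rewrite scaler0 !subr0 rnorm0 mulr_ge0// ltW.
by apply: deriv_on_ext (deriv_onD (dF j) IHr) => t _; rewrite big_cons.
Qed.

(** The output of a generalised solution is, after integrating twice, the
    convolution of the ramp responses with the coordinates of the input. The
    bound on smooth inputs makes the first derivative of this convolution
    Lipschitz, so that the output has a bounded density. *)
Lemma Cinf_BIBO_Linf_BIBO : finite_dimensional U -> finite_dimensional Y ->
  Cinf_BIBO_stable S -> Linf_BIBO_stable S.
Proof.
move=> /real_coordinates_exist[mU [e [lU [eU eD eZ [KU KU0 eK]]]]].
move=> /real_coordinates_exist[mY [f [lY [fY fD fZ [KY KY0 fK]]]]].
move=> [c c0 bibo].
pose a := \sum_(j < mU) c * rnorm (e j); pose b := \sum_(i < mY) rnorm (f i).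
have a0 : 0 <= a by apply: sumr_ge0 => j _; rewrite mulr_ge0 ?rnorm_ge0 ?(ltW c0).
have b0 : 0 <= b by apply: sumr_ge0 => i _; exact: rnorm_ge0.
have C0 : 0 <= b * (KY * (a * KU)) by rewrite !mulr_ge0 ?(ltW KU0) ?(ltW KY0).
(* The summand 1 keeps the constant positive when U or Y is trivial. *)
exists (b * (KY * (a * KU)) + 1); first by rewrite ltr_pwDr.
move=> u x y [_ _ [x0 xE] yE] ub x00.
have [k [bk uk kb]] := input_coordinates eU eD eZ KU0 eK ub.
have Bl r : 0 <= r -> rlinear (fun v => sn_Tm1 S r (sn_B S v)).
  move=> r0; have [h1 h2] := linear_rlinear (sn_B S); have [h3 h4] := sg_rlinear (sn_Tm1 S) r.
  by split=> *; rewrite ?h1 ?h3 ?h2 ?h4.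
have jx0 : sn_j S x0 = 0.
  have := xE 0 (lexx _); rewrite x00 sg0.
  rewrite (bochner_vconv bk uk (P := fun r v => sn_Tm1 S r (sn_B S v)))//; last first.
    by move=> j; exact: orbit_cont.
  rewrite big1 ?addr0// => j _; apply: vconv0 (bk j); exact: orbit_cont.
have {}xE t : 0 <= t -> x t =
    bochner_integral `[0, t]%classic (fun s => sn_Tm1 S (t - s) (sn_B S (u s))).
  by move=> t0; rewrite xE// jx0 linear0 add0r.
have out := generalised_output bk uk xE.
have sb j := Cinf_smooth_bound (S := S) (e j) c0
  (fun u x y cs x0 us => let: And3 _ _ h := bibo u x y cs x0 us in h).
have cj0 j : 0 <= c * rnorm (e j) by rewrite mulr_ge0 ?rnorm_ge0 ?(ltW c0).
have : forall j, exists p, [/\ deriv_on (@half_line R) (vconv (ramp_out S (e j)) (k j)) p,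
    p 0 = 0 & forall T K s t, 0 < T -> 0 <= K ->
      {ae mu, forall s, 0 <= s <= T -> `|k j s| <= K} ->
      0 <= s <= T -> 0 <= t <= T ->
      rnorm (p s - p t) <= c * rnorm (e j) * K * `|s - t|].
  by move=> j; apply: (bounded_kernel (ramp_out_cont S (e j)) (cj0 j) (sb j) (bk j)).
move=> /choice[p hp]; pose q t := \sum_(j < mU) p j t.
have dq : deriv_on (@half_line R)
    (fun t => \sum_(j < mU) vconv (ramp_out S (e j)) (k j) t) q.
  by apply: deriv_on_sum => j; case: (hp j).
have q_lip T M : 0 < T -> 0 <= M -> {ae mu, forall s, `[0, T]%classic s -> rnorm (u s) <= M} ->
    forall s t, 0 <= s <= T -> 0 <= t <= T ->
    rnorm (q s - q t) <= a * (KU * M) * `|s - t|.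
  move=> T0 M0 uM s t sT tT; rewrite -sumrB (le_trans (ler_rnorm_sum _ _ _))//.
  rewrite /a !mulr_suml ler_sum// => j _; have [_ _ h] := hp j.
  apply: (h T (KU * M)) => //; first by rewrite mulr_ge0// ltW.
  apply: ae_imp (ae_and uM (kb j)) => r [h1 h2] rT; case/andP: (rT) => r0 _.
  by rewrite (le_trans (h2 r0))// ler_pM2l// h1//= in_itv.
have uM T : 0 < T -> let M := fine (Linf_norm `[0, T]%classic u) in
    [/\ 0 <= M, Linf_norm `[0, T]%classic u = M%:E &
        {ae mu, forall s, `[0, T]%classic s -> rnorm (u s) <= M}].
  move=> T0; have Mf : Linf_norm `[0, T]%classic u \is a fin_num.
    by rewrite ge0_fin_numE ?Linf_norm_ge0//; case: ub => _; exact.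
  split; rewrite ?fine_ge0 ?Linf_norm_ge0 ?fineK//.
  by apply: ae_imp (ae_le_Linf_norm `[0, T]%classic u) => s h /h; rewrite -lee_fin fineK.
have z0 : \sum_(j < mU) vconv (ramp_out S (e j)) (k j) 0 = 0.
  by rewrite big1// => j _; apply: vconv0 (bk j); exact: ramp_out_cont.
have q0 : q 0 = 0 by rewrite /q big1// => j _; case: (hp j).
have [|g [bg zE gb]] := double_primitive_density fY fD fZ KY0 fK dq z0 q0.
  move=> T; have [T0|T0] := ltP 0 T.
    have [M0 _ h] := uM T T0; eexists; last exact: (q_lip T _ T0 M0 h).
    by rewrite !mulr_ge0 ?(ltW KU0).
  exists 0 => // s t /andP[s0 sT] /andP[t0 tT].
  have E (r : R) : 0 <= r -> r <= T -> r = 0.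
    by move=> r0 rT; apply/eqP; rewrite eq_le r0 (le_trans rT).
  by rewrite (E s)// (E t)// subrr rnorm0 mul0r.
have bound t : 0 < t -> (Linf_norm `[0%R, t]%classic (fun s => real_comb f (g ^~ s)) <=
    (b * (KY * (a * KU)) + 1)%:E * Linf_norm `[0%R, t]%classic u)%E.
  move=> t0; have [M0 -> h] := uM t t0; set M := fine _ in M0 h *.
  rewrite -EFinM; apply: Linf_norm_le; first by rewrite mulr_ge0// addr_ge0.
  (* The density obeys the bound strictly before [t]; the endpoint is negligible. *)
  exists [set t]; split; [exact: measurable_set1|exact: lebesgue_measure_set1|].
  move=> s /=; apply: contra_notP => /eqP st; rewrite /= in_itv /= => /andP[s0 st'].
  have sT : 0 <= s < t by rewrite s0 lt_neqAle st.
  rewrite (le_trans (gb _ _ (q_lip t M t0 M0 h) s sT))// -/b.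
  by rewrite mulrDl mul1r !mulrA ler_wpDr.
exists (fun t => real_comb f (g ^~ t)); split => //.
  split; first exact: strongly_measurable_comb.
  move=> t t0; apply: le_lt_trans (bound t t0) _.
  by have [_ -> _] := uM t t0; rewrite -EFinM ltry.
move=> phi; rewrite yE -(pairing_density phi bg zE) /complex_integral.
by congr (_ +i* _); apply: eq_Rintegral => t /set_mem t0; rewrite out.
Qed.

End SmoothToBounded.

(** * Classical solutions as generalised solutions *)

Section Orbits.
Context (R : realType) (X : completeNormedModType R[i]) (T : c0_semigroup X).

Lemma orbit_along_cont (w : R -> X) t : cont_on (@half_line R) w ->
  cont_on `[0, t]%classic (fun s => T (t - s) (w s)).
Proof.
move=> wc s0 s0t e e0; have e20 : 0 < e / 2 by rewrite divr_gt0.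
have [M M0 hM] := sg_loc_bound T t.
have [d1 d10 h1] := wc s0 (half_line_segment s0t) _ (divr_gt0 e20 M0).
have [d2 d20 h2] := cont_on_reverse (t := t) (orbit_cont T (w s0)) s0t e20.
exists (Num.min d1 d2); first by rewrite lt_min d10.
move=> s st; rewrite lt_min => /andP[sd1 sd2].
rewrite -(subrK (T (t - s) (w s0)) (T (t - s) (w s))) -addrA.
rewrite (le_trans (ler_rnormD _ _))// (splitr e) lerD//; last exact: h2.
have := h1 s (half_line_segment st) sd1; rewrite ler_pdivlMr// => hw.
rewrite -(rlinearB (sg_rlinear T (t - s))) (le_trans (hM _ _ _ _))// ?[M * _]mulrC//.
  by move: st; rewrite /= in_itv /= subr_ge0 => /andP[].
by move: st; rewrite /= in_itv /= gerBl => /andP[].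
Qed.

(** The product rule: the increment splits into that of [v], transported by
    the bounded operators [T (t - s)], and that of the reversed orbit of [v
    s0], which is differentiable because [v s0] lies in the domain of the
    generator. *)
Lemma orbit_along_deriv (v v' a : R -> X) t :
  (forall s, 0 <= s -> generator T (v s) (a s)) -> deriv_on (@half_line R) v v' ->
  deriv_on `[0, t]%classic (fun s => T (t - s) (v s)) (fun s => T (t - s) (v' s - a s)).
Proof.
move=> va dv s0 s0t e e0; have e30 : 0 < e / 3 by rewrite divr_gt0.
have [M M0 hM] := sg_loc_bound T t; have s00 := half_line_segment s0t.
have [d1 d10 h1] := dv s0 s00 _ (divr_gt0 e30 M0).
have [d2 d20 h2] := cont_on_reverse (t := t) (orbit_cont T (v' s0)) s0t e30.
have [d3 d30 h3] := deriv_on_reverse (t := t) (orbit_deriv (va s0 s00)) s0t e30.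
exists (Num.min d1 (Num.min d2 d3)); first by rewrite !lt_min d10 d20.
move=> s st; rewrite !lt_min => /and3P[sd1 sd2 sd3].
have L r := rlinearB (sg_rlinear T r).
have -> : T (t - s) (v s) - T (t - s0) (v s0) - (s - s0)%:C *: T (t - s0) (v' s0 - a s0) =
    T (t - s) (v s - v s0 - (s - s0)%:C *: v' s0) +
    ((s - s0)%:C *: (T (t - s) (v' s0) - T (t - s0) (v' s0)) +
    (T (t - s) (v s0) - T (t - s0) (v s0) - (s - s0)%:C *: - T (t - s0) (a s0))).
  rewrite !L !sgZ !scalerBr scalerN.
  set A := T (t - s) (v s); set B := T (t - s) (v s0); set C := _ *: T (t - s) (v' s0).
  set D := T (t - s0) (v s0); set E := _ *: T (t - s0) (v' s0); set F := _ *: T (t - s0) (a s0).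
  rewrite !opprB opprK; apply/eqP; rewrite -subr_eq0; apply/eqP.
  rewrite [X in _ - X](_ : _ = A - D - E + F); last first.
    rewrite addrA (addrA (A - B - C)) subrK addrA addrA.
    by rewrite [A - B - E]addrAC subrK [A - E - D]addrAC.
  by rewrite addrA addrAC subrr.
have t1 : rnorm (T (t - s) (v s - v s0 - (s - s0)%:C *: v' s0)) <= e / 3 * `|s - s0|.
  have := h1 s (half_line_segment st) sd1; rewrite -[leRHS]mulrAC ler_pdivlMr// => hv.
  rewrite (le_trans (hM _ _ _ _))// ?[M * _]mulrC//.
    by move: st; rewrite /= in_itv /= subr_ge0 => /andP[].
  by move: st; rewrite /= in_itv /= gerBl => /andP[].
rewrite (le_trans (ler_rnormD _ _))//.
have -> : e * `|s - s0| = e / 3 * `|s - s0| + (e / 3 * `|s - s0| + e / 3 * `|s - s0|) by field.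
rewrite lerD// (le_trans (ler_rnormD _ _))// lerD//; last exact: h3.
by rewrite rnormZr mulrC ler_wpM2r// h2.
Qed.

End Orbits.

Section ClassicalSolutions.
Context (R : realType) (U X Y : completeNormedModType R[i]) (S : system_node U X Y).
Variables (u : R -> U) (x x' : R -> X).
Hypothesis uc : cont_on (@half_line R) u.
Hypothesis dx : deriv_on (@half_line R) x x'.
Hypothesis xu : forall t, 0 <= t -> sn_j S (x' t) = sn_Am1 S (x t) + sn_B S (u t).
Hypothesis x0 : x 0 = 0.

Let jl := linear_rlinear (sn_j S).
Let Bl := linear_rlinear (sn_B S).
Let Bb : rbounded (sn_B S) := linear_bounded_rnorm (@sn_B_continuous _ _ _ _ S).

(** Integrate the derivative of [T (t - s) (x s)] over [0, t]: the
    contribution of the generator cancels. *)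
Lemma variation_of_constants t : 0 <= t -> sn_j S (x t) =
  bochner_integral `[0, t]%classic (fun s => sn_Tm1 S (t - s) (sn_B S (u s))).
Proof.
move=> t0; have gen s : 0 <= s -> generator (sn_Tm1 S) (sn_j S (x s)) (sn_Am1 S (x s)).
  by move=> _; exact: Am1_graph.
have dF := orbit_along_deriv (t := t) gen (rlinear_deriv_on jl (j_rbounded S) dx).
have {}dF : deriv_on `[0, t]%classic (fun s => sn_Tm1 S (t - s) (sn_j S (x s)))
    (fun s => sn_Tm1 S (t - s) (sn_B S (u s))).
  apply: deriv_on_ext dF => // s /half_line_segment s0.
  by rewrite xu// addrAC subrr add0r.
have Fc := orbit_along_cont (sn_Tm1 S) (t := t) (rlinear_cont_on Bl Bb uc).
have := Bint_FTC t0 dF Fc.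
rewrite subrr sg0 x0 (rlinear0 jl) (rlinear0 (sg_rlinear (sn_Tm1 S) _)) subr0 => h.
apply/esym; apply: (Bint_bochner_integral (measurable_itv _) (segment_lty 0 t) h).
exact: ae_all.
Qed.

End ClassicalSolutions.

Section ClassicalOutputs.
Context (R : realType) (U X Y : completeNormedModType R[i]) (S : system_node U X Y).
Variables (u : R -> U) (x x' : R -> X).
Hypothesis uc : cont_on (@half_line R) u.
Hypothesis dx : deriv_on (@half_line R) x x'.
Hypothesis xu : forall t, 0 <= t -> sn_j S (x' t) = sn_Am1 S (x t) + sn_B S (u t).
Hypothesis x0 : x 0 = 0.

Let out a b w := CR S (node_pt S *: a - b) + sn_G S (node_pt S) w.

Let out_deriv (a b a' b' : R -> X) (w w' : R -> U) :
  deriv_on (@half_line R) a a' -> deriv_on (@half_line R) b b' ->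
  deriv_on (@half_line R) w w' ->
  deriv_on (@half_line R) (fun t => out (a t) (b t) (w t)) (fun t => out (a' t) (b' t) (w' t)).
Proof.
move=> da db dw; apply: deriv_onD.
  apply: (rlinear_deriv_on (CR_rlinear S) (CR_rbounded S)); apply: deriv_onD.
    exact: rlinear_deriv_on (scale_rlinear X (node_pt S)) (scale_rbounded X (node_pt S)) da.
  exact: rlinear_deriv_on (opp_rlinear X) (opp_rbounded X) db.
exact: rlinear_deriv_on (G_rlinear S) (G_rbounded S) dw.
Qed.

Let out0 : out 0 0 0 = 0.
Proof.
by rewrite /out scaler0 subrr (rlinear0 (CR_rlinear S)) (rlinear0 (G_rlinear S)) addr0.
Qed.

(** Integrated twice, the state equation still holds in X, where the output is
    a bounded function of the state, its derivative and the input. *)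
Lemma classical_output : exists z q : R -> Y,
  [/\ deriv_on (@half_line R) z q,
      deriv_on (@half_line R) q (fun t => CD S (x t) (u t)), z 0 = 0, q 0 = 0 &
      forall t, 0 <= t ->
        CDm1 (bochner_integral `[0, t]%classic (fun s => (t - s)%:C *: sn_j S (x s)))
             (bochner_integral `[0, t]%classic (fun s => (t - s)%:C *: u s)) = z t].
Proof.
have xc := deriv_on_cont dx.
have dX1 := primitive_deriv xc; have X1c := deriv_on_cont dX1.
have dX2 := primitive_deriv X1c.
have dU1 := primitive_deriv uc; have U1c := deriv_on_cont dU1.
have dU2 := primitive_deriv U1c.
have X10 := primitive0 xc; have X20 := primitive0 X1c.
have U10 := primitive0 uc; have U20 := primitive0 U1c.
set X1 := primitive x in dX1 X1c dX2 X10 X20; set X2 := primitive X1 in dX2 X20.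
set U1 := primitive u in dU1 U1c dU2 U10 U20; set U2 := primitive U1 in dU2 U20.
have jl := linear_rlinear (sn_j S); have jb := j_rbounded S.
have Al := linear_rlinear (sn_Am1 S); have Ab := Am1_rbounded S.
have Bl := linear_rlinear (sn_B S).
have Bb : rbounded (sn_B S) := linear_bounded_rnorm (@sn_B_continuous _ _ _ _ S).
have djx := rlinear_deriv_on jl jb dx.
have st1 t : 0 <= t -> sn_Am1 S (X1 t) + sn_B S (U1 t) = sn_j S (x t).
  move=> t0; have d := deriv_onD (rlinear_deriv_on Al Ab dX1) (rlinear_deriv_on Bl Bb dU1).
  have {}d : deriv_on (@half_line R) (fun t => sn_Am1 S (X1 t) + sn_B S (U1 t))
      (fun t => sn_j S (x' t)).
    by apply: deriv_on_ext d => // s s0; rewrite xu.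
  by apply: (deriv_on_unique d djx) t0; rewrite X10 U10 x0 !linear0 addr0.
have djX1 := rlinear_deriv_on jl jb dX1; have djX2 := rlinear_deriv_on jl jb dX2.
have st2 t : 0 <= t -> sn_Am1 S (X2 t) + sn_B S (U2 t) = sn_j S (X1 t).
  move=> t0; have d := deriv_onD (rlinear_deriv_on Al Ab dX2) (rlinear_deriv_on Bl Bb dU2).
  have {}d : deriv_on (@half_line R) (fun t => sn_Am1 S (X2 t) + sn_B S (U2 t))
      (fun t => sn_j S (x t)).
    by apply: deriv_on_ext d => // s s0; rewrite st1.
  by apply: (deriv_on_unique d djX1) t0; rewrite X10 X20 U20 !linear0 addr0.
exists (fun t => out (X2 t) (X1 t) (U2 t)), (fun t => out (X1 t) (x t) (U1 t)).
split; [exact: out_deriv| |by rewrite X20 X10 U20 out0|by rewrite X10 x0 U10 out0|].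
  apply: deriv_on_ext (out_deriv dX1 dx dU1) => // t t0.
  by rewrite (CD_formula (w := x' t))// xu.
move=> t t0; have mI := measurable_itv `[0, t]; have fin := segment_lty 0 t.
have bint (V : completeNormedModType R[i]) (f : R -> V) v :
    Bint `[0, t]%classic f v -> bochner_integral `[0, t]%classic f = v.
  by move=> h; apply: (Bint_bochner_integral mI fin h); exact: ae_all.
rewrite (bint _ _ (sn_j S (X2 t))); last first.
  by apply: (Bint_double_primitive djX1 djX2 (deriv_on_cont djx)); rewrite // ?X10 ?X20 linear0.
rewrite (bint _ _ (U2 t)); last exact: (Bint_double_primitive dU1 dU2 uc).
by rewrite CDm1_j (CD_formula (w := X1 t))// st2.
Qed.

End ClassicalOutputs.

(** * Recovering pointwise bounds from test functions *)

Section PointwiseBound.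
Context (R : realType) (Y : completeNormedModType R[i]).
Notation mu := (@lebesgue_measure R).
Notation rc k := (fun t : R => (k t)%:C : cline R).

(** The positive part of [p] is compared with [q]; the negative part can only
    lower the integral, also when [p] is not measurable. *)
Lemma Rintegral_ae_le (D : set R) (p q : R -> R) : measurable D ->
  measurable_fun D q -> (forall t, D t -> 0 <= q t) ->
  (\int[mu]_(t in D) (q t)%:E < +oo)%E -> {ae mu, forall t, D t -> p t <= q t} ->
  \int[mu]_(t in D) p t <= \int[mu]_(t in D) q t.
Proof.
move=> mD mq q0 qfin pq; rewrite /Rintegral integralE.
set a := (X in fine (X - _)%E); set b := (X in fine (_ - X)%E); set I := (X in _ <= fine X).
have b0 : (0 <= b)%E by apply: integral_ge0 => t _; exact: funeneg_ge0.
have a0 : (0 <= a)%E by apply: integral_ge0 => t _; exact: funepos_ge0.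
have aI : (a <= I)%E.
  apply: le_lower_integral => //; first by apply/measurable_EFinP.
  apply: ae_imp pq => t h Dt; by rewrite [leLHS]funeposE ge_max !lee_fin h// q0.
have If : I \is a fin_num by rewrite ge0_fin_numE// (le_trans a0).
have af : a \is a fin_num by rewrite ge0_fin_numE// (le_lt_trans aI).
move: b b0 => [b| |]//= b0; last by rewrite -(fineK af) /= fine_ge0// (le_trans a0).
rewrite -(fineK af) -EFinB /= lerBlDr.
rewrite (@le_trans _ _ (fine I))//; first by rewrite fine_le.
by rewrite lerDl -lee_fin.
Qed.

Variables (l : Y -> R) (K : R).
Hypotheses (lD : forall v w, l (v + w) = l v + l w)
  (lZ : forall (r : R) v, l (r%:C *: v) = r * l v)
  (K0 : 0 < K) (lK : forall v, `|l v| <= K * rnorm v).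

(** It is [v |-> l v - i l (i v)]. *)
Lemma complexification : exists lam : {linear Y -> R[i]^o},
  [/\ forall v, complex.Re (lam v) = l v, continuous lam &
      exists2 M, 0 < M & forall v, rnorm (lam v) <= M * rnorm v].
Proof.
pose L (v : Y) : R[i]^o := l v +i* (- l ('i *: v)).
have iZ (c : R[i]) (v : Y) : c *: v = (complex.Re c)%:C *: v + (complex.Im c)%:C *: ('i *: v).
  by rewrite scalerA -scalerDl {1}(complexE c) [_ * 'i]mulrC.
have ii v : l ('i *: ('i *: v)) = - l v.
  rewrite scalerA -expr2 sqrCi (_ : -1 = (-1 : R)%:C); last by rewrite rmorphN.
  by rewrite lZ mulN1r.
have Llin : linear L.
  move=> c v w; rewrite /L scalerDr !lD scalerA [_ * c]mulrC -scalerA.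
  rewrite (iZ c v) (iZ c ('i *: v)) !lD !lZ ii; case: c => a b /=.
  by rewrite /GRing.scale /=; simpc; congr (_ +i* _); ring.
pose lam : {linear Y -> R[i]^o} := HB.pack L (GRing.isLinear.Build _ _ _ _ L Llin).
have lamM v : rnorm (lam v) <= (2 * K) * rnorm v.
  rewrite (le_trans (line_norm_parts _))//= normrN mulrDl mulrDl mul1r lerD//.
  rewrite (le_trans (lK _))// ler_pM2l// rnormZ normCi /=.
  by rewrite mul1r.
have M0 : 0 < 2 * K by rewrite mulr_gt0.
exists lam; split => //; last by exists (2 * K).
move=> v; apply/cvg_rnormP => e e0.
have /cvg_rnormP h : id @ nbhs v --> v by exact: cvg_id.
apply: filterS (h _ (divr_gt0 e0 M0)) => w.
by rewrite ler_pdivlMr// mulrC -linearB; exact: le_trans.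
Qed.

(** The functional is fixed and only its scalar factor varies, so
    differentiability in operator norm reduces to that of the scalar. *)
Lemma scalar_test_function (psi : nat -> R -> R) (M : R) (lam : {linear Y -> R[i]^o}) :
  (forall n, deriv_on (@half_line R) (rc (psi n)) (rc (psi n.+1))) ->
  (forall t, M < t -> psi 0%N t = 0) -> continuous lam ->
  (exists2 B, 0 < B & forall v, rnorm (lam v) <= B * rnorm v) ->
  exists phi : test_function Y, forall n t v, phi n t v = (psi n t)%:C * lam v.
Proof.
move=> dpsi supp lc [B B0 hB].
pose f n t : {linear Y -> R[i]^o} := (psi n t)%:C \*: lam.
have fc n t : 0 <= t -> continuous (f n t) by move=> _ v; apply: cvgZr; exact: lc.
have fd n t : 0 <= t -> op_cvg (increments (@half_line R) t)
    (fun h y => (h^-1)%:C *: (f n (t + h) y - f n t y)) (f n.+1 t).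
  move=> t0; have /has_derivative_onP/(_ t t0)/cvg_rnormP dn := dpsi n.
  pose Q (h : R) (v : Y) : R[i]^o := (h^-1)%:C *: (f n (t + h) v - f n t v) - f n.+1 t v.
  have small (e : R) : 0 < e -> \forall h \near increments (@half_line R) t,
      (0 <= op_norm (Q h) <= e%:E)%E.
    move=> e0; apply: filterS (dn _ (divr_gt0 e0 B0)) => h hh; apply/andP; split.
      apply: ereal_sup_ubound; exists 0; first by rewrite /= rnorm0.
      have l0 : lam 0 = 0 by exact: linear0.
      by rewrite /Q /f /= l0 !scaler0 !subr0 scaler0 rnorm0.
    apply: ge_ereal_sup => _ [v /= v1 <-]; rewrite lee_fin.
    have -> : Q h v =
        ((h^-1)%:C * ((psi n (t + h))%:C - (psi n t)%:C) - (psi n.+1 t)%:C) *: lam v.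
      by rewrite /Q /f /= /GRing.scale /=; ring.
    rewrite rnormZ; apply: (@le_trans _ _ (e / B * (B * rnorm v))).
      by apply: ler_pM => //; exact: Re_norm_ge0.
    by rewrite mulrA divfK ?gt_eqF// ler_piMr// ltW.
  apply/fine_cvgP; split.
    apply: filterS (small 1 ltr01) => h /andP[h0 h1].
    by rewrite ge0_fin_numE// (le_lt_trans h1)// ltry.
  apply/cvgrPdist_le => e e0; apply: filterS (small e e0) => h /andP[h0 he].
  rewrite sub0r normrN ger0_norm ?fine_ge0// -lee_fin fineK//.
  by rewrite ge0_fin_numE// (le_lt_trans he)// ltry.
have fs : exists M : R, forall t y, M < t -> f 0%N t y = 0.
  by exists M => t y Mt; rewrite /f /= supp// scale0r.
by exists (TestFunction fc fd fs).
Qed.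

(** A continuous function and an essentially bounded one that agree as
    distributions: testing against bumps concentrated to the right of [t]
    transfers the essential bound to the value at [t]. *)
Lemma pointwise_bound (y h : R -> Y) (M : R) : cont_on (@half_line R) y -> 0 <= M ->
  (forall phi : test_function Y,
    complex_integral (@half_line R) (fun t => phi 0%N t (y t)) =
    complex_integral (@half_line R) (fun t => phi 0%N t (h t))) ->
  (forall T, 0 < T -> {ae mu, forall s, `[0, T]%classic s -> rnorm (h s) <= M}) ->
  forall t, 0 <= t -> l (y t) <= K * M.
Proof.
move=> yc M0 yh hM t t0; apply/ler_addgt0Pr => e e0.
have [lam [lamE lamc lamb]] := complexification.
have lc : cont_on (@half_line R) (fun s => lam (y s) : cline R).
  exact: (rlinear_cont_on (linear_rlinear lam) lamb yc).
have [d d0 hd] := lc t t0 e e0.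
have [sg [dsg sg01 sg1 [a a0 early] late]] := smooth_step_exists d0.
(* A bump of integral one supported in [t, T], with all its derivatives. *)
pose psi n s := sg n.+1 (s - t); pose T := t + d.
have T0 : 0 < T by rewrite ltr_wpDl.
have shift n : deriv_on setT (fun s => (sg n (s - t))%:C : cline R) (rc (psi n)).
  move=> s _ r r0; have [x x0 hx] := dsg n (s - t) Logic.I r r0; exists x => // s' _.
  by have := hx (s' - t) Logic.I; rewrite (_ : s' - t - (s - t) = s' - s)//; ring.
have sub := @subsetT _ (@half_line R).
have dpsi n := deriv_onW sub (shift n.+1).
have supp s : T < s -> psi 0%N s = 0.
  move=> Ts; apply: (late (s - t) _).2.
  by rewrite lerBrDl ltW.
have [phi phiE] := scalar_test_function dpsi supp lamc lamb.
have pc := deriv_on_cont (shift 1%N); have bp := cont_loc_bounded pc.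
have I1 : rprim (psi 0%N) T = 1.
  have := deriv_on_unique (rprim_deriv pc) (deriv_onW sub (shift 0%N)) _ (ltW T0).
  rewrite rprim0// early ?sub0r ?(le_trans _ (ltW a0)) ?oppr_le0// => /(_ erefl).
  rewrite (_ : T - t = d); last by rewrite /T; ring.
  by rewrite (late d _).1// => -[].
have mI := measurable_itv `[0, T]; have fin := segment_lty 0 T.
have [B B0 hB] := loc_bounded_gt0 T bp.
have [v hv] : exists v, Bint `[0, T]%classic (fun s => (psi 0%N s)%:C *: (lam (y s) : cline R)) v.
  have zs := cont_on_simplifiable (cont_onW (@half_line_segment R T) lc).
  have kT s : `[0, T]%classic s -> `|psi 0%N s| <= B by rewrite /= in_itv; exact: hB.
  by have [w hw] := Bint_exists mI fin (simplifiable_scale bp.1 kT zs); exists w.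
have mean (w : cline R) : Bint `[0, T]%classic (fun s => (psi 0%N s)%:C *: w) w.
  by have := rprimP T w bp; rewrite I1 scale1r.
have close : rnorm (v - lam (y t) : cline R) <= e.
  apply: (@Bint_dominated _ _ _ _ _ (fun s => psi 0%N s * e) _ mI fin _ (BintB mI fin hv (mean _))).
  - by apply: measurable_funTS; apply: measurable_funM => //; exact: bp.1.
  - by apply: Bint_ext (mean e%:C) => s _; rewrite rmorphM.
  - move=> s /half_line_segment s0; rewrite -scalerBr rnormZr ger0_norm ?sg1//.
    have [st|st] := ltP `|s - t| d; first by rewrite ler_wpM2l ?sg1// hd.
    rewrite (_ : psi 0%N s = 0) ?mul0r//; move: st; rewrite ler_normr => /orP[st|].
      exact: (late _ st).2.
    rewrite lerNr => st; apply: early; rewrite (le_trans st)// (le_trans _ (ltW a0))//.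
    by rewrite oppr_le0 ltW.
have vE : complex_integral (@half_line R) (fun s => phi 0%N s (y s)) = v.
  have lateP s : T < s -> (psi 0%N s)%:C *: (lam (y s) : cline R) = 0.
    by move=> Ts; rewrite supp// scale0r.
  rewrite -(complex_integral_Bint hv lateP) /complex_integral.
  by congr (_ +i* _); apply: eq_Rintegral => s _; rewrite phiE.
have mH : measurable (@half_line R).
  rewrite (_ : @half_line R = `[0, +oo[%classic); first exact: measurable_itv.
  by apply/seteqP; split=> s; rewrite /half_line /= in_itv /= andbT.
have KM0 : 0 <= K * M by rewrite mulr_ge0// ltW.
have qseg : \int[mu]_(s in @half_line R) (K * M * psi 0%N s) = K * M.
  rewrite (@Rintegral_segment _ T) => [|s /supp ->]; last by rewrite mulr0.
  by rewrite RintegralZl//; [rewrite -/(rprim _ _) I1 mulr1|exact: loc_bounded_integrable].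
have Rev : complex.Re v <= K * M.
  rewrite -vE yh /= -qseg; apply: Rintegral_ae_le => //.
  - by apply: measurable_funTS; apply: measurable_funM => //; exact: bp.1.
  - by move=> s _; rewrite mulr_ge0// sg1.
  - rewrite (_ : (\int[mu]_(s in @half_line R) (K * M * psi 0%N s)%:E =
        \int[mu]_(s in `[0%R, T]) (K * M * psi 0%N s)%:E)%E).
      have bq : loc_bounded (fun s => K * M * psi 0%N s).
        by apply: cont_loc_bounded; exact: deriv_on_cont (deriv_on_cstM (K * M) (shift 1%N)).
      have : (\int[mu]_(s in `[0%R, T]) (K * M * psi 0%N s)%:E)%E \is a fin_num.
        by apply: integrable_fin_num => //; exact: loc_bounded_integrable bq.
      by rewrite fin_numElt => /andP[].
    rewrite (_ : `[0, T]%classic = @half_line R `&` `[0, T]%classic); last first.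
      apply/seteqP; split=> s; last by case.
      by rewrite /= in_itv /= => /andP[s0 sT]; rewrite /half_line /= s0.
    rewrite integral_mkcondr; apply: eq_integral => s /set_mem s0.
    rewrite patchE; case: ifPn => //; rewrite in_set_itv in_itv /= negb_and -!ltNge.
    by move: s0; rewrite /half_line /= => s0 /orP[|/supp ->]; rewrite ?mulr0// ltNge s0.
  - apply: ae_imp (hM T T0) => s hs s0; rewrite phiE.
    rewrite (_ : complex.Re _ = psi 0%N s * l (h s)); last first.
      by rewrite -lamE; case: (lam (h s)) => p q /=; rewrite mul0r subr0.
    rewrite [leRHS]mulrC; have [sT|/supp ->] := leP s T; last by rewrite !mul0r.
    rewrite ler_wpM2l ?sg1// (le_trans (ler_norm _))// (le_trans (lK _))// ler_pM2l//.
    by apply: hs; rewrite /= in_itv /= s0.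
rewrite -lamE; have -> : lam (y t) = v - (v - lam (y t)) :> cline R by rewrite subKr.
rewrite Re_lineD lerD// (le_trans (ler_norm _))// (le_trans (Re_line_norm _))//.
by rewrite rnormN.
Qed.

End PointwiseBound.

(** * From essentially bounded inputs to smooth inputs *)

Section BoundedToSmooth.
Context (R : realType) (U X Y : completeNormedModType R[i]) (S : system_node U X Y).
Notation mu := (@lebesgue_measure R).
Notation rc k := (fun t : R => (k t)%:C : cline R).

(** Freezing a function at negative times makes its coordinates Borel on the
    whole line. *)
Lemma coordinate_loc_bounded (V : normedModType R[i]) (l : V -> R) (K : R) (v : R -> V) :
  (forall v w, l (v + w) = l v + l w) -> (forall (r : R) v, l (r%:C *: v) = r * l v) ->
  0 < K -> (forall v, `|l v| <= K * rnorm v) -> cont_on (@half_line R) v ->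
  cont_on setT (rc (fun t => l (v (Num.max 0 t)))).
Proof.
move=> lD lZ K0 lK vc t _ e e0.
have max0 (s : R) : half_line (Num.max 0 s) by rewrite /half_line /= le_max lexx.
have [d d0 hd] := vc _ (max0 t) _ (divr_gt0 e0 K0); exists d => // s _ st.
rewrite -rmorphB rnorm_line (le_trans (real_lipschitz lD lZ lK _ _))// mulrC -ler_pdivlMr//.
apply: hd => //; apply: le_lt_trans st.
have [s0|s0] := leP 0 s; have [t0|t0] := leP 0 t => //.
- by rewrite subr0 !ger0_norm// ?subr_ge0 ?(le_trans (ltW t0))// lerBrDr gerDl ltW.
- by rewrite sub0r normrN ger0_norm// ltr0_norm ?subr_lt0 ?(lt_le_trans s0)// opprB lerBrDr gerDl ltW.
- by rewrite subrr normr0.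
Qed.

Lemma Cc_infty_bounded (u : R -> U) : cont_on (@half_line R) u -> Cc_infty u ->
  exists2 M, 0 <= M & forall t, 0 <= t -> rnorm (u t) <= M.
Proof.
move=> uc [_ [a [b [a0 ab]]]].
have [M M0 hM] := cont_on_bounded (Num.max 1 b) uc.
exists M; first exact: ltW.
move=> t t0; have [tb|] := leP t (Num.max 1 b); first by rewrite hM// t0.
rewrite gt_max => /andP[t1 bt]; rewrite ab ?rnorm0 ?ltW ?bt ?orbT//.
by rewrite (lt_trans ltr01).
Qed.

(** In coordinates a continuous input is a combination of Borel functions. *)
Lemma continuous_input (u : R -> U) : finite_dimensional U ->
  cont_on (@half_line R) u -> (exists2 M, 0 <= M & forall t, 0 <= t -> rnorm (u t) <= M) ->
  L1_loc u /\ Linf_loc u.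
Proof.
move=> /real_coordinates_exist[m [e [l [eU eD eZ [K K0 eK]]]]] uc [M M0 uM].
have bk j := cont_loc_bounded (coordinate_loc_bounded (eD j) (eZ j) K0 (eK j) uc).
have sm : strongly_measurable (@half_line R) u.
  have [s hs] := strongly_measurable_comb e bk; exists s.
  apply: ae_imp hs => t h t0; have := h t0.
  by rewrite [X in _ --> X -> _](_ : _ = u t)// -eU max_r.
split; split => // t t0; last first.
  apply: le_lt_trans (ltry M); apply: Linf_norm_le => //.
  by apply: ae_all => s /half_line_segment; exact: uM.
apply: (@le_lt_trans _ _ (\int[mu]_(s in `[0%R, t]) M%:E)%E); last first.
  by rewrite integral_cst//= -ge0_fin_numE ?fin_numM// ?mule_ge0// ge0_fin_numE// segment_lty.
apply: le_lower_integral => //; [by move=> s _; rewrite lee_fin rnorm_ge0| ].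
by apply: ae_all => s /half_line_segment s0; rewrite lee_fin uM.
Qed.

(** A classical solution is a generalised one, so its output is essentially
    bounded by the input as a distribution, hence pointwise by continuity. *)
Lemma Linf_BIBO_Cinf_BIBO : finite_dimensional U -> finite_dimensional Y ->
  Linf_BIBO_stable S -> Cinf_BIBO_stable S.
Proof.
move=> finU /real_coordinates_exist[m [f [l [fY fD fZ [K K0 fK]]]]] [c c0 bibo].
pose C := \sum_(i < m) K * c * rnorm (f i).
have C0 : 0 <= C by apply: sumr_ge0 => i _; rewrite !mulr_ge0 ?rnorm_ge0 ?(ltW c0) ?(ltW K0).
(* The summand 1 keeps the constant positive when Y is trivial. *)
exists (C + 1); first by rewrite ltr_pwDr.
move=> u x y [/cont_onP uc ycw _ [x' [_ /has_derivative_onP dx xu]] yE] x0 Cu.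
have yc := (cont_onP _ _).1 ycw.
have [M M0 uM] := Cc_infty_bounded uc Cu.
have [uL1 uLoc] := continuous_input finU uc (ex_intro2 _ _ M M0 uM).
pose N := fine (Linf_norm (@half_line R) u).
have NE : Linf_norm (@half_line R) u = N%:E.
  rewrite fineK// ge0_fin_numE ?Linf_norm_ge0// (@le_lt_trans _ _ M%:E) ?ltry//.
  by apply: Linf_norm_le => //; exact: ae_all.
have N0 : 0 <= N by rewrite fine_ge0// Linf_norm_ge0.
have [z [q [dz dq z0 q0 zE]]] := classical_output uc dx xu x0.
pose dist : Y_distribution Y := fun phi => complex_integral (@half_line R) (fun t => phi 2%N t
  (CDm1 (bochner_integral `[0, t]%classic (fun s => (t - s)%:C *: sn_j S (x s)))
        (bochner_integral `[0, t]%classic (fun s => (t - s)%:C *: u s)))).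
have gen : generalised_solution u (fun t => sn_j S (x t)) dist.
  split => //.
    apply/cont_onP.
    exact: rlinear_cont_on (linear_rlinear (sn_j S)) (j_rbounded S) (deriv_on_cont dx).
  exists 0 => t t0; rewrite !linear0 add0r.
  exact: variation_of_constants uc dx xu x0 t t0.
have [|h [_ hrep hb]] := bibo _ _ _ gen uLoc; first by rewrite x0 linear0.
have hM T : 0 < T -> {ae mu, forall s, `[0, T]%classic s -> rnorm (h s) <= c * N}.
  move=> T0; apply: ae_imp (ae_le_Linf_norm `[0, T]%classic h) => s hs sT.
  rewrite -lee_fin (le_trans (hs sT))// (le_trans (hb T T0))// EFinM.
  apply: lee_pmul; rewrite ?lee_fin ?(ltW c0) ?Linf_norm_ge0//.
  apply: Linf_norm_le => //; apply: ae_imp (ae_le_Linf_norm (@half_line R) u) => r hr rT.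
  by rewrite -lee_fin -NE hr//; exact: half_line_segment rT.
(* The coordinates of the output are their own densities. *)
pose g i t := l i (y (Num.max 0 t)).
have gc i := coordinate_loc_bounded (fD i) (fZ i) K0 (fK i) yc.
have bg i : loc_bounded (g i) := cont_loc_bounded (gc i).
have zg t : 0 <= t -> z t = real_comb f (fun i => rprim (rprim (g i)) t).
  move=> t0; rewrite [LHS]fY; apply: eq_bigr => i _; congr (_ *: _).
  have l0 : l i 0 = 0 by have := fZ i 0 0; rewrite scaler0 mul0r.
  have lin : rlinear (fun v : Y => (l i v)%:C : cline R).
    by split=> *; rewrite ?fD ?fZ ?rmorphD ?rmorphM.
  have lb : rbounded (fun v : Y => (l i v)%:C : cline R).
    by exists K => // v; rewrite rnorm_line.
  have d2 : deriv_on (@half_line R) (rc (fun t => l i (q t))) (rc (g i)).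
    by apply: deriv_on_ext (rlinear_deriv_on lin lb dq) => // r r0; rewrite /g max_r// yE.
  have qg r : 0 <= r -> (l i (q r))%:C = (rprim (g i) r)%:C :> cline R.
    move=> r0; apply: (deriv_on_unique d2 (rprim_deriv (gc i))) r0.
    by rewrite q0 l0; congr (_%:C); apply/esym; exact: rprim0 (bg i).
  have d1 : deriv_on (@half_line R) (rc (fun t => l i (z t))) (rc (rprim (g i))).
    exact: deriv_on_ext (rlinear_deriv_on lin lb dz).
  apply: (deriv_on_unique d1 (rprim_deriv (rprim_cont (bg i)))) t0.
  by rewrite z0 l0 rprim0//; exact: rprim_loc_bounded.
have pairing (phi : test_function Y) :
    complex_integral (@half_line R) (fun t => phi 0%N t (y t)) =
    complex_integral (@half_line R) (fun t => phi 0%N t (h t)).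
  rewrite -hrep; transitivity (complex_integral (@half_line R)
      (fun t => phi 0%N t (real_comb f (g ^~ t)))).
    rewrite /complex_integral; congr (_ +i* _); apply: eq_Rintegral => t /set_mem t0;
      by rewrite [X in phi 0%N t X]fY /g max_r.
  rewrite -(pairing_density phi bg zg) /dist /complex_integral.
  by congr (_ +i* _); apply: eq_Rintegral => t /set_mem t0; rewrite zE.
have bound t : 0 <= t -> rnorm (y t) <= C * N.
  move=> t0; rewrite [y t]fY (le_trans (ler_rnorm_sum _ _ _))// /C mulr_suml ler_sum// => i _.
  rewrite rnormZr -mulrA [_ * N]mulrC mulrA ler_wpM2r ?rnorm_ge0// -mulrA ler_norml lerNl.
  have cN : 0 <= c * N by rewrite mulr_ge0// ltW.
  have up := pointwise_bound (fD i) (fZ i) K0 (fK i) yc cN pairing hM t0.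
  rewrite up andbT.
  apply: (pointwise_bound (l := fun v => - l i v) _ _ K0 _ yc cN pairing hM t0).
  - by move=> v w; rewrite fD opprD.
  - by move=> r v; rewrite fZ mulrN.
  - by move=> v; rewrite normrN.
split => //; first by exists (C * N).
rewrite NE -EFinM; apply: Linf_norm_le; first by rewrite mulr_ge0// addr_ge0.
apply: ae_all => t t0; rewrite (le_trans (bound t t0))// mulrDl mul1r lerDl//.
Qed.

End BoundedToSmooth.

Theorem theorem3p5 (R : realType) (U X Y : completeNormedModType R[i])
    (S : system_node U X Y)
    (finU : finite_dimensional U) (finY : finite_dimensional Y) :
  Cinf_BIBO_stable S <-> Linf_BIBO_stable S.
Proof.
by split; [exact: Cinf_BIBO_Linf_BIBO|exact: Linf_BIBO_Cinf_BIBO].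
Qed.
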